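(* Let $K_\nu$ be a completion (archimedean or not) of a number field, $\chi$ a unitary character of $K_\nu^\times$, $s\in\mathbb{C}$ with $0<\mathrm{Re}(s)<1$, and $N\ge1$ an integer. Then, as an identity of distributions on $K_\nu\setminus\{0\}$, $$K_N\bigl(\chi(x)^{-1}|x|^{-s}\bigr)=\left(\frac{\partial^{N+1}}{\partial s^{N+1}}\log\Gamma(\chi,s)\right)\chi(x)^{-1}|x|^{-s},$$ where the distribution $K_N(\chi(x)^{-1}|x|^{-s})$ is defined by $\alpha\mapsto(-1)^N\int_{K_\nu}K_N(\alpha)(x)\,\chi(x)^{-1}|x|^{-s}\,dx$ (an absolutely convergent integral) for Schwartz-Bruhat functions $\alpha$ of compact support vanishing identically in a neighborhood of the origin.
   Context: $\lambda$ is the additive character of $K_\nu$ given by $\lambda(x)=\exp(2\pi i\{\mathrm{Tr}(x)\})$ for $\nu$ finite ($\mathrm{Tr}$ the trace to $\mathbb{Q}_p$, $\{a\}$ the polar part of $a\in\mathbb{Q}_p$) and $\lambda(x)=\exp(-2\pi i\,\mathrm{Tr}(x))$ for $\nu$ archimedean ($\mathrm{Tr}$ the trace to $\mathbb{R}$). $dx$ is the self-dual Haar measure for $\lambda$, and $\mathcal{F}(\varphi)(y)=\int_{K_\nu}\varphi(x)\lambda(-xy)\,dx$. $|t|$ is the module: $d(tx)=|t|\,dx$ (so $|z|=z\bar z$ on $\mathbb{C}$). $A$ is multiplication by $\log(|x|)$, $B(\varphi)=\mathcal{F}(\log(|y|)\,\mathcal{F}^{-1}(\varphi)(y))$, $H=A+B$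 is the conductor operator, and $K=i[B,A]$ is the commutator operator. The higher commutators, acting on Schwartz-Bruhat functions vanishing identically in a neighborhood of the origin, are $K_1=iK=[A,H]$, $K_{N+1}=[A,K_N]$; explicitly $K_N=\sum_{j=0}^N(-1)^{N-j}\binom Nj A^jHA^{N-j}$. For two such test functions $\int K_N(\alpha_1)\alpha_2\,dx=(-1)^N\int\alpha_1K_N(\alpha_2)\,dx$, which is the reason for the sign in the definition of $K_N$ on distributions. For $0<\mathrm{Re}(s)<1$ the Tate-Gel'fand-Graev Gamma function $\Gamma(\chi,s)$ is defined by the identity of tempered distributions $\mathcal{F}(\chi(x)|x|^{s-1})=\Gamma(\chi,s)\,\chi^{-1}(y)|y|^{-s}$; it is analytic and non-vanishing in this strip, so that the derivatives of $\log\Gamma(\chi,s)$ in $s$ are well defined. *)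

(* Defs.v *)
From HB Require Import structures.
From mathcomp Require Import all_boot all_order all_algebra all_field complex.
From mathcomp Require Import all_classical all_reals all_analysis.

Set Implicit Arguments.
Unset Strict Implicit.
Unset Printing Implicit Defensive.

Import Order.TTheory GRing.Theory Num.Theory numFieldNormedType.Exports.

Local Open Scope classical_set_scope.
Local Open Scope ring_scope.
Local Open Scope complex_scope.

HB.instance Definition _ (R : realType) := NormedModule.copy R[i] R[i]^o.

(* Fields with an absolute value, with the topology and uniformity it defines.
   The norm structures of the library require `|x *+ n| = `|x| *+ n and so
   exclude p-adic absolute values. *)
HB.mixin Record Field_isValued (R : realType) K & GRing.Field K := {
  absv : K -> R ;
  absv0 : absv 0 = 0 ;
  absv_gt0 : forall x : K, x != 0 -> 0 < absv x ;
  absvM : forall x y : K, absv (x * y) = absv x * absv y ;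
  absvD : forall x y : K, absv (x + y) <= absv x + absv y }.

#[short(type="valuedFieldType")]
HB.structure Definition ValuedField (R : realType) :=
  {K of Field_isValued R K & GRing.Field K}.

Section ValuedFieldTopology.
Variables (R : realType) (K : valuedFieldType R).
Implicit Types (x y z : K) (e : R).

Let vball x e : set K := [set y | absv (x - y : K) < e].
Let vent : set_system (K * K) := entourage_ vball.

Lemma absvN x : absv (- x : K) = absv x :> R.
Proof.
have sqr_absvN1 : absv (- 1 : K) ^+ 2 = absv (1 : K) ^+ 2 :> R.
  by rewrite !expr2 -!absvM mulrNN.
have absv_ge0 y : 0 <= absv y :> R.
  by have [->|/absv_gt0/ltW//] := eqVneq y 0; rewrite absv0.
have absvN1 : absv (- 1 : K) = absv (1 : K) :> R.
  by apply/eqP; rewrite -(eqrXn2 (n := 2))// sqr_absvN1.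
by rewrite -mulN1r absvM absvN1 -absvM mul1r.
Qed.

Let vball_center x e : 0 < e -> vball x e x.
Proof. by rewrite /vball /= subrr absv0. Qed.

Let vball_sym x y e : vball x e y -> vball y e x.
Proof. by rewrite /vball /= -opprB absvN. Qed.

Let vball_triangle x y z e1 e2 :
  vball x e1 y -> vball y e2 z -> vball x (e1 + e2) z.
Proof.
rewrite /vball /= => xy yz; rewrite -(subrK y x) -addrA.
exact: le_lt_trans (absvD _ _) (ltrD xy yz).
Qed.

HB.instance Definition _ := hasNbhs.Build (ValuedField.sort K) (nbhs_ vent).

HB.instance Definition _ := @Nbhs_isPseudoMetric.Build R (ValuedField.sort K)
  vent erefl vball vball_center vball_sym vball_triangle erefl.

HB.instance Definition _ := isPointed.Build (ValuedField.sort K) 0.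

Lemma ball_absv x e y : ball x e y = (absv (x - y) < e) :> Prop.
Proof. by []. Qed.

End ValuedFieldTopology.

Arguments absv {R K} : rename.

Notation Borel K := (g_sigma_algebraType (@open K)).

Section ComplexAnalysis.
Variable R : realType.

Definition expC (z : R[i]) : R[i] :=
  (expR (complex.Re z))%:C * (cos (complex.Im z) +i* sin (complex.Im z)).

(* r ^ z for r > 0; at r = 0 the value is irrelevant in what follows. *)
Definition cpow (r : R) (z : R[i]) : R[i] := expC (z * (ln r)%:C).

Definition strip : set R[i] := [set z | 0 < complex.Re z < 1].

(* The derivatives of log f at s are those of any such L. *)
Definition is_log_branch (f : R[i] -> R[i]) (s : R[i]) (L : R[i] -> R[i]) :=
  \forall z \near s, {for z, continuous L} /\ expC (L z) = f z.

Context {d : measure_display} {T : measurableType d}.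
Variable mu : {measure set T -> \bar R}.

Definition Cintegrable (f : T -> R[i]) : Prop :=
  mu.-integrable setT (fun x => (complex.Re (f x))%:E) /\
  mu.-integrable setT (fun x => (complex.Im (f x))%:E).

Definition Cintegral (f : T -> R[i]) : R[i] :=
  Rintegral mu setT (fun x => complex.Re (f x)) +i*
  Rintegral mu setT (fun x => complex.Im (f x)).

End ComplexAnalysis.

Section LocalField.
Variables (R : realType) (K : valuedFieldType R).

(* K is the completion of F at the place defined by the absolute value of F
   induced by iota. *)
Definition is_completion (F : fieldExtType rat) (iota : {rmorphism F -> K}) :=
  [/\ exists x : F, x != 0 /\ absv (iota x) != 1,
      dense (range iota)
    & forall G : set_system K, ProperFilter G -> cauchy G -> cvg G].

Definition archimedean : Prop := exists n : nat, 1 < absv (n%:R : K).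

(* The closure of Q in K: a copy of Q_p or of the field of real numbers. *)
Definition base_field : set K := closure (range (ratr : rat -> K)).

Definition is_basis n (e : 'I_n -> K) : Prop :=
  forall y : K, exists! c : 'rV[K]_n,
    (forall j, base_field (c 0 j)) /\ y = \sum_j c 0 j * e j.

Definition is_trace (x t : K) : Prop :=
  exists n (e : 'I_n -> K) (M : 'M[K]_n),
    [/\ is_basis e, forall i j, base_field (M i j),
        forall i, x * e i = \sum_j M i j * e j & t = \tr M].

(* The trace of K over base_field. *)
Definition trace (x : K) : K := xget 0 [set t | is_trace x t].

(* For K archimedean, the continuous embedding of R in K. *)
Definition real_emb (t : R) : K :=
  xget 0 [set x : K | exists2 q : nat -> rat,
    (ratr (q n) : R) @[n --> \oo] --> t & (ratr (q n) : K) @[n --> \oo] --> x].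

Definition real_trace (x : K) : R := xget 0 [set t | real_emb t = trace x].

(* For K above the prime p and a in Q_p: the r in Z[1/p] with 0 <= r < 1 and
   a - r in Z_p. *)
Definition polar_part (a : K) : rat :=
  xget 0 [set r : rat | 0 <= r < 1 /\ exists p m n : nat,
    [/\ prime p, absv (p%:R : K) < 1, r = m%:R / p%:R ^+ n
      & absv (a - ratr r) <= 1]].

Definition lambda (x : K) : R[i] :=
  if `[< archimedean >] then expC (- ('i%C * (2 * pi * real_trace x)%:C))
  else expC ('i%C * (2 * pi * ratr (polar_part (trace x)))%:C).

Definition dirderiv (v : K) (g : K -> R) : K -> R :=
  fun x => (fun h : R => g (x + real_emb h * v))^`()%classic 0.

Definition dirderivs (vs : seq K) (g : K -> R) : K -> R := foldr dirderiv g vs.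

(* Used for K archimedean, where it says that g is infinitely differentiable on
   the real vector space K. *)
Definition smooth (g : K -> R) : Prop :=
  forall vs : seq K, continuous (dirderivs vs g) /\
    forall v x, derivable (fun h : R => dirderivs vs g (x + real_emb h * v)) 0 1.

Definition rapidly_decreasing (g : K -> R) : Prop :=
  forall (vs : seq K) (m : nat), exists c : R, forall x,
    absv x ^+ m * `|dirderivs vs g x| <= c.

Definition schwartz (f : K -> R[i]) : Prop :=
  [/\ smooth (fun x => complex.Re (f x)), smooth (fun x => complex.Im (f x)),
      rapidly_decreasing (fun x => complex.Re (f x))
    & rapidly_decreasing (fun x => complex.Im (f x))].

Definition compact_support (f : K -> R[i]) : Prop :=
  compact (closure [set x | f x != 0]).

Definition locally_constant (f : K -> R[i]) : Prop :=
  forall x, \forall y \near x, f y = f x.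

Definition schwartz_bruhat (f : K -> R[i]) : Prop :=
  (archimedean -> schwartz f) /\
  (~ archimedean -> locally_constant f /\ compact_support f).

(* Test functions on K \ {0}. *)
Definition test_function (f : K -> R[i]) : Prop :=
  [/\ schwartz_bruhat f, compact_support f & \forall x \near (0 : K), f x = 0].

Definition unitary_character (chi : K -> R[i]) : Prop :=
  [/\ forall x y, x != 0 -> y != 0 -> chi (x * y) = chi x * chi y,
      forall x, x != 0 -> `|chi x| = 1
    & forall x, x != 0 -> {for x, continuous chi}].

Variable mu : {measure set (Borel K) -> \bar R}.

Definition is_haar : Prop :=
  [/\ forall (a : K) (A : set (Borel K)), measurable A ->
        mu [set a + x | x in (A : set K)] = mu A,
      forall A : set K, compact A -> (mu A < +oo)%E
    & forall U : set K, open U -> U !=set0 -> (0 < mu U)%E].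

(* d(tx) = |t| dx *)
Definition is_module (modulus : K -> R) : Prop :=
  forall (t : K) (A : set (Borel K)), measurable A ->
    mu [set t * x | x in (A : set K)] = ((modulus t)%:E * mu A)%E.

Definition fourier (f : K -> R[i]) : K -> R[i] :=
  fun y => Cintegral mu (fun x : Borel K => f x * lambda (- (x * y : K))).

Definition fourier_inv (f : K -> R[i]) : K -> R[i] :=
  fun y => Cintegral mu (fun x : Borel K => f x * lambda (x * y : K)).

Definition self_dual : Prop :=
  forall f, schwartz_bruhat f -> fourier_inv (fourier f) = f.

Definition comm (P Q : (K -> R[i]) -> K -> R[i]) : (K -> R[i]) -> K -> R[i] :=
  fun f x => P (Q f) x - Q (P f) x.

Variable modulus : K -> R.

Definition opA (f : K -> R[i]) : K -> R[i] :=
  fun x => (ln (modulus x))%:C * f x.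

Definition opB (f : K -> R[i]) : K -> R[i] :=
  fourier (fun y => (ln (modulus y))%:C * fourier_inv f y).

Definition opH (f : K -> R[i]) : K -> R[i] := fun x => opA f x + opB f x.

Definition opK (f : K -> R[i]) : K -> R[i] := fun x => 'i%C * comm opB opA f x.

(* K_1 = iK, which is [A,H] (opK1E below). *)
Definition opK1 (f : K -> R[i]) : K -> R[i] := fun x => 'i%C * opK f x.

(* K_N for N >= 1. *)
Definition opKN (N : nat) : (K -> R[i]) -> K -> R[i] :=
  iter N.-1 (comm opA) opK1.

(* The distribution T(x) dx, for a locally integrable function T. *)
Definition dist (T : K -> R[i]) (f : K -> R[i]) : R[i] :=
  Cintegral mu (fun x : Borel K => f x * T x).

(* The distribution K_N(T) on K \ {0}. *)
Definition KN_dist (N : nat) (T : K -> R[i]) (f : K -> R[i]) : R[i] :=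
  (-1) ^+ N * dist T (opKN N f).

Variable chi : K -> R[i].

(* chi(x) |x|^s and chi(x)^-1 |x|^s *)
Definition quasichar (s : R[i]) (x : K) : R[i] := chi x * cpow (modulus x) s.
Definition quasicharV (s : R[i]) (x : K) : R[i] :=
  (chi x)^-1 * cpow (modulus x) s.

(* Gam is the Gamma function s |-> Gamma(chi, s) on 0 < Re s < 1; the Fourier
   transform of a tempered distribution T is f |-> T(fourier f). *)
Definition is_Gamma (Gam : R[i] -> R[i]) : Prop :=
  forall s, strip s -> forall f, schwartz_bruhat f ->
    dist (quasichar (s - 1)) (fourier f) = Gam s * dist (quasicharV (- s)) f.

Lemma opK1E f : opK1 f = comm opA opH f.
Proof.
apply/funext => x; rewrite /opK1 /opK /comm /opH mulrA.
have -> : 'i%C * 'i%C = -1 :> R[i] by rewrite -expr2 sqr_i.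
by rewrite mulN1r opprB [in RHS]/opA mulrDr opprD addrACA subrr add0r.
Qed.

End LocalField.

(* Main.v *)
Require Import Defs.
From HB Require Import structures.
From mathcomp Require Import all_boot all_order all_algebra all_field complex.
From mathcomp Require Import all_classical all_reals all_analysis.
From mathcomp Require Import measurable_realfun zify ring lra.

Set Implicit Arguments.
Unset Strict Implicit.
Unset Printing Implicit Defensive.

Import Order.TTheory GRing.Theory Num.Theory numFieldNormedType.Exports.

Local Open Scope classical_set_scope.
Local Open Scope ring_scope.
Local Open Scope complex_scope.

(** Proof idea.  Write M(f)(s) for the integral of f chi^-1 |x|^-s.  Multiplying f by
    log|x| differentiates M(f) and changes its sign.  It therefore suffices to show
    that H has symbol g = Gam'/Gam, i.e. M(H f) = g M(f) for every test function f:
    by induction each commutator with A then replaces a symbol by the opposite of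
    its derivative, so that K_N has symbol (-1)^N g^(N).

    Since B f = F(log|y| F^-1 f), Tate's argument (Fubini) applied to
    k = log|y| F^-1 f and to test functions gives Gam M(B f) = integral of
    log|y| F f(y) chi(y) |y|^(s-1), which by the definition of Gam is the derivative
    of Gam M(f); hence M(B f) = g M(f) - M(A f).  The same identity with k a bump
    function shows that Gam has no zero in the strip.  These manipulations need
    M(B f) to converge.  The quantity (int f dt/|t|) B(h)(0) is symmetric in f and h,
    so B(h)(0) = c int h dt/|t|, and a translation of h gives B(h)(y) = O(1/|y|).

    Fubini's theorem requires the integrability of F f only.  In the non-archimedean
    case F f has compact support; in the archimedean case it decays by finite
    differences.  The compactness of balls, needed throughout, follows from
    Ostrowski's theorem for the closure of Q in K, and the finiteness of the
    number field transfers it to K. *)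

(** * Valued fields *)

(** The main obstacle is that log|y| F^-1 f is in general singular at 0, hence no Schwartz-Bruhat
    function, so that the definition of Gamma cannot be applied to it. In Tate's argument the
    definition and Fourier inversion are applied to an auxiliary test function g instead, while k
    need only be integrable with convergent Mellin integrals. For the same reason B f has no rapid
    decay; the estimate O(1/|y|) is what an open strip of exponents tolerates, and the class [tame]
    makes this stable under multiplication by log|x|. The estimate itself rests on the identity
    log|v| = log|tv| - log|t|, in which the second term integrates to a multiple of h(0) = 0. No
    regularity of Gamma is assumed. Near each s it is a quotient of two Mellin integrals whose
    denominator does not vanish for a well chosen test function, and differentiability is obtained
    from that; the same holds at each commutator for the symbol reached so far. All integrals are
    compared with |x|^-1 exp(-e |log|x||), which is integrable for every e > 0. *)

Section ValuedFieldTheory.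
Context {R : realType} {K : valuedFieldType R}.
Implicit Types (x y z : K) (e : R).

Lemma absv_ge0 x : 0 <= absv x.
Proof. by have [->|/absv_gt0/ltW//] := eqVneq x 0; rewrite absv0. Qed.

Lemma absv_eq0 x : (absv x == 0) = (x == 0).
Proof.
have [->|/[dup] x0 /absv_gt0 /lt0r_neq0/negbTE->] := eqVneq x 0.
  by rewrite absv0 eqxx.
by [].
Qed.

Lemma absv_gt0E x : (0 < absv x) = (x != 0).
Proof. by rewrite lt0r absv_eq0 absv_ge0 andbT. Qed.

Lemma absv1 : absv (1 : K) = 1.
Proof.
have n0 : absv (1 : K) != 0 by rewrite absv_eq0 oner_neq0.
by apply: (mulfI n0); rewrite -absvM !mulr1.
Qed.

Lemma absvB x y : absv (x - y) = absv (y - x).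
Proof. by rewrite -opprB absvN. Qed.

Lemma absvX x n : absv (x ^+ n) = absv x ^+ n.
Proof. by elim: n => [|n IH]; rewrite ?expr0 ?absv1// !exprS absvM IH. Qed.

Lemma absvV x : absv x^-1 = (absv x)^-1.
Proof.
have [->|x0] := eqVneq x 0; first by rewrite invr0 absv0 invr0.
have n0 : absv x != 0 by rewrite absv_eq0.
by apply: (mulfI n0); rewrite -absvM !divff// absv1.
Qed.

Lemma absvf_div x y : absv (x / y) = absv x / absv y.
Proof. by rewrite absvM absvV. Qed.

Lemma absv_sum I (r : seq I) (P : pred I) (F : I -> K) :
  absv (\sum_(i <- r | P i) F i) <= \sum_(i <- r | P i) absv (F i).
Proof.
elim/big_rec2 : _ => [|i y1 y2 Pi h]; first by rewrite absv0.
by apply: le_trans (absvD _ _) _; rewrite lerD2l.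
Qed.

Lemma ler_absvB x y : `|absv x - absv y| <= absv (x - y).
Proof.
have h a b : absv a - absv b <= absv (a - b :> K).
  by rewrite lerBlDr -{1}(subrK b a) absvD.
by rewrite ler_norml h andbT lerNl opprB absvB h.
Qed.

Lemma nbhs_absvP x (A : set K) :
  nbhs x A <-> exists2 e : R, 0 < e & forall y, absv (x - y) < e -> A y.
Proof.
split=> [/nbhs_ballP[e /= e0 he]|[e e0 he]]; first by exists e.
by apply/nbhs_ballP; exists e.
Qed.

Lemma cvg_absvP T (F : set_system T) (FF : Filter F) (f : T -> K) (l : K) :
  f @ F --> l <-> forall e, 0 < e -> \forall t \near F, absv (l - f t) < e.
Proof.
split=> [h e e0|h]; first by have /(h _) : nbhs l (ball l e) by exact: nbhsx_ballx.
by apply/cvg_ballP => e e0; exact: h.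
Qed.

Lemma cvg_absv0P T (F : set_system T) (FF : Filter F) (f : T -> K) (l : K) :
  f @ F --> l <-> absv (l - f t) @[t --> F] --> (0 : R).
Proof.
split=> [/cvg_absvP h|h]; first apply/cvgr0Pnorm_lt => e e0.
  by near=> t; rewrite ger0_norm ?absv_ge0//; near: t; exact: h.
apply/cvg_absvP => e e0; move/cvgr0Pnorm_lt : h => /(_ _ e0).
by apply: filterS => t /=; rewrite ger0_norm ?absv_ge0.
Unshelve. all: by end_near. Qed.

Global Instance nbhs_valued_filter x : ProperFilter (nbhs x).
Proof. exact: (@nbhs_pfilter (K : topologicalType)). Qed.

Lemma absv_continuous : continuous (absv : K -> R).
Proof.
move=> x; apply/cvgrPdist_lt => e e0.
apply/nbhs_absvP; exists e => // y xy.
exact: le_lt_trans (ler_absvB _ _) xy.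
Qed.

Lemma absv_hausdorff : hausdorff_space K.
Proof.
rewrite ball_hausdorff => x y xy.
have h : 0 < absv (x - y) by rewrite absv_gt0E subr_eq0.
have h2 : 0 < absv (x - y) / 2 by rewrite divr_gt0.
exists (PosNum h2, PosNum h2) => /=.
apply/eqP; rewrite -subset0 => z [/=]; rewrite !ball_absv => h3 h4.
rewrite absvB in h4.
by have := le_lt_trans (absvD _ _) (ltrD h3 h4); rewrite subrKA -splitr ltxx.
Qed.

Lemma cvgDK T (F : set_system T) (FF : Filter F) (f g : T -> K) (a b : K) :
  f @ F --> a -> g @ F --> b -> (fun t => f t + g t) @ F --> a + b.
Proof.
move=> /cvg_absvP fa /cvg_absvP gb; apply/cvg_absvP => e e0.
have e2 : 0 < e / 2 by rewrite divr_gt0.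
near=> t.
have -> : a + b - (f t + g t) = (a - f t) + (b - g t) by ring.
rewrite (splitr e); apply: le_lt_trans (absvD _ _) (ltrD _ _); near: t.
  exact: fa.
exact: gb.
Unshelve. all: by end_near. Qed.

Lemma cvgNK T (F : set_system T) (FF : Filter F) (f : T -> K) (a : K) :
  f @ F --> a -> (fun t => - f t) @ F --> - a.
Proof.
move=> /cvg_absvP fa; apply/cvg_absvP => e /fa; apply: filterS => t.
by rewrite -opprD absvN.
Qed.

Lemma cvgMK T (F : set_system T) (FF : Filter F) (f g : T -> K) (a b : K) :
  f @ F --> a -> g @ F --> b -> (fun t => f t * g t) @ F --> a * b.
Proof.
move=> /cvg_absv0P fa /cvg_absv0P gb; apply/cvg_absv0P.
have h : (absv (a - f t) * (absv b + absv (b - g t)) + absv a * absv (b - g t))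
     @[t --> F] --> (0 : R).
  rewrite (_ : 0 = 0 * (absv b + 0) + absv a * 0); last by rewrite mul0r mulr0 addr0.
  apply: cvgD; apply: cvgM => //; last exact: cvg_cst.
  by apply: cvgD => //; exact: cvg_cst.
apply: (squeeze_cvgr _ (cvg_cst 0) h); near=> t.
rewrite absv_ge0/=.
have -> : a * b - f t * g t = (a - f t) * (b - (b - g t)) + a * (b - g t) by ring.
apply: le_trans (absvD _ _) _; rewrite !absvM lerD2r ler_wpM2l ?absv_ge0//.
by apply: le_trans (absvD _ _) _; rewrite absvN.
Unshelve. all: by end_near. Qed.

Lemma cvgVK T (F : set_system T) (FF : ProperFilter F) (f : T -> K) (a : K) : a != 0 ->
  f @ F --> a -> (fun t => (f t)^-1) @ F --> a^-1.
Proof.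
move=> a0 /[dup] /cvg_absv0P fa fa'; apply/cvg_absv0P.
have na : absv a != 0 by rewrite absv_eq0.
have ha : absv (f t) @[t --> F] --> absv a.
  apply: (cvg_trans _ (@absv_continuous a)).
  exact: (@cvg_comp _ _ _ f absv F (nbhs a)).
have h : (absv (a - f t) * ((absv a) * absv (f t))^-1) @[t --> F] --> (0 : R).
  rewrite (_ : 0 = 0 * (absv a * absv a)^-1); last by rewrite mul0r.
  apply: cvgM => //; apply: cvgV; first by rewrite mulf_neq0.
  by apply: cvgM => //; exact: cvg_cst.
apply: cvg_trans h; apply: near_eq_cvg; near=> t.
have ft0 : f t != 0.
  have : 0 < absv (f t).
    near: t; apply: (cvgr_gt (absv a) ha); by rewrite absv_gt0E.
  by rewrite absv_gt0E.
have -> : a^-1 - (f t)^-1 = - ((a - f t) / (a * f t)).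
  by field; apply/andP.
by rewrite absvN absvf_div absvM.
Unshelve. all: by end_near. Qed.

Lemma addl_continuous a : continuous (fun x => a + x).
Proof. by move=> x; apply: cvgDK; [exact: cvg_cst|exact: cvg_id]. Qed.

Lemma mull_continuous a : continuous (fun x => a * x).
Proof. by move=> x; apply: cvgMK; [exact: cvg_cst|exact: cvg_id]. Qed.

Lemma opp_continuousK : continuous (fun x => - x).
Proof. by move=> x; apply: cvgNK; exact: cvg_id. Qed.

Lemma inv_continuousK x : x != 0 -> {for x, continuous (fun y => y^-1)}.
Proof. by move=> x0; apply: cvgVK => //; exact: cvg_id. Qed.

Lemma closed_absv_le e : closed [set x : K | absv x <= e].
Proof. exact: (closed_comp (fun x _ => @absv_continuous x) (@closed_le _ e)). Qed.

Lemma open_absv_lt e : open [set x : K | absv x < e].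
Proof. exact: (open_comp (fun x _ => @absv_continuous x) (@open_lt _ e)). Qed.

Lemma open_absv_gt e : open [set x : K | e < absv x].
Proof. exact: (open_comp (fun x _ => @absv_continuous x) (@open_gt _ e)). Qed.

Lemma closureKP (A : set K) x :
  closure A x <-> forall e, 0 < e -> exists2 y, A y & absv (x - y) < e.
Proof.
split=> [h e e0|h B /nbhs_absvP[e e0 he]].
  by have [y [Ay xy]] := h _ (nbhsx_ballx x e e0); exists y.
by have [y Ay xy] := h _ e0; exists y; split => //; exact: he.
Qed.

End ValuedFieldTheory.

(** The tensor power trick: an estimate proved for all n-th powers up to a factor linear in n holds
    without that factor. It serves in Ostrowski's theorem, in the ultrametric inequality and for the
    absolute value on the unit circle. *)
Lemma exp_le_linear (R : realType) (r C : R) : 0 <= r ->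
  (forall n, r ^+ n <= C * n.+1%:R) -> r <= 1.
Proof.
move=> r0 h; rewrite leNgt; apply/negP => r1.
pose d := r - 1; have d0 : 0 < d by rewrite subr_gt0.
have bern n : 1 + n%:R * d <= r ^+ n.
  elim: n => [|n IH]; first by rewrite mul0r addr0 expr0.
  have rd : r = 1 + d by rewrite /d addrC subrK.
  rewrite exprS; apply: (le_trans _ (ler_wpM2l r0 IH)); rewrite rd.
  have := mulr_ge0 (mulr_ge0 (ler0n R n) (ltW d0)) (ltW d0).
  rewrite -[n.+1]addn1 natrD; nra.
have C0 : 0 <= C by have := h 0%N; rewrite expr0 mulr1; lra.
(* At the even exponent 2(n+1) the square of Bernoulli's inequality gives a quadratic lower bound;
   the 3 comes from 2(n+1) + 1 <= 3(n+1). *)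
have [n hn] : exists n : nat, 3 * C / d ^+ 2 < n.+1%:R.
  exists (Num.bound (3 * C / d ^+ 2)).
  apply: (@lt_le_trans _ _ (Num.bound (3 * C / d ^+ 2))%:R); last by rewrite ler_nat.
  by apply/archi_boundP/divr_ge0; [exact: mulr_ge0|apply/exprn_ge0/ltW].
have := h (2 * n.+1)%N; rewrite mulnC exprM => h1.
have h2 : (n.+1%:R * d) ^+ 2 <= (r ^+ n.+1) ^+ 2.
  have hp : n.+1%:R * d <= r ^+ n.+1 by apply: le_trans (bern _); lra.
  apply: lerXn2r => //; rewrite nnegrE; last exact: exprn_ge0.
  exact: mulr_ge0 (ler0n _ _) (ltW d0).
have h3 : C * (n.+1 * 2).+1%:R <= C * (3 * n.+1%:R).
  rewrite ler_wpM2l// -natrM ler_nat; lia.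
have h4 := le_trans (le_trans h2 h1) h3.
have n0 : 0 < n.+1%:R :> R by rewrite ltr0n.
move: hn; rewrite ltr_pdivrMr ?exprn_gt0// => hn.
have : n.+1%:R * (3 * C) < n.+1%:R * (n.+1%:R * d ^+ 2) by rewrite ltr_pM2l.
lra.
Qed.

(** * Ostrowski's theorem *)

Section Ostrowski.
Context {R : realType} {K : valuedFieldType R}.
Implicit Types (x y z : K) (e : R).

Lemma absv_nat_le n : absv (n%:R : K) <= n%:R.
Proof.
elim: n => [|n IH]; first by rewrite absv0.
by rewrite -addn1 !natrD; apply: le_trans (absvD _ _) _; rewrite absv1 lerD2r.
Qed.

(** Expansion in base b: there are [trunc_log b n] + 1 digits, each of absolute value at most b, and
    the powers of b that they multiply are at most the last power of the maximum. *)
Lemma absv_nat_digits b n : (1 < b)%N -> (0 < n)%N ->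
  absv (n%:R : K) <= b%:R * (trunc_log b n).+1%:R *
    Num.max 1 (absv (b%:R : K)) ^+ trunc_log b n.
Proof.
move=> b1; set M := Num.max _ _.
have M1 : 1 <= M by rewrite le_max lexx.
have M0 : 0 <= M by apply: le_trans M1.
elim/ltn_ind: n => n IH n0.
have [nb|bn] := ltnP n b.
  rewrite (@trunc_log_eq b 0 n b1) ?expn0 ?n0 ?expn1// expr0 !mulr1.
  by apply: le_trans (absv_nat_le _) _; rewrite ler_nat ltnW.
set q := (n %/ b)%N; set d := (n %% b)%N.
have q0 : (0 < q)%N by rewrite divn_gt0// ltnW.
have qn : (q < n)%N by rewrite ltn_Pdiv.
have -> : trunc_log b n = (trunc_log b q).+1.
  apply: trunc_log_eq => //; apply/andP; split.
    rewrite expnSr; apply: leq_trans (leq_trunc_div n b).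
    by rewrite leq_mul2r trunc_logP ?orbT.
  rewrite (expnSr b (trunc_log b q).+1).
  apply: leq_trans (ltn_ceil n (ltnW b1)) _.
  by rewrite leq_mul2r trunc_log_ltn ?orbT.
set k := trunc_log b q; rewrite (divn_eq n b) -/q -/d natrD natrM.
apply: le_trans (absvD _ _) _; rewrite absvM.
have h1 : absv (q%:R : K) * absv (b%:R : K) <= b%:R * k.+1%:R * M ^+ k * M.
  by apply: ler_pM; rewrite ?absv_ge0// ?IH// le_max lexx orbT.
have h2 : absv (d%:R : K) <= b%:R * M ^+ k.+1.
  apply: le_trans (absv_nat_le _) _.
  have h : d%:R <= b%:R :> R by rewrite ler_nat ltnW// ltn_pmod// ltnW.
  apply: (le_trans h); rewrite ler_peMr//; exact: exprn_ege1.
apply: le_trans (lerD h1 h2) _.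
rewrite -[k.+2]addn1 natrD mulrDr mulr1 mulrDl exprSr !mulrA//.
Qed.

(** The power a^n has at most n log a / log b + 1 digits in base b, so its bound is linear in n up
    to an n-th power; [exp_le_linear] removes the linear factor. *)
Lemma absv_nat_cmp a b : (0 < a)%N -> (1 < b)%N ->
  absv (a%:R : K) <=
    Num.max 1 (absv (b%:R : K)) `^ (ln a%:R / ln b%:R).
Proof.
move=> a0 b1; set M := Num.max _ _; set th := _ / _.
have M1 : 1 <= M by rewrite le_max lexx.
have M0 : 0 < M by apply: lt_le_trans M1.
have lnb : 0 < ln (b%:R : R) by rewrite ln_gt0// ltr1n.
have th0 : 0 <= th by rewrite divr_ge0 ?ln_ge0 ?ler1n ?(ltnW b1).
have Mth : 0 < M `^ th by rewrite powR_gt0.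
rewrite -[leRHS]mul1r -ler_pdivrMr//.
apply: (@exp_le_linear _ _ (b%:R * (th + 1))).
  by rewrite divr_ge0 ?absv_ge0 ?ltW.
move=> n; rewrite expr_div_n ler_pdivrMr ?exprn_gt0// -absvX -natrX.
have an0 : (0 < a ^ n)%N by rewrite expn_gt0 a0.
apply: le_trans (absv_nat_digits b1 an0) _; set L := trunc_log _ _.
have Lth : L%:R <= th * n%:R.
  rewrite /th mulrAC ler_pdivlMr// mulr_natl mulr_natr.
  rewrite -!lnXn ?ltr0n// ?(ltnW b1)// -!natrX.
  rewrite ler_ln ?posrE ?ltr0n ?an0 ?expn_gt0 ?(ltnW b1)// ler_nat.
  exact: trunc_logP.
rewrite ler_pM//.
- by rewrite exprn_ge0 ?ltW.
- rewrite -mulrA ler_wpM2l// -addn1 -(addn1 n) !natrD.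
  have : 0 <= n%:R :> R by []. nra.
- rewrite -(powR_mulrn _ (ltW M0)) -powR_mulrn ?powR_ge0// -powRrM.
  exact: ler_powR.
Qed.

(** The quotient ln|b| / ln b does not depend on b > 1, since [absv_nat_cmp] can be used in both
    directions once |b| > 1 is known. *)
Lemma archimedean_absv_nat : archimedean K ->
  exists2 c : R, 0 < c & forall n : nat, absv (n%:R : K) = n%:R `^ c.
Proof.
move=> [n0 hn0].
(* If |b| <= 1 for a single b > 1, comparison with b would bound all integers by 1. *)
have hb b : (1 < b)%N -> 1 < absv (b%:R : K).
  move=> b1; rewrite ltNge; apply/negP => b1'.
  have n00 : (0 < n0)%N by case: n0 hn0 => //; rewrite absv0 ltNge ler01.
  have := absv_nat_cmp n00 b1; rewrite (max_idPl b1') powR1.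
  by rewrite leNgt hn0.
pose f b := ln (absv (b%:R : K)) / ln (b%:R : R).
have fle a b : (1 < a)%N -> (1 < b)%N -> f a <= f b.
  move=> a1 b1; have := absv_nat_cmp (ltnW a1) b1.
  rewrite (max_idPr (ltW (hb _ b1))) => h.
  have a0 : 0 < absv (a%:R : K) by apply: lt_trans (hb _ a1).
  have h2 : ln (absv (a%:R : K)) <= ln a%:R / ln b%:R * ln (absv (b%:R : K)).
    by rewrite -ln_powR ler_ln ?posrE ?powR_gt0// (lt_trans _ (hb _ b1)).
  rewrite /f ler_pdivrMr ?ln_gt0 ?ltr1n//; apply: le_trans h2 _.
  by rewrite mulrC mulrA mulrAC.
exists (f 2) => [|n]; first by rewrite divr_gt0 ?ln_gt0 ?hb ?ltr1n.
have f20 : f 2%N != 0 by rewrite gt_eqF// divr_gt0 ?ln_gt0 ?hb ?ltr1n.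
case: n => [|[|n]]; first by rewrite absv0 powR0.
  by rewrite absv1 powR1.
have -> : f 2%N = f n.+2 by apply/eqP; rewrite eq_le !fle.
have h0 : 0 < absv (n.+2%:R : K) by apply: lt_trans (hb _ _).
rewrite /powR pnatr_eq0/= /f divfK ?lnK ?posrE//.
by rewrite gt_eqF// ln_gt0// ltr1n.
Qed.

End Ostrowski.

(** * The ultrametric inequality and primes of absolute value less than 1 *)

Section NonArchimedean.
Context {R : realType} {K : valuedFieldType R}.
Hypothesis narch : ~ archimedean K.
Implicit Types (x y z : K).

Lemma absv_nat_le1 n : absv (n%:R : K) <= 1.
Proof. by rewrite leNgt; apply/negP => h; apply: narch; exists n. Qed.

Lemma absv_int_le1 (m : int) : absv (m%:~R : K) <= 1.
Proof.
case: m => n; first exact: absv_nat_le1.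
by rewrite NegzE mulrNz absvN; exact: absv_nat_le1.
Qed.

(** Binomial coefficients are integers, of absolute value at most 1, so |x + y|^n is at most (n + 1)
    M^n. *)
Lemma absvD_max x y : absv (x + y) <= Num.max (absv x) (absv y).
Proof.
set M := Num.max _ _.
have xM : absv x <= M by rewrite le_max lexx.
have yM : absv y <= M by rewrite le_max lexx orbT.
have M0 : 0 <= M by apply: le_trans (absv_ge0 _) xM.
have [M00|Mn0] := eqVneq M 0.
  apply: le_trans (absvD _ _) _; apply: (le_trans (lerD xM yM)).
  by rewrite M00 addr0.
have Mp : 0 < M by rewrite lt0r Mn0.
rewrite -[leRHS]mul1r -ler_pdivrMr//.
apply: (@exp_le_linear _ _ 1); first by rewrite divr_ge0// absv_ge0.
move=> n; rewrite mul1r expr_div_n ler_pdivrMr ?exprn_gt0// -absvX exprDn.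
apply: le_trans (absv_sum _ _ _) _.
apply: (@le_trans _ _ (\sum_(i < n.+1) M ^+ n)); last first.
  by rewrite sumr_const card_ord mulr_natl.
apply: ler_sum => i _; rewrite -mulr_natl absvM.
apply: (@le_trans _ _ (1 * M ^+ n)); last by rewrite mul1r.
apply: ler_pM; rewrite ?absv_ge0 ?absv_nat_le1// absvM !absvX.
have -> : M ^+ n = M ^+ (n - i) * M ^+ i by rewrite -exprD subnK// -ltnS.
by apply: ler_pM; rewrite ?exprn_ge0 ?absv_ge0// lerXn2r ?nnegrE ?absv_ge0.
Qed.

Lemma absvD_le x y e : absv x <= e -> absv y <= e -> absv (x + y) <= e.
Proof. by move=> xe ye; apply: le_trans (absvD_max _ _) _; rewrite ge_max xe. Qed.

Lemma absvD_lt x y e : absv x < e -> absv y < e -> absv (x + y) < e.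
Proof. by move=> xe ye; apply: le_lt_trans (absvD_max _ _) _; rewrite gt_max xe. Qed.

Lemma absvB_le x y e : absv x <= e -> absv y <= e -> absv (x - y) <= e.
Proof. by move=> xe ye; apply: absvD_le; rewrite ?absvN. Qed.

Lemma absv_sum_le I (r : seq I) (F : I -> K) e : 0 <= e ->
  (forall i, absv (F i) <= e) -> absv (\sum_(i <- r) F i) <= e.
Proof.
move=> e0 h; elim/big_rec : _ => [|i x _ hx]; first by rewrite absv0.
exact: absvD_le.
Qed.

Lemma absv_lt_prime n : (0 < n)%N -> absv (n%:R : K) < 1 ->
  exists2 p : nat, prime p & absv (p%:R : K) < 1.
Proof.
elim/ltn_ind: n => n IH n0 n1.
have nn1 : (1 < n)%N.
  by case: n n0 n1 {IH} => [|[|n]]//; rewrite absv1 ltxx.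
have [h|h] := ltP (absv ((pdiv n)%:R : K)) 1.
  by exists (pdiv n) => //; exact: pdiv_prime.
have p1 : (1 < pdiv n)%N by apply: prime_gt1; exact: pdiv_prime.
apply: (IH (n %/ pdiv n)%N).
- by rewrite ltn_Pdiv.
- by rewrite divn_gt0 ?(ltnW p1)// dvdn_leq// pdiv_dvd.
- move: n1; rewrite -{1}(divnK (pdiv_dvd n)) natrM absvM.
  by apply: le_lt_trans; rewrite ler_peMr ?absv_ge0.
Qed.

Section Prime.
Variable p : nat.
Hypotheses (pp : prime p) (p1 : absv (p%:R : K) < 1).

(** By Bezout's identity 1 would otherwise be a sum of two terms of absolute value less than 1. *)
Lemma absv_coprime (m : int) : coprimez m p -> absv (m%:~R : K) = 1.
Proof.
move=> /coprimezP[[u v] /= uv]; apply/eqP; rewrite eq_le absv_int_le1/= leNgt.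
apply/negP => m1.
have : absv (1 : K) < 1; last by rewrite absv1 ltxx.
rewrite -[1](_ : (1 : int)%:~R = _)// -uv rmorphD !rmorphM/= absvD_lt// absvM.
  by apply: le_lt_trans m1; rewrite ler_piMl ?absv_ge0 ?absv_int_le1.
by apply: le_lt_trans p1; rewrite ler_piMl ?absv_ge0 ?absv_int_le1.
Qed.

Lemma absv_p_unique q : prime q -> absv (q%:R : K) < 1 -> q = p.
Proof.
move=> qp q1; apply/eqP; apply/negP => /negP qnp.
have : coprimez q p by rewrite coprimezE/= prime_coprime// dvdn_prime2.
by move=> /absv_coprime h; move: q1; rewrite -pmulrn in h; rewrite h ltxx.
Qed.

Hypothesis pK0 : (p%:R : K) != 0.

Lemma absv_dvd_pexp n (m : int) : absv (m%:~R : K) <= absv (p%:R : K) ^+ n ->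
  (p%:Z ^+ n %| m)%Z.
Proof.
have p0 : 0 < absv (p%:R : K) by rewrite absv_gt0E.
elim: n m => [|n IH] m hm; first by rewrite expr0 dvd1z.
have pm : (p%:Z %| m)%Z.
  apply: contraT => npm.
  have cm : coprimez m p by rewrite coprimezE coprime_sym prime_coprime.
  move: hm; rewrite (absv_coprime cm) leNgt => /negP[].
  by rewrite exprn_ilt1// ltW.
have [k mk] : exists k, m = k * p%:Z by exists (m %/ p)%Z; rewrite divzK.
rewrite mk exprSr dvdz_mul//; apply: IH.
by move: hm; rewrite mk rmorphM/= absvM exprSr ler_pM2r.
Qed.

End Prime.
End NonArchimedean.

Section CompleteTools.
Context {R : realType} {K : valuedFieldType R}.
Hypothesis cK : forall G : set_system K, ProperFilter G -> cauchy G -> cvg G.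
Implicit Types (x y z : K).

(** An ultrafilter containing A contains a ball of each finite cover, hence is Cauchy, and converges
    by completeness. *)
Lemma totally_bounded_compact (A : set K) : closed A ->
  (forall e : R, 0 < e -> exists n (s : nat -> K), forall x, A x ->
     exists2 i, (i < n)%N & absv (s i - x) < e) -> compact A.
Proof.
move=> cA tA; rewrite compact_ultra => F UF FA.
have cF : cauchy F.
  apply: cauchy_exP => e e0; have [n [s hs]] := tA e e0.
  have : F [set x | exists2 i, (i < n)%N & absv (s i - x) < e].
    by apply: filterS FA.
  elim: n {hs} => [|n IH] h.
    by have [x []] := filter_ex h.
  have [hF|hF] := in_ultra_setVsetC (ball (s n) e) UF; first by exists (s n).
  apply: IH; apply: filterS (filterI h hF) => x [] [j].
  rewrite ltnS leq_eqVlt => /orP[/eqP->//|ilt xi] _.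
  by exists j.
have [x Fx] : exists x, F --> x by exists (lim F); exact: cK.
exists x; split => //.
exact: (@closed_cvg _ _ F _ id A cA FA x Fx).
Qed.

End CompleteTools.

(** * The closure of Q above a prime p *)

Section RatNonArch.
Context {R : realType} {K : valuedFieldType R} (J : {rmorphism rat -> K}).
Hypothesis cK : forall G : set_system K, ProperFilter G -> cauchy G -> cvg G.
Implicit Types (x y z : K).

Lemma ratr_valuedE q : ratr q = J q. Proof. by rewrite (fmorph_eq_rat J). Qed.

Lemma natr_valued_neq0 n : (n.+1%:R : K) != 0.
Proof. by rewrite -(rmorph_nat J) fmorph_eq0 pnatr_eq0. Qed.

Lemma base_fieldP x : @base_field R K x <->
  forall e : R, 0 < e -> exists q : rat, absv (x - J q) < e.
Proof.
split=> [/closureKP h e /h[_ [q _ <-]]|h]; first by rewrite ratr_valuedE; exists q.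
apply/closureKP => e /h[q hq]; exists (ratr q); first by exists q.
by rewrite ratr_valuedE.
Qed.

Lemma base_field_rat q : @base_field R K (J q).
Proof. by apply/base_fieldP => e e0; exists q; rewrite subrr absv0. Qed.

Lemma base_fieldD x y : @base_field R K x -> @base_field R K y -> @base_field R K (x + y).
Proof.
move=> /base_fieldP hx /base_fieldP hy; apply/base_fieldP => e e0.
have e2 : 0 < e / 2 by rewrite divr_gt0.
have [q hq] := hx _ e2; have [q' hq'] := hy _ e2; exists (q + q').
rewrite rmorphD (splitr e) opprD addrACA.
exact: le_lt_trans (absvD _ _) (ltrD _ _).
Qed.

Lemma base_fieldN x : @base_field R K x -> @base_field R K (- x).
Proof.
move=> /base_fieldP hx; apply/base_fieldP => e /hx[q hq]; exists (- q).
by rewrite rmorphN -opprD absvN.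
Qed.

Lemma base_fieldM x y : @base_field R K x -> @base_field R K y -> @base_field R K (x * y).
Proof.
move=> /base_fieldP hx /base_fieldP hy; apply/base_fieldP => e e0.
have e2 : 0 < e / 2 by rewrite divr_gt0.
have c0 : 0 < absv y + 1 by rewrite ltr_wpDl ?absv_ge0.
have [q hq] := hx (e / 2 / (absv y + 1)) (divr_gt0 e2 c0).
have d0 : 0 < absv (J q) + 1 by rewrite ltr_wpDl ?absv_ge0.
have [q' hq'] := hy (e / 2 / (absv (J q) + 1)) (divr_gt0 e2 d0).
exists (q * q'); rewrite rmorphM.
have -> : x * y - J q * J q' = (x - J q) * y + J q * (y - J q') by ring.
rewrite (splitr e); apply: le_lt_trans (absvD _ _) _; rewrite !absvM.
move: hq hq'; rewrite !ltr_pdivlMr// => hq hq'.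
have := absv_ge0 (x - J q); have := absv_ge0 (y - J q'); nra.
Qed.

Lemma base_fieldV x : @base_field R K x -> @base_field R K x^-1.
Proof.
have [->|x0] := eqVneq x 0; first by rewrite invr0.
move=> /base_fieldP hx; apply/base_fieldP => e e0.
have ax : 0 < absv x by rewrite absv_gt0E.
have d0 : 0 < Num.min (absv x / 2) (e * absv x ^+ 2 / 2).
  by rewrite lt_min !divr_gt0 ?mulr_gt0 ?exprn_gt0.
have [q] := hx _ d0; rewrite lt_min => /andP[h1 h2]; exists q^-1; rewrite fmorphV.
have qx : absv x / 2 < absv (J q).
  have := absvD (x - J q) (J q); rewrite subrK; lra.
have q0 : J q != 0 by rewrite -absv_gt0E; apply: lt_trans qx; rewrite divr_gt0.
have -> : x^-1 - (J q)^-1 = - ((x - J q) / (x * J q)) by field; apply/andP.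
rewrite absvN absvf_div absvM ltr_pdivrMr ?mulr_gt0 ?absv_gt0E//.
apply: lt_trans h2 _; rewrite -mulrA ltr_pM2l// expr2 -mulrA ltr_pM2l//.
Qed.

Lemma base_field_closed : closed (@base_field R K).
Proof. exact: closed_closure. Qed.

Hypothesis narch : ~ archimedean K.
Variable p : nat.
Hypotheses (pp : prime p) (p1 : absv (p%:R : K) < 1).

Let pK0 : (p%:R : K) != 0.
Proof. by case: p (prime_gt0 pp) => // n _; exact: natr_valued_neq0. Qed.

Let ap0 : 0 < absv (p%:R : K). Proof. by rewrite absv_gt0E. Qed.

Lemma J_int (z : int) : J z%:~R = z%:~R. Proof. by rewrite rmorph_int. Qed.

Lemma absv_p_expn_lt (e : R) : 0 < e -> exists n, absv (p%:R : K) ^+ n < e.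
Proof.
move=> e0.
have : absv (p%:R : K) ^+ n @[n --> \oo] --> (0 : R).
  by apply: cvg_expr; rewrite ger0_norm ?absv_ge0.
move=> /cvgr0Pnorm_lt/(_ _ e0)[n _ /(_ n (leqnn n)) /=].
by rewrite ger0_norm ?exprn_ge0 ?absv_ge0//; exists n.
Qed.

(** The bound |q| <= 1 forces the denominator to be prime to p. The integer is the numerator times
    an inverse of the denominator modulo p^n, reduced modulo p^n. *)
Lemma rat_approx_nat q n : absv (J q) <= 1 ->
  exists2 m : nat, (m < p ^ n)%N & absv (J q - m%:R) <= absv (p%:R : K) ^+ n.
Proof.
move=> q1.
have den0 : (denq q)%:~R != 0 :> K.
  by rewrite -J_int fmorph_eq0 intr_eq0 denq_neq0.
have qE : J q = (numq q)%:~R / (denq q)%:~R.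
  by rewrite -{1}(divq_num_den q) fmorph_div !J_int.
have cop : coprimez (denq q) p.
  rewrite coprimezE coprime_sym prime_coprime//; apply/negP => pd.
  have cn : coprimez (numq q) p.
    rewrite coprimezE coprime_sym prime_coprime//; apply/negP => pn.
    have := coprime_num_den q; rewrite /coprime => /eqP g1.
    by have := dvdn_gcd p `|numq q| `|denq q|; rewrite pd pn g1 dvdn1/= => /eqP pe; move: pp; rewrite pe.
  have dlt : absv ((denq q)%:~R : K) < 1.
    have [k kE] : exists k, denq q = k * p%:Z.
      by exists (denq q %/ p)%Z; rewrite divzK.
    rewrite kE rmorphM/= absvM; apply: le_lt_trans p1.
    by rewrite ler_piMl ?absv_ge0 ?absv_int_le1.
  move: q1; rewrite qE absvf_div (absv_coprime narch p1 cn) div1r.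
  by rewrite invf_le1 ?absv_gt0E// leNgt dlt.
have cop' : coprimez (p%:Z ^+ n) (denq q).
  case: n => [|n]; first by rewrite expr0 coprimezE coprime1n.
  by rewrite coprimez_pexpl// coprimezE coprime_sym.
have [[u v] /= uv] := coprimezP _ _ cop'.
have pn0 : p%:Z ^+ n != 0 by rewrite expf_neq0// -lt0n prime_gt0.
pose m := ((numq q * v) %% (p%:Z ^+ n))%Z.
have m0 : 0 <= m by apply: modz_ge0.
have mlt : m < p%:Z ^+ n.
  by have := ltz_mod (numq q * v) pn0; rewrite ger0_norm.
exists `|m|%N.
  have e : p%:Z ^+ n = (p ^ n)%N by rewrite -[RHS]natz natrX natz.
  by rewrite -ltz_nat gez0_abs// -e.
have -> : (`|m|%N%:R : K) = m%:~R by rewrite -[in RHS](gez0_abs m0).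
pose w := ((numq q * v) %/ (p%:Z ^+ n))%Z.
have mE : m = numq q * v - w * p%:Z ^+ n.
  by rewrite [X in X - _](divz_eq (numq q * v) (p%:Z ^+ n)) addrAC subrr add0r.
have num : numq q - m * denq q = (numq q * u + w * denq q) * p%:Z ^+ n.
  have h1 : v * denq q = 1 - u * p%:Z ^+ n by rewrite -uv addrAC subrr add0r.
  rewrite mE mulrBl -[numq q * v * _]mulrA h1.
  by move: (numq q) (denq q) (p%:Z ^+ n) => a b P; ring.
have -> : J q - m%:~R = (numq q * u + w * denq q)%:~R * p%:R ^+ n / (denq q)%:~R.
  have -> : (p%:R : K) ^+ n = (p%:Z ^+ n)%:~R by rewrite rmorphXn/=.
  by rewrite -intrM -num intrB intrM qE mulrBl mulfK.
rewrite absvf_div absvM absvX (absv_coprime narch p1 cop) divr1.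
by rewrite ler_piMl ?exprn_ge0 ?absv_ge0 ?absv_int_le1.
Qed.

(** The integers below p^n form a finite net of mesh |p|^n. *)
Lemma base_field_ball1_compact : compact [set x : K | @base_field R K x /\ absv x <= 1].
Proof.
apply: totally_bounded_compact => //.
  exact: closedI base_field_closed (@closed_absv_le _ _ _).
move=> e e0; have [n hn] := absv_p_expn_lt e0.
have d0 : 0 < Num.min 1 (absv (p%:R : K) ^+ n) by rewrite lt_min ltr01 exprn_gt0.
exists (p ^ n)%N, (fun i => i%:R) => x [/base_fieldP /(_ _ d0)[q]].
rewrite lt_min => /andP[/ltW h1 /ltW h2] x1.
have q1 : absv (J q) <= 1.
  have -> : J q = x - (x - J q) by rewrite subKr.
  exact: absvB_le.
have [m mlt hm] := rat_approx_nat n q1; exists m => //.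
apply: le_lt_trans hn.
by rewrite absvB -[x](subrK (J q)) -addrA absvD_le.
Qed.

Lemma base_field_ball_compactN (r : R) :
  compact [set x : K | @base_field R K x /\ absv x <= r].
Proof.
have r0 : 0 < Num.max r 1 by rewrite lt_max ltr01 orbT.
have [k hk] := absv_p_expn_lt (divr_gt0 (@ltr01 R) r0).
pose c : K := p%:R ^+ k.
have c0 : c != 0 by rewrite expf_neq0.
have bc : @base_field R K c.
  by rewrite /c -(rmorph_nat J) -rmorphXn; exact: base_field_rat.
have hc := @continuous_compact _ _ (fun x : K => c^-1 * x) _
  (continuous_subspaceT (@mull_continuous R K c^-1)) base_field_ball1_compact.
apply: subclosed_compact hc _.
  exact: closedI base_field_closed (@closed_absv_le _ _ _).
move=> x [bx xr] /=; exists (c * x); last by rewrite mulKf.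
split; first exact: base_fieldM.
rewrite absvM absvX; move: hk; rewrite ltr_pdivlMr// => /ltW hk.
apply: le_trans hk; rewrite ler_wpM2l ?exprn_ge0 ?absv_ge0//.
by rewrite (le_trans xr)// le_max lexx.
Qed.

(** A large power p^n brings a rational approximation of x into the unit ball, where an integer m <
    p^n approximates it to within |p|^n; then m / p^n is the polar part. *)
Lemma polar_ex x : @base_field R K x -> exists (r : rat) (m n : nat),
  [/\ 0 <= r < 1, r = m%:R / p%:R ^+ n & absv (x - J r) <= 1].
Proof.
move=> /base_fieldP/(_ _ ltr01)[q hq].
have c0 : 0 < absv (J q) + 1 by rewrite ltr_wpDl ?absv_ge0.
have [n hn] := absv_p_expn_lt (divr_gt0 (@ltr01 R) c0).
have : absv (J (p%:R ^+ n * q)) <= 1.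
  rewrite rmorphM rmorphXn rmorph_nat absvM absvX.
  move: hn; rewrite ltr_pdivlMr// => /ltW; apply: le_trans.
  by rewrite ler_wpM2l ?exprn_ge0 ?absv_ge0// lerDl.
move=> /(rat_approx_nat n)[m mlt hm].
have p0 : 0 < (p%:R : rat) by rewrite ltr0n prime_gt0.
exists (m%:R / p%:R ^+ n), m, n; split => //.
  rewrite divr_ge0 ?exprn_ge0//= ltr_pdivrMr ?exprn_gt0// mul1r.
  by rewrite -natrX ltr_nat.
rewrite -[x](subrK (J q)) -addrA absvD_le ?(ltW hq)//.
rewrite fmorph_div rmorphXn !rmorph_nat.
have -> : J q - m%:R / p%:R ^+ n = (J (p%:R ^+ n * q) - m%:R) / p%:R ^+ n.
  by rewrite rmorphM rmorphXn rmorph_nat mulrBl mulrAC divff ?mul1r ?expf_neq0.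
by rewrite absvf_div absvX ler_pdivrMr ?exprn_gt0// mul1r.
Qed.

(** Defects of additivity of the polar part are of this form, so they disappear in the
    exponential. *)
Lemma polar_int (k : int) n : absv (J (k%:~R / p%:R ^+ n)) <= 1 ->
  exists z : int, k%:~R / p%:R ^+ n = z%:~R :> rat.
Proof.
rewrite fmorph_div rmorphXn rmorph_nat J_int absvf_div absvX.
rewrite ler_pdivrMr ?exprn_gt0// mul1r => /(absv_dvd_pexp narch pp p1 pK0) h.
exists (k %/ p%:Z ^+ n)%Z; rewrite -{1}(divzK h) rmorphM/= rmorphXn/=.
by rewrite mulfK// expf_neq0// pnatr_eq0 -lt0n prime_gt0.
Qed.

End RatNonArch.

(** Otherwise all nonzero integers have absolute value 1, all rationals at most 1, and so do all
    elements of F, being roots of monic polynomials with rational coefficients. Applied to x0 and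
    its inverse this contradicts |x0| <> 1. *)
Lemma completion_prime (R : realType) (F : fieldExtType rat)
    (K : valuedFieldType R) (iota : {rmorphism F -> K}) :
  is_completion iota -> ~ archimedean K ->
  exists2 p : nat, prime p & absv (p%:R : K) < 1.
Proof.
move=> [[x0 [x00 x01]] _ _] narch; apply: contrapT => hp.
have n1 (n : nat) : (0 < n)%N -> absv (n%:R : K) = 1.
  move=> n0; apply/eqP; rewrite eq_le absv_nat_le1//= leNgt; apply/negP => h.
  by apply: hp; exact: absv_lt_prime h.
have z1 (z : int) : absv (z%:~R : K) = 1 \/ z = 0.
  case: z => n; first by case: n => [|n]; [right|left; apply: n1].
  by left; rewrite NegzE mulrNz absvN; apply: n1.
pose J : {rmorphism rat -> K} := iota \o in_alg F.
have J1 q : absv (J q) <= 1.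
  rewrite -(divq_num_den q) fmorph_div !rmorph_int absvf_div.
  have [->|/eqP] := z1 (denq q); last by rewrite denq_eq0.
  by rewrite divr1 absv_int_le1.
have le1 (x : F) : absv (iota x) <= 1.
  have /polyOver1P[P PE] := minPolyOver 1%AS x.
  have := root_minPoly 1%AS x; have := monic_minPoly 1%AS x.
  have := size_minPoly 1%AS x; rewrite PE.
  set Q := map_poly _ _; set n := adjoin_degree _ _ => sQ mQ /rootP rQ.
  have nE : n = n.-1.+1 by [].
  have eQ : iota x ^+ n = - \sum_(i < n) J P`_i * iota x ^+ i.
    have := congr1 iota rQ; rewrite horner_coef sQ big_ord_recr/= rmorph0.
    move/monicP: mQ; rewrite lead_coefE sQ/= => ->.
    rewrite mul1r rmorphD/= rmorphXn/= addrC => /eqP; rewrite addr_eq0 => /eqP ->.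
    rewrite rmorph_sum; congr (- _); apply: eq_bigr => i _.
    by rewrite rmorphM rmorphXn coef_map.
  (* If |x| > 1, the leading term of the minimal polynomial would exceed all the others, against the
     ultrametric inequality. *)
  rewrite leNgt; apply/negP => hx.
  have : absv (iota x) ^+ n <= absv (iota x) ^+ n.-1.
    rewrite -absvX eQ absvN absv_sum_le ?exprn_ge0 ?absv_ge0// => i.
    rewrite absvM absvX -[leRHS]mul1r ler_pM ?J1 ?exprn_ge0 ?absv_ge0//.
    by rewrite ler_weXn2l ?ltW// -ltnS -nE.
  have h0 : 0 < absv (iota x) := lt_trans ltr01 hx.
  by rewrite [X in _ ^+ X <= _]nE exprS leNgt ltr_pMl ?exprn_gt0// hx.
move/negP: x01; apply; rewrite eq_le le1/=.
have := le1 x0^-1; rewrite fmorphV absvV invf_le1// absv_gt0E fmorph_eq0//.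
Qed.

(** * Completions are finite-dimensional over the closure of Q *)

Section FiniteDimension.
Context {R : realType} {K : valuedFieldType R} (J : {rmorphism rat -> K}).
Hypothesis base_proper : forall r : R,
  compact [set x : K | base_field x /\ absv x <= r].
Implicit Types (x y z : K) (s : seq K).

Lemma base_field0 : base_field (0 : K).
Proof. by rewrite -(rmorph0 J); exact: base_field_rat. Qed.

Lemma base_field1 : base_field (1 : K).
Proof. by rewrite -(rmorph1 J); exact: base_field_rat. Qed.

Lemma base_field_sum I (r : seq I) (f : I -> K) :
  (forall i, base_field (f i)) -> base_field (\sum_(i <- r) f i).
Proof.
move=> h; elim/big_rec : _ => [|i x _ hx]; first exact: base_field0.
exact: base_fieldD.
Qed.

(** The span over the closure of Q, by recursion on the list because the arguments below add one
    generator at a time to a closed subspace. *)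
Fixpoint kspan s : set K :=
  if s is e :: s' then [set x | exists2 c, base_field c & kspan s' (x - c * e)]
  else [set 0].

Lemma kspan0 s : kspan s 0.
Proof.
elim: s => //= e s IH; exists 0; first exact: base_field0.
by rewrite mul0r subr0.
Qed.

Lemma kspanD s x y : kspan s x -> kspan s y -> kspan s (x + y).
Proof.
elim: s x y => /= [x y -> ->|e s IH x y [c bc hc] [d bd hd]]; first by rewrite addr0.
exists (c + d); first exact: base_fieldD.
by rewrite mulrDl opprD addrACA; exact: IH.
Qed.

Lemma kspanZ s c x : base_field c -> kspan s x -> kspan s (c * x).
Proof.
move=> bc; elim: s x => /= [x ->|e s IH x [d bd hd]]; first by rewrite mulr0.
exists (c * d); first exact: base_fieldM.
by rewrite -mulrA -mulrBr; exact: IH.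
Qed.

Lemma kspanN s x : kspan s x -> kspan s (- x).
Proof.
rewrite -mulN1r; apply: kspanZ; apply: base_fieldN => //; exact: base_field1.
Qed.

Lemma kspan_cons s e x : kspan s x -> kspan (e :: s) x.
Proof.
by move=> h; exists 0; [exact: base_field0|rewrite mul0r subr0].
Qed.

Lemma kspan_mem s e : e \in s -> kspan s e.
Proof.
elim: s => // f s IH; rewrite inE => /orP[/eqP->|/IH]; last exact: kspan_cons.
exists 1; first exact: base_field1.
by rewrite mul1r subrr; exact: kspan0.
Qed.

Lemma kspan_sumP s x : kspan s x <-> exists c : nat -> K,
  (forall i, base_field (c i)) /\ x = \sum_(i < size s) c i * s`_i.
Proof.
elim: s x => [|e s IH] x /=.
  split=> [->|[c [_ ->]]]; last by rewrite big_ord0.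
  by exists (fun=> 0); split=> [_|]; [exact: base_field0|rewrite big_ord0].
split=> [[c bc /IH[d [bd xE]]]|[c [bc ->]]].
  exists (fun i => if i is j.+1 then d j else c); split; first by case.
  rewrite big_ord_recl/=; apply/eqP; rewrite addrC -subr_eq xE; apply/eqP.
  by apply: eq_bigr => i _.
exists (c 0%N) => //; apply/IH; exists (fun i => c i.+1); split => //.
by rewrite big_ord_recl/= addrAC subrr add0r; apply: eq_bigr => i _.
Qed.

(** A point of the closure is already a limit of points of W in a fixed ball, and that part of W is
    compact, hence closed. *)
Lemma proper_closed (W : set K) :
  (forall r : R, compact [set x : K | W x /\ absv x <= r]) -> closed W.
Proof.
move=> hW x cx.
have cl := compact_closed absv_hausdorff (hW (absv x + 1)).
suff [] : [set x0 : K | W x0 /\ absv x0 <= absv x + 1] x by [].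
apply: cl; move/closureKP : cx => cx; apply/closureKP => e e0.
have [y Wy] := cx (Num.min e 1) (ltac:(by rewrite lt_min e0 ltr01)).
rewrite lt_min => /andP[xy1 xy2]; exists y => //; split => //.
rewrite -[y](subrK x); apply: le_trans (absvD _ _) _.
by rewrite absvB addrC lerD2l ltW.
Qed.

(** The constant d is a lower bound for the distance from e to the closed subspace; homogeneity
    extends the bound to the multiples of e. *)
Lemma kspan_dist s e : closed (kspan s) -> ~ kspan s e ->
  exists2 d : R, 0 < d & forall c w, base_field c -> kspan s w ->
    absv c * d <= absv (w + c * e).
Proof.
move=> cs nse.
have /nbhs_absvP[d d0 hd] : nbhs e (~` kspan s).
  by apply: open_nbhs_nbhs; split => //; exact: closed_openC.
exists d => // c w bc hw; have [->|c0] := eqVneq c 0.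
  by rewrite absv0 mul0r absv_ge0.
have -> : w + c * e = c * (e - - (c^-1 * w)) by field.
rewrite absvM ler_wpM2l ?absv_ge0// leNgt; apply/negP => /hd; apply.
by apply: kspanN; apply: kspanZ => //; exact: base_fieldV.
Qed.

Lemma kspan_proper s r : compact [set x : K | kspan s x /\ absv x <= r].
Proof.
elim: s r => [|e s IH] r.
  apply: (@subclosed_compact _ _ [set (0 : K)]); last by move=> x [].
    apply: closedI (@closed_absv_le _ _ _) => /=.
    exact: compact_closed absv_hausdorff (@compact_set1 _ (0 : K)).
  exact: compact_set1.
have cs : closed (kspan s) by exact: proper_closed IH.
have [se|nse] := pselect (kspan s e).
  suff -> : kspan (e :: s) = kspan s by exact: IH.
  apply/seteqP; split=> x; last exact: kspan_cons.
  by move=> [c bc h]; rewrite -[x](subrK (c * e)); apply: kspanD => //; exact: kspanZ.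
have [d d0 hd] := kspan_dist cs nse.
(* By [kspan_dist] an element of the ball of radius r has its coefficient at e bounded by r1, and
   then its remaining part by r2. The ball is thus cut out of the image of a product of two compact
   sets. *)
pose r1 := r / d; pose r2 := r + r1 * absv e.
pose f := fun z : K * K => z.1 + z.2 * e.
have cf : continuous f.
  move=> z; apply: cvgDK; first exact: cvg_fst.
  by apply: cvgMK; [exact: cvg_snd|exact: cvg_cst].
have hc := @continuous_compact _ _ f _ (continuous_subspaceT cf)
  (compact_setX (IH r2) (@base_proper r1)).
have -> : [set x | kspan (e :: s) x /\ absv x <= r] =
   (f @` ([set x | kspan s x /\ absv x <= r2] `*`
          [set x | base_field x /\ absv x <= r1])) `&` [set x : K | absv x <= r].
  apply/seteqP; split=> x /=.
    move=> [[c bc hw] xr]; split => //; exists (x - c * e, c); last by rewrite /f/= subrK.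
    have c1 : absv c <= r1.
      rewrite ler_pdivlMr//; apply: le_trans (hd _ _ bc hw) _.
      by rewrite subrK.
    split; split => //=; apply: le_trans (absvD _ _) _.
    by rewrite absvN lerD// absvM ler_wpM2r ?absv_ge0.
  move=> [[[w c] /= [[hw _] [bc _]]] <- h]; split => //.
  by exists c => //; rewrite /f/= addrK.
by apply: compact_closedI => //; exact: closed_absv_le.
Qed.

Lemma kspan_closed s : closed (kspan s).
Proof. exact: proper_closed (@kspan_proper s). Qed.

Fixpoint kfree s : Prop := if s is e :: s' then ~ kspan s' e /\ kfree s' else True.

Lemma kfree_ex s : exists2 s', kfree s' & kspan s' = kspan s.
Proof.
elim: s => [|e s [s' fs' ss']]; first by exists [::].
have [h|h] := pselect (kspan s' e); last by exists (e :: s') => //=; rewrite ss'.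
exists s' => //; apply/seteqP; split=> x.
  by rewrite ss'; exact: kspan_cons.
move=> [c bc h']; rewrite -[x](subrK (c * e)).
by apply: kspanD; [rewrite ss'|exact: kspanZ].
Qed.

(** Continuity of the coordinates, by the same distance estimate. It gives both the uniqueness of
    coordinates and the bound on the trace. *)
Lemma kfree_coord_le s : kfree s -> exists2 C : R, 0 <= C &
  forall c : nat -> K, (forall i, base_field (c i)) ->
  forall i, (i < size s)%N -> absv (c i) <= C * absv (\sum_(j < size s) c j * s`_j).
Proof.
elim: s => [_|e s IH /= [nse /IH[C C0 hC]]]; first by exists 0.
have [d d0 hd] := kspan_dist (@kspan_closed s) nse.
exists (d^-1 + C * (1 + absv e / d)).
  by rewrite addr_ge0 ?invr_ge0 ?mulr_ge0 ?addr_ge0 ?mulr_ge0 ?absv_ge0 ?invr_ge0// ltW.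
move=> c bc i; rewrite big_ord_recl/=.
set w := \sum_(_ < _) _; have wE : w = \sum_(j < size s) c j.+1 * s`_j.
  by apply: eq_bigr => j _.
have hw : kspan s w by apply/kspan_sumP; exists (fun i => c i.+1).
have := hd _ _ (bc 0%N) hw; rewrite -ler_pdivlMr// addrC => h0.
set x := c 0%N * e + w in h0 *.
have x0 := absv_ge0 x.
have Cd : 0 <= C * (1 + absv e / d).
  by rewrite mulr_ge0 ?addr_ge0 ?mulr_ge0 ?absv_ge0 ?invr_ge0// ltW.
rewrite mulrDl; case: i => [_|i].
  by apply: le_trans h0 _; rewrite mulrC lerDl mulr_ge0.
rewrite ltnS => ilt; have := hC (fun i => c i.+1) (fun i => bc i.+1) i ilt.
rewrite -wE => h; apply: le_trans h _.
apply: (@le_trans _ _ (C * (1 + absv e / d) * absv x)); last first.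
  by rewrite lerDr mulr_ge0 ?invr_ge0// ltW.
rewrite -mulrA ler_wpM2l//.
have -> : w = x - c 0%N * e by rewrite /x addrAC subrr add0r.
apply: le_trans (absvD _ _) _; rewrite absvN absvM mulrDl mul1r lerD2l.
have -> : absv e / d * absv x = absv x / d * absv e by ring.
by rewrite ler_wpM2r ?absv_ge0.
Qed.

End FiniteDimension.

(** * Bases and the trace of a completion over the closure of Q *)

Section Completion.
Context {R : realType} {K : valuedFieldType R} {F : fieldExtType rat}
  (iota : {rmorphism F -> K}).
Hypothesis hK : is_completion iota.
Hypothesis base_proper : forall r : R,
  compact [set x : K | base_field x /\ absv x <= r].
Implicit Types (x y z : K) (s : seq K).

Let J : {rmorphism rat -> K} := iota \o in_alg F.

(** The image of F lies in the span of a rational basis of F; this span is closed and the image is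
    dense. *)
Lemma completion_span : exists2 s : seq K, kfree s & kspan s = setT.
Proof.
pose t := [seq iota e | e <- vbasis {:F}].
have [s fs st] := kfree_ex J t; exists s => //; rewrite st.
apply/seteqP; split=> // x _; apply: (kspan_closed J base_proper).
move=> B; case: hK => _ dF _.
move=> /nbhs_absvP[e e0 he].
have oU : open [set y : K | absv (x - y) < e].
  rewrite openE => y xy; apply/nbhs_absvP; exists (e - absv (x - y)).
    by rewrite subr_gt0.
  move=> z yz /=; have := absvD (x - y) (y - z); rewrite subrKA.
  by move=> h; apply: le_lt_trans h _; rewrite -ltrBrDl.
have /dF/(_ oU)[z [/= xz [y _ yz]]] : [set y : K | absv (x - y) < e] !=set0.
  by exists x; rewrite /= subrr absv0.
exists (iota y); split; last by apply: he; rewrite yz.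
rewrite (coord_vbasis (memvf y)) rmorph_sum.
apply: (big_ind (kspan t)); [exact: kspan0|exact: kspanD|move=> i _].
rewrite -mulr_algl rmorphM; apply: (kspanZ J); first exact: (@base_field_rat _ _ J (coord (vbasis {:F}) i y)).
by apply: (kspan_mem J); apply: (map_f iota); rewrite mem_nth// size_tuple.
Qed.

Lemma basis_ex : exists (n : nat) (e : 'I_n -> K), is_basis e /\
  exists2 C : R, 0 <= C & forall c : 'rV[K]_n, (forall j, base_field (c 0 j)) ->
    forall j, absv (c 0 j) <= C * absv (\sum_j c 0 j * e j).
Proof.
have [s fs st] := completion_span.
have [C C0 hC] := kfree_coord_le J base_proper fs.
have hb (c : 'rV[K]_(size s)) : (forall j, base_field (c 0 j)) ->
    forall j, absv (c 0 j) <= C * absv (\sum_(j < size s) c 0 j * s`_j).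
  move=> bc j.
  pose c' i := if insub i is Some k then c 0 k else 0.
  have bc' i : base_field (c' i).
    by rewrite /c'; case: insubP => // _; exact: (base_field0 J).
  have := hC c' bc' j (ltn_ord j).
  have c'E (k : 'I_(size s)) : c' k = c 0 k by rewrite /c' valK.
  rewrite c'E; under eq_bigr do rewrite c'E.
  by [].
exists (size s), (fun i => s`_i); split; last by exists C.
move=> y; have : kspan s y by rewrite st.
move=> /(kspan_sumP J)[c [bc yE]].
exists (\row_j c j); split.
  split=> [j|]; first by rewrite mxE.
  by rewrite yE; apply: eq_bigr => j _; rewrite mxE.
(* Two expansions of y differ by an expansion of 0, whose coefficients vanish by the coordinate
   bound. *)
move=> d [bd yE']; apply/rowP => j; rewrite mxE; apply/eqP; rewrite -subr_eq0 -absv_eq0.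
rewrite eq_le absv_ge0 andbT.
have bcd k : base_field ((\row_j c j - d) 0 k).
  by rewrite !mxE; apply: (base_fieldD J) => //; exact: (base_fieldN J).
have := hb _ bcd j; rewrite !mxE => h; apply: le_trans h _.
under eq_bigr do rewrite !mxE mulrBl.
by rewrite sumrB -yE -yE' subrr absv0 mulr0.
Qed.

Section Trace.
Variables (n : nat) (e : 'I_n -> K) (be : is_basis e).

Let E : 'cV[K]_n := \col_i e i.

Lemma basis_mx_inj m (A B : 'M[K]_(m, n)) :
  (forall i j, base_field (A i j)) -> (forall i j, base_field (B i j)) ->
  A *m E = B *m E -> A = B.
Proof.
move=> bA bB AB; apply/row_matrixP => i.
have [c [_ cu]] := be ((A *m E) i 0).
have h (D : 'M[K]_(m, n)) : (forall i j, base_field (D i j)) ->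
    (D *m E) i 0 = (A *m E) i 0 -> c = row i D.
  move=> bD DA; apply: cu; split=> [j|]; first by rewrite mxE.
  by rewrite -DA mxE; apply: eq_bigr => j _; rewrite !mxE.
by rewrite -(h A)// -(h B)// AB.
Qed.

Lemma basis_mx_ex m (v : 'I_m -> K) : exists2 A : 'M[K]_(m, n),
  forall i j, base_field (A i j) & forall i, v i = \sum_j A i j * e j.
Proof.
have /choice[c hc] : forall i, exists c : 'rV[K]_n,
    (forall j, base_field (c 0 j)) /\ v i = \sum_j c 0 j * e j.
  by move=> i; have [c [hc _]] := be (v i); exists c.
exists (\matrix_i c i) => i => [j|]; first by rewrite mxE; exact: (hc i).1.
by rewrite (hc i).2; apply: eq_bigr => j _; rewrite mxE.
Qed.

End Trace.

Lemma base_field_mulmx m n q (A : 'M[K]_(m, n)) (B : 'M[K]_(n, q)) :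
  (forall i j, base_field (A i j)) -> (forall i j, base_field (B i j)) ->
  forall i j, base_field ((A *m B) i j).
Proof.
move=> bA bB i j; rewrite mxE; apply: (base_field_sum J) => k.
exact: (base_fieldM J).
Qed.

(** Change of basis: M = P M' Q with Q P = 1, and the trace is cyclic. The matrices P and Q are
    rectangular a priori, as the two bases are not known to have the same length. *)
Lemma is_trace_unique x t t' : is_trace x t -> is_trace x t' -> t = t'.
Proof.
move=> [n [e [M [be bM hM ->]]]] [n' [e' [M' [be' bM' hM' ->]]]].
have [P bP hP] := basis_mx_ex be' e.
have [Q bQ hQ] := basis_mx_ex be e'.
have b1 m i j : base_field ((1%:M : 'M[K]_m) i j).
  by rewrite mxE; case: eqP => _; [exact: (base_field1 J)|exact: (base_field0 J)].
pose E : 'cV[K]_n := \col_i e i; pose E' : 'cV[K]_n' := \col_i e' i.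
have EP : E = P *m E'.
  by apply/colP => i; rewrite !mxE hP; apply: eq_bigr => j _; rewrite mxE.
have EQ : E' = Q *m E.
  by apply/colP => i; rewrite !mxE hQ; apply: eq_bigr => j _; rewrite mxE.
have EM : x *: E = M *m E.
  by apply/colP => i; rewrite !mxE hM; apply: eq_bigr => j _; rewrite mxE.
have EM' : x *: E' = M' *m E'.
  by apply/colP => i; rewrite !mxE hM'; apply: eq_bigr => j _; rewrite mxE.
have QP : Q *m P = 1%:M.
  apply: (basis_mx_inj be'); [exact: base_field_mulmx|exact: b1|].
  by rewrite -/E' mul1mx -mulmxA -EP -EQ.
have -> : M = P *m M' *m Q.
  apply: (basis_mx_inj be) => //; first by do 2?apply: base_field_mulmx.
  by rewrite -/E -EM -[RHS]mulmxA -EQ -mulmxA -EM' -scalemxAr -EP.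
by rewrite mxtrace_mulC mulmxA QP mul1mx.
Qed.

Lemma is_trace_traceE x t : is_trace x t -> trace x = t.
Proof.
move=> h; apply: (xget_unique _ h) => t' h'; exact: is_trace_unique h' h.
Qed.

Lemma trace_mx n (e : 'I_n -> K) x : is_basis e -> exists M : 'M[K]_n,
  [/\ forall i j, base_field (M i j), forall i, x * e i = \sum_j M i j * e j &
    trace x = \tr M].
Proof.
move=> be; have [M bM hM] := basis_mx_ex be (fun i => x * e i).
by exists M; split => //; apply: is_trace_traceE; exists n, e, M.
Qed.

Lemma base_field_trace x : base_field (trace x).
Proof.
have [n [e [be _]]] := basis_ex; have [M [bM _ ->]] := trace_mx x be.
by apply: (base_field_sum J) => i.
Qed.

Lemma traceD x y : trace (x + y) = trace x + trace y.
Proof.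
have [n [e [be _]]] := basis_ex.
have [M [bM hM ->]] := trace_mx x be; have [M' [bM' hM' ->]] := trace_mx y be.
rewrite -mxtraceD; apply: is_trace_traceE; exists n, e, (M + M'); split => //.
  by move=> i j; rewrite mxE; apply: (base_fieldD J).
move=> i; rewrite mulrDl hM hM' -big_split/=; apply: eq_bigr => j _.
by rewrite mxE mulrDl.
Qed.

Lemma traceZ c x : base_field c -> trace (c * x) = c * trace x.
Proof.
move=> bc; have [n [e [be _]]] := basis_ex.
have [M [bM hM ->]] := trace_mx x be.
rewrite -mxtraceZ; apply: is_trace_traceE; exists n, e, (c *: M); split => //.
  by move=> i j; rewrite mxE; apply: (base_fieldM J).
move=> i; rewrite -mulrA hM mulr_sumr; apply: eq_bigr => j _.
by rewrite mxE mulrA.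
Qed.

(** Each diagonal entry is a coordinate of x e_i, hence at most a constant times |x| |e_i|. *)
Lemma absv_trace_le : exists2 C : R, 0 <= C &
  forall x, absv (trace x) <= C * absv x.
Proof.
have [n [e [be [C C0 hC]]]] := basis_ex.
exists (C * \sum_i absv (e i)).
  by rewrite mulr_ge0// sumr_ge0// => i _; exact: absv_ge0.
move=> x; have [M [bM hM ->]] := trace_mx x be.
apply: le_trans (absv_sum _ _ _) _; rewrite mulrAC mulr_sumr.
apply: ler_sum => i _.
have bi k : base_field (row i M 0 k) by rewrite mxE.
have := hC _ bi i; rewrite mxE.
under eq_bigr do rewrite mxE.
by rewrite -hM absvM mulrA.
Qed.

Lemma ball_compact r : compact [set x : K | absv x <= r].
Proof.
have [s _ st] := completion_span.
have := @kspan_proper _ _ J base_proper s r.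
suff -> : [set x | kspan s x /\ absv x <= r] = [set x : K | absv x <= r] by [].
by apply/seteqP; split=> x /=; [case|rewrite st].
Qed.

End Completion.

Lemma norm_powR_continuous (R : realType) (c : R) : 0 < c ->
  continuous (fun t : R => `|t| `^ c).
Proof.
move=> c0 t; have [->|t0] := eqVneq t 0.
  apply/cvgrPdist_lt => e e0; rewrite normr0 powR0 ?gt_eqF//.
  have d0 : 0 < e `^ c^-1 by rewrite powR_gt0.
  apply/nbhs_ballP; exists (e `^ c^-1) => //= y; rewrite /ball/= sub0r normrN => h.
  rewrite sub0r normrN ger0_norm ?powR_ge0//.
  have := gt0_ltr_powR c0; move=> /(_ `|y| (e `^ c^-1)); rewrite !nnegrE.
  rewrite normr_ge0 (ltW d0) => /(_ isT isT h).
  by rewrite -powRrM mulVf ?gt_eqF// powRr1// ltW.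
have h : {for t, continuous (fun t : R => expR (c * ln `|t|))}.
  apply: continuous_comp; last exact: continuous_expR.
  apply: continuousM; first exact: cvg_cst.
  apply: continuous_comp; first exact: norm_continuous.
  by apply: continuous_ln; rewrite normr_gt0.
rewrite /continuous_at.
have -> : `|t| `^ c = expR (c * ln `|t|) by rewrite /powR normr_eq0 (negbTE t0).
apply: cvg_trans h; apply: near_eq_cvg.
have : \forall s \near t, s != 0.
  exact: (open_comp (fun=> fun=> cvg_id) (@open_neq R 0)).
by apply: filterS => s s0; rewrite /powR normr_eq0 (negbTE s0).
Qed.

(** * Archimedean completions *)

Section Archimedean.
Context {R : realType} {K : valuedFieldType R} (J : {rmorphism rat -> K}).
Hypothesis cK : forall G : set_system K, ProperFilter G -> cauchy G -> cvg G.
Variable c : R.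
Hypotheses (c0 : 0 < c) (absv_nat : forall n : nat, absv (n%:R : K) = n%:R `^ c).
Implicit Types (x y z : K) (s t : R) (q : rat).

Lemma absv_ratr q : absv (J q) = `|ratr q : R| `^ c.
Proof.
have absz (z : int) : absv (z%:~R : K) = `|z%:~R : R| `^ c.
  case: z => n; first by rewrite ger0_norm ?ler0n// -pmulrn absv_nat.
  by rewrite NegzE !mulrNz absvN normrN ger0_norm ?ler0n// -pmulrn absv_nat.
rewrite -(divq_num_den q) !fmorph_div !rmorph_int/= absvf_div normf_div.
by rewrite powRM ?invr_ge0// -[`|_|^-1]powR_inv1// -powRrM mulN1r powRN !absz.
Qed.

Lemma powR_lt_root (e u : R) : 0 < e -> 0 <= u -> u < e `^ c^-1 -> u `^ c < e.
Proof.
move=> e0 u0 h; have := gt0_ltr_powR c0 => /(_ u (e `^ c^-1)); rewrite !nnegrE.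
rewrite u0 powR_ge0 => /(_ isT isT h).
by rewrite -powRrM mulVf ?gt_eqF// powRr1// ltW.
Qed.

Lemma powR_le_root (u r : R) : 0 <= u -> u `^ c <= r -> u <= r `^ c^-1.
Proof.
move=> u0 h; have ci : 0 <= c^-1 by rewrite invr_ge0 ltW.
have r0 : 0 <= r by apply: le_trans h; exact: powR_ge0.
have := ge0_ler_powR ci => /(_ (u `^ c) r); rewrite !nnegrE powR_ge0 r0.
by move=> /(_ isT isT h); rewrite -powRrM divff ?gt_eqF// powRr1.
Qed.

Lemma rat_seq_cvg t : exists q_ : nat -> rat, (ratr (q_ n) : R) @[n --> \oo] --> t.
Proof.
have /choice[q_ hq] : forall n : nat, exists q : rat,
    t < (ratr q : R) < t + n.+1%:R^-1.
  move=> n; have : t < t + n.+1%:R^-1 by rewrite ltrDl invr_gt0.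
  by move=> /rat_in_itvoo[q]; rewrite in_itv; exists q.
exists q_.
have h : t + n.+1%:R^-1 @[n --> \oo] --> t.
  rewrite -[X in _ --> X]addr0; apply: cvgD; first exact: cvg_cst.
  exact: cvg_harmonic.
apply: (squeeze_cvgr _ (cvg_cst t) h).
by near=> n; have /andP[h1 h2] := hq n; rewrite !ltW.
Unshelve. all: by end_near. Qed.

(** The relation in which [real_emb] chooses a value: [cvgJ] and [rel_unique] make it the graph of a
    total function, so the default of [xget] is never taken. *)
Let rel t x := exists2 q : nat -> rat,
    (ratr (q n) : R) @[n --> \oo] --> t & (ratr (q n) : K) @[n --> \oo] --> x.

Let cvgJ (q_ : nat -> rat) t : (ratr (q_ n) : R) @[n --> \oo] --> t ->
  exists x, J (q_ n) @[n --> \oo] --> x.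
Proof.
move=> hq.
have : cauchy (J (q_ n) @[n --> \oo]).
  apply: cauchy_exP => e e0.
  have d0 : 0 < e `^ c^-1 / 2 by rewrite divr_gt0// powR_gt0.
  move/cvgrPdist_lt : (hq) => /(_ _ d0)[N _ hN].
  exists (J (q_ N)); exists N => // n Nn /=.
  rewrite ball_absv -rmorphB absv_ratr rmorphB; apply: powR_lt_root => //.
  rewrite [e `^ _]splitr -(subrKA t); apply: le_lt_trans (ler_normD _ _) _.
  by apply: ltrD; [rewrite distrC; apply: hN => /=|exact: hN].
by move=> /cK h; exists (lim (J (q_ n) @[n --> \oo])).
Qed.

Let rel_unique t x y : rel t x -> rel t y -> x = y.
Proof.
move=> [q qt qx] [q' qt' qy].
have h : J (q n) - J (q' n) @[n --> \oo] --> x - y.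
  apply: cvgDK; first by under eq_fun do rewrite -ratr_valuedE.
  by apply: cvgNK; under eq_fun do rewrite -ratr_valuedE.
have h2 : `|ratr (q n) - ratr (q' n) : R| `^ c @[n --> \oo] --> (0 : R).
  have h2 : `|t| `^ c @[t --> (0 : R)] --> (0 : R).
    have := @norm_powR_continuous R c c0 0.
    by rewrite /continuous_at/= normr0 powR0 ?gt_eqF.
  apply: (@cvg_comp _ _ _ (fun n => ratr (q n) - ratr (q' n) : R)
    (fun t : R => `|t| `^ c) _ (nbhs (0 : R))) => //.
  by rewrite -(subrr t); apply: cvgB.
have h3 : absv (x - y) = 0.
  apply: (@cvg_unique _ _ (absv (J (q n) - J (q' n)) @[n --> \oo])).
  - exact: Rhausdorff.
  - exact: (@cvg_comp _ _ _ _ absv _ _ _ h (@absv_continuous R K (x - y))).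
  - rewrite /= (_ : (fun n => absv (J (q n) - J (q' n))) =
      (fun n => `|ratr (q n) - ratr (q' n) : R| `^ c))//.
    by apply/funext => n; rewrite -rmorphB absv_ratr rmorphB.
by move/eqP: h3; rewrite absv_eq0 subr_eq0 => /eqP.
Qed.

Lemma real_emb_rel t x : rel t x -> real_emb K t = x.
Proof. by move=> h; apply: (xget_unique _ h) => y h'; exact: rel_unique h' h. Qed.

Lemma real_emb_cvg (q_ : nat -> rat) t : (ratr (q_ n) : R) @[n --> \oo] --> t ->
  J (q_ n) @[n --> \oo] --> real_emb K t.
Proof.
move=> hq; have [x hx] := cvgJ hq; suff -> : real_emb K t = x by [].
apply: real_emb_rel; exists q_ => //.
by under eq_fun do rewrite (ratr_valuedE J).
Qed.

Lemma real_emb_rat q : real_emb K (ratr q) = J q.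
Proof.
apply: real_emb_rel; exists (fun=> q); first exact: cvg_cst.
by rewrite (ratr_valuedE J); exact: cvg_cst.
Qed.

Lemma real_emb_lim (q_ : nat -> rat) t x : (ratr (q_ n) : R) @[n --> \oo] --> t ->
  J (q_ n) @[n --> \oo] --> x -> real_emb K t = x.
Proof.
move=> h h'; apply: real_emb_rel; exists q_ => //.
by under eq_fun do rewrite (ratr_valuedE J).
Qed.

Lemma real_embB s t : real_emb K (s - t) = real_emb K s - real_emb K t.
Proof.
have [q hq] := rat_seq_cvg s; have [q' hq'] := rat_seq_cvg t.
apply: (@real_emb_lim (fun n => q n - q' n)).
  by under eq_fun do rewrite rmorphB; exact: cvgB.
under eq_fun do rewrite rmorphB; apply: cvgDK; first exact: real_emb_cvg.
by apply: cvgNK; exact: real_emb_cvg.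
Qed.

Lemma real_embM s t : real_emb K (s * t) = real_emb K s * real_emb K t.
Proof.
have [q hq] := rat_seq_cvg s; have [q' hq'] := rat_seq_cvg t.
apply: (@real_emb_lim (fun n => q n * q' n)).
  by under eq_fun do rewrite rmorphM; exact: cvgM.
by under eq_fun do rewrite rmorphM; apply: cvgMK; exact: real_emb_cvg.
Qed.

Lemma real_emb1 : real_emb K 1 = 1.
Proof. by rewrite -(rmorph1 J) -real_emb_rat rmorph1. Qed.

Lemma real_emb_rmorphism :
  exists r : {rmorphism R -> K}, forall t, r t = real_emb K t.
Proof.
have m1 : zmod_morphism (real_emb K) by exact: real_embB.
have m2 : monoid_morphism (real_emb K).
  by split; [exact: real_emb1|exact: real_embM].
pose f1 := GRing.isZmodMorphism.Build R K (real_emb K) m1.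
pose f2 := GRing.isMonoidMorphism.Build R K (real_emb K) m2.
pose r : {rmorphism R -> K} := HB.pack (real_emb K) f1 f2.
by exists r.
Qed.

Lemma absv_real_emb t : absv (real_emb K t) = `|t| `^ c.
Proof.
have [q hq] := rat_seq_cvg t.
apply: (@cvg_unique _ _ (absv (J (q n)) @[n --> \oo])).
- exact: Rhausdorff.
- exact: (@cvg_comp _ _ _ _ absv _ _ _ (real_emb_cvg hq) (@absv_continuous R K _)).
- rewrite /= (_ : (fun n => absv (J (q n))) = (fun n => `|ratr (q n) : R| `^ c)).
    exact: (@cvg_comp _ _ _ _ _ _ _ _ hq (@norm_powR_continuous R c c0 t)).
  by apply/funext => n; rewrite absv_ratr.
Qed.

Lemma real_emb_continuous : continuous (real_emb K).
Proof.
move=> t; apply/cvg_absvP => e e0; apply/nbhs_ballP; exists (e `^ c^-1) => /=.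
  by rewrite powR_gt0.
by move=> s; rewrite /ball/= => h; rewrite -real_embB absv_real_emb powR_lt_root.
Qed.

Lemma real_emb_bound M : compact (real_emb K @` `[- M, M]).
Proof.
apply: continuous_compact; last exact: segment_compact.
exact/continuous_subspaceT/real_emb_continuous.
Qed.

(** Rationals close to x are bounded in the real absolute value, and the image of a bounded interval
    is compact, hence closed. *)
Lemma base_field_real_emb x : base_field x <-> exists t, x = real_emb K t.
Proof.
split=> [bx|[t ->]]; last first.
  have [q hq] := rat_seq_cvg t.
  apply/(base_fieldP J) => e e0.
  have /cvg_absvP/(_ _ e0)[N _ /(_ N (leqnn N)) h] := real_emb_cvg hq.
  by exists (q N).
pose M := (absv x + 1) `^ c^-1.
have a1 : 0 < absv x + 1 by rewrite ltr_wpDl ?absv_ge0.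
suff : (real_emb K @` `[- M, M]) x by move=> [t _ <-]; exists t.
have cl := compact_closed absv_hausdorff (@real_emb_bound M); apply: cl.
apply/closureKP => e e0.
have d0 : 0 < Num.min e 1 by rewrite lt_min e0 ltr01.
have [q] := (base_fieldP J x).1 bx _ d0; rewrite lt_min => /andP[h1 h2].
exists (J q) => //=; exists (ratr q); last exact: real_emb_rat.
rewrite /= in_itv/= -ler_norml /M.
have : absv (J q) <= absv x + 1.
  have := absvD (J q - x) x; rewrite subrK absvB; lra.
rewrite absv_ratr => h.
exact: powR_le_root.
Qed.

Lemma base_field_ball_compactA (r : R) :
  compact [set x : K | base_field x /\ absv x <= r].
Proof.
have [r0|r0] := ltP r 0.
  suff -> : [set x : K | base_field x /\ absv x <= r] = set0 by exact: compact0.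
  rewrite -subset0 => x [_] /le_lt_trans/(_ r0).
  by move=> /(le_lt_trans (absv_ge0 x)); rewrite ltxx.
apply: (@subclosed_compact _ _ (real_emb K @` `[- (r `^ c^-1), r `^ c^-1])).
- exact: closedI (@base_field_closed R K) (@closed_absv_le _ _ _).
- exact: real_emb_bound.
- move=> x [/base_field_real_emb[t ->]]; rewrite absv_real_emb => h.
  exists t => //; rewrite /= in_itv/= -ler_norml.
  exact: powR_le_root.
Qed.

End Archimedean.

(** * Archimedean completions are the real or the complex numbers *)

Section RealOrComplex.
Context {R : realType} {K : valuedFieldType R} (r : {rmorphism R -> K}).
Implicit Types (x y z : K) (s t : R).

(** As an eigenvalue of a real matrix, x is a root of the characteristic polynomial p, and p^2 is a
    product of real quadratics (X - Re z)^2 + (Im z)^2, one of which vanishes at x. This plays the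
    part of the Gelfand-Mazur theorem. *)
Lemma eigen_quadratic n (M : 'M[R]_n) (v : 'cV[K]_n) x : v != 0 ->
  x *: v = map_mx r M *m v ->
  exists a b : R, (x - r a) ^+ 2 + r b ^+ 2 = 0.
Proof.
(* Transposed because [eigenvalue] refers to row vectors. *)
move=> v0 xv; pose p := char_poly M^T.
have px : root (map_poly r p) x.
  rewrite map_char_poly -eigenvalue_root_char; apply/eigenvalueP.
  exists v^T; last by rewrite -trmx_eq0 trmxK.
  by rewrite -map_trmx -trmx_mul -xv linearZ.
pose rc : {rmorphism R -> R[i]} := real_complex R.
have [zs pE] := closed_field_poly_normal (map_poly rc p).
have mp : map_poly rc p \is monic by rewrite monic_map// char_poly_monic.
rewrite (monicP mp) scale1r in pE.
pose Q (z : R[i]) : {poly R} :=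
  ('X - (complex.Re z)%:P) ^+ 2 + ((complex.Im z) ^+ 2)%:P.
(* Since p is its own conjugate, p^2 is the product of p and its conjugate. Each root z meets its
   conjugate in the other factor, which avoids pairing conjugate roots within p. *)
have p2E : p ^+ 2 = \prod_(z <- zs) Q z.
  apply: (@map_poly_inj _ _ rc); rewrite rmorphXn rmorph_prod/= expr2.
  have pE' : map_poly rc p = \prod_(z <- zs) ('X - (z^*%C)%:P).
    have -> : map_poly rc p = map_poly (@conjc R) (map_poly rc p).
      rewrite -map_poly_comp; apply: eq_map_poly => t /=.
      by rewrite oppr0.
    rewrite pE rmorph_prod/=; apply: eq_bigr => z _.
    by rewrite map_polyXsubC.
  rewrite {1}pE pE' -big_split/=; apply: eq_bigr => z _.
  rewrite rmorphD/= rmorphXn/= map_polyXsubC map_polyC/= rmorphXn/=.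
  have zE : z = (complex.Re z)%:C + 'i%C * (complex.Im z)%:C by exact: complexE.
  have zE' : z^*%C = (complex.Re z)%:C - 'i%C * (complex.Im z)%:C.
    by case: z {zE} => a b; rewrite /=; simpc.
  rewrite {1}zE zE' -/rc; move: (rc (complex.Re z)) (rc (complex.Im z)) => a b.
  have b2 : (b ^+ 2)%:P = b%:P * b%:P by rewrite expr2 polyCM.
  rewrite b2 polyCD polyCB !polyCM.
  have i2 : ('i%C%:P : {poly R[i]}) * 'i%C%:P = -1.
    by rewrite -polyCM -expr2 sqr_i polyCN.
  move: ('i%C%:P) i2 => I i2.
  rewrite (_ : _ * _ = ('X - a%:P) ^+ 2 - (I * I) * (b%:P * b%:P)); last by ring.
  by rewrite i2; ring.
have : (map_poly r (p ^+ 2)).[x] = 0.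
  by rewrite rmorphXn horner_exp (rootP px) expr0n.
rewrite p2E rmorph_prod horner_prod => /eqP.
rewrite prodf_seq_eq0 => /hasP[z _ /= /eqP hz].
exists (complex.Re z), (complex.Im z); move: hz.
rewrite rmorphD/= rmorphXn/= map_polyXsubC map_polyC/= rmorphXn/=.
by rewrite !hornerE.
Qed.

(* In the real case [b = 0] and [j = 0]; [a] and [b] are the real and imaginary
   parts otherwise. *)
Definition coordinates (j : K) (a b : K -> R) :=
  [/\ forall x, x = r (a x) + j * r (b x),
      forall x y, a (x + y) = a x + a y /\ b (x + y) = b x + b y,
      forall t x, a (r t * x) = t * a x /\ b (r t * x) = t * b x,
      forall x y, a (x * y) = a x * a y - b x * b y /\
        b (x * y) = a x * b y + b x * a y &
      forall t, a (r t) = t /\ b (r t) = 0].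

(** If -1 = j^2 in K, every quadratic splits and K = R + jR. Otherwise b must be 0, for (x - a) / b
    would be a square root of -1, so x = a and K = R. *)
Lemma coordinates_ex :
  (forall x, exists a b : R, (x - r a) ^+ 2 + r b ^+ 2 = 0) ->
  exists j a b, coordinates j a b.
Proof.
move=> quad.
have [[j j2]|nj] := pselect (exists j : K, j ^+ 2 = -1); last first.
  have /choice[a ha] : forall x, exists a : R, x = r a.
    move=> x; have [a [b ab]] := quad x; exists a; apply/eqP; rewrite -subr_eq0.
    apply/negPn/negP => xa; apply: nj; have [b0|b0] := eqVneq (r b) 0.
      by move: ab; rewrite b0 expr0n addr0 => /eqP; rewrite expf_eq0/= (negbTE xa).
    exists ((x - r a) / r b); rewrite expr_div_n.
    move/eqP: ab; rewrite addr_eq0 => /eqP->.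
    by rewrite mulNr divff// expf_neq0.
  have ar t : a (r t) = t by apply: (fmorph_inj r); rewrite -ha.
  exists 0, a, (fun=> 0); split.
  - by move=> x; rewrite mul0r addr0.
  - by move=> x y; rewrite {1}(ha x) {1}(ha y) -rmorphD ar addr0.
  - by move=> t x; rewrite {1}(ha x) -rmorphM ar mulr0.
  - by move=> x y; rewrite {1}(ha x) {1}(ha y) -rmorphM ar !mulr0 mul0r subr0 addr0.
  - by move=> t; rewrite ar.
have /choice[ab hab] : forall x, exists ab : R * R, x = r ab.1 + j * r ab.2.
  move=> x; have [a [b xab]] := quad x.
  have : (x - r a - j * r b) * (x - r a + j * r b) = 0.
    rewrite -subr_sqr exprMn j2 mulN1r opprK//.
  move/eqP; rewrite mulf_eq0 => /orP[/eqP h|/eqP h].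
    exists (a, b) => /=; apply/eqP; rewrite -subr_eq0 opprD addrA.
    exact/eqP.
  exists (a, - b) => /=; apply/eqP; rewrite -subr_eq0 opprD addrA rmorphN mulrN opprK.
  exact/eqP.
(* Coordinates are unique because j is not real, -1 being no square in R. *)
have uniq s t : r s + j * r t = 0 -> s = 0 /\ t = 0.
  move=> h; have [t0|t0] := eqVneq t 0.
    move: h; rewrite t0 rmorph0 mulr0 addr0 => /eqP.
    by rewrite fmorph_eq0 => /eqP.
  have jE : j = r (- s / t).
    have e : j * r t = - r s by apply/eqP; rewrite -addr_eq0 addrC h.
    by rewrite fmorph_div rmorphN -e mulfK ?fmorph_eq0.
  have : (- s / t) ^+ 2 = -1.
    by apply: (fmorph_inj r); rewrite rmorphXn -jE j2 rmorphN rmorph1.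
  have := sqr_ge0 (- s / t); lra.
have uniq2 s t s' t' : r s + j * r t = r s' + j * r t' -> s = s' /\ t = t'.
  move=> h; have [|] := uniq (s - s') (t - t').
    rewrite !rmorphB; apply/eqP; rewrite mulrBr addrACA -opprD h subrr//.
  by move=> /eqP + /eqP; rewrite !subr_eq0 => /eqP-> /eqP->.
exists j, (fun x => (ab x).1), (fun x => (ab x).2); split.
- by [].
- move=> x y; apply: uniq2; rewrite -hab {1}(hab x) {1}(hab y) !rmorphD mulrDr.
  by rewrite addrACA.
- move=> t x; apply: uniq2; rewrite -hab {1}(hab x) !rmorphM mulrDr.
  by rewrite mulrCA.
- move=> x y; apply: uniq2; rewrite -hab {1}(hab x) {1}(hab y).
  rewrite rmorphB rmorphD !rmorphM.
  move: (r _) (r _) (r _) (r _) => a b c d.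
  rewrite (_ : _ * _ = d * b + j ^+ 2 * (c * a) + j * (d * a + c * b)); last by ring.
  by rewrite j2 mulN1r.
- by move=> t; apply: uniq2; rewrite -hab rmorph0 mulr0 addr0.
Qed.

Section Norm.
Variables (j : K) (a b : K -> R).
Hypothesis jab : coordinates j a b.

(** The norm form of C over R, respectively the square on R. *)
Definition sqnorm x : R := a x ^+ 2 + b x ^+ 2.

Lemma coordE x : x = r (a x) + j * r (b x). Proof. by case: jab. Qed.

Lemma coordD x y : (a (x + y) = a x + a y) * (b (x + y) = b x + b y).
Proof. by case: jab => _ h _ _ _; have [h1 h2] := h x y. Qed.

Lemma coordZ t x : (a (r t * x) = t * a x) * (b (r t * x) = t * b x).
Proof. by case: jab => _ _ h _ _; have [h1 h2] := h t x. Qed.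

Lemma coordM x y : (a (x * y) = a x * a y - b x * b y) *
  (b (x * y) = a x * b y + b x * a y).
Proof. by case: jab => _ _ _ h _; have [h1 h2] := h x y. Qed.

Lemma coordr t : (a (r t) = t) * (b (r t) = 0).
Proof. by case: jab => _ _ _ _ h; have [h1 h2] := h t. Qed.

Lemma coord0 : (a 0 = 0) * (b 0 = 0).
Proof. by have := coordr 0; rewrite rmorph0. Qed.

Lemma coordN x : (a (- x) = - a x) * (b (- x) = - b x).
Proof.
have := coordZ (-1) x; rewrite rmorphN rmorph1 mulN1r => -[-> ->].
by rewrite !mulN1r.
Qed.

Lemma coordB x y : (a (x - y) = a x - a y) * (b (x - y) = b x - b y).
Proof. by rewrite !coordD !coordN. Qed.

Lemma sqnorm_ge0 x : 0 <= sqnorm x.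
Proof. by rewrite addr_ge0// sqr_ge0. Qed.

Lemma sqnorm_gt0 x : x != 0 -> 0 < sqnorm x.
Proof.
move=> x0; rewrite lt0r sqnorm_ge0 andbT paddr_eq0 ?sqr_ge0// !expf_eq0/=.
apply/negP => /andP[/eqP ax /eqP bx].
by move: x0; rewrite (coordE x) ax bx rmorph0 mulr0 addr0 eqxx.
Qed.

Lemma sqnorm0 : sqnorm 0 = 0.
Proof. by rewrite /sqnorm !coord0 expr0n addr0. Qed.

Lemma sqnormM x y : sqnorm (x * y) = sqnorm x * sqnorm y.
Proof. by rewrite /sqnorm !coordM; ring. Qed.

Lemma sqnormr t : sqnorm (r t) = t ^+ 2.
Proof. by rewrite /sqnorm !coordr expr0n addr0. Qed.

Lemma sqnorm1 : sqnorm 1 = 1.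
Proof. by rewrite -(rmorph1 r) sqnormr expr1n. Qed.

Lemma sqnormX x n : sqnorm (x ^+ n) = sqnorm x ^+ n.
Proof. by elim: n => [|n IH]; rewrite ?expr0 ?sqnorm1// !exprS sqnormM IH. Qed.

Lemma coord_le x : (`|a x| <= Num.sqrt (sqnorm x)) * (`|b x| <= Num.sqrt (sqnorm x)).
Proof. by split; rewrite -sqrtr_sqr ler_wsqrtr// ?lerDl ?lerDr sqr_ge0. Qed.

Variable c : R.
Hypotheses (c0 : 0 < c) (absvr : forall t, absv (r t) = `|t| `^ c).

(** The powers of x stay on the unit circle, where both coordinates are at most 1, so their absolute
    values are bounded by 1 + |j|. *)
Let absv_le1 x : sqnorm x = 1 -> absv x <= 1.
Proof.
move=> x1; apply: (@exp_le_linear _ _ (1 + absv j)); first exact: absv_ge0.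
move=> n; rewrite -absvX.
have u1 t : `|t| <= 1 -> absv (r t) <= 1.
  move=> t1; rewrite absvr; apply: (@le_trans _ _ (1 `^ c)); last by rewrite powR1.
  by apply: ge0_ler_powR; rewrite ?nnegrE ?(ltW c0).
have h1 := coord_le (x ^+ n); rewrite sqnormX x1 expr1n sqrtr1 in h1.
rewrite (coordE (x ^+ n)).
apply: (@le_trans _ _ (1 + absv j)).
  apply: le_trans (absvD _ _) _; rewrite absvM lerD ?u1 ?h1//.
  by rewrite ler_piMr ?absv_ge0// u1// h1.
by rewrite ler_peMr ?addr_ge0 ?absv_ge0// ler1n.
Qed.

Lemma absv_sqnorm1 x : sqnorm x = 1 -> absv x = 1.
Proof.
move=> x1; apply/eqP; rewrite eq_le absv_le1//=.
have x0 : x != 0 by apply: contra_eq_neq x1 => ->; rewrite sqnorm0 eq_sym oner_eq0.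
have : sqnorm x^-1 = 1.
  have := sqnormM x x^-1; rewrite divff// sqnorm1 x1 mul1r; exact/esym.
by move=> /absv_le1; rewrite absvV invf_le1// absv_gt0E.
Qed.

Lemma polar_decomp x : x != 0 -> exists2 u, sqnorm u = 1 &
  x = r (Num.sqrt (sqnorm x)) * u.
Proof.
move=> x0; have s0 : Num.sqrt (sqnorm x) != 0.
  by rewrite gt_eqF// sqrtr_gt0 sqnorm_gt0.
exists (x / r (Num.sqrt (sqnorm x))); last by rewrite mulrC divfK// fmorph_eq0.
by rewrite -fmorphV mulrC sqnormM sqnormr exprVn sqr_sqrtr ?sqnorm_ge0// mulVf// gt_eqF// sqnorm_gt0.
Qed.

Lemma absv_sqnorm x : absv x = Num.sqrt (sqnorm x) `^ c.
Proof.
have [->|/[dup] x0 /polar_decomp[u u1 {1}->]] := eqVneq x 0.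
  by rewrite absv0 sqnorm0 sqrtr0 powR0// gt_eqF.
by rewrite absvM (absv_sqnorm1 u1) mulr1 absvr ger0_norm// sqrtr_ge0.
Qed.

Lemma sqrt_sqnorm x : Num.sqrt (sqnorm x) = absv x `^ c^-1.
Proof. by rewrite absv_sqnorm -powRrM divff ?gt_eqF// powRr1// sqrtr_ge0. Qed.

Lemma coord_continuous : continuous a * continuous b.
Proof.
have h (f : K -> R) : (forall x y, f (x - y) = f x - f y) ->
    (forall x, `|f x| <= absv x `^ c^-1) -> continuous f.
  move=> fB fle x; apply/cvgrPdist_lt => e e0.
  apply/nbhs_absvP; exists (e `^ c); first by rewrite powR_gt0.
  move=> y xy; rewrite -fB; apply: le_lt_trans (fle _) _.
  apply: (@powR_lt_root _ c^-1); rewrite ?invr_gt0 ?absv_ge0//.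
  by rewrite invrK.
by split; apply: h => x *; rewrite ?coordB// -sqrt_sqnorm coord_le.
Qed.

End Norm.
End RealOrComplex.

(** * Complex numbers and the character lambda *)

Notation normc := ComplexField.Normc.normc.

Section ComplexNumbers.
Context {R : realType}.
Implicit Types (z w : R[i]) (t : R).

Lemma normc_ReIm z : normc z = Num.sqrt (complex.Re z ^+ 2 + complex.Im z ^+ 2).
Proof. by case: z. Qed.

Lemma normr_normc z : `|z| = (normc z)%:C.
Proof. by rewrite normc_def normc_ReIm. Qed.

Lemma normc_ge0 z : 0 <= normc z.
Proof. by rewrite normc_ReIm sqrtr_ge0. Qed.

Lemma normc0 : normc (0 : R[i]) = 0. Proof. exact: ComplexField.Normc.normc0. Qed.
Lemma normc1 : normc (1 : R[i]) = 1. Proof. exact: ComplexField.Normc.normc1. Qed.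

Lemma normcM z w : normc (z * w) = normc z * normc w.
Proof. exact: ComplexField.Normc.normcM. Qed.

Lemma normcV z : normc z^-1 = (normc z)^-1.
Proof. exact: ComplexField.Normc.normcV. Qed.

Lemma normc_eq0 z : (normc z == 0) = (z == 0).
Proof.
apply/eqP/eqP => [|->]; last exact: normc0.
exact: ComplexField.Normc.eq0_normc.
Qed.

Lemma normc_gt0 z : (0 < normc z) = (z != 0).
Proof. by rewrite lt0r normc_ge0 andbT normc_eq0. Qed.

Lemma normcN z : normc (- z) = normc z.
Proof. by rewrite !normc_ReIm /=; case: z => a b /=; rewrite !sqrrN. Qed.

Lemma ler_normcD z w : normc (z + w) <= normc z + normc w.
Proof. exact: (@le_normcD R z w). Qed.

Lemma ler_normcB z w : normc (z - w) <= normc z + normc w.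
Proof. by apply: le_trans (ler_normcD _ _) _; rewrite normcN. Qed.

Lemma normcB z w : normc (z - w) = normc (w - z).
Proof. by rewrite -normcN opprB. Qed.

Lemma normc_real t : normc t%:C = `|t|.
Proof. by rewrite normc_ReIm/= expr0n addr0 sqrtr_sqr. Qed.

Lemma normci : normc ('i%C : R[i]) = 1.
Proof. by rewrite normc_ReIm/= expr0n add0r expr1n sqrtr1. Qed.

Lemma Re_le_normc z : `|complex.Re z| <= normc z.
Proof. by rewrite normc_ReIm -sqrtr_sqr ler_wsqrtr// lerDl sqr_ge0. Qed.

Lemma Im_le_normc z : `|complex.Im z| <= normc z.
Proof. by rewrite normc_ReIm -sqrtr_sqr ler_wsqrtr// lerDr sqr_ge0. Qed.

Lemma normc_le_ReIm z : normc z <= `|complex.Re z| + `|complex.Im z|.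
Proof.
rewrite {1}(complexE z); apply: le_trans (ler_normcD _ _) _.
by rewrite normcM normci mul1r !normc_real.
Qed.

Lemma cReD z w : complex.Re (z + w) = complex.Re z + complex.Re w.
Proof. by case: z w => ? ? []. Qed.
Lemma cImD z w : complex.Im (z + w) = complex.Im z + complex.Im w.
Proof. by case: z w => ? ? []. Qed.
Lemma cReN z : complex.Re (- z) = - complex.Re z. Proof. by case: z. Qed.
Lemma cImN z : complex.Im (- z) = - complex.Im z. Proof. by case: z. Qed.
Lemma cReB z w : complex.Re (z - w) = complex.Re z - complex.Re w.
Proof. by rewrite cReD cReN. Qed.
Lemma cImB z w : complex.Im (z - w) = complex.Im z - complex.Im w.
Proof. by rewrite cImD cImN. Qed.
Lemma cReM z w : complex.Re (z * w) =
  complex.Re z * complex.Re w - complex.Im z * complex.Im w.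
Proof. by case: z w => ? ? []. Qed.
Lemma cImM z w : complex.Im (z * w) =
  complex.Re z * complex.Im w + complex.Im z * complex.Re w.
Proof. by case: z w => ? ? []. Qed.

Lemma complexP z w : complex.Re z = complex.Re w -> complex.Im z = complex.Im w ->
  z = w.
Proof. by case: z w => ? ? [? ?] /= -> ->. Qed.

Lemma nbhs_normcP z (A : set R[i]) :
  nbhs z A <-> exists2 e : R, 0 < e & forall w, normc (z - w) < e -> A w.
Proof.
split=> [/nbhs_ballP[e /= e0 he]|[e e0 he]].
  case: e e0 he => er ei; rewrite ltcE/= => /andP[/eqP -> er0] he.
  exists er => // w zw; apply: he; rewrite /ball/= normr_normc.
  by rewrite ltcE/= eqxx.
apply/nbhs_ballP; exists e%:C; first by rewrite /= ltcR.
by move=> w; rewrite /ball/= normr_normc ltcR; exact: he.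
Qed.

Lemma cvg_normcP T (F : set_system T) (FF : Filter F) (f : T -> R[i]) (l : R[i]) :
  f @ F --> l <-> forall e : R, 0 < e -> \forall t \near F, normc (l - f t) < e.
Proof.
split=> [h e e0|h].
  have : nbhs l [set w | normc (l - w) < e] by apply/nbhs_normcP; exists e.
  by move=> /h.
move=> A /nbhs_normcP[e e0 he]; have := h _ e0.
by apply: filterS => t; exact: he.
Qed.

Lemma expCD z w : expC (z + w) = expC z * expC w.
Proof.
apply: complexP; rewrite /expC cReD cImD ?cReM ?cImM/= expRD cosD sinD; ring.
Qed.

Lemma expC0 : expC (0 : R[i]) = 1.
Proof. by apply: complexP; rewrite /expC /= expR0 cos0 sin0; ring. Qed.

Lemma normc_expC z : normc (expC z) = expR (complex.Re z).
Proof.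
rewrite /expC normcM normc_real normc_ReIm/= cos2Dsin2 sqrtr1 mulr1.
by rewrite ger0_norm// expR_ge0.
Qed.

Lemma expC_neq0 z : expC z != 0.
Proof. by rewrite -normc_gt0 normc_expC expR_gt0. Qed.

Lemma expCN z : expC (- z) = (expC z)^-1.
Proof.
apply: (mulfI (expC_neq0 z)); rewrite -expCD subrr expC0 divff// expC_neq0//.
Qed.

Lemma expC_i t : expC ('i%C * t%:C) = cos t +i* sin t.
Proof.
by rewrite /expC cReM cImM/= !mul0r mulr0 subrr mul1r add0r expR0 mul1r.
Qed.

Lemma expC_real t : expC t%:C = (expR t)%:C.
Proof. by rewrite /expC /= cos0 sin0 mulr1. Qed.

Lemma expC_2pi (k : int) : expC ('i%C * (2 * pi * k%:~R)%:C) = 1 :> R[i].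
Proof.
have h (n : nat) : expC ('i%C * (2 * pi * n%:R)%:C) = 1 :> R[i].
  elim: n => [|n IH]; first by rewrite mulr0 mulr0 expC0.
  have -> : (2 * pi * n.+1%:R)%:C = (2 * pi * n%:R)%:C + (2 * pi)%:C :> R[i].
    by apply: complexP; rewrite /= ?addr0// -natr1; ring.
  rewrite mulrDr expCD IH mul1r expC_i.
  by rewrite mulr_natl cos2pi sin2pi.
case: k => n; first exact: h.
rewrite NegzE mulrNz mulrN rmorphN mulrN expCN.
by have := h n.+1; rewrite -pmulrn => ->; rewrite invr1.
Qed.

Lemma taylor_le (f f1 f2 : R -> R) (M : R) :
  (forall x, is_derive x (1 : R) f (f1 x)) -> (forall x, is_derive x (1 : R) f1 (f2 x)) ->
  (forall x, 0 <= x <= 1 -> `|f2 x| <= M) -> `|f 1 - f 0 - f1 0| <= M.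
Proof.
move=> df df1 hM.
have cont (g g1 : R -> R) (a b : R) : (forall x, is_derive x (1 : R) g (g1 x)) ->
    {within `[a, b], continuous g}.
  by move=> dg; apply: derivable_within_continuous => x _; have [] := dg x.
have [c c01 hc] := @MVT R f f1 0 1 ltr01 (fun x _ => df x) (cont _ _ _ _ df).
move: c01; rewrite in_itv/= => /andP[c0 c1].
have [e ec he] := @MVT R f1 f2 0 c c0 (fun x _ => df1 x) (cont _ _ _ _ df1).
move: ec; rewrite in_itv/= => /andP[e0 ec].
rewrite hc subr0 mulr1 he subr0 normrM -[leRHS]mulr1.
apply: ler_pM => //; last by rewrite ger0_norm ltW.
by apply: hM; rewrite !ltW// (lt_trans ec).
Qed.

Let ecos_derive (a b x : R) : is_derive x (1 : R) (fun t => expR (t * a) * cos (t * b))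
  (expR (x * a) * (a * cos (x * b) - b * sin (x * b))).
Proof.
have h1 : is_derive x (1 : R) (fun t => expR (t * a)) (a * expR (x * a)).
  have : is_derive x (1 : R) (fun t : R => t * a) a.
    by apply: is_derive_eq; rewrite /GRing.scale/=; ring.
  by move=> h; apply: is_derive_eq; rewrite mulrC.
have h2 : is_derive x (1 : R) (fun t => cos (t * b)) (b * - sin (x * b)).
  have : is_derive x (1 : R) (fun t : R => t * b) b.
    by apply: is_derive_eq; rewrite /GRing.scale/=; ring.
  by move=> h; apply: is_derive_eq; rewrite mulrC.
have := is_deriveM h1 h2 => h; apply: is_derive_eq; rewrite /GRing.scale/=; ring.
Qed.

Let esin_derive (a b x : R) : is_derive x (1 : R) (fun t => expR (t * a) * sin (t * b))
  (expR (x * a) * (a * sin (x * b) + b * cos (x * b))).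
Proof.
have h1 : is_derive x (1 : R) (fun t => expR (t * a)) (a * expR (x * a)).
  have : is_derive x (1 : R) (fun t : R => t * a) a.
    by apply: is_derive_eq; rewrite /GRing.scale/=; ring.
  by move=> h; apply: is_derive_eq; rewrite mulrC.
have h2 : is_derive x (1 : R) (fun t => sin (t * b)) (b * cos (x * b)).
  have : is_derive x (1 : R) (fun t : R => t * b) b.
    by apply: is_derive_eq; rewrite /GRing.scale/=; ring.
  by move=> h; apply: is_derive_eq; rewrite mulrC.
have := is_deriveM h1 h2 => h; apply: is_derive_eq; rewrite /GRing.scale/=; ring.
Qed.

Lemma cos_norm_le1 t : `|cos t| <= 1.
Proof. by rewrite ler_norml cos_geN1 cos_le1. Qed.

Lemma sin_norm_le1 t : `|sin t| <= 1.
Proof. by rewrite ler_norml sin_geN1 sin_le1. Qed.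

(** Taylor expansion of t |-> exp(tz) on [0, 1], separately for the real and the imaginary part.
    Each second derivative is at most 4 |z|^2 exp|Re z|, whence the 8. *)
Lemma expC_taylor z : normc (expC z - 1 - z) <=
  8 * normc z ^+ 2 * expR `|complex.Re z|.
Proof.
set a := complex.Re z; set b := complex.Im z; set n := normc z.
have an : `|a| <= n by exact: Re_le_normc.
have bn : `|b| <= n by exact: Im_le_normc.
have n0 : 0 <= n by exact: normc_ge0.
have bound (p q u v x : R) : 0 <= x <= 1 -> `|p| <= n -> `|q| <= n ->
    `|u| <= 2 * n -> `|v| <= 2 * n ->
    `|expR (x * a) * (p * u + q * v)| <= 4 * n ^+ 2 * expR `|a|.
  move=> /andP[x0 x1] pn qn un vn.
  rewrite mulrC normrM [`|expR _|]ger0_norm ?expR_ge0//.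
  apply: ler_pM; [exact: normr_ge0|exact: expR_ge0| |]; last first.
    rewrite ler_expR; apply: le_trans (ler_norm _) _.
    by rewrite normrM (ger0_norm x0) ler_piMl.
  apply: le_trans (ler_normD _ _) _; rewrite !normrM.
  rewrite (_ : 4 * n ^+ 2 = n * (2 * n) + n * (2 * n)); last by ring.
  by apply: lerD; apply: ler_pM.
have m2 (p q u v : R) : `|p| <= n -> `|q| <= n -> `|u| <= 1 -> `|v| <= 1 ->
    `|p * u + q * v| <= 2 * n.
  move=> pn qn u1 v1; apply: le_trans (ler_normD _ _) _; rewrite !normrM.
  rewrite (_ : 2 * n = n * 1 + n * 1); last by ring.
  by apply: lerD; apply: ler_pM.
have dcos x : is_derive x (1 : R)
    (fun t => expR (t * a) * (a * cos (t * b) - b * sin (t * b)))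
    (expR (x * a) * (a * (a * cos (x * b) + - b * sin (x * b)) +
       - b * (a * sin (x * b) + b * cos (x * b)))).
  have h1 := is_deriveZ a (ecos_derive a b x).
  have h2 := is_deriveZ (- b) (esin_derive a b x).
  have h3 := is_deriveD h1 h2.
  have -> : (fun t => expR (t * a) * (a * cos (t * b) - b * sin (t * b))) =
    (a \*: (fun t => expR (t * a) * cos (t * b)) +
     (- b) \*: (fun t => expR (t * a) * sin (t * b)))%R.
    apply/funext => t.
    change (expR (t * a) * (a * cos (t * b) - b * sin (t * b)) =
      a * (expR (t * a) * cos (t * b)) + - b * (expR (t * a) * sin (t * b))).
    by ring.
  by apply: is_derive_eq; rewrite /GRing.scale/=; ring.
have dsin x : is_derive x (1 : R)
    (fun t => expR (t * a) * (a * sin (t * b) + b * cos (t * b)))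
    (expR (x * a) * (a * (a * sin (x * b) + b * cos (x * b)) +
       b * (a * cos (x * b) + - b * sin (x * b)))).
  have h1 := is_deriveZ a (esin_derive a b x).
  have h2 := is_deriveZ b (ecos_derive a b x).
  have h3 := is_deriveD h1 h2.
  have -> : (fun t => expR (t * a) * (a * sin (t * b) + b * cos (t * b))) =
    (a \*: (fun t => expR (t * a) * sin (t * b)) +
     b \*: (fun t => expR (t * a) * cos (t * b)))%R.
    apply/funext => t.
    change (expR (t * a) * (a * sin (t * b) + b * cos (t * b)) =
      a * (expR (t * a) * sin (t * b)) + b * (expR (t * a) * cos (t * b))).
    by ring.
  by apply: is_derive_eq; rewrite /GRing.scale/=; ring.
have hr := @taylor_le _ _ _ (4 * n ^+ 2 * expR `|a|) (ecos_derive a b) dcos.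
have hi := @taylor_le _ _ _ (4 * n ^+ 2 * expR `|a|) (esin_derive a b) dsin.
apply: le_trans (normc_le_ReIm _) _.
rewrite (_ : 8 * _ * _ = 4 * n ^+ 2 * expR `|a| + 4 * n ^+ 2 * expR `|a|); last by ring.
apply: lerD.
  move: hr; rewrite !mul1r !mul0r expR0 cos0 sin0 !mul1r mulr1 mulr0 subr0.
  rewrite !cReB /expC cReM/= mul0r subr0; apply => x x01.
  apply: bound => //; rewrite ?normrN//; apply: m2; rewrite ?normrN//.
  - exact: cos_norm_le1. - exact: sin_norm_le1.
  - exact: sin_norm_le1. - exact: cos_norm_le1.
move: hi; rewrite !mul1r !mul0r expR0 cos0 sin0 !mul1r mulr1 mulr0 add0r subr0.
rewrite !cImB /expC cImM/= mul0r addr0 subr0; apply => x x01.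
apply: bound => //; apply: m2; rewrite ?normrN//.
- exact: sin_norm_le1. - exact: cos_norm_le1.
- exact: cos_norm_le1. - exact: sin_norm_le1.
Qed.

Lemma expC_i_lip t : normc (expC ('i%C * t%:C) - 1) <= 2 * `|t|.
Proof.
have h (f f1 : R -> R) : (forall x, is_derive x (1 : R) f (f1 x)) ->
    (forall x, `|f1 x| <= 1) -> `|f t - f 0| <= `|t|.
  move=> df f11.
  have cont (a b : R) : {within `[a, b], continuous f}.
    by apply: derivable_within_continuous => x _; have [] := df x.
  have [t0|t0] := leP 0 t.
    have [c _ ->] := @MVT_segment R f f1 0 t t0 (fun x _ => df x) (cont _ _).
    by rewrite subr0 normrM ler_piMl.
  have [c _ hc] := @MVT_segment R f f1 t 0 (ltW t0) (fun x _ => df x) (cont _ _).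
  by rewrite distrC hc sub0r normrM normrN ler_piMl.
rewrite expC_i; apply: le_trans (normc_le_ReIm _) _.
rewrite cReB cImB/= subr0 mulr2n mulrDl mul1r.
apply: lerD.
  have := h cos (fun x => - sin x) (@is_derive_cos R); rewrite cos0; apply => x.
  by rewrite normrN sin_norm_le1.
have := h sin cos (@is_derive_sin R); rewrite sin0 subr0; apply => x.
exact: cos_norm_le1.
Qed.

End ComplexNumbers.

(** * Local compactness and the character lambda *)

Section CompletionTheory.
Context {R : realType} {K : valuedFieldType R} {F : fieldExtType rat}
  {iota : {rmorphism F -> K}}.
Hypothesis hK : is_completion iota.
Implicit Types (x y z : K) (t : R).

Let J : {rmorphism rat -> K} := iota \o in_alg F.

Let cK : forall G : set_system K, ProperFilter G -> cauchy G -> cvg G.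
Proof. by case: hK. Qed.

Lemma completion_base_proper t : compact [set x : K | base_field x /\ absv x <= t].
Proof.
have [/archimedean_absv_nat[c c0 hc]|na] := pselect (archimedean K).
  exact: (base_field_ball_compactA J cK c0 hc).
have [p pp p1] := completion_prime hK na.
exact: (base_field_ball_compactN J cK na pp p1).
Qed.

Lemma closed_ball_compact t : compact [set x : K | absv x <= t].
Proof. exact: ball_compact hK completion_base_proper t. Qed.

(** Multiplication by x has a real matrix in a basis over the closure of Q, and the column of basis
    vectors is an eigenvector of this matrix for the eigenvalue x. *)
Lemma archimedean_coordinates : archimedean K -> exists (c : R)
    (r : {rmorphism R -> K}) j a b,
  [/\ 0 < c, forall t, r t = real_emb K t, forall t, absv (r t) = `|t| `^ c,
    coordinates r j a b & forall x, base_field x <-> exists t, x = r t].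
Proof.
move=> /archimedean_absv_nat[c c0 hc].
have [r rE] := real_emb_rmorphism J cK c0 hc.
have bfE x : base_field x <-> exists t, x = r t.
  split=> [/(base_field_real_emb J cK c0 hc)[t ->]|[t ->]]; first by exists t; rewrite rE.
  by apply/(base_field_real_emb J cK c0 hc); exists t; rewrite rE.
suff /coordinates_ex[j [a [b jab]]] : forall x, exists a b : R, (x - r a) ^+ 2 + r b ^+ 2 = 0.
  exists c, r, j, a, b; split => // t.
  by rewrite rE; apply: (absv_real_emb J cK c0 hc).
move=> x; have [n [e [be _]]] := basis_ex hK completion_base_proper.
have [M bM hM] := basis_mx_ex be (fun i => x * e i).
have /choice[M' hM'] : forall ij : 'I_n * 'I_n, exists t, M ij.1 ij.2 = r t.
  by move=> [i k]; apply/bfE; exact: bM.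
apply: (@eigen_quadratic _ _ r n (\matrix_(i, k) M' (i, k)) (\col_i e i)).
  have [d [[_ d1] _]] := be 1.
  apply: contra_eq_neq d1 => e0; rewrite big1 ?oner_neq0// => i _.
  by have := congr1 (fun v : 'cV_n => v i 0) e0; rewrite !mxE => ->; rewrite mulr0.
apply/colP => i; rewrite !mxE hM; apply: eq_bigr => k _; rewrite !mxE.
by rewrite -(hM' (i, k)).
Qed.

Lemma real_trace_emb c (r : {rmorphism R -> K}) :
  (forall t, r t = real_emb K t) -> (forall x, base_field x <-> exists t, x = r t) ->
  0 < c -> (forall t, absv (r t) = `|t| `^ c) ->
  [/\ forall x y, real_trace (x + y) = real_trace x + real_trace y,
      forall t x, real_trace (r t * x) = t * real_trace x &
      exists2 C : R, 0 <= C & forall x, `|real_trace x| <= C * absv x `^ c^-1].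
Proof.
move=> rE bfE c0 absr.
have trE x : r (real_trace x) = trace x.
  have [t ht] := (bfE _).1 (@base_field_trace _ _ _ _ hK completion_base_proper x).
  have : [set t | real_emb K t = trace x] t by rewrite /= -rE.
  by move=> h; rewrite rE; apply: (@xgetPex _ 0 [set t | real_emb K t = trace x]); exists t.
have inj s t : r s = r t -> s = t by apply: fmorph_inj.
split.
- move=> x y; apply: inj; rewrite rmorphD !trE.
  exact: (traceD hK completion_base_proper).
- move=> t x; apply: inj; rewrite rmorphM !trE.
  by apply: (traceZ hK completion_base_proper); apply/bfE; exists t.
have [C C0 hC] := absv_trace_le hK completion_base_proper.
exists (C `^ c^-1); first exact: powR_ge0.
move=> x; rewrite -powRM ?absv_ge0//; apply: powR_le_root => //.
by rewrite -absr trE.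
Qed.

Lemma lambda_arch x : archimedean K ->
  lambda x = expC ('i%C * (- (2 * pi * real_trace x))%:C).
Proof.
by move=> ha; rewrite /lambda; case: asboolP => // _; rewrite rmorphN mulrN.
Qed.

Section NonArch.
Hypothesis na : ~ archimedean K.
Variable p : nat.
Hypotheses (pp : prime p) (p1 : absv (p%:R : K) < 1).

Let lamE x : lambda x = expC ('i%C * (2 * pi * ratr (polar_part (trace x)))%:C).
Proof. by rewrite /lambda; case: asboolP. Qed.

Let polarP x : base_field x -> exists m n : nat,
  [/\ 0 <= polar_part x < 1, polar_part x = m%:R / p%:R ^+ n &
      absv (x - J (polar_part x)) <= 1].
Proof.
move=> bx; have [r [m [n [r01 rE xr]]]] := polar_ex J na pp p1 bx.
have : exists r : rat, [set r : rat | 0 <= r < 1 /\ exists p m n : nat,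
    [/\ prime p, absv (p%:R : K) < 1, r = m%:R / p%:R ^+ n
      & absv (x - ratr r) <= 1]] r.
  by exists r; split => //; exists p, m, n; split => //; rewrite (ratr_valuedE J).
move=> /(@xgetPex _ 0) [h1 [p' [m' [n' [pp' p1' e h]]]]].
rewrite (absv_p_unique na pp p1 pp' p1') in e.
by exists m', n'; split => //; rewrite -(ratr_valuedE J).
Qed.

Let expC_int (q : rat) (k : int) n : q = k%:~R / p%:R ^+ n ->
  absv (J q) <= 1 -> expC ('i%C * (2 * pi * ratr q)%:C) = 1 :> R[i].
Proof.
move=> -> /(polar_int na pp p1)[z ->].
by rewrite ratr_int expC_2pi.
Qed.

Let p0 : p%:R != 0 :> rat.
Proof. by rewrite pnatr_eq0 -lt0n prime_gt0. Qed.

(** The defect of additivity a - b - c of the polar parts lies in Z[1/p] and in the unit ball, hence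
    is an integer. *)
Lemma lambda_nonarchD x y : lambda (x + y) = lambda x * lambda y.
Proof.
have bt := base_field_trace hK completion_base_proper.
have [m1 [n1 [_ e1 h1]]] := polarP (bt (x + y)).
have [m2 [n2 [_ e2 h2]]] := polarP (bt x).
have [m3 [n3 [_ e3 h3]]] := polarP (bt y).
rewrite !lamE; set a := polar_part _ in e1 h1 *.
set b := polar_part _ in e2 h2 *; set c := polar_part _ in e3 h3 *.
have abc1 : expC ('i%C * (2 * pi * ratr (a - b - c))%:C) = 1 :> R[i].
  apply: (@expC_int _ (m1%:Z * p%:Z ^+ (n2 + n3) - m2%:Z * p%:Z ^+ (n1 + n3)
    - m3%:Z * p%:Z ^+ (n1 + n2)) (n1 + n2 + n3)).
    rewrite e1 e2 e3 !rmorphB !rmorphM !rmorphXn/= !exprD; field.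
    by rewrite !expf_neq0.
  have -> : J (a - b - c) = (trace x - J b) + (trace y - J c) - (trace (x + y) - J a).
    rewrite !rmorphB (traceD hK completion_base_proper); ring.
  by apply: absvB_le => //; apply: absvD_le.
have -> : ratr a = ratr (a - b - c) + ratr b + ratr c :> R.
  by rewrite !rmorphB; ring.
move: abc1; move: (ratr (a - b - c)) (ratr b) (ratr c) => u v w abc1.
rewrite (_ : 'i%C * _ = 'i%C * (2 * pi * u)%:C + 'i%C * (2 * pi * v)%:C +
  'i%C * (2 * pi * w)%:C); last by apply: complexP; rewrite /=; ring.
by rewrite !expCD abc1 mul1r.
Qed.

Lemma lambda_nonarch_near x : absv (trace x) <= 1 -> lambda x = 1.
Proof.
move=> tx; have bt := @base_field_trace _ _ _ _ hK completion_base_proper x.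
have [m [n [_ e h]]] := polarP bt; rewrite lamE; apply: (@expC_int _ m n e).
have -> : J (polar_part (trace x)) = trace x - (trace x - J (polar_part (trace x))).
  by rewrite subKr.
exact: absvB_le.
Qed.

End NonArch.

Lemma lambdaD x y : lambda (x + y) = lambda x * lambda y.
Proof.
have [ha|na] := pselect (archimedean K); last first.
  by have [p pp p1] := completion_prime hK na; exact: lambda_nonarchD pp p1 x y.
have [c [r [j [a [b [c0 rE absr _ bfE]]]]]] := archimedean_coordinates ha.
have [trD _ _] := real_trace_emb rE bfE c0 absr.
by rewrite !lambda_arch// trD mulrDr opprD rmorphD mulrDr expCD.
Qed.

Lemma normc_lambda x : normc (lambda x) = 1.
Proof.
have h (u : R) : normc (expC ('i%C * u%:C)) = 1.
  by rewrite expC_i normc_ReIm/= cos2Dsin2 sqrtr1.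
have [ha|na] := pselect (archimedean K); first by rewrite lambda_arch.
by rewrite /lambda; case: asboolP.
Qed.

(** In the non-archimedean case lambda is 1 where the trace is at most 1, and 2 bounds the
    difference elsewhere. The exponent k is there because an archimedean absolute value is a power
    of the usual one. *)
Lemma lambda_lip : exists C k : R, [/\ 0 <= C, 0 < k &
  forall x, normc (lambda x - 1) <= C * absv x `^ k].
Proof.
have [ha|na] := pselect (archimedean K).
  have [c [r [j [a [b [c0 rE absr _ bfE]]]]]] := archimedean_coordinates ha.
  have [_ _ [C C0 hC]] := real_trace_emb rE bfE c0 absr.
  exists (2 * (2 * pi * C)), c^-1; split; [|by rewrite invr_gt0|].
    by rewrite !mulr_ge0// pi_ge0.
  move=> x; rewrite lambda_arch//; apply: le_trans (expC_i_lip _) _.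
  rewrite normrN normrM ger0_norm ?mulr_ge0 ?pi_ge0// -!mulrA.
  by rewrite !ler_wpM2l ?pi_ge0.
have [p pp p1] := completion_prime hK na.
have [C C0 hC] := absv_trace_le hK completion_base_proper.
exists (2 * C), 1; split; [by rewrite mulr_ge0|by []|].
move=> x; rewrite powRr1 ?absv_ge0//.
have [h|h] := leP (absv (trace x)) 1.
  rewrite (lambda_nonarch_near na pp p1 h) subrr normc0.
  by rewrite !mulr_ge0 ?absv_ge0.
apply: (@le_trans _ _ 2).
  apply: le_trans (ler_normcB _ _) _; rewrite normc_lambda normc1.
  by rewrite -[leRHS]/(1 + 1).
rewrite -mulrA ler_peMr//; apply: le_trans (hC x); exact: ltW.
Qed.

Lemma lambda0 : lambda (0 : K) = 1.
Proof.
have := lambdaD 0 0; rewrite addr0 => h.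
have n0 : lambda (0 : K) != 0 by rewrite -normc_eq0 normc_lambda oner_eq0.
by apply: (mulfI n0); rewrite -h mulr1.
Qed.

Lemma lambda_continuous : continuous (@lambda R K).
Proof.
have [C [k [C0 k0 hC]]] := lambda_lip.
move=> x; apply/cvg_normcP => e e0.
have d0 : 0 < (e / (C + 1)) `^ k^-1.
  by rewrite powR_gt0// divr_gt0// ltr_wpDl.
apply/nbhs_absvP; exists ((e / (C + 1)) `^ k^-1) => // y xy.
have -> : lambda x - lambda y = lambda y * (lambda (x - y) - 1).
  by rewrite mulrBr mulr1 -lambdaD addrCA subrr addr0.
rewrite normcM normc_lambda mul1r; apply: le_lt_trans (hC _) _.
have h : absv (x - y) `^ k < e / (C + 1).
  apply: powR_lt_root => //; last exact: absv_ge0.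
  by rewrite divr_gt0// ltr_wpDl.
apply: (@le_lt_trans _ _ ((C + 1) * absv (x - y) `^ k)).
  by rewrite ler_wpM2r ?powR_ge0// lerDl.
by rewrite mulrC -ltr_pdivlMr// ltr_wpDl.
Qed.

End CompletionTheory.

(** * Integration of complex functions *)

Section ComplexIntegration.
Context {R : realType} {d : measure_display} {T : measurableType d}.
Variable mu : {measure set T -> \bar R}.
Implicit Types (f g : T -> R[i]) (c : R[i]) (u v : T -> R).

Definition Cmeas f := measurable_fun setT (fun x => complex.Re (f x)) /\
  measurable_fun setT (fun x => complex.Im (f x)).

Lemma Cmeas_cst c : Cmeas (fun=> c).
Proof. by split; exact: measurable_cst. Qed.

Lemma CmeasD f g : Cmeas f -> Cmeas g -> Cmeas (fun x => f x + g x).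
Proof.
move=> [f1 f2] [g1 g2]; split.
  by under eq_fun do rewrite cReD; exact: measurable_funD.
by under eq_fun do rewrite cImD; exact: measurable_funD.
Qed.

Lemma CmeasN f : Cmeas f -> Cmeas (fun x => - f x).
Proof.
move=> [f1 f2]; split.
  by under eq_fun do rewrite cReN; exact: measurable_funN.
by under eq_fun do rewrite cImN; exact: measurable_funN.
Qed.

Lemma CmeasB f g : Cmeas f -> Cmeas g -> Cmeas (fun x => f x - g x).
Proof. by move=> mf mg; apply: CmeasD => //; exact: CmeasN. Qed.

Lemma CmeasM f g : Cmeas f -> Cmeas g -> Cmeas (fun x => f x * g x).
Proof.
move=> [f1 f2] [g1 g2]; split.
  under eq_fun do rewrite cReM.
  by apply: measurable_funB; exact: measurable_funM.
under eq_fun do rewrite cImM.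
by apply: measurable_funD; exact: measurable_funM.
Qed.

Lemma Cmeas_real u : measurable_fun setT u -> Cmeas (fun x => (u x)%:C).
Proof. by move=> mu'; split => //=; exact: measurable_cst. Qed.

Lemma Cmeas_normc f : Cmeas f -> measurable_fun setT (fun x => normc (f x)).
Proof.
move=> [f1 f2].
rewrite (_ : (fun x => _) =
  (fun x => (complex.Re (f x) ^+ 2 + complex.Im (f x) ^+ 2) `^ 2^-1)).
  apply: (measurableT_comp (measurable_powR _)).
  by apply: measurable_funD; exact: measurable_funX.
apply/funext => x; rewrite normc_ReIm powR12_sqrt//.
by rewrite addr_ge0// sqr_ge0.
Qed.

Lemma Cintegrable_meas f : Cintegrable mu f -> Cmeas f.
Proof.
move=> [/integrableP[/measurable_EFinP h1 _] /integrableP[/measurable_EFinP h2 _]].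
by split.
Qed.

Lemma Rintegrable_le u v : measurable_fun setT u -> (forall x, `|u x| <= v x) ->
  mu.-integrable setT (EFin \o v) -> mu.-integrable setT (EFin \o u).
Proof.
move=> mu' uv; apply: le_integrable => //; first exact/measurable_EFinP.
by move=> x _ /=; rewrite lee_fin (le_trans (uv x))// ler_norm.
Qed.

Lemma Cintegrable_le f v : Cmeas f -> (forall x, normc (f x) <= v x) ->
  mu.-integrable setT (EFin \o v) -> Cintegrable mu f.
Proof.
move=> [f1 f2] fv iv; split.
  apply: (Rintegrable_le (v := v)) => // x.
  exact: le_trans (Re_le_normc _) _.
apply: (Rintegrable_le (v := v)) => // x.
exact: le_trans (Im_le_normc _) _.
Qed.

Lemma Cintegrable_normc f : Cintegrable mu f ->
  mu.-integrable setT (EFin \o (fun x => normc (f x))).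
Proof.
move=> /[dup] /Cintegrable_meas mf [i1 i2].
apply: (Rintegrable_le (v := fun x => `|complex.Re (f x)| + `|complex.Im (f x)|)).
- exact: Cmeas_normc.
- by move=> x; rewrite ger0_norm ?normc_ge0//; exact: normc_le_ReIm.
- have := integrableD measurableT (integrable_norm i1) (integrable_norm i2).
  by [].
Qed.

Lemma CintegrableD f g : Cintegrable mu f -> Cintegrable mu g ->
  Cintegrable mu (fun x => f x + g x).
Proof.
move=> [f1 f2] [g1 g2]; split.
  under eq_fun do rewrite cReD EFinD; exact: integrableD.
by under eq_fun do rewrite cImD EFinD; exact: integrableD.
Qed.

Lemma CintegrableZ c f : Cintegrable mu f -> Cintegrable mu (fun x => c * f x).
Proof.
move=> fi; have := integrableZl measurableT (normc c) (Cintegrable_normc fi).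
apply: Cintegrable_le.
  by apply: CmeasM; [exact: Cmeas_cst|exact: Cintegrable_meas].
by move=> x; rewrite normcM.
Qed.

Lemma CintegrableZr c f : Cintegrable mu f -> Cintegrable mu (fun x => f x * c).
Proof. by move=> /(CintegrableZ c); under eq_fun do rewrite mulrC. Qed.

Lemma CintegrableN f : Cintegrable mu f -> Cintegrable mu (fun x => - f x).
Proof. by move=> /(CintegrableZ (-1)); under eq_fun do rewrite mulN1r. Qed.

Lemma CintegrableB f g : Cintegrable mu f -> Cintegrable mu g ->
  Cintegrable mu (fun x => f x - g x).
Proof. by move=> fi gi; apply: CintegrableD => //; exact: CintegrableN. Qed.

Lemma CintegralD f g : Cintegrable mu f -> Cintegrable mu g ->
  Cintegral mu (fun x => f x + g x) = Cintegral mu f + Cintegral mu g.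
Proof.
move=> [f1 f2] [g1 g2]; apply: complexP; rewrite ?cReD ?cImD /=.
  by under eq_Rintegral do rewrite cReD; rewrite RintegralD.
by under eq_Rintegral do rewrite cImD; rewrite RintegralD.
Qed.

Lemma CintegralZ c f : Cintegrable mu f ->
  Cintegral mu (fun x => c * f x) = c * Cintegral mu f.
Proof.
move=> [f1 f2].
have z1 (t : R) : mu.-integrable setT (EFin \o (fun x => t * complex.Re (f x))).
  by have := integrableZl measurableT t f1.
have z2 (t : R) : mu.-integrable setT (EFin \o (fun x => t * complex.Im (f x))).
  by have := integrableZl measurableT t f2.
apply: complexP; rewrite ?cReM ?cImM /=.
  under eq_Rintegral do rewrite cReM.
  by rewrite RintegralB// !RintegralZl.
under eq_Rintegral do rewrite cImM.
by rewrite RintegralD// !RintegralZl.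
Qed.

Lemma CintegralZr c f : Cintegrable mu f ->
  Cintegral mu (fun x => f x * c) = Cintegral mu f * c.
Proof.
by move=> fi; rewrite mulrC -CintegralZ//; congr Cintegral; apply/funext => x; rewrite mulrC.
Qed.

Lemma CintegralN f : Cintegrable mu f ->
  Cintegral mu (fun x => - f x) = - Cintegral mu f.
Proof.
by move=> /(CintegralZ (-1)); under eq_fun do rewrite mulN1r; rewrite mulN1r.
Qed.

Lemma CintegralB f g : Cintegrable mu f -> Cintegrable mu g ->
  Cintegral mu (fun x => f x - g x) = Cintegral mu f - Cintegral mu g.
Proof. by move=> fi gi; rewrite CintegralD ?CintegralN//; exact: CintegrableN. Qed.

Lemma Rintegral_le u v : mu.-integrable setT (EFin \o u) ->
  (forall x, `|u x| <= v x) -> mu.-integrable setT (EFin \o v) ->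
  `|Rintegral mu setT u| <= Rintegral mu setT v.
Proof.
move=> ui uv vi; apply: le_trans (le_normr_Rintegral measurableT ui) _.
apply: le_Rintegral => //; exact: (integrable_norm ui).
Qed.

Lemma normc_Cintegral_le f v : Cintegrable mu f -> (forall x, normc (f x) <= v x) ->
  mu.-integrable setT (EFin \o v) ->
  normc (Cintegral mu f) <= 2 * Rintegral mu setT v.
Proof.
move=> [f1 f2] fv vi; apply: le_trans (normc_le_ReIm _) _ => /=.
rewrite mulr2n mulrDl mul1r; apply: lerD; apply: Rintegral_le => // x.
  exact: le_trans (Re_le_normc _) _.
exact: le_trans (Im_le_normc _) _.
Qed.

End ComplexIntegration.

(** * Fubini's theorem for complex functions *)

Section FubiniComplex.
Context {R : realType} {d1 d2 : measure_display}
  {T1 : measurableType d1} {T2 : measurableType d2}.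
Variables (m1 : {sigma_finite_measure set T1 -> \bar R})
  (m2 : {sigma_finite_measure set T2 -> \bar R}).

(** At a section with infinite integral [Rintegral] takes a default value. Almost every section is
    integrable, so the partial integrals agree almost everywhere with the extended ones of Fubini's
    theorem. *)
Let outer (F : T1 * T2 -> R) : (m1 \x m2)%E.-integrable setT (EFin \o F) ->
  m1.-integrable setT (EFin \o (fun x => Rintegral m2 setT (fun y => F (x, y)))) /\
  (\int[m1]_x (Rintegral m2 setT (fun y => F (x, y)))%:E =
   \int[m1]_x \int[m2]_y (F (x, y))%:E)%E.
Proof.
move=> iF; have mG := measurable_fubini_F iF.
have iG := integrable_fubini_F iF.
have mFG : measurable_fun setT
    (fun x : T1 => (Rintegral m2 setT (fun y => F (x, y)))%:E).
  apply/measurable_EFinP.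
  exact: (measurableT_comp (fine_measurable measurableT) mG).
have ae : ae_eq m1 setT
    (EFin \o (fun x => Rintegral m2 setT (fun y => F (x, y))))
    (fubini_F m2 (EFin \o F)).
  have := ae_integrable1 iF; apply: filterS => x ix _ /=.
  by rewrite /Rintegral fineK//; exact: integrable_fin_num.
split.
  apply/integrableP; split => //.
  have /integrableP[mG' ltG] := iG; apply: le_lt_trans ltG.
  rewrite le_eqVlt; apply/orP; left; apply/eqP.
  apply: ae_eq_integral => //; [exact: measurableT_comp|exact: measurableT_comp|].
  by apply: filterS ae => x h /h ->.
exact: ae_eq_integral.
Qed.

Let outer2 (F : T1 * T2 -> R) : (m1 \x m2)%E.-integrable setT (EFin \o F) ->
  m2.-integrable setT (EFin \o (fun y => Rintegral m1 setT (fun x => F (x, y)))) /\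
  (\int[m2]_y (Rintegral m1 setT (fun x => F (x, y)))%:E =
   \int[m2]_y \int[m1]_x (F (x, y))%:E)%E.
Proof.
move=> iF; have mG := measurable_fubini_G iF.
have iG : m2.-integrable setT (fubini_G m1 (EFin \o F)).
  have mF := measurable_int _ iF.
  apply/integrableP; split => //.
  have := (@integrable21ltyP _ _ _ _ _ m1 m2 _ mF).1 iF; apply: le_lt_trans.
  have mA : measurable_fun setT (fun z : T1 * T2 => `|(F z)%:E|%E).
    by apply: measurableT_comp.
  apply: ge0_le_integral => //.
  - exact: measurableT_comp.
  - by apply: (@measurable_fun_fubini_tonelli_G _ _ _ _ _ m1 _ mA) => z; exact: abse_ge0.
  - move=> y _; apply: le_abse_integral => //.
    exact: (measurableT_comp mF (measurable_pair2 y)).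
have mFG : measurable_fun setT
    (fun y : T2 => (Rintegral m1 setT (fun x => F (x, y)))%:E).
  apply/measurable_EFinP.
  exact: (measurableT_comp (fine_measurable measurableT) mG).
have ae : ae_eq m2 setT
    (EFin \o (fun y => Rintegral m1 setT (fun x => F (x, y))))
    (fubini_G m1 (EFin \o F)).
  have := ae_integrable2 iF; apply: filterS => x ix _ /=.
  by rewrite /Rintegral fineK//; exact: integrable_fin_num.
split.
  apply/integrableP; split => //.
  have /integrableP[mG' ltG] := iG; apply: le_lt_trans ltG.
  rewrite le_eqVlt; apply/orP; left; apply/eqP.
  apply: ae_eq_integral => //; [exact: measurableT_comp|exact: measurableT_comp|].
  by apply: filterS ae => x h /h ->.
exact: ae_eq_integral.
Qed.

Lemma Cfubini (F : T1 -> T2 -> R[i]) :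
  Cmeas (fun z : T1 * T2 => F z.1 z.2) ->
  (\int[m1]_x \int[m2]_y (normc (F x y))%:E < +oo)%E ->
  [/\ Cintegrable m1 (fun x => Cintegral m2 (F x)),
      Cintegrable m2 (fun y => Cintegral m1 (F^~ y)) &
  Cintegral m1 (fun x => Cintegral m2 (F x)) =
  Cintegral m2 (fun y => Cintegral m1 (F^~ y))].
Proof.
move=> mF ltF; have [mR mI] := mF.
have ilt (G : T1 * T2 -> R) : measurable_fun setT G ->
    (forall z, `|G z| <= normc (F z.1 z.2)) ->
    (m1 \x m2)%E.-integrable setT (EFin \o G).
  move=> mG GF; apply/integrable12ltyP; first exact/measurable_EFinP.
  apply: le_lt_trans ltF.
  have mN : measurable_fun setT (fun z : T1 * T2 => (normc (F z.1 z.2))%:E).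
    exact/measurable_EFinP/Cmeas_normc.
  have mG' : measurable_fun setT (fun z : T1 * T2 => `|(G z)%:E|%E).
    by apply: measurableT_comp => //; exact/measurable_EFinP.
  apply: ge0_le_integral => //.
  - by move=> x _; apply: integral_ge0 => y _; exact: abse_ge0.
  - by apply: (@measurable_fun_fubini_tonelli_F _ _ _ _ _ m2 _ mG') => z; exact: abse_ge0.
  - by apply: (@measurable_fun_fubini_tonelli_F _ _ _ _ _ m2 _ mN) => z; rewrite lee_fin normc_ge0.
  move=> x _; apply: ge0_le_integral => //.
  - exact: (measurableT_comp mG' (measurable_pair1 x)).
  - exact: (measurableT_comp mN (measurable_pair1 x)).
  - by move=> y _; rewrite lee_fin (GF (x, y)).
have iR := ilt _ mR (fun z => Re_le_normc _).
have iI := ilt _ mI (fun z => Im_le_normc _).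
have [h1 e1] := outer iR; have [h2 e2] := outer iI.
have [h3 e3] := outer2 iR; have [h4 e4] := outer2 iI.
split => //; rewrite /Cintegral /=.
have := Fubini iR; have := Fubini iI => /= eI eR.
by congr (_ +i* _); rewrite [LHS]/Rintegral [RHS]/Rintegral;
  rewrite ?e1 ?e2 ?e3 ?e4 ?eI ?eR.
Qed.

End FubiniComplex.

(** * Change of variables under maps that scale the measure *)

Section MeasureChange.
Context {R : realType} {d : measure_display} {T : measurableType d}.
Variable mu : {measure set T -> \bar R}.
Variables (phi : T -> T) (k : {nonneg R}).
Hypothesis mphi : measurable_fun setT phi.
Hypothesis muphi : forall A, measurable A -> mu (phi @^-1` A) = (k%:num%:E * mu A)%E.

Lemma ge0_integral_change (f : T -> \bar R) : measurable_fun setT f ->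
  (forall x, 0 <= f x)%E ->
  (\int[mu]_x f (phi x) = k%:num%:E * \int[mu]_x f x)%E.
Proof.
move=> mf f0; pose phi' : {mfun T >-> T} := HB.pack phi (isMeasurableFun.Build _ _ _ _ phi mphi).
rewrite -ge0_integral_mscale//.
have := @ge0_integral_pushforward _ _ _ _ _ phi' mphi mu setT f measurableT mf (fun y _ => f0 y).
rewrite preimage_setT => <-.
apply: (@eq_measure_integral _ _ _ setT (mscale k mu) (pushforward mu phi')) => A mA _.
exact: muphi.
Qed.

Lemma integrable_change (f : T -> R) : mu.-integrable setT (EFin \o f) ->
  mu.-integrable setT (EFin \o (fun x => f (phi x))).
Proof.
move=> /integrableP[mf ltf]; apply/integrableP; split.
  exact: (measurableT_comp mf mphi).
rewrite (ge0_integral_change (f := fun x => `|(f x)%:E|%E)) //.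
  by rewrite lte_mul_pinfty.
exact: measurableT_comp.
Qed.

Lemma Rintegral_change (f : T -> R) : mu.-integrable setT (EFin \o f) ->
  Rintegral mu setT (fun x => f (phi x)) = k%:num * Rintegral mu setT f.
Proof.
move=> fi; have /integrableP[mf ltf] := fi; rewrite /Rintegral.
rewrite integralE [in RHS]integralE.
have h (g : T -> \bar R) : measurable_fun setT g -> (forall x, 0 <= g x)%E ->
  (\int[mu]_x g (phi x) = k%:num%:E * \int[mu]_x g x)%E := @ge0_integral_change g.
have e1 := h _ (measurable_funepos mf) (fun x => funepos_ge0 (EFin \o f) x).
have e2 := h _ (measurable_funeneg mf) (fun x => funeneg_ge0 (EFin \o f) x).
transitivity (fine (k%:num%:E * (\int[mu]_x (EFin \o f)^\+ x) -
    k%:num%:E * (\int[mu]_x (EFin \o f)^\- x))%E).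
  transitivity (fine (\int[mu]_x ((EFin \o f)^\+ (phi x)) -
      \int[mu]_x ((EFin \o f)^\- (phi x)))%E); last by rewrite e1 e2.
  by congr (fine (adde _ (oppe _))); apply: eq_integral => x _; rewrite ?funeposE ?funenegE.
have p1 := integrable_pos_fin_num measurableT fi.
have p2 := integrable_neg_fin_num measurableT fi.
by rewrite -(fineK p1) -(fineK p2) -!EFinM -!EFinB/= mulrBr.
Qed.

Lemma Cintegrable_change (f : T -> R[i]) : Cintegrable mu f ->
  Cintegrable mu (fun x => f (phi x)).
Proof. by move=> [f1 f2]; split; exact: (integrable_change (f := fun x => _ (f x))). Qed.

Lemma Cintegral_change (f : T -> R[i]) : Cintegrable mu f ->
  Cintegral mu (fun x => f (phi x)) = k%:num%:C * Cintegral mu f.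
Proof.
move=> [f1 f2]; apply: complexP; rewrite ?cReM ?cImM/= mul0r ?subr0 ?addr0.
  exact: (Rintegral_change (f := fun x => complex.Re (f x))).
exact: (Rintegral_change (f := fun x => complex.Im (f x))).
Qed.

End MeasureChange.

(** * Borel measurability on K and on K x K *)

Section BorelField.
Context {R : realType} {K : valuedFieldType R} {F : fieldExtType rat}
  {iota : {rmorphism F -> K}}.
Hypothesis hK : is_completion iota.
Implicit Types (x y z : K) (A : set K).

Lemma open_measurableK A : open A -> measurable (A : set (Borel K)).
Proof. by move=> oA; apply: sub_sigma_algebra. Qed.

Lemma closed_measurableK A : closed A -> measurable (A : set (Borel K)).
Proof.
move=> cA; rewrite -[A]setCK; apply: (@measurableC _ (Borel K)).
by apply: open_measurableK; exact: closed_openC.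
Qed.

Lemma open_preimage (U : topologicalType) (f : K -> U) (D : set K) (B : set U) :
  open D -> (forall x, D x -> {for x, continuous f}) -> open B ->
  open (D `&` f @^-1` B).
Proof.
move=> oD cf oB; rewrite openE => x [Dx Bx]; apply: filterI.
  exact: open_nbhs_nbhs.
by apply: (cf x Dx); apply: open_nbhs_nbhs.
Qed.

Lemma continuous_on_measurable (f : K -> R) (D : set K) : open D ->
  (forall x, D x -> {for x, continuous f}) ->
  measurable_fun (D : set (Borel K)) f.
Proof.
move=> oD cf; apply: (measurability _ (RGenOInfty.measurableE R)).
move=> /= _ [_ [a ->] <-]; apply: open_measurableK.
by apply: open_preimage => //; exact: interval_open.
Qed.

Lemma open_neq0K : open [set x : K | x != 0].
Proof.
rewrite (_ : [set x : K | x != 0] = [set x | 0 < absv x]).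
  exact: open_absv_gt.
by apply/seteqP; split=> x /=; rewrite absv_gt0E.
Qed.

Lemma setT_split0 : setT = [set x : K | x != 0] `|` [set 0].
Proof.
by apply/seteqP; split=> // x _; have [->|x0] := eqVneq x 0; [right|left].
Qed.

Lemma measurable_set0K : measurable ([set 0] : set (Borel K)).
Proof.
apply: closed_measurableK.
exact: compact_closed absv_hausdorff (@compact_set1 _ (0 : K)).
Qed.

(** Continuity is asked for away from 0, as {0} is measurable: logarithms, inverses and characters
    have arbitrary values at 0. *)
Lemma measurable_off0 (f : K -> R) : (forall x, x != 0 -> {for x, continuous f}) ->
  measurable_fun setT (f : Borel K -> R).
Proof.
move=> cf; rewrite setT_split0; apply/measurable_funU.
- exact: open_measurableK open_neq0K.
- exact: measurable_set0K.
split; last exact: measurable_fun_set1.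
by apply: continuous_on_measurable => //; exact: open_neq0K.
Qed.

Lemma Re_continuous_at (f : K -> R[i]) x : {for x, continuous f} ->
  {for x, continuous (fun y => complex.Re (f y))} /\
  {for x, continuous (fun y => complex.Im (f y))}.
Proof.
move=> /cvg_normcP cf; split; apply/cvgrPdist_lt => e /cf; apply: filterS => y.
  by rewrite -cReB; exact: le_lt_trans (Re_le_normc _).
by rewrite -cImB; exact: le_lt_trans (Im_le_normc _).
Qed.

Lemma Cmeas_off0 (f : K -> R[i]) : (forall x, x != 0 -> {for x, continuous f}) ->
  Cmeas (f : Borel K -> R[i]).
Proof.
by move=> cf; split; apply: measurable_off0 => x /cf/Re_continuous_at[].
Qed.

Lemma Cmeas_continuous (f : K -> R[i]) : continuous f -> Cmeas (f : Borel K -> R[i]).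
Proof. by move=> cf; apply: Cmeas_off0 => x _; exact: cf. Qed.

Lemma measurable_off0K (f : K -> K) : (forall x, x != 0 -> {for x, continuous f}) ->
  measurable_fun setT (f : Borel K -> Borel K).
Proof.
move=> cf; rewrite setT_split0; apply/measurable_funU.
- exact: open_measurableK open_neq0K.
- exact: measurable_set0K.
split; last exact: measurable_fun_set1.
apply: (@measurability _ _ (Borel K) (Borel K) _ _ (@open K) erefl).
move=> /= _ [B oB <-]; apply: open_measurableK.
by apply: open_preimage => //; exact: open_neq0K.
Qed.

(** Rational coordinate vectors in a basis of F are countable, and the image of F is dense. *)
Lemma dense_seq : exists D : nat -> K, forall x (e : R), 0 < e ->
  exists n, absv (x - D n) < e.
Proof.
pose n := \dim {:F}.
pose D k : K := if (unpickle k : option 'rV[rat]_n) is Some c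
  then iota (\sum_i c 0 i *: (vbasis {:F})`_i) else 0.
exists D => x e e0; case: hK => _ dF _.
have oU : open [set y : K | absv (x - y) < e].
  rewrite openE => y xy; apply/nbhs_absvP; exists (e - absv (x - y)).
    by rewrite subr_gt0.
  move=> z yz /=; have := absvD (x - y) (y - z); rewrite subrKA.
  by move=> h; apply: le_lt_trans h _; rewrite -ltrBrDl.
have /dF/(_ oU)[z [/= xz [y _ yz]]] : [set y : K | absv (x - y) < e] !=set0.
  by exists x; rewrite /= subrr absv0.
exists (pickle (\row_i coord (vbasis {:F}) i y)); rewrite /D pickleK.
under eq_bigr do rewrite mxE.
by rewrite -(coord_vbasis (memvf y)) yz.
Qed.

(** [Borel K * Borel K] carries the product sigma-algebra, the one of Fubini's theorem. It contains
    the open sets of the product since K is separable: these are countable unions of products of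
    balls of radius 1/(k+1) about points of the dense sequence. *)
Lemma measurable_prodK (h : K * K -> K) : continuous h ->
  measurable_fun setT (h : Borel K * Borel K -> Borel K).
Proof.
move=> ch; apply: (@measurability _ _ _ (Borel K) _ _ (@open K) erefl).
move=> /= _ [B oB <-]; rewrite setTI.
have [D dD] := dense_seq.
pose bl n k : set K := [set y | absv (y - D n) < k.+1%:R^-1].
have obl n k : open (bl n k).
  rewrite openE => y yD; apply/nbhs_absvP; exists (k.+1%:R^-1 - absv (y - D n)).
    by rewrite subr_gt0.
  move=> z yz; rewrite /bl/=; have := absvD (z - y) (y - D n); rewrite subrKA.
  by move=> h2; apply: le_lt_trans h2 _; rewrite -ltrBrDr absvB.
pose G m : set (K * K) := if (unpickle m : option (nat * nat * nat)) is Some t then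
  (if `[< bl t.1.1 t.2 `*` bl t.1.2 t.2 `<=` h @^-1` B >]
   then bl t.1.1 t.2 `*` bl t.1.2 t.2 else set0) else set0.
have -> : h @^-1` B = \bigcup_m G m.
  apply/seteqP; split=> [[x y] /= Bxy|z [m _]]; last first.
    by rewrite /G; case: unpickle => // t; case: asboolP => // hs; exact: hs.
  have : nbhs (x, y) (h @^-1` B) by apply: ch; exact: open_nbhs_nbhs.
  move=> [[U V] /= [/nbhs_absvP[e1 e10 h1] /nbhs_absvP[e2 e20 h2]] UV].
  pose e := Num.min e1 e2; have e0 : 0 < e by rewrite lt_min e10 e20.
  have [k hk] : exists k : nat, k.+1%:R^-1 < e / 2.
    have := @cvg_harmonic R; move/cvgr0Pnorm_lt => /(_ (e / 2)); rewrite divr_gt0//.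
    move=> /(_ isT)[N _ /(_ N (leqnn N))] /=; rewrite ger0_norm ?harmonic_ge0//.
    by exists N.
  have k0 : 0 < k.+1%:R^-1 :> R by rewrite invr_gt0.
  have [n1 hn1] := dD x _ k0; have [n2 hn2] := dD y _ k0.
  exists (pickle (n1, n2, k)) => //; rewrite /G pickleK /=.
  have close (u v : K) n : absv (u - D n) < k.+1%:R^-1 -> bl n k v -> absv (u - v) < e.
    move=> un vn; rewrite (splitr e).
    have := absvD (u - D n) (D n - v); rewrite subrKA => h3.
    apply: le_lt_trans h3 _; apply: ltrD; first exact: lt_trans hk.
    by rewrite absvB; exact: lt_trans hk.
  case: asboolP => [_|[]]; first by split.
  move=> [u v] /= [bu bv]; apply: (UV (u, v)); split => /=.
    by apply: h1; apply: lt_le_trans (close _ _ _ hn1 bu) _; rewrite ge_min lexx.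
  by apply: h2; apply: lt_le_trans (close _ _ _ hn2 bv) _; rewrite ge_min lexx orbT.
apply: bigcupT_measurable => m; rewrite /G; case: unpickle => // t.
case: asboolP => // _; apply: measurableX; exact: open_measurableK.
Qed.

Lemma measurable_mulK :
  measurable_fun setT (fun z : Borel K * Borel K => ((z.1 : K) * (z.2 : K)) : Borel K).
Proof.
apply: (@measurable_prodK (fun z : K * K => z.1 * z.2)) => z.
by apply: cvgMK; [exact: cvg_fst|exact: cvg_snd].
Qed.

Lemma measurable_mullK t : measurable_fun setT ((fun x => t * x : K) : Borel K -> Borel K).
Proof. by apply: measurable_off0K => x _; exact: mull_continuous. Qed.

Lemma measurable_addlK t : measurable_fun setT ((fun x => t + x : K) : Borel K -> Borel K).
Proof. by apply: measurable_off0K => x _; exact: addl_continuous. Qed.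

Lemma Cmeas_comp {d : measure_display} {T : measurableType d} (f : Borel K -> R[i])
  (g : T -> Borel K) : @Cmeas R _ (Borel K) f -> measurable_fun setT g ->
  @Cmeas R d T (fun t => f (g t)).
Proof. by move=> [f1 f2] mg; split; [exact: (measurableT_comp f1 mg)|exact: (measurableT_comp f2 mg)]. Qed.

End BorelField.

Lemma measurable_absv_le {R : realType} {K : valuedFieldType R} (e : R) :
  measurable ([set x | absv x <= e] : set (Borel K)).
Proof. by apply: closed_measurableK; exact: closed_absv_le. Qed.

Lemma measurable_absv_lt {R : realType} {K : valuedFieldType R} (e : R) :
  measurable ([set x | absv x < e] : set (Borel K)).
Proof. by apply: open_measurableK; exact: open_absv_lt. Qed.

(** * Haar measure and module *)

Section SigmaFiniteCopy.
Context {R : realType} {d : measure_display} {T : measurableType d}.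
Variables (mu : {measure set T -> \bar R}) (h : sigma_finite setT mu).

(** An alias indexed by the proof of sigma-finiteness, on which the structure expected by Fubini's
    theorem can be declared. *)
Definition sigma_finite_copy of sigma_finite setT mu : set T -> \bar R := mu.

HB.instance Definition _ := Measure.copy (sigma_finite_copy h) mu.
HB.instance Definition _ := Measure_isSigmaFinite.Build _ _ _ (sigma_finite_copy h) h.

Lemma sigma_finite_pack :
  exists m : {sigma_finite_measure set T -> \bar R}, (m : set T -> \bar R) = mu.
Proof. by exists (sigma_finite_copy h : {sigma_finite_measure set T -> \bar R}). Qed.

End SigmaFiniteCopy.

Section HaarMeasure.
Context {R : realType} {K : valuedFieldType R} {F : fieldExtType rat}
  {iota : {rmorphism F -> K}}.
Hypothesis hK : is_completion iota.
Variable mu : {measure set (Borel K) -> \bar R}.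
Hypothesis hmu : is_haar mu.
Variable modulus : K -> R.
Hypothesis hmod : is_module mu modulus.
Implicit Types (x y z t : K) (A : set K).

Let B1 : set K := [set x | absv x <= 1].

Let mB1 : measurable (B1 : set (Borel K)).
Proof. exact: measurable_absv_le. Qed.

Lemma haar_ball_lty (e : R) : (mu [set x : K | (absv x <= e)%R] < +oo)%E.
Proof. by case: hmu => _ + _; apply; exact: closed_ball_compact hK e. Qed.

Lemma haar_ball_gt0 (e : R) : 0 < e -> (0 < mu [set x : K | (absv x <= e)%R])%E.
Proof.
move=> e0; case: hmu => _ _ h.
apply: (@lt_le_trans _ _ (mu [set x : K | (absv x < e)%R])).
  by apply: h; [exact: open_absv_lt|exists 0; rewrite /= absv0].
apply: le_measure; rewrite ?inE//.
- exact: measurable_absv_lt.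
- exact: measurable_absv_le.
by move=> x /= /ltW.
Qed.

Let muB1 : exists2 v : R, 0 < v & mu B1 = v%:E.
Proof.
have h1 := haar_ball_lty 1; have h2 := haar_ball_gt0 (@ltr01 R).
exists (fine (mu B1)); first by rewrite fine_gt0// h2 h1.
by rewrite fineK// ge0_fin_numE ?measure_ge0.
Qed.

Lemma haar_sigma_finite : sigma_finite setT mu.
Proof.
exists (fun n : nat => [set x : K | absv x <= n%:R]).
  apply/seteqP; split=> // x _; exists (Num.bound (absv x)) => //=.
  by apply/ltW/archi_boundP/absv_ge0.
by move=> n; split; [exact: measurable_absv_le|exact: haar_ball_lty].
Qed.

Lemma haar_sigma_finite_measure :
  exists m : {sigma_finite_measure set (Borel K) -> \bar R}, (m : set _ -> _) = mu.
Proof.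
exact: sigma_finite_pack haar_sigma_finite.
Qed.

Lemma modulus_ge0 t : 0 <= modulus t.
Proof.
have [v v0 hv] := muB1; have := hmod t mB1; rewrite hv -EFinM => h.
have : (0 <= (modulus t * v)%:E)%E by rewrite -h measure_ge0.
by rewrite lee_fin pmulr_lge0.
Qed.

Lemma image_mul_preimage t A : t != 0 ->
  [set t * x | x in A] = (fun x => t^-1 * x) @^-1` A.
Proof.
move=> t0; apply/seteqP; split=> [_ [x Ax <-]|x /= h] /=; first by rewrite mulKf.
by exists (t^-1 * x) => //; rewrite mulVKf.
Qed.

Let msc t A : t != 0 -> measurable (A : set (Borel K)) ->
  measurable ([set t * x | x in A] : set (Borel K)).
Proof.
move=> t0 mA; rewrite image_mul_preimage//.
by rewrite -[X in measurable X]setTI; apply: measurable_mullK.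
Qed.

Lemma modulusM x y : y != 0 -> modulus (x * y) = modulus x * modulus y.
Proof.
move=> y0; have [v v0 hv] := muB1.
have h1 := hmod (x * y) mB1.
have h2 := hmod x (msc y0 mB1); rewrite (hmod y mB1) hv in h2.
rewrite hv in h1.
have : [set x * y * z | z in B1] = [set x * w | w in [set y * z | z in B1]].
  rewrite image_comp; apply/seteqP; split=> _ [z Bz <-]; exists z => //=; rewrite mulrA//.
move=> e; rewrite -e h1 -!EFinM in h2; case: h2 => h2.
by apply: (mulIf (lt0r_neq0 v0)); rewrite -mulrA.
Qed.

Lemma modulus1 : modulus 1 = 1.
Proof.
have [v v0 hv] := muB1; have := hmod 1 mB1.
rewrite (_ : [set _ | _ in _] = B1).
  rewrite hv -EFinM => -[h].
  by apply: (mulIf (lt0r_neq0 v0)); rewrite mul1r -h.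
by apply/seteqP; split=> [_ [x Bx <-]|x Bx]; [rewrite mul1r|exists x; rewrite ?mul1r].
Qed.

Lemma modulus_gt0 t : t != 0 -> 0 < modulus t.
Proof.
move=> t0; rewrite lt0r modulus_ge0 andbT; apply/eqP => m0.
have := @modulusM t t^-1; rewrite invr_eq0 => /(_ t0).
by rewrite divff// modulus1 m0 mul0r => /eqP; rewrite oner_eq0.
Qed.

Lemma modulusV t : t != 0 -> modulus t^-1 = (modulus t)^-1.
Proof.
move=> t0; have n0 : modulus t != 0 by rewrite gt_eqF// modulus_gt0.
apply: (mulfI n0); rewrite -modulusM ?invr_eq0// !divff// modulus1//.
Qed.

(** Multiplication by x / y, of absolute value 1, preserves the unit ball, whose measure is finite
    and nonzero. *)
Lemma modulus_absv_eq x y : absv x = absv y -> modulus x = modulus y.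
Proof.
have [->|x0] := eqVneq x 0.
  by rewrite absv0 => /esym/eqP; rewrite absv_eq0 => /eqP->.
move=> xy; have y0 : y != 0 by rewrite -absv_eq0 -xy absv_eq0.
have u1 : absv (x / y) = 1 by rewrite absvf_div xy divff// absv_eq0.
have xy0 : x / y != 0 by rewrite mulf_neq0// invr_eq0.
have [v v0 hv] := muB1; have := hmod (x / y) mB1.
rewrite (_ : [set _ | _ in _] = B1); last first.
  apply/seteqP; split=> [_ [z Bz <-]|z Bz] /=; first by rewrite /B1/= absvM u1 mul1r.
  exists (z / (x / y)); last by rewrite mulrC divfK.
  by rewrite /B1/= absvf_div u1 divr1.
rewrite hv -EFinM => -[h].
have h1 : modulus (x / y) = 1 by apply: (mulIf (lt0r_neq0 v0)); rewrite mul1r -h.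
by rewrite -[x](divfK y0) modulusM// h1 mul1r.
Qed.

Let thick (e : R) : 0 < e -> exists n : nat,
  (mu [set x : K | (absv x <= 1 + n.+1%:R^-1)%R] < mu B1 + e%:E)%E.
Proof.
move=> e0; pose G n : set (Borel K) := [set x : K | absv x <= 1 + n.+1%:R^-1].
have mG n : measurable (G n) by exact: measurable_absv_le.
have GB : \bigcap_n G n = B1.
  apply/seteqP; split=> [x h|x Bx n _]; last first.
    by rewrite /G/=; apply: le_trans Bx _; rewrite lerDl.
  rewrite /B1/= leNgt; apply/negP => x1.
  have d0 : 0 < absv x - 1 by rewrite subr_gt0.
  have := @cvg_harmonic R; move/cvgr0Pnorm_lt => /(_ _ d0)[N _ /(_ N (leqnn N))] /=.
  rewrite ger0_norm ?harmonic_ge0// ltNge => /negP; apply.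
  by rewrite lerBlDl; exact: (h N I).
have := @nonincreasing_cvg_mu _ _ _ mu G (haar_ball_lty _) mG.
rewrite GB => /(_ mB1); have [v v0 hv] := muB1; rewrite hv => h.
have cv : mu (G n) @[n --> \oo] --> v%:E.
  apply: h => n m nm; rewrite subsetEset => x; rewrite /G/= => h.
  by apply: le_trans h _; rewrite lerD2l lef_pV2 ?posrE// ler_nat.
have : \forall n \near \oo, (mu (G n) < (v + e)%:E)%E.
  have hn : nbhs v%:E [set y | (y < (v + e)%:E)%E].
    apply: open_nbhs_nbhs; split; last by rewrite /= lte_fin ltrDl.
    exact: open_ereal_lt_ereal.
  exact: (cv _ hn).
by case=> N _ /(_ N (leqnn N)) hN; exists N; rewrite //= EFinD.
Qed.

(** For x near 1 the unit ball is carried into a slightly larger ball, whose measure is close to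
    that of the unit ball by [thick]. *)
Let modulus_near1_le (e : R) : 0 < e -> \forall x \near (1 : K), modulus x < 1 + e.
Proof.
move=> e0; have [v v0 hv] := muB1.
have [n hn] := thick (mulr_gt0 e0 v0).
apply/nbhs_absvP; exists (n.+1%:R^-1); first by rewrite invr_gt0.
move=> x x1.
have x0 : x != 0.
  apply: contraTneq x1 => ->; rewrite subr0 absv1 -leNgt.
  by rewrite invf_le1// ler1n.
have xle : absv x <= 1 + n.+1%:R^-1.
  have h := absvD (x - 1) 1; rewrite subrK absv1 absvB in h.
  by apply: le_trans h _; rewrite addrC lerD2l ltW.
have : (mu [set (x * z)%R | z in B1] <= mu [set z : K | (absv z <= 1 + n.+1%:R^-1)%R])%E.
  apply: le_measure; rewrite ?inE//; first exact: msc.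
    exact: measurable_absv_le.
  move=> _ [z Bz <-] /=; rewrite absvM; apply: le_trans xle.
  by rewrite ler_piMr ?absv_ge0.
move=> /le_lt_trans/(_ hn); rewrite (hmod x mB1) hv -EFinM -EFinD lte_fin.
by rewrite -ltr_pdivlMr// mulrDl divff ?gt_eqF// mulfK ?gt_eqF.
Qed.

(** Upper bounds for the modules of x / t and of t / x, both close to 1, amount to a two-sided
    bound. *)
Lemma modulus_continuous_neq0 t : t != 0 -> {for t, continuous modulus}.
Proof.
move=> t0; apply/cvgrPdist_lt => e e0.
have mt := modulus_gt0 t0.
pose d := e / modulus t / 2; have d0 : 0 < d by rewrite !divr_gt0.
pose d' := Num.min d (1/2).
have d'0 : 0 < d' by rewrite lt_min d0 divr_gt0.
have d'1 : d' <= 1/2 by rewrite ge_min lexx orbT.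
have d'd : d' <= d by rewrite ge_min lexx.
have h1 : \forall x \near t, modulus (x / t) < 1 + d'.
  have c : {for t, continuous (fun x => x / t)}.
    by apply: cvgMK; [exact: cvg_id|exact: cvg_cst].
  have hn : nbhs (t / t) [set y | modulus y < 1 + d'].
    by rewrite divff//; exact: modulus_near1_le.
  exact: (c _ hn).
have h2 : \forall x \near t, modulus (t / x) < 1 + d'.
  have c : {for t, continuous (fun x => t / x)}.
    by apply: cvgMK; [exact: cvg_cst|exact: inv_continuousK].
  have hn : nbhs (t / t) [set y | modulus y < 1 + d'].
    by rewrite divff//; exact: modulus_near1_le.
  exact: (c _ hn).
have h3 : \forall x \near t, x != 0 by apply: open_nbhs_nbhs; split => //; exact: open_neq0K.
near=> x.
have x0 : x != 0 by near: x.
have xt : modulus x = modulus (x / t) * modulus t by rewrite -modulusM// divfK.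
have l1 : modulus (x / t) < 1 + d' by near: x.
have l2 : modulus (t / x) < 1 + d' by near: x.
have l3 : 1 - d' <= modulus (x / t).
  have xt0 : t / x != 0 by rewrite mulf_neq0// invr_eq0.
  have mp := modulus_gt0 xt0.
  rewrite -[x / t]invrK invf_div modulusV//.
  apply: (@le_trans _ _ (1 + d')^-1); last first.
    by rewrite lef_pV2 ?posrE// ?ltW// addr_gt0.
  rewrite -[leRHS]mul1r ler_pdivlMr ?addr_gt0//; nra.
rewrite xt -{1}[modulus t]mul1r -mulrBl normrM (gtr0_norm mt) -ltr_pdivlMr//.
rewrite ltr_norml; have : d < e / modulus t by rewrite /d ltr_pdivrMr// ltr_pMr ?divr_gt0// ltr1n.
lra.
Unshelve. all: by end_near. Qed.

(** Take t0 = x^2 with |x| < 1. The image of the unit ball under t0 misses the open shell |x^2| <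
    |z| < 1, which contains x and so has positive measure; with t0 = x the shell could be empty. *)
Lemma uniformizer : exists t0 : K, [/\ t0 != 0, absv t0 < 1, 0 < modulus t0 & modulus t0 < 1].
Proof.
have [x [x0 x1]] : exists x : K, x != 0 /\ absv x < 1.
  case: hK => -[y [y0 y1]] _ _; have iy0 : iota y != 0 by rewrite fmorph_eq0.
  have [h|h] := ltP (absv (iota y)) 1; first by exists (iota y).
  exists (iota y)^-1; rewrite invr_eq0 absvV invf_lt1 ?absv_gt0E//; split => //.
  by rewrite lt_neqAle eq_sym y1.
have x20 : x * x != 0 by rewrite mulf_neq0.
have ax : 0 < absv x by rewrite absv_gt0E.
have x21 : absv (x * x) < absv x by rewrite absvM gtr_pMl.
exists (x * x); split => //; first exact: lt_trans x1.
  exact: modulus_gt0.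
have [v v0 hv] := muB1; have := hmod (x * x) mB1; rewrite hv -EFinM => h.
have oU : open [set z : K | absv (x * x) < absv z /\ absv z < 1].
  exact: openI (@open_absv_gt _ _ _) (@open_absv_lt _ _ _).
have mU : (0 < mu [set z : K | (absv (x * x) < absv z)%R /\ (absv z < 1)%R])%E.
  by case: hmu => _ _; apply => //; exists x.
have : (mu ([set (x * x * z)%R | z in B1] `|`
    [set z : K | (absv (x * x) < absv z)%R /\ (absv z < 1)%R]) <= mu B1)%E.
  apply: le_measure; rewrite ?inE//.
    by apply: measurableU; [exact: msc|exact: open_measurableK].
  move=> z [[w Bw <-]|[_ /ltW//]].
  rewrite /B1/= absvM -[leRHS]mulr1; apply: ler_pM; rewrite ?absv_ge0//.
  exact/ltW/(lt_trans x21).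
rewrite measureU//.
- rewrite [X in (X + _ <= _)%E]h hv => h2.
  have h3 : ((modulus (x * x) * v)%:E < v%:E)%E by apply: lt_le_trans h2; rewrite lteDl.
  by move: h3; rewrite lte_fin gtr_pMl.
- exact: msc.
- exact: open_measurableK.
- rewrite -subset0 => z [[w Bw <-] [h2 _]]; move: h2; rewrite !absvM ltNge.
  by rewrite ler_piMr ?mulr_ge0 ?absv_ge0.
Qed.

End HaarMeasure.

(** * Dilations, translations and the multiplicative shells of K *)

Section HaarIntegration.
Context {R : realType} {K : valuedFieldType R} {F : fieldExtType rat}
  {iota : {rmorphism F -> K}}.
Hypothesis hK : is_completion iota.
Variable mu : {measure set (Borel K) -> \bar R}.
Hypothesis hmu : is_haar mu.
Variable modulus : K -> R.
Hypothesis hmod : is_module mu modulus.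
Implicit Types (x y z t : K) (A : set K).

Let mge0 t : 0 <= modulus t. Proof. exact: (modulus_ge0 hK hmu hmod). Qed.
Let mgt0 t : t != 0 -> 0 < modulus t. Proof. exact: (modulus_gt0 hK hmu hmod). Qed.
Let mM x y : y != 0 -> modulus (x * y) = modulus x * modulus y.
Proof. exact: (modulusM hK hmu hmod). Qed.
Let mV t : t != 0 -> modulus t^-1 = (modulus t)^-1.
Proof. exact: (modulusV hK hmu hmod). Qed.
Let m1 : modulus 1 = 1. Proof. exact: (modulus1 hK hmu hmod). Qed.

Lemma modulusN x : modulus (- x) = modulus x.
Proof. by apply: (modulus_absv_eq hK hmu hmod); rewrite absvN. Qed.

Lemma modulusX x n : x != 0 -> modulus (x ^+ n) = modulus x ^+ n.
Proof.
by move=> x0; elim: n => [|n IH]; rewrite ?expr0 ?m1// !exprSr mM// IH.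
Qed.

Let minv_nng t : {nonneg R} := NngNum (etrans (invr_ge0 (modulus t)) (mge0 t)).

Let mul_preimage t (t0 : t != 0) A : measurable (A : set (Borel K)) ->
  mu ((fun x : Borel K => t * x : Borel K) @^-1` A) = ((minv_nng t)%:num%:E * mu A)%E.
Proof.
move=> mA; have := hmod t^-1 mA.
by rewrite image_mul_preimage ?invr_eq0// invrK mV.
Qed.

Let add_preimage t A : measurable (A : set (Borel K)) ->
  mu ((fun x : Borel K => t + x : Borel K) @^-1` A) = ((1%:nng : {nonneg R})%:num%:E * mu A)%E.
Proof.
move=> mA; rewrite mul1e; have [h _ _] := hmu; rewrite -(h (- t) A mA).
congr (mu _); apply/seteqP; split=> [x Ax|_ [x Ax <-]] /=; last by rewrite addrA subrr add0r.
by exists (t + x) => //; rewrite addKr.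
Qed.

Lemma ge0_integral_mulK t (f : K -> \bar R) : t != 0 ->
  measurable_fun setT (f : Borel K -> \bar R) -> (forall x, 0 <= f x)%E ->
  (\int[mu]_x f (t * x)%R = (modulus t)^-1%:E * \int[mu]_x f x)%E.
Proof.
move=> t0 mf f0.
exact: (ge0_integral_change (measurable_mullK t) (mul_preimage t0) mf f0).
Qed.

Lemma Cintegral_mulK t (f : K -> R[i]) : t != 0 -> Cintegrable mu f ->
  Cintegrable mu (fun x => f (t * x)) /\
  Cintegral mu (fun x => f (t * x)) = ((modulus t)^-1)%:C * Cintegral mu f.
Proof.
move=> t0 fi; split.
  exact: (Cintegrable_change (measurable_mullK t) (mul_preimage t0) fi).
exact: (Cintegral_change (measurable_mullK t) (mul_preimage t0) fi).
Qed.

Lemma Cintegral_addK t (f : K -> R[i]) : Cintegrable mu f ->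
  Cintegrable mu (fun x => f (t + x)) /\
  Cintegral mu (fun x => f (t + x)) = Cintegral mu f.
Proof.
move=> fi; split.
  exact: (Cintegrable_change (measurable_addlK t) (@add_preimage t) fi).
by rewrite (Cintegral_change (measurable_addlK t) (@add_preimage t) fi) mul1r.
Qed.

Lemma Rintegral_addK t (f : K -> R) : mu.-integrable setT (EFin \o f) ->
  mu.-integrable setT (EFin \o (fun x => f (t + x))) /\
  Rintegral mu setT (fun x => f (t + x)) = Rintegral mu setT f.
Proof.
move=> fi; split.
  exact: (integrable_change (measurable_addlK t) (@add_preimage t) fi).
by rewrite (Rintegral_change (measurable_addlK t) (@add_preimage t) fi) mul1r.
Qed.

Lemma Cintegral_oppK (f : K -> R[i]) : Cintegrable mu f ->
  Cintegrable mu (fun x => f (- x)) /\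
  Cintegral mu (fun x => f (- x)) = Cintegral mu f.
Proof.
move=> fi; have := Cintegral_mulK (_ : -1 != 0) fi; rewrite oppr_eq0 oner_eq0.
move=> /(_ isT); rewrite modulusN m1 invr1 mul1r.
by under eq_fun do rewrite mulN1r.
Qed.

Lemma expn_lt_ex (u e : R) : 0 <= u < 1 -> 0 < e -> exists n : nat, u ^+ n < e.
Proof.
move=> /andP[u0 u1] e0; have : u ^+ n @[n --> \oo] --> (0 : R).
  by apply: cvg_expr; rewrite ger0_norm.
move=> /cvgr0Pnorm_lt/(_ _ e0)[n _ /(_ n (leqnn n)) /=].
by rewrite ger0_norm ?exprn_ge0//; exists n.
Qed.

Lemma annulus_decomp t0 x : t0 != 0 -> absv t0 < 1 -> x != 0 ->
  exists n y, absv t0 < absv y <= 1 /\ (x = t0 ^+ n * y \/ y = t0 ^+ n * x).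
Proof.
move=> t00 a1 x0; set a := absv t0.
have a0 : 0 < a by rewrite absv_gt0E.
have ax : 0 < absv x by rewrite absv_gt0E.
have [x1|x1] := ltP 1 (absv x).
  have exn : exists n, a ^+ n * absv x <= 1.
    have [n hn] := @expn_lt_ex a (absv x)^-1 (ltac:(by rewrite ltW)) (ltac:(by rewrite invr_gt0)).
    by exists n; rewrite -ler_pdivlMr// div1r ltW.
  case: (ex_minnP exn) => -[|n]; first by rewrite expr0 mul1r leNgt x1.
  move=> hn hmin; exists n.+1, (t0 ^+ n.+1 * x); split; last by right.
  rewrite absvM absvX hn andbT exprS -mulrA ltr_pMr// ltNge; apply/negP => h.
  by have := hmin _ h; rewrite ltnn.
have exn : exists n, a ^+ n.+1 < absv x.
  have [n hn] := @expn_lt_ex a (absv x) (ltac:(by rewrite ltW)) ax.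
  by exists n; apply: le_lt_trans hn; rewrite exprS ler_piMl ?exprn_ge0 ?ltW.
case: (ex_minnP exn) => n hn hmin; exists n, (x / t0 ^+ n); split; last first.
  by left; rewrite mulrC divfK// expf_neq0.
rewrite absvf_div absvX -/a ltr_pdivlMr ?exprn_gt0// -exprS hn/=.
rewrite ler_pdivrMr ?exprn_gt0// mul1r leNgt; apply/negP => h.
case: n hmin h {hn} => [_|n hmin /hmin]; last by rewrite ltnn.
by rewrite expr0 ltNge x1.
Qed.

(** The exponent k is chosen so that |t0|^k is the module of t0. The quotient h is then invariant
    under t0, and its bounds come from the compact shell |t0| <= |y| <= 1, which meets every
    orbit. *)
Lemma modulus_absv : exists k c C : R, [/\ 0 < k, 0 < c, 0 < C &
  forall x, x != 0 -> c * absv x `^ k <= modulus x <= C * absv x `^ k].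
Proof.
have [t0 [t00 a1 r0 r1]] := uniformizer hK hmu hmod.
set a := absv t0 in a1; set rh := modulus t0 in r0 r1.
have a0 : 0 < a by rewrite absv_gt0E.
pose k := ln rh / ln a.
have lna : ln a < 0 by rewrite ln_lt0// a0.
have k0 : 0 < k by rewrite /k -mulrNN -invrN divr_gt0// oppr_gt0// ln_lt0// r0.
have ak : a `^ k = rh.
  by rewrite /powR gt_eqF//= /k divfK ?lt_eqF// lnK.
pose h x := modulus x / absv x `^ k.
have ht n x : x != 0 -> h (t0 ^+ n * x) = h x.
  move=> x0; elim: n => [|n IH]; first by rewrite expr0 mul1r.
  rewrite -IH exprS -mulrA; set y := _ * x.
  have y0 : y != 0 by rewrite mulf_neq0// expf_neq0.
  rewrite /h mM// absvM powRM ?absv_ge0// ak invfM -/rh.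
  by rewrite mulrACA divff ?mul1r// gt_eqF.
have cpt : compact [set x : K | a <= absv x <= 1].
  rewrite (_ : [set x | _] = [set x : K | absv x <= 1] `&` ~` [set x | absv x < a]).
    apply: compact_closedI; first exact: closed_ball_compact hK 1.
    exact/open_closedC/open_absv_lt.
  apply/seteqP; split=> x /= => [/andP[h1 h2]|[h1 h2]].
    by split=> //; apply/negP; rewrite -leNgt.
  by rewrite h1 andbT leNgt; apply/negP.
have ch : {within [set x : K | a <= absv x <= 1], continuous modulus}.
  apply: continuous_in_subspaceT => x; rewrite inE/= => /andP[ax _].
  apply: (modulus_continuous_neq0 hK hmu hmod).
  by rewrite -absv_gt0E (lt_le_trans a0).
have ne : [set x : K | a <= absv x <= 1] !=set0.
  by exists 1; rewrite /= absv1 lexx ltW.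
have [xM xMin hM] := compact_EVT_max ne cpt ch.
have [xm xmin hm] := compact_EVT_min ne cpt ch.
have xm0 : xm != 0.
  move: xmin; rewrite inE/= => /andP[ax _].
  by rewrite -absv_gt0E (lt_le_trans a0).
exists k, (modulus xm), (modulus xM / rh); split => //.
- exact: mgt0.
- rewrite divr_gt0//; apply: lt_le_trans (hM 1 _); first by rewrite m1.
  by rewrite inE/= absv1 lexx ltW.
move=> x x0.
have [n [y [/andP[ay y1] xy]]] := annulus_decomp t00 a1 x0.
have y0 : y != 0 by rewrite -absv_gt0E (lt_trans a0).
have -> : modulus x = h y * absv x `^ k.
  have -> : h y = h x by case: xy => ->; rewrite ht.
  by rewrite /h divfK// gt_eqF// powR_gt0// absv_gt0E.
have yin : y \in [set x : K | a <= absv x <= 1] by rewrite inE/= ltW.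
rewrite !ler_pM2r ?powR_gt0 ?absv_gt0E//.
have yk1 : absv y `^ k <= 1.
  have <- : (1 : R) `^ k = 1 by rewrite powR1.
  by apply: ge0_ler_powR; rewrite ?nnegrE ?absv_ge0// ltW.
have yka : rh <= absv y `^ k.
  by rewrite -ak; apply: ge0_ler_powR; rewrite ?nnegrE ?absv_ge0 ?ltW.
have yk0 : 0 < absv y `^ k by rewrite powR_gt0// absv_gt0E.
apply/andP; split.
  apply: le_trans (hm _ yin) _; rewrite /h ler_pdivlMr// ler_piMr//.
rewrite /h; apply: ler_pM; rewrite ?invr_ge0 ?(ltW yk0)//; first exact: hM.
by rewrite lef_pV2.
Qed.

(** 0 lies in the images of the unit ball under the t0^n, whose measures decrease geometrically. *)
Lemma haar_set0 : mu ([set 0] : set K) = 0%E.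
Proof.
have [t0 [t00 a1 r0 r1]] := uniformizer hK hmu hmod.
pose B1 : set K := [set x | absv x <= 1].
have mB1 : measurable (B1 : set (Borel K)) by exact: measurable_absv_le.
have lt1 : (mu B1 < +oo)%E by exact: (@haar_ball_lty _ _ _ _ hK mu hmu 1).
apply/eqP; rewrite eq_le measure_ge0 andbT; apply/lee_addgt0Pr => e e0.
rewrite add0e.
have v0 : 0 < fine (mu B1) + 1 by rewrite ltr_wpDl// fine_ge0.
have [n hn] := @expn_lt_ex (modulus t0) (e / (fine (mu B1) + 1))
  (ltac:(by rewrite ltW)) (ltac:(by rewrite divr_gt0)).
have tn0 : t0 ^+ n != 0 by rewrite expf_neq0.
apply: (@le_trans _ _ (mu [set (t0 ^+ n * x)%R | x in B1])).
  apply: le_measure; rewrite ?inE//; first exact: measurable_set0K.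
    rewrite image_mul_preimage// -[X in measurable X]setTI.
    exact: measurable_mullK.
  by move=> _ ->; exists 0; rewrite ?mulr0// /B1/= absv0.
rewrite (hmod _ mB1) modulusX// -(@fineK _ (mu B1)) ?ge0_fin_numE//.
rewrite -EFinM lee_fin; move: hn; rewrite ltr_pdivlMr// => /ltW; apply: le_trans.
by rewrite ler_wpM2l ?exprn_ge0// lerDl.
Qed.

Lemma modulus0 : modulus 0 = 0.
Proof.
have [v v0 hv] : exists2 v : R, 0 < v & mu [set x : K | (absv x <= 1)%R] = v%:E.
  exists (fine (mu [set x : K | (absv x <= 1)%R])).
    by rewrite fine_gt0// (haar_ball_gt0 hmu)//= (haar_ball_lty hK hmu).
  by rewrite fineK// ge0_fin_numE ?measure_ge0// (haar_ball_lty hK hmu).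
have := hmod 0 (@measurable_absv_le R K 1).
rewrite (_ : [set 0 * x | x in _] = [set 0]).
  rewrite haar_set0 hv -EFinM => -[/esym/eqP].
  by rewrite mulf_eq0 (gt_eqF v0) orbF => /eqP.
apply/seteqP; split=> [_ [x _ <-]|_ ->] /=; first by rewrite mul0r.
by exists 1; rewrite ?mulr1 /= ?absv1.
Qed.

Lemma measurable_modulus : measurable_fun setT (modulus : Borel K -> R).
Proof. by apply: measurable_off0 => x; exact: (modulus_continuous_neq0 hK hmu hmod). Qed.

Definition elog x : R := `|ln (modulus x)|.

Lemma elog_ge0 x : 0 <= elog x. Proof. exact: normr_ge0. Qed.

Lemma measurable_lnmod : measurable_fun setT ((fun x => ln (modulus x)) : Borel K -> R).
Proof. exact: (measurableT_comp (@measurable_ln R) measurable_modulus). Qed.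

(** The density of the dilation invariant measure dx / |x|, times a factor that decays like a power
    of |x| both at 0 and at infinity. All Mellin integrals are compared with it. *)
Definition weight (e : R) x : R := (modulus x)^-1 * expR (- e * elog x).

Lemma weight_ge0 e x : 0 <= weight e x.
Proof. by rewrite mulr_ge0 ?invr_ge0 ?expR_ge0. Qed.

Lemma measurable_weight e : measurable_fun setT (weight e : Borel K -> R).
Proof.
have h : measurable_fun setT ((fun x => (modulus x)^-1) : Borel K -> R).
  apply: measurable_off0 => x x0; apply: cvgV; first by rewrite gt_eqF// mgt0.
  exact: (modulus_continuous_neq0 hK hmu hmod).
apply: measurable_funM => //; apply: (measurableT_comp (@measurable_expR R)).
apply: (measurable_funM (measurable_cst _)).
apply: (measurableT_comp (@normr_measurable R setT)).
exact: measurable_lnmod.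
Qed.

(** The shells [Dn] and [En] are dilates of one shell by powers of t0. Their measures for dx / |x|
    are comparable, and the exponential factor contributes q^n with q = rh^e < 1, so two geometric
    series bound the integral. *)
Lemma weight_integrable e : 0 < e -> mu.-integrable setT (EFin \o weight e).
Proof.
move=> e0.
have [t0 [t00 a1 r0 r1]] := uniformizer hK hmu hmod.
set rh := modulus t0 in r0 r1.
have lr0 : ln rh < 0 by rewrite ln_lt0// r0.
pose Dn n : set (Borel K) := [set x | rh ^+ n.+1 < modulus x <= rh ^+ n].
pose En n : set (Borel K) := [set x | rh ^- n < modulus x <= rh ^- n.+1].
pose D0 := Dn 0%N.
have mI (u v : R) : measurable ([set x | u < modulus x <= v] : set (Borel K)).
  rewrite (_ : [set x | _] = setT `&` (modulus : Borel K -> R) @^-1` `]u, v]%classic).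
    exact: measurable_modulus.
  by rewrite setTI; apply/seteqP; split=> x /=; rewrite in_itv.
have mulE (t : K) (u v : R) : t != 0 ->
   [set x : K | modulus t * u < modulus x <= modulus t * v] =
   [set t * x | x in [set x : K | u < modulus x <= v]].
  move=> tn0; have mt := mgt0 tn0.
  rewrite image_mul_preimage//; apply/seteqP; split=> x /=.
    have [->|x0] := eqVneq x 0.
      rewrite mulr0 modulus0 => /andP[h1 h2]; apply/andP; split.
        by move: h1; rewrite pmulr_rlt0.
      by move: h2; rewrite pmulr_rge0.
    by rewrite mM// mV// ltr_pdivlMl// ler_pdivrMl.
  have [->|x0] := eqVneq x 0.
    rewrite mulr0 modulus0 => /andP[h1 h2]; apply/andP.
    by rewrite pmulr_rlt0// pmulr_rge0.
  by rewrite mM// mV// ltr_pdivlMl// ler_pdivrMl.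
have muD n : mu (Dn n) = ((rh ^+ n)%:E * mu D0)%E.
  rewrite -modulusX//; have := hmod (t0 ^+ n) (mI rh 1).
  rewrite -mulE ?expf_neq0// modulusX// mulr1 -exprSr -/rh => ->.
  by rewrite /D0 /Dn expr1 expr0.
have muE n : mu (En n) = ((rh ^- n.+1)%:E * mu D0)%E.
  have tn0 : t0 ^- n.+1 != 0 by rewrite invr_eq0 expf_neq0.
  have := hmod (t0 ^- n.+1) (mI rh 1).
  rewrite -mulE// mV ?expf_neq0// modulusX// mulr1 -/rh.
  rewrite (_ : rh ^- n.+1 * rh = rh ^- n) => [->|]; first by rewrite /D0 /Dn expr1 expr0.
  by rewrite exprSr invfM divfK// gt_eqF.
have D0fin : (mu D0 < +oo)%E.
  have [k [c [C [k0 c0 C0 hk]]]] := modulus_absv.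
  apply: (@le_lt_trans _ _ (mu [set x : K | (absv x <= c^-1 `^ k^-1)%R])); last first.
    exact: (@haar_ball_lty _ _ _ _ hK mu hmu).
  apply: le_measure; rewrite ?inE//; [exact: mI|exact: measurable_absv_le|].
  move=> x; rewrite /D0/Dn/= expr0 expr1 => /andP[h1 h2].
  have x0 : x != 0 by apply: contraTneq h1 => ->; rewrite modulus0 -leNgt ltW.
  apply: powR_le_root => //; rewrite ?absv_ge0//.
  have /andP[h3 _] := hk x x0; rewrite -div1r ler_pdivlMr// mulrC.
  exact: le_trans h3 h2.
pose v := fine (mu D0).
have vE : mu D0 = v%:E by rewrite fineK// ge0_fin_numE ?measure_ge0.
have v0 : 0 <= v by rewrite fine_ge0.
pose q := expR (e * ln rh).
have q0 : 0 < q by exact: expR_gt0.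
have q1 : q < 1 by rewrite expR_lt1 pmulr_rlt0.
have qn n : q ^+ n = expR (- e * (n%:R * - ln rh)).
  by rewrite /q -expRM_natl; congr expR; ring.
have lnr (n : nat) : ln (rh ^+ n) = n%:R * ln rh by rewrite lnXn// mulr_natl.
have wD n x : Dn n x -> weight e x <= rh^-1 * rh ^- n * q ^+ n.
  move=> /andP[h1 h2]; have x0 : 0 < modulus x by apply: lt_trans h1; rewrite exprn_gt0.
  apply: ler_pM; rewrite ?invr_ge0 ?expR_ge0//.
    by rewrite -invfM -exprS lef_pV2 ?posrE ?exprn_gt0// ltW.
  rewrite qn ler_expR !mulNr lerN2 ler_pM2l// /elog.
  have : ln (modulus x) <= n%:R * ln rh by rewrite -lnr ler_ln ?posrE ?exprn_gt0.
  move=> h; rewrite mulrN -lerN2 opprK; apply: le_trans h.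
  by rewrite lerNl ler_normr lexx orbT.
have wE n x : En n x -> weight e x <= rh ^+ n * q ^+ n.
  move=> /andP[h1 h2].
  have x0 : 0 < modulus x by apply: lt_trans h1; rewrite invr_gt0 exprn_gt0.
  apply: ler_pM; rewrite ?invr_ge0 ?expR_ge0//.
    by rewrite -[leRHS]invrK lef_pV2 ?posrE ?invr_gt0 ?exprn_gt0// ltW.
  rewrite qn ler_expR !mulNr lerN2 ler_pM2l// /elog.
  have : n%:R * - ln rh <= ln (modulus x).
    rewrite mulrN -lnr -lnV ?posrE ?exprn_gt0// ler_ln ?posrE ?invr_gt0 ?exprn_gt0//.
    exact: ltW.
  by move=> h; apply: le_trans h _; rewrite ler_norm.
have mw := measurable_weight e.
have mwE (A : set (Borel K)) : measurable A -> measurable_fun A (EFin \o weight e).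
  by move=> mA; apply/measurable_EFinP; exact: measurable_funTS.
have mDn n : measurable (Dn n) by exact: mI.
have mEn n : measurable (En n) by exact: mI.
have bound (A : set (Borel K)) (c : R) : measurable A ->
    (forall x, A x -> weight e x <= c) ->
    (\int[mu]_(x in A) (weight e x)%:E <= c%:E * mu A)%E.
  move=> mA hc; rewrite -integral_cst//; apply: ge0_le_integral => //.
  - by move=> x _; rewrite lee_fin weight_ge0.
  - exact: mwE.
(* The factor rh^-1 accounts for the variation of 1/|x| within one shell. *)
pose g n := rh^-1 * v * q ^+ n.
have intD n : (\int[mu]_(x in Dn n) (weight e x)%:E <= (g n)%:E)%E.
  apply: le_trans (bound _ _ (mDn n) (wD n)) _; rewrite muD vE -!EFinM lee_fin.
  rewrite le_eqVlt; apply/orP; left; apply/eqP; rewrite /g.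
  by field; rewrite expf_neq0 ?gt_eqF.
have intE n : (\int[mu]_(x in En n) (weight e x)%:E <= (g n)%:E)%E.
  apply: le_trans (bound _ _ (mEn n) (wE n)) _; rewrite muE vE -!EFinM lee_fin.
  rewrite le_eqVlt; apply/orP; left; apply/eqP; rewrite /g exprS.
  by field; rewrite expf_neq0 ?gt_eqF.
have sumg : (\sum_(0 <= n <oo) (g n)%:E < +oo)%E.
  have q1' : `|q| < 1 by rewrite gtr0_norm.
  have := @cvg_geometric_series _ (rh^-1 * v) q q1' => h.
  have := cvg_lim (@Rhausdorff R) h => hl.
  have hc : cvgn (series (geometric (rh^-1 * v) q)) by apply/cvg_ex; eexists; exact: h.
  rewrite (_ : (fun n => _) = EFin \o series (geometric (rh^-1 * v) q)); last first.
    by apply/funext => n /=; rewrite /series/= sumEFin.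
  by rewrite EFin_lim// ltry.
have triv (G : nat -> set (Borel K)) (u : nat -> R) :
    (forall n, G n = [set x | u n.+1 < modulus x <= u n]) ->
    {homo u : n m / (n <= m)%N >-> m <= n} -> trivIset setT G.
  move=> GE hu; apply/trivIsetP => i j _ _.
  wlog : i j / (i < j)%N => [hw|ij _].
    move=> nij; have := nij; rewrite neq_ltn => /orP[ij|ji]; first exact: hw.
    by rewrite setIC; apply: hw => //; rewrite eq_sym.
  rewrite -subset0 => x []; rewrite !GE/= => /andP[h1 _] /andP[_ h2].
  by have := lt_le_trans h1 (le_trans h2 (hu _ _ ij)); rewrite ltxx.
have triv2 (G : nat -> set (Borel K)) (u : nat -> R) :
    (forall n, G n = [set x | u n < modulus x <= u n.+1]) ->
    {homo u : n m / (n <= m)%N >-> n <= m} -> trivIset setT G.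
  move=> GE hu; apply/trivIsetP => i j _ _.
  wlog : i j / (i < j)%N => [hw|ij _].
    move=> nij; have := nij; rewrite neq_ltn => /orP[ij|ji]; first exact: hw.
    by rewrite setIC; apply: hw => //; rewrite eq_sym.
  rewrite -subset0 => x []; rewrite !GE/= => /andP[_ h1] /andP[h2 _].
  by have := lt_le_trans h2 (le_trans h1 (hu _ _ ij)); rewrite ltxx.
have tD : trivIset setT Dn.
  apply: (triv _ (fun n => rh ^+ n)) => // n m nm.
  by rewrite ler_wiXn2l// ltW.
have tE : trivIset setT En.
  apply: (triv2 _ (fun n => rh ^- n)) => // n m nm.
  by rewrite lef_pV2 ?posrE ?exprn_gt0// ler_wiXn2l// ltW.
have cov : setT = (\bigcup_n Dn n `|` \bigcup_n En n) `|` [set (0 : K)].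
  apply/seteqP; split=> // x _; have [->|x0] := eqVneq x 0; first by right.
  left; have mx := mgt0 x0.
  have rr : 0 <= rh < 1 by rewrite ltW.
  have [x1|x1] := leP (modulus x) 1.
    left; have exn : exists n, rh ^+ n < modulus x by exact: expn_lt_ex.
    case: (ex_minnP exn) => -[|n]; first by rewrite expr0 ltNge x1.
    move=> hn hmin; exists n => //; rewrite /Dn/= hn/= leNgt; apply/negP => h.
    by have := hmin _ h; rewrite ltnn.
  right; have exn : exists n, rh ^+ n <= (modulus x)^-1.
    have [n hn] := @expn_lt_ex rh (modulus x)^-1 rr (ltac:(by rewrite invr_gt0)).
    by exists n; rewrite ltW.
  case: (ex_minnP exn) => -[|n].
    by rewrite expr0 invf_ge1// leNgt x1.
  move=> hn hmin; exists n => //; rewrite /En/=; apply/andP; split.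
    rewrite ltNge; apply/negP => h; have := hmin n; rewrite ltnn => h'.
    suff : false by []; apply: h'.
    by rewrite -[leLHS]invrK lef_pV2 ?posrE ?invr_gt0 ?exprn_gt0.
  by rewrite -[leLHS]invrK lef_pV2 ?posrE ?invr_gt0 ?exprn_gt0.
apply/integrableP; split; first exact: mwE.
under eq_integral do rewrite gee0_abs ?lee_fin ?weight_ge0//.
have mUD : measurable (\bigcup_n Dn n) by exact: bigcupT_measurable.
have mUE : measurable (\bigcup_n En n) by exact: bigcupT_measurable.
have w0 (A : set (Borel K)) x : A x -> (0 <= (weight e x)%:E)%E.
  by rewrite lee_fin weight_ge0.
have mW (A : set (Borel K)) : measurable A ->
    measurable_fun A (fun x : Borel K => (weight e x)%:E) by exact: mwE.
have mS : measurable ([set 0] : set (Borel K)) by exact: measurable_set0K.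
have d1 : [disjoint (\bigcup_n Dn n) & (\bigcup_n En n)].
  apply/eqP; rewrite -subset0 => x [[n _ /andP[_ h1]] [m _ /andP[h2 _]]].
  have := lt_le_trans h2 h1; apply/negP; rewrite -leNgt.
  apply: (@le_trans _ _ 1); first by rewrite exprn_ile1 ?ltW.
  by rewrite invf_ge1 ?exprn_gt0// exprn_ile1 ?ltW.
have d2 : [disjoint (\bigcup_n Dn n `|` \bigcup_n En n) & [set (0 : K)]].
  apply/eqP; rewrite -subset0 => x [hx x0]; move: hx; rewrite x0.
  have h0 k : (rh ^+ k < 0) = false by rewrite ltNge exprn_ge0// (ltW r0).
  by case=> -[n _ /andP[+ _]]; rewrite modulus0 ?invr_lt0 h0.
have bnd (G : nat -> set (Borel K)) : (forall n, measurable (G n)) -> trivIset setT G ->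
    (forall n, (\int[mu]_(x in G n) (weight e x)%:E <= (g n)%:E)%E) ->
    (\int[mu]_(x in \bigcup_n G n) (weight e x)%:E < +oo)%E.
  move=> mG tG hG; rewrite ge0_integral_bigcup//.
  - apply: le_lt_trans sumg; apply: lee_nneseries => n _ //.
    by move=> _; apply: integral_ge0 => x _; rewrite lee_fin weight_ge0.
  - by apply: mW; exact: bigcupT_measurable.
  - by move=> x _; rewrite lee_fin weight_ge0.
rewrite [X in integral _ X _]cov ge0_integral_setU//; first last.
- by move=> x _; rewrite lee_fin weight_ge0.
- by apply: mW; apply: measurableU => //; apply: measurableU.
- by apply: measurableU.
rewrite ge0_integral_setU//; first last.
- by move=> x _; rewrite lee_fin weight_ge0.
- by apply: mW; apply: measurableU.
rewrite [X in (_ + X)%E](_ : _ = 0%E) ?adde0; last first.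
  by apply: null_set_integral; [|exact: mwE|exact: haar_set0].
by apply: lte_add_pinfty; exact: bnd.
Qed.

End HaarIntegration.

(** * Mellin integrals *)

Section Tame.
Context {R : realType} {K : valuedFieldType R} {F : fieldExtType rat}
  {iota : {rmorphism F -> K}}.
Hypothesis hK : is_completion iota.
Variable mu : {measure set (Borel K) -> \bar R}.
Hypothesis hmu : is_haar mu.
Variable modulus : K -> R.
Hypothesis hmod : is_module mu modulus.
Implicit Types (x y z t : K) (f : K -> R[i]).

Let mgt0 t : t != 0 -> 0 < modulus t. Proof. exact: (modulus_gt0 hK hmu hmod). Qed.
Let mge0 t : 0 <= modulus t. Proof. exact: (modulus_ge0 hK hmu hmod). Qed.
Let mM x y : y != 0 -> modulus (x * y) = modulus x * modulus y.
Proof. exact: (modulusM hK hmu hmod). Qed.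
Let m0 : modulus 0 = 0. Proof. exact: (modulus0 hK hmu hmod). Qed.

(* The quotient of |x| by a power of the absolute value is multiplicative and
   bounded, hence trivial. *)
Lemma modulus_powR : exists2 k : R, 0 < k & forall x, modulus x = absv x `^ k.
Proof.
have [k [c [C [k0 c0 C0 h]]]] := modulus_absv hK hmu hmod.
exists k => // x; have [->|x0] := eqVneq x 0.
  by rewrite m0 absv0 powR0 ?gt_eqF.
pose d y := ln (modulus y) - k * ln (absv y).
have a0 y : y != 0 -> 0 < absv y by rewrite absv_gt0E.
have dX n : d (x ^+ n) = n%:R * d x.
  rewrite /d (modulusX hK hmu hmod)// absvX lnXn ?mgt0// lnXn ?a0//.
  by rewrite mulr_natl mulrnBl -mulrnAr.
have db y : y != 0 -> ln c <= d y <= ln C.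
  move=> y0; have /andP[h1 h2] := h y y0.
  have p0 : 0 < absv y `^ k by rewrite powR_gt0// a0.
  rewrite /d -ln_powR -ln_div ?posrE ?mgt0//.
  by rewrite !ler_ln ?posrE ?divr_gt0 ?mgt0// ler_pdivlMr// ler_pdivrMr// h1.
have d0 : d x = 0.
  apply/eqP/negPn/negP => dn0.
  have /archi_boundP : 0 <= (`|ln c| + `|ln C| + 1) / `|d x|.
    by rewrite divr_ge0// !addr_ge0.
  set n := Num.bound _; rewrite ltr_pdivrMr ?normr_gt0// -[n%:R]ger0_norm// -normrM -dX.
  have /andP[h1 h2] := db (x ^+ n) (expf_neq0 n x0).
  apply/negP; rewrite -leNgt ler_norml; apply/andP; split.
    rewrite lerNl; apply: (le_trans (y := - ln c)); first by rewrite lerN2.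
    by rewrite (le_trans (ler_norm _))// normrN -addrA lerDl addr_ge0.
  rewrite (le_trans h2)// (le_trans (ler_norm _))// -addrA addrCA lerDl addr_ge0//.
have p0 : 0 < absv x `^ k by rewrite powR_gt0// a0.
by apply: ln_inj; rewrite ?posrE ?mgt0// ln_powR; apply/eqP; rewrite -subr_eq0; apply/eqP.
Qed.

Local Notation u := (elog modulus).

Lemma elog_le e x : 0 < e -> u x <= e^-1 * expR (e * u x).
Proof.
move=> e0; rewrite -ler_pdivrMl ?invr_gt0// invrK.
by apply: le_trans (expR_ge1Dx _); rewrite lerDr.
Qed.

(** Relative to 1/|x|, the quotient |x|^w / (1 + |x|) behaves like |x|^(1 + w) at 0 and like |x|^w
    at infinity. Hence e is limited by the distances of w to the two ends of the strip -1 < w <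
    0. *)
Lemma powR_weight w e x : x != 0 -> e <= 1 + w -> e <= - w ->
  expR (w * ln (modulus x)) <= (1 + modulus x) * weight modulus e x.
Proof.
move=> x0 e1 e2; have mx := mgt0 x0.
have mE : modulus x = expR (ln (modulus x)) by rewrite lnK.
rewrite /weight /elog; set l := ln _ in mE *; rewrite mE -expRN -expRD.
have -> : w * l = (w * l + l + e * `|l|) + (- l + - e * `|l|) by ring.
rewrite [X in X <= _]expRD ler_pM2r ?expR_gt0//.
have [l0|l0] := leP 0 l.
  rewrite ger0_norm// (@le_trans _ _ (expR l))// ?ler_expR; last by rewrite lerDr.
  rewrite -subr_ge0 (_ : _ - _ = l * (- w - e)); last by ring.
  by rewrite mulr_ge0// subr_ge0.
rewrite ltr0_norm// (@le_trans _ _ 1)//; last by rewrite lerDl expR_ge0.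
rewrite expR_le1 (_ : _ + _ = l * (1 + w - e)); last by ring.
by rewrite nmulr_rle0// subr_ge0.
Qed.

Lemma expR_weight a e x : expR (a * u x) * weight modulus e x = weight modulus (e - a) x.
Proof. by rewrite /weight mulrCA -expRD; congr (_ * expR _); ring. Qed.

(* Almost bounded near 0 and almost O(1/|x|) at infinity: what the convergence
   of the Mellin integrals in the open strip needs. *)
Definition tame f := Cmeas (f : Borel K -> R[i]) /\
  forall e : R, 0 < e -> exists2 C : R, 0 <= C &
    forall x, x != 0 -> normc (f x) * (1 + modulus x) <= C * expR (e * u x).

(** The exponent 2 leaves room at infinity for the integrability of f and of log|x| f. This is the
    decay established for Fourier transforms of test functions. *)
Definition rapid f := Cmeas (f : Borel K -> R[i]) /\
  exists2 C : R, 0 <= C & forall x, normc (f x) * (1 + modulus x) ^+ 2 <= C.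

Lemma rapid_tame f : rapid f -> tame f.
Proof.
move=> [mf [C C0 hC]]; split=> // e e0; exists C => // x x0.
have m1x : 1 <= 1 + modulus x by rewrite lerDl.
apply: (@le_trans _ _ C); last first.
  by rewrite ler_peMr// -[leLHS]expR0 ler_expR mulr_ge0 ?elog_ge0// ltW.
apply: le_trans (hC x); rewrite ler_wpM2l ?normc_ge0// expr2 ler_peMr//.
exact: le_trans m1x.
Qed.

Lemma Cmeas_lnmod : Cmeas ((fun x => (ln (modulus x))%:C) : Borel K -> R[i]).
Proof. by apply: Cmeas_real; exact: (measurable_lnmod hK hmu hmod). Qed.

Lemma opA_tame f : tame f -> tame (opA modulus f).
Proof.
move=> [mf hf]; split; first by apply: CmeasM => //; exact: Cmeas_lnmod.
move=> e e0; have e2 : 0 < e / 2 by rewrite divr_gt0.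
have [C C0 hC] := hf _ e2; exists ((e / 2)^-1 * C); first by rewrite mulr_ge0// invr_ge0 ltW.
move=> x x0; rewrite /opA normcM normc_real -mulrA.
have -> : expR (e * u x) = expR (e / 2 * u x) * expR (e / 2 * u x).
  by rewrite -expRD; congr expR; field.
rewrite mulrACA; apply: ler_pM; rewrite ?mulr_ge0 ?normc_ge0 ?addr_ge0//.
  exact: elog_le.
exact: hC.
Qed.

Lemma tameB f g : tame f -> tame g -> tame (fun x => f x - g x).
Proof.
move=> [mf hf] [mg hg]; split; first exact: CmeasB.
move=> e e0; have [C C0 hC] := hf e e0; have [D D0 hD] := hg e e0.
exists (C + D) => [|x x0]; first exact: addr_ge0.
rewrite mulrDl; apply: le_trans (lerD (hC x x0) (hD x x0)).
by rewrite -mulrDl ler_wpM2r ?addr_ge0// ler_normcB.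
Qed.

Lemma tameD f g : tame f -> tame g -> tame (fun x => f x + g x).
Proof.
move=> [mf hf] [mg hg]; split; first exact: CmeasD.
move=> e e0; have [C C0 hC] := hf e e0; have [D D0 hD] := hg e e0.
exists (C + D) => [|x x0]; first exact: addr_ge0.
rewrite mulrDl; apply: le_trans (lerD (hC x x0) (hD x x0)).
by rewrite -mulrDl ler_wpM2r ?addr_ge0// ler_normcD.
Qed.

Lemma integrable_off0 (a : R) : mu.-integrable setT (EFin \o (fun x : K => a * (x == 0)%:R)).
Proof.
have m0' : measurable ([set 0] : set (Borel K)) by exact: measurable_set0K.
have e1 : (fun x : K => (x == 0)%:R : R) = \1_([set 0] : set (Borel K)).
  apply/funext => x; rewrite indicE; congr (_%:R : R); congr nat_of_bool.
  by apply/eqP/idP; rewrite inE.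
have ms : measurable_fun setT ((fun x => (x == 0)%:R) : Borel K -> R).
  by rewrite e1; exact: measurable_indic.
suff h : mu.-integrable setT (EFin \o ((fun x => (x == 0)%:R) : Borel K -> R)).
  exact: (integrableZl measurableT a h).
apply/integrableP; split; first exact/measurable_EFinP.
under eq_integral => x _ do rewrite /= ger0_norm//.
rewrite (_ : (fun x => _) = EFin \o \1_([set 0] : set (Borel K))); last by rewrite -e1.
by rewrite integral_indic// setIT (haar_set0 hK hmu hmod) ltry.
Qed.

Lemma Cintegrable_weight f (C e : R) : Cmeas (f : Borel K -> R[i]) -> 0 < e ->
  (forall x, x != 0 -> normc (f x) <= C * weight modulus e x) -> Cintegrable mu f.
Proof.
move=> mf e0 hf.
have i1 := integrableZl measurableT C (weight_integrable hK hmu hmod e0).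
have i2 := integrable_off0 (normc (f 0)).
(* The weight is 0 at 0, because 0^-1 = 0, while f 0 is arbitrary; the second summand covers this
   point. *)
apply: (Cintegrable_le (v := fun x : Borel K =>
  C * weight modulus e x + normc (f 0) * ((x : K) == 0)%:R)) => //.
  move=> x; have [->|x0] := eqVneq x 0.
    by rewrite mulr1 lerDr /weight m0 invr0 mul0r mulr0.
  by rewrite mulr0 addr0 hf.
exact: (integrableD measurableT i1 i2).
Qed.

Lemma Cintegral_ext0 f g : Cmeas (f : Borel K -> R[i]) -> Cmeas (g : Borel K -> R[i]) ->
  (forall x, x != 0 -> f x = g x) -> Cintegral mu f = Cintegral mu g.
Proof.
move=> [f1 f2] [g1 g2] fg.
have ae (a b : Borel K -> R) : (forall x : K, x != 0 -> a x = b x) ->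
    ae_eq mu setT (EFin \o a) (EFin \o b).
  move=> ab; exists [set 0]; split; first exact: measurable_set0K.
    exact: (haar_set0 hK hmu hmod).
  move=> x /= h; apply/eqP/negPn/negP => x0; apply: h => _ /=.
  by rewrite ab.
rewrite /Cintegral /Rintegral; congr (fine _ +i* fine _).
  apply: ae_eq_integral => //; [exact/measurable_EFinP|exact/measurable_EFinP|].
  by apply: ae => x /fg ->.
apply: ae_eq_integral => //; [exact/measurable_EFinP|exact/measurable_EFinP|].
by apply: ae => x /fg ->.
Qed.

Lemma normc_Cintegral_weight f (C e : R) : Cmeas (f : Borel K -> R[i]) -> 0 < e ->
  (forall x, x != 0 -> normc (f x) <= C * weight modulus e x) ->
  normc (Cintegral mu f) <= 2 * (C * Rintegral mu setT (weight modulus e : Borel K -> R)).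
Proof.
move=> mf e0 hf; have iw := weight_integrable hK hmu hmod e0.
have iCw : mu.-integrable setT (EFin \o (fun x : Borel K => C * weight modulus e x)).
  exact: (integrableZl measurableT C iw).
rewrite -RintegralZl//.
(* The factor is 1 away from 0 and 0 at 0, so that g satisfies the bound at every point. *)
pose g x := f x * (weight modulus e x * modulus x * expR (e * u x))%:C.
have gf x : x != 0 -> f x = g x.
  move=> x0; rewrite /g (_ : _ * _ * _ = 1 :> R) ?mulr1//.
  by rewrite /weight [X in X * _]mulrAC mulVf ?mul1r ?gt_eqF ?mgt0// -expRD mulNr addNr expR0.
have mg : Cmeas (g : Borel K -> R[i]).
  apply: CmeasM => //; apply: Cmeas_real; apply: measurable_funM.
    apply: measurable_funM; first exact: (measurable_weight hK hmu hmod).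
    exact: (measurable_modulus hK hmu hmod).
  apply: (measurableT_comp (@measurable_expR R)); apply: (measurable_funM (measurable_cst _)).
  apply: (measurableT_comp (@normr_measurable R setT)).
  exact: (measurable_lnmod hK hmu hmod).
have g0 x : normc (g x) <= C * weight modulus e x.
  have [->|x0] := eqVneq x 0; last by rewrite -gf// hf.
  by rewrite normcM normc_real /weight m0 invr0 !mul0r normr0 !mulr0.
rewrite (Cintegral_ext0 mf mg gf); apply: normc_Cintegral_le => //.
exact: (Cintegrable_le (v := fun x : Borel K => C * weight modulus e x)).
Qed.

Lemma rapid_weight f : rapid f -> exists2 C : R, 0 <= C &
  forall x, x != 0 -> normc (f x) <= C * weight modulus 1 x.
Proof.
move=> [mf [C C0 hC]]; exists C => // x x0; have mx := mgt0 x0.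
have h1 : 0 < (1 + modulus x) ^+ 2 by rewrite exprn_gt0// addr_gt0.
rewrite -(ler_pM2r h1); apply: le_trans (hC x) _; rewrite -mulrA ler_peMr//.
rewrite /weight mulNr mul1r expRN /elog -invfM.
rewrite ler_pdivlMl ?mulr_gt0 ?expR_gt0// mulr1.
have [l0|l0] := leP 0 (ln (modulus x)).
  by rewrite ger0_norm// lnK// -expr2 ler_pXn2r ?nnegrE ?addr_ge0// ?lerDr// ltW.
rewrite ltr0_norm// expRN lnK// mulfV ?gt_eqF//.
by rewrite -[leLHS](expr1n _ 2) ler_pXn2r ?nnegrE ?addr_ge0// lerDl ltW.
Qed.

Lemma rapid_log_weight f : rapid f -> exists2 C : R, 0 <= C &
  forall x, x != 0 -> u x * normc (f x) <= C * weight modulus 2^-1 x.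
Proof.
move=> /rapid_weight[C C0 hC]; exists (2 * C) => [|x x0]; first by rewrite mulr_ge0.
apply: le_trans (ler_pM (elog_ge0 _ _) (normc_ge0 _) (elog_le x (ltac:(by []) : 0 < (2^-1 : R))) (hC x x0)) _.
rewrite invrK mulrACA expR_weight (_ : 1 - 2^-1 = 2^-1 :> R)//.
by field.
Qed.

Lemma rapid_integrable f : rapid f -> Cintegrable mu f.
Proof.
move=> rf; have [C C0 hC] := rapid_weight rf.
by apply: (Cintegrable_weight _ ltr01 hC); case: rf.
Qed.

Lemma opA_rapid_integrable f : rapid f -> Cintegrable mu (opA modulus f).
Proof.
move=> rf; have [C C0 hC] := rapid_log_weight rf.
apply: (@Cintegrable_weight _ C 2^-1) => //.
  by apply: CmeasM; [exact: Cmeas_lnmod|case: rf].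
by move=> x x0; rewrite /opA normcM normc_real; exact: hC.
Qed.

Section QuasiCharacter.
Variable c : K -> R[i].
Hypothesis hc : unitary_character c.

Lemma normc_character x : x != 0 -> normc (c x) = 1.
Proof.
case: hc => _ h _ /h; rewrite normr_normc => h1.
by apply: (complexI (R := R)); rewrite h1.
Qed.

Lemma cpowD r (z w : R[i]) : cpow r (z + w) = cpow r z * cpow r w :> R[i].
Proof. by rewrite /cpow mulrDl expCD. Qed.

Lemma normc_cpow r (z : R[i]) : normc (cpow r z) = expR (complex.Re z * ln r) :> R.
Proof. by rewrite normc_expC cReM mulr0 subr0. Qed.

Lemma cpowM (r s : R) (z : R[i]) : 0 < r -> 0 < s -> cpow (r * s) z = cpow r z * cpow s z.
Proof. by move=> r0 s0; rewrite /cpow lnM ?posrE// rmorphD mulrDr expCD. Qed.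

Lemma normc_quasichar (z : R[i]) x : x != 0 ->
  normc (quasichar modulus c z x) = expR (complex.Re z * ln (modulus x)).
Proof. by move=> x0; rewrite normcM normc_character// mul1r normc_cpow. Qed.

Lemma quasicharM (z : R[i]) x y : x != 0 -> y != 0 ->
  quasichar modulus c z (x * y) = quasichar modulus c z x * quasichar modulus c z y.
Proof.
move=> x0 y0; case: hc => h _ _.
by rewrite /quasichar h// mM// cpowM ?mgt0// mulrACA.
Qed.

Lemma Cmeas_quasichar (z : R[i]) : Cmeas (quasichar modulus c z : Borel K -> R[i]).
Proof.
apply: CmeasM; first by apply: Cmeas_off0; case: hc.
have h := measurable_lnmod hK hmu hmod.
have mz (a : R) : measurable_fun setT ((fun x => a * ln (modulus x)) : Borel K -> R).
  by apply: (measurable_funM (measurable_cst _)).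
rewrite (_ : (fun x => _) = (fun x : Borel K => (expR (complex.Re z * ln (modulus x)))%:C *
    (cos (complex.Im z * ln (modulus x)) +i* sin (complex.Im z * ln (modulus x))))); last first.
  by apply/funext => x; rewrite /cpow/expC cReM cImM !mulr0 subr0 add0r.
apply: CmeasM.
  by apply: Cmeas_real; exact: (measurableT_comp (@measurable_expR R) (mz _)).
split=> /=.
  exact: (measurableT_comp (continuous_measurable_fun (@continuous_cos R)) (mz _)).
exact: (measurableT_comp (continuous_measurable_fun (@continuous_sin R)) (mz _)).
Qed.

(** The measure is dx and not dx / |x|, so the strip of convergence is -1 < Re z < 0. It is reached
    from 0 < Re s < 1 by z = -s and by z = s - 1. *)
Definition mellin f (z : R[i]) : R[i] :=
  Cintegral mu (fun x : Borel K => f x * quasichar modulus c z x).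

(** Of the room 8e, one e is spent on tameness and three on the Taylor remainder: two for log^2|x|
    and one for the exponential of |Re h| |log|x||. The weight of exponent 4e remains. *)
Let gap (z : R[i]) : -1 < complex.Re z < 0 -> exists2 e : R, 0 < e &
  8 * e <= 1 + complex.Re z /\ 8 * e <= - complex.Re z.
Proof.
move=> /andP[h1 h2]; exists (Num.min (1 + complex.Re z) (- complex.Re z) / 8).
  by rewrite divr_gt0// lt_min -ltrBlDl sub0r h1 oppr_gt0.
by rewrite mulrC divfK// !ge_min !lexx orbT.
Qed.

Lemma tame_weight f (z : R[i]) e : tame f -> 0 < e ->
  8 * e <= 1 + complex.Re z -> 8 * e <= - complex.Re z ->
  exists2 C : R, 0 <= C & forall x, x != 0 ->
    normc (f x) * expR (complex.Re z * ln (modulus x)) <= C * weight modulus (7 * e) x.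
Proof.
move=> [mf hf] e0 h1 h2; have [C C0 hC] := hf e e0; exists C => // x x0.
apply: (le_trans (ler_wpM2l (normc_ge0 _) (powR_weight x0 h1 h2))).
rewrite mulrA; apply: le_trans (ler_wpM2r (weight_ge0 hK hmu hmod _ _) (hC x x0)) _.
rewrite -mulrA expR_weight (_ : 8 * e - e = 7 * e)//; ring.
Qed.

Lemma tame_mellin_integrable f (z : R[i]) : tame f -> -1 < complex.Re z < 0 ->
  Cintegrable mu (fun x : Borel K => f x * quasichar modulus c z x).
Proof.
move=> tf /gap[e e0 [h1 h2]]; have [C C0 hC] := tame_weight tf e0 h1 h2.
apply: (@Cintegrable_weight _ C (7 * e)) => //.
- by apply: CmeasM; [case: tf|exact: Cmeas_quasichar].
- by rewrite mulr_gt0.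
- by move=> x x0; rewrite normcM normc_quasichar// hC.
Qed.

(** Differentiation under the integral sign in quantitative form: |x|^h - 1 - h log|x| is quadratic
    in h, and its growth in x is absorbed by the weight. *)
Lemma mellin_taylor f (z : R[i]) : tame f -> -1 < complex.Re z < 0 ->
  exists C d : R, [/\ 0 <= C, 0 < d & forall h : R[i], normc h < d ->
    normc (mellin f (z + h) - mellin f z - h * mellin (opA modulus f) z) <= C * normc h ^+ 2].
Proof.
move=> tf zs; have [e e0 [h1 h2]] := gap zs; have [C C0 hC] := tame_weight tf e0 h1 h2.
have i3 := tame_mellin_integrable tf zs.
have i4 := tame_mellin_integrable (opA_tame tf) zs.
pose W := Rintegral mu setT (weight modulus (4 * e) : Borel K -> R).
have W0 : 0 <= W by apply: Rintegral_ge0 => x _; exact: (weight_ge0 hK hmu hmod).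
pose D := C * 8 * (e^-1) ^+ 2.
have D0 : 0 <= D by rewrite mulr_ge0 ?exprn_ge0 ?invr_ge0 ?mulr_ge0// ltW.
exists (2 * (D * W)), e; split=> // [|h he]; first by rewrite mulr_ge0// mulr_ge0.
have i5 : Cintegrable mu (fun x : Borel K => f x * quasichar modulus c (z + h) x).
  apply: tame_mellin_integrable => //; rewrite cReD.
  have := le_lt_trans (Re_le_normc h) he; rewrite ltr_norml => /andP[? ?].
  by apply/andP; split; lra.
rewrite /mellin -CintegralZ// -CintegralB// -CintegralB//; [|exact: CintegrableB|exact: CintegrableZ].
rewrite -mulrA [D * W * _]mulrAC.
apply: normc_Cintegral_weight.
- apply: (@Cintegrable_meas _ _ _ mu); apply: CintegrableB; [exact: CintegrableB|exact: CintegrableZ].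
- by rewrite mulr_gt0.
move=> x x0; set l := ln (modulus x).
have -> : f x * quasichar modulus c (z + h) x - f x * quasichar modulus c z x -
    h * (opA modulus f x * quasichar modulus c z x) =
    f x * quasichar modulus c z x * (expC (h * l%:C) - 1 - h * l%:C).
  rewrite /opA /quasichar cpowD -/l {2}/cpow -/l; ring.
rewrite normcM normcM normc_quasichar//.
apply: (le_trans (ler_pM _ (normc_ge0 _) (hC x x0) (expC_taylor _))).
  by rewrite mulr_ge0 ?normc_ge0 ?expR_ge0.
rewrite normcM normc_real -[`|l|]/(u x) cReM mulr0 subr0 normrM -[`|l|]/(u x).
have h3 : expR (`|complex.Re h| * u x) <= expR (e * u x).
  by rewrite ler_expR ler_wpM2r ?elog_ge0// (le_trans (Re_le_normc h))// ltW.
have h4 : u x ^+ 2 <= (e^-1) ^+ 2 * (expR (e * u x) * expR (e * u x)).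
  rewrite -expr2 -exprMn ler_pXn2r ?nnegrE ?elog_ge0 ?mulr_ge0 ?invr_ge0 ?expR_ge0//; last exact: ltW.
  exact: elog_le.
have w0 := weight_ge0 hK hmu hmod.
apply: (@le_trans _ _ (C * weight modulus (7 * e) x * (8 * (normc h ^+ 2 *
   ((e^-1) ^+ 2 * (expR (e * u x) * expR (e * u x)))) * expR (e * u x)))).
  apply: ler_wpM2l; first by rewrite mulr_ge0.
  rewrite exprMn; apply: ler_pM; rewrite ?expR_ge0 ?mulr_ge0 ?exprn_ge0 ?normc_ge0 ?elog_ge0//.
  by rewrite ler_wpM2l// ler_wpM2l// exprn_ge0// normc_ge0.
have -> : weight modulus (4 * e) x = weight modulus (7 * e) x *
    (expR (e * u x) * expR (e * u x) * expR (e * u x)).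
  have -> : expR (e * u x) * expR (e * u x) * expR (e * u x) = expR (3 * e * u x).
    by rewrite -!expRD; congr expR; ring.
  by rewrite [RHS]mulrC expR_weight; congr (weight _ _ _); ring.
by rewrite le_eqVlt; apply/orP; left; apply/eqP; rewrite /D; ring.
Qed.

End QuasiCharacter.
End Tame.

(** * Fourier transform and Tate's identity *)

Section FourierFubini.
Context {R : realType} {K : valuedFieldType R} {F : fieldExtType rat}
  {iota : {rmorphism F -> K}}.
Hypothesis hK : is_completion iota.
Variable mu : {measure set (Borel K) -> \bar R}.
Hypothesis hmu : is_haar mu.
Variable modulus : K -> R.
Hypothesis hmod : is_module mu modulus.
Implicit Types (x y z t v w : K) (f g h k p : K -> R[i]).

Let mgt0 t : t != 0 -> 0 < modulus t. Proof. exact: (modulus_gt0 hK hmu hmod). Qed.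
Let mge0 t : 0 <= modulus t. Proof. exact: (modulus_ge0 hK hmu hmod). Qed.
Let m0 : modulus 0 = 0. Proof. exact: (modulus0 hK hmu hmod). Qed.

Lemma Cmeas_fst f : Cmeas (f : Borel K -> R[i]) ->
  Cmeas (fun z : Borel K * Borel K => f z.1).
Proof. by move=> mf; exact: (Cmeas_comp mf measurable_fst). Qed.

Lemma Cmeas_snd f : Cmeas (f : Borel K -> R[i]) ->
  Cmeas (fun z : Borel K * Borel K => f z.2).
Proof. by move=> mf; exact: (Cmeas_comp mf measurable_snd). Qed.

Lemma Cmeas_prod f : Cmeas (f : Borel K -> R[i]) ->
  Cmeas (fun z : Borel K * Borel K => f ((z.1 : K) * (z.2 : K))).
Proof. by move=> mf; exact: (Cmeas_comp mf (measurable_mulK hK)). Qed.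

Lemma ge0_integral_normc f : Cintegrable mu f -> exists2 N : R, 0 <= N &
  (\int[mu]_x (normc (f x))%:E = N%:E)%E.
Proof.
move=> /Cintegrable_normc/integrableP[m1].
under eq_integral => x _ do rewrite /= ger0_norm ?normc_ge0//.
move=> lt; exists (fine (\int[mu]_x (normc (f x))%:E)%E).
  by rewrite fine_ge0//; apply: integral_ge0 => x _; rewrite lee_fin normc_ge0.
by rewrite fineK// ge0_fin_numE//; apply: integral_ge0 => x _; rewrite lee_fin normc_ge0.
Qed.

Lemma Cmeas_ext0 f g : Cmeas (f : Borel K -> R[i]) -> (forall x, x != 0 -> f x = g x) ->
  Cmeas (g : Borel K -> R[i]).
Proof.
move=> mf fg.
rewrite (_ : g = fun x => f x + (g 0 - f 0) * ((x == 0)%:R : R)%:C).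
  apply: CmeasD => //; apply: CmeasM; first exact: Cmeas_cst.
  apply: Cmeas_real.
  have := integrable_off0 hK hmu hmod 1.
  move=> /integrableP[/measurable_EFinP + _].
  by under eq_fun do rewrite mul1r.
apply/funext => x; have [->|x0] := eqVneq x 0; first by rewrite mulr1 addrC subrK.
by rewrite mulr0 addr0 fg.
Qed.

Lemma Cintegrable_ext0 f g : Cintegrable mu f -> (forall x, x != 0 -> f x = g x) ->
  Cintegrable mu g.
Proof.
move=> fi fg; have i2 := integrable_off0 hK hmu hmod (normc (g 0)).
apply: (Cintegrable_le (v := fun x : Borel K => normc (f x) + normc (g 0) * ((x : K) == 0)%:R)).
- exact: Cmeas_ext0 (Cintegrable_meas fi) fg.
- move=> x; have [->|x0] := eqVneq (x : K) 0.
    by rewrite mulr1 lerDr normc_ge0.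
  by rewrite mulr0 addr0 fg.
exact: (integrableD measurableT (Cintegrable_normc fi) i2).
Qed.

Lemma Cmeas_indic0 : Cmeas ((fun x => ((x != 0)%:R : R)%:C) : Borel K -> R[i]).
Proof.
apply: (@Cmeas_ext0 (fun=> 1)); first exact: Cmeas_cst.
by move=> x ->.
Qed.

(** The bound is asked for x <> 0, where dilation by x is invertible. Replacing G by G', which is
    zero on the null slice x = 0, changes none of the integrals. *)
Lemma fubiniK (G : K -> K -> R[i]) (v : K -> R) :
  Cmeas (fun z : Borel K * Borel K => G z.1 z.2) ->
  mu.-integrable setT (EFin \o (v : Borel K -> R)) ->
  (forall x, x != 0 -> (\int[mu]_y (normc (G x y))%:E <= (v x)%:E)%E) ->
  [/\ Cintegrable mu (fun x => Cintegral mu (G x)),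
      Cintegrable mu (fun y => Cintegral mu (G^~ y)) &
  Cintegral mu (fun x => Cintegral mu (G x)) =
  Cintegral mu (fun y => Cintegral mu (G^~ y))].
Proof.
have [m hm] := haar_sigma_finite_measure hK hmu.
have mE : mu = (m : {measure set (Borel K) -> \bar R}) by apply: eq_measure; exact/esym.
have hE1 := Cintegral_ext0 hK hmu hmod.
have hE2 := Cintegrable_ext0.
rewrite mE in hE1 hE2 *.
move=> mG iv hv.
pose G' x y := ((x != 0)%:R : R)%:C * G x y.
have GE x y : x != 0 -> G' x y = G x y by rewrite /G' => ->; rewrite mul1r.
have mG' : Cmeas (fun z : Borel K * Borel K => G' z.1 z.2).
  by apply: CmeasM => //; exact: (Cmeas_fst Cmeas_indic0).
have [mv ltv] := integrableP _ _ _ iv.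
have [||i1 i2 e] := @Cfubini _ _ _ _ _ m m G'.
- exact: mG'.
- apply: le_lt_trans ltv; apply: ge0_le_integral => //.
  + by move=> x _; apply: integral_ge0 => y _; rewrite lee_fin normc_ge0.
  + have mn : measurable_fun setT (fun z : Borel K * Borel K => (normc (G' z.1 z.2))%:E).
      by apply/measurable_EFinP; exact: Cmeas_normc.
    by apply: (@measurable_fun_fubini_tonelli_F _ _ _ _ _ m _ mn) => z; rewrite lee_fin normc_ge0.
  + exact: measurableT_comp.
  + move=> x _; have [x0|x0] := eqVneq (x : K) 0.
      rewrite integral0_eq ?abse_ge0// => y _.
      by rewrite /G' x0 eqxx mul0r normc0.
    under eq_integral => y _ do rewrite GE//.
    by apply: (le_trans (hv x x0)); rewrite lee_fin ler_norm.
have e1 (y : Borel K) : Cintegral m (G'^~ y) = Cintegral m (G^~ y).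
  have mGy : Cmeas (fun x : Borel K => G x y).
    by case: mG => h1 h2; split; [exact: (measurableT_comp h1 (@pair2_measurable _ _ (Borel K) (Borel K) y))|
      exact: (measurableT_comp h2 (@pair2_measurable _ _ (Borel K) (Borel K) y))].
  by apply: hE1; [apply: CmeasM; [exact: Cmeas_indic0|]|exact: mGy|move=> x; exact: GE].
have e2 (x : K) : x != 0 -> Cintegral m (G' x) = Cintegral m (G x).
  by move=> x0; congr Cintegral; apply/funext => y; exact: GE.
have e3 : (fun y : Borel K => Cintegral m (G'^~ y)) = (fun y : Borel K => Cintegral m (G^~ y)).
  by apply/funext.
rewrite e3 in i2 e; have i3 := hE2 _ _ i1 e2; split; [exact: i3|exact: i2|].
apply: (etrans _ e); apply/esym; apply: hE1; [exact: Cintegrable_meas i1|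
  exact: Cintegrable_meas i3|exact: e2].
Qed.

Lemma fubini_prod f h (kap : K -> K -> R[i]) : Cintegrable mu f -> Cintegrable mu h ->
  Cmeas (fun z : Borel K * Borel K => kap z.1 z.2) ->
  (forall x y, normc (kap x y) <= 1) ->
  [/\ Cintegrable mu (fun x => Cintegral mu (fun y => f x * h y * kap x y)),
      Cintegrable mu (fun y => Cintegral mu (fun x => f x * h y * kap x y)) &
  Cintegral mu (fun x => Cintegral mu (fun y => f x * h y * kap x y)) =
  Cintegral mu (fun y => Cintegral mu (fun x => f x * h y * kap x y))].
Proof.
move=> fi hi mk k1; have mf := Cintegrable_meas fi; have mh := Cintegrable_meas hi.
have [N N0 hN] := ge0_integral_normc hi.
apply: (@fubiniK (fun x y => f x * h y * kap x y) (fun x => N * normc (f x))).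
- by apply: CmeasM => //; apply: CmeasM; [exact: Cmeas_fst|exact: Cmeas_snd].
- exact: (integrableZl measurableT N (Cintegrable_normc fi)).
move=> x x0; rewrite EFinM -hN muleC -ge0_integralZl//.
- apply: ge0_le_integral => //.
  + by move=> y _; rewrite lee_fin normc_ge0.
  + apply/measurable_EFinP; apply: Cmeas_normc.
    apply: CmeasM; first by apply: CmeasM => //; exact: Cmeas_cst.
    by case: mk => h1 h2; split; [exact: (measurableT_comp h1 (@pair1_measurable _ _ (Borel K) (Borel K) x))|
      exact: (measurableT_comp h2 (@pair1_measurable _ _ (Borel K) (Borel K) x))].
  + by apply/measurable_EFinP; apply: (measurable_funM (measurable_cst _)); exact: Cmeas_normc.
  + move=> y _; rewrite -EFinM lee_fin !normcM ler_piMr// mulr_ge0 ?normc_ge0//.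
- by apply/measurable_EFinP; exact: Cmeas_normc.
- by move=> y _; rewrite lee_fin normc_ge0.
- by rewrite lee_fin normc_ge0.
Qed.

(** For fixed t <> 0 the inner integral of p(tv) dv is 1/|t| times that of p, so the double integral
    separates. *)
Lemma fubini_dil f p : Cmeas (f : Borel K -> R[i]) ->
  Cintegrable mu (fun t => f t * ((modulus t)^-1)%:C) -> Cintegrable mu p ->
  Cintegrable mu (fun v => Cintegral mu (fun t => f t * p (t * v))) /\
  Cintegral mu (fun v => Cintegral mu (fun t => f t * p (t * v))) =
  Cintegral mu (fun t => f t * ((modulus t)^-1)%:C) * Cintegral mu p.
Proof.
move=> mf fi pi; have mp := Cintegrable_meas pi.
have [N N0 hN] := ge0_integral_normc pi.
have := @fubiniK (fun t v => f t * p (t * v)) (fun t => N * normc (f t * ((modulus t)^-1)%:C)).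
case.
- by apply: CmeasM; [exact: Cmeas_fst|exact: Cmeas_prod].
- exact: (integrableZl measurableT N (Cintegrable_normc fi)).
- move=> t t0.
  have e1 : (\int[mu]_v (normc (p (t * v)%R))%:E = (modulus t)^-1%:E * N%:E)%E.
    rewrite -hN; apply: (ge0_integral_mulK hK hmu hmod t0 (f := fun x => (normc (p x))%:E)).
      by apply/measurable_EFinP; exact: Cmeas_normc.
    by move=> x; rewrite lee_fin normc_ge0.
  have mpt : Cmeas ((fun v => p (t * v)) : Borel K -> R[i]).
    exact: (Cmeas_comp mp (measurable_mullK t)).
  under eq_integral => v _ do rewrite normcM EFinM.
  rewrite ge0_integralZl//.
  + by rewrite e1 -!EFinM lee_fin normcM normc_real ger0_norm ?invr_ge0// [leRHS]mulrC -mulrA.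
  + by apply/measurable_EFinP; exact: Cmeas_normc.
  + by move=> y _; rewrite lee_fin normc_ge0.
  + by rewrite lee_fin normc_ge0.
move=> i1 i2 e; split; first exact: i2.
apply: (etrans (esym e)); rewrite -CintegralZr; last exact: fi.
apply: (Cintegral_ext0 hK hmu hmod).
- exact: Cintegrable_meas i1.
- by apply: CmeasM; [exact: Cintegrable_meas fi|exact: Cmeas_cst].
move=> t t0; have [j1 j2] := Cintegral_mulK hK hmu hmod t0 pi.
apply: (etrans (CintegralZ (f t) j1)).
by rewrite j2 mulrA.
Qed.

Lemma Cmeas_lambda : Cmeas (@lambda R K : Borel K -> R[i]).
Proof. by apply: Cmeas_continuous; exact: (lambda_continuous hK). Qed.

Lemma Cmeas_opp f : Cmeas (f : Borel K -> R[i]) -> Cmeas ((fun x => f (- x)) : Borel K -> R[i]).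
Proof.
move=> mf; rewrite (_ : (fun x => _) = fun x => f (-1 * x)).
  exact: (Cmeas_comp mf (measurable_mullK (-1))).
by apply/funext => x; rewrite mulN1r.
Qed.

Lemma CintegrableM_bounded f p (C : R) : Cintegrable mu f ->
  Cmeas (p : Borel K -> R[i]) -> (forall x, normc (p x) <= C) ->
  Cintegrable mu (fun x => f x * p x).
Proof.
move=> fi mp pC; apply: (Cintegrable_le (v := fun x : Borel K => C * normc (f x))).
- by apply: CmeasM => //; exact: Cintegrable_meas fi.
- by move=> x; rewrite normcM mulrC ler_wpM2r ?normc_ge0.
- exact: (integrableZl measurableT C (Cintegrable_normc fi)).
Qed.

Lemma fourierE f y : fourier mu f y = fourier_inv mu f (- y).
Proof. by congr Cintegral; apply/funext => x; rewrite mulrN. Qed.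

Lemma fourier_inv_integrable f y : Cintegrable mu f ->
  Cintegrable mu (fun x : Borel K => f x * lambda ((x : K) * y)).
Proof.
move=> fi; apply: (@CintegrableM_bounded _ (fun x => lambda (x * y)) 1) => //.
  rewrite (_ : (fun x => _) = fun x => lambda (y * x)).
    exact: (Cmeas_comp Cmeas_lambda (measurable_mullK y)).
  by apply/funext => x; rewrite mulrC.
by move=> x; rewrite normc_lambda.
Qed.

(** Fubini's theorem against an integrable weight makes weight times transform measurable; the
    weight is positive away from 0 and can be divided out. *)
Lemma fourier_inv_meas f : Cintegrable mu f -> Cmeas (fourier_inv mu f : Borel K -> R[i]).
Proof.
move=> fi; have w1 := weight_integrable hK hmu hmod (@ltr01 R).
have wi : Cintegrable mu (fun x : Borel K => (weight modulus 1 x)%:C).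
  apply: (@Cintegrable_weight _ _ _ _ hK mu hmu modulus hmod _ 1 1) => //.
    by apply: Cmeas_real; exact: (measurable_weight hK hmu hmod).
  by move=> x x0; rewrite mul1r normc_real ger0_norm// (weight_ge0 hK hmu hmod).
have [||_ i2 _] := @fubini_prod f _ (fun x y => lambda (x * y)) fi wi.
- exact: (Cmeas_prod Cmeas_lambda).
- by move=> x y; rewrite normc_lambda.
have mw : Cmeas ((fun x => (modulus x * expR (elog modulus x))%:C) : Borel K -> R[i]).
  apply: Cmeas_real; apply: measurable_funM; first exact: (measurable_modulus hK hmu hmod).
  apply: (measurableT_comp (@measurable_expR R)).
  apply: (measurableT_comp (@normr_measurable R setT)).
  exact: (measurable_lnmod hK hmu hmod).
apply: (Cmeas_ext0 (CmeasM (Cintegrable_meas i2) mw)) => y y0.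
rewrite (_ : (fun x => _) = fun x => (weight modulus 1 y)%:C * (f x * lambda (x * y))); last first.
  by apply/funext => x; rewrite mulrAC mulrC.
rewrite CintegralZ; last exact: fourier_inv_integrable.
have wE : weight modulus 1 y * (modulus y * expR (elog modulus y)) = 1.
  by rewrite /weight mulrACA mulVf ?gt_eqF ?mgt0// mul1r -expRD mulNr mul1r addNr expR0.
by rewrite mulrAC -rmorphM wE mul1r.
Qed.

Lemma fourier_inv_bound f : Cintegrable mu f ->
  exists2 C : R, 0 <= C & forall y, normc (fourier_inv mu f y) <= C.
Proof.
move=> fi; exists (2 * Rintegral mu setT (fun x : Borel K => normc (f x))).
  by rewrite mulr_ge0//; apply: Rintegral_ge0 => x _; rewrite normc_ge0.
move=> y; apply: normc_Cintegral_le; first exact: fourier_inv_integrable.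
  by move=> x; rewrite normcM normc_lambda mulr1.
exact: Cintegrable_normc.
Qed.

End FourierFubini.

(** * The symmetry behind B(h)(0) and Tate's identity *)

Section TateIdentity.
Context {R : realType} {K : valuedFieldType R} {F : fieldExtType rat}
  {iota : {rmorphism F -> K}}.
Hypothesis hK : is_completion iota.
Variable mu : {measure set (Borel K) -> \bar R}.
Hypothesis hmu : is_haar mu.
Variable modulus : K -> R.
Hypothesis hmod : is_module mu modulus.
Implicit Types (x y z t v w : K) (f g h k p : K -> R[i]).

Let mgt0 t : t != 0 -> 0 < modulus t. Proof. exact: (modulus_gt0 hK hmu hmod). Qed.
Let mge0 t : 0 <= modulus t. Proof. exact: (modulus_ge0 hK hmu hmod). Qed.
Let m0 : modulus 0 = 0. Proof. exact: (modulus0 hK hmu hmod). Qed.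
Let mM x y : y != 0 -> modulus (x * y) = modulus x * modulus y.
Proof. exact: (modulusM hK hmu hmod). Qed.

Lemma eq_Cintegral f g : (forall x, f x = g x) ->
  Cintegral mu (f : Borel K -> R[i]) = Cintegral mu (g : Borel K -> R[i]).
Proof. by move=> /funext ->. Qed.

Definition annular f := Cmeas (f : Borel K -> R[i]) /\
  exists r C : R, [/\ 0 < r, 0 <= C &
    forall x, f x != 0 -> r <= modulus x <= r^-1 /\ normc (f x) <= C].

Lemma annular0 f : annular f -> f 0 = 0.
Proof.
move=> [_ [r [C [r0 _ h]]]]; apply/eqP/negPn/negP => /h[].
by rewrite m0 leNgt r0.
Qed.

Lemma annular_bounded f : annular f -> exists2 C : R, 0 <= C & forall x, normc (f x) <= C.
Proof.
move=> [_ [r [C [r0 C0 h]]]]; exists C => // x.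
by have [->|/h[]//] := eqVneq (f x) 0; rewrite normc0.
Qed.

Lemma annularM f p : annular f -> Cmeas (p : Borel K -> R[i]) ->
  (forall r : R, 0 < r -> exists C : R, forall x, r <= modulus x <= r^-1 -> normc (p x) <= C) ->
  annular (fun x => f x * p x).
Proof.
move=> [mf [r [C [r0 C0 h]]]] mp hp; split; first exact: CmeasM.
have [D hD] := hp r r0; exists r, (C * Num.max D 0).
split=> // [|x]; first by rewrite mulr_ge0// le_max lexx orbT.
rewrite mulf_eq0 negb_or => /andP[/h[h1 h2] _]; split=> //.
by rewrite normcM ler_pM ?normc_ge0// le_max hD.
Qed.

Lemma annular_rapid f : annular f -> rapid modulus f.
Proof.
move=> [mf [r [C [r0 C0 h]]]]; split=> //; exists (C * (1 + r^-1) ^+ 2).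
  by rewrite mulr_ge0// exprn_ge0// addr_ge0// invr_ge0 ltW.
move=> x; have [->|/h[/andP[h1 h2] h3]] := eqVneq (f x) 0.
  by rewrite normc0 mul0r mulr_ge0// exprn_ge0// addr_ge0// invr_ge0 ltW.
apply: ler_pM => //; rewrite ?normc_ge0 ?exprn_ge0 ?addr_ge0//.
by rewrite ler_pXn2r ?nnegrE ?addr_ge0 ?invr_ge0 ?(ltW r0)// lerD2l.
Qed.

Lemma annular_integrable f : annular f -> Cintegrable mu f.
Proof. by move=> /annular_rapid/(rapid_integrable hK hmu hmod). Qed.

Lemma elog_annulus (r : R) x : 0 < r -> r <= modulus x <= r^-1 -> elog modulus x <= `|ln r|.
Proof.
move=> r0 /andP[h1 h2]; have mx := lt_le_trans r0 h1.
have h3 : ln r <= ln (modulus x) by rewrite ler_ln ?posrE.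
have h4 : ln (modulus x) <= - ln r by rewrite -lnV// ler_ln ?posrE ?invr_gt0.
rewrite /elog ler_norml; apply/andP; split.
  by rewrite lerNl (le_trans (y := - ln r))// ?lerN2// -normrN ler_norm.
by apply: (le_trans h4); rewrite -normrN ler_norm.
Qed.

Lemma opA_annular f : annular f -> annular (opA modulus f).
Proof.
move=> af; rewrite /opA (_ : (fun x => _) = fun x => f x * (ln (modulus x))%:C); last first.
  by apply/funext => x; rewrite mulrC.
apply: annularM => //; first exact: (Cmeas_lnmod hK hmu hmod).
by move=> r r0; exists `|ln r| => x /(elog_annulus r0); rewrite normc_real.
Qed.

Lemma Cmeas_modV : Cmeas ((fun x => ((modulus x)^-1)%:C) : Borel K -> R[i]).
Proof.
apply: Cmeas_real; apply: measurable_off0 => x x0.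
apply: cvgV; first by rewrite gt_eqF// mgt0.
exact: (modulus_continuous_neq0 hK hmu hmod).
Qed.

Lemma annular_modV f : annular f -> annular (fun x => f x * ((modulus x)^-1)%:C).
Proof.
move=> af; apply: annularM => //; first exact: Cmeas_modV.
move=> r r0; exists r^-1 => x /andP[h1 h2].
have mx := lt_le_trans r0 h1.
by rewrite normc_real ger0_norm ?invr_ge0// lef_pV2.
Qed.

Lemma annular_tame f : annular f -> tame modulus f.
Proof. by move=> /annular_rapid/(rapid_tame hK hmu hmod). Qed.

(** The inversion formula enters through its value at 0, where it says that the integral of F^-1 h
    is h(0) = 0. *)
Definition nice h := [/\ annular h, rapid modulus (fourier_inv mu h) &
  fourier mu (fourier_inv mu h) = h].

(* B(h)(0); the values of B(h) elsewhere are obtained by translating h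
   (opB_translate). *)
Definition log_functional h : R[i] := Cintegral mu (opA modulus (fourier_inv mu h)).

(** A multiplicative convolution of f with F^-1 h. Written as the double integral of f(t) h(u)
    lambda(tuv) it is symmetric in f and h. *)
Let E f h v := Cintegral mu (fun t : Borel K => f t * fourier_inv mu h ((t : K) * v)).

Let E_sym f h v : Cintegrable mu f -> Cintegrable mu h -> E f h v = E h f v.
Proof.
move=> fi hi.
have [||_ _ e] := @fubini_prod _ _ _ _ hK mu hmu modulus hmod f h (fun x y => lambda (x * y * v)) fi hi.
- apply: (Cmeas_prod hK (f := fun x => lambda (x * v))).
  rewrite (_ : (fun x => _) = fun x => lambda (v * x)).
    exact: (Cmeas_comp (Cmeas_lambda hK) (measurable_mullK v)).
  by apply/funext => x; rewrite mulrC.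
- by move=> x y; rewrite normc_lambda.
have e1 a b : Cintegrable mu b ->
    E a b v = Cintegral mu (fun x => Cintegral mu (fun y => a x * b y * lambda (x * y * v))).
  move=> bi; apply: eq_Cintegral => x.
  apply: (etrans (esym (CintegralZ (a x) (fourier_inv_integrable hK (x * v) bi)))).
  by apply: eq_Cintegral => y; rewrite mulrA (mulrCA (y : K)) mulrA.
apply: (etrans (e1 f h hi)); apply: (etrans e); apply/esym; apply: (etrans (e1 h f fi)).
apply: eq_Cintegral => x; apply: eq_Cintegral => y.
by rewrite [h x * _]mulrC [x * y]mulrC.
Qed.

(** Write log|v| = log|tv| - log|t| inside E. By [fubini_dil] the first term gives the left-hand
    side, and the second one a multiple of the integral of F^-1 h, which is 0. *)
Let log_functionalE f h : nice f -> nice h ->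
  Cintegral mu (fun t => f t * ((modulus t)^-1)%:C) * log_functional h =
  Cintegral mu (fun v : Borel K => (ln (modulus v))%:C * E f h v).
Proof.
move=> [af rf Ff] [ah rh Fh].
have hi := rapid_integrable hK hmu hmod rh.
have Ahi := opA_rapid_integrable hK hmu hmod rh.
have [i1 e1] := fubini_dil hK hmu hmod af.1 (annular_integrable (annular_modV af)) Ahi.
have aAf := opA_annular af.
have [i2 e2] := fubini_dil hK hmu hmod aAf.1 (annular_integrable (annular_modV aAf)) hi.
have e3 : Cintegral mu (fourier_inv mu h) = 0.
  rewrite -(annular0 ah) -[in RHS]Fh; apply: eq_Cintegral => x.
  by rewrite mulr0 oppr0 (lambda0 hK) mulr1.
rewrite e3 mulr0 in e2; rewrite -[LHS]subr0; apply: (etrans (congr2 (fun a b => a - b) (esym e1) (esym e2))).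
apply: (etrans (esym (CintegralB i1 i2))).
have mi := Cintegrable_meas (CintegrableB i1 i2).
suff pe v : v != 0 -> Cintegral mu (fun t => f t * opA modulus (fourier_inv mu h) (t * v)) -
    Cintegral mu (fun t => opA modulus f t * fourier_inv mu h (t * v)) =
    (ln (modulus v))%:C * E f h v.
  exact: (Cintegral_ext0 hK hmu hmod mi (Cmeas_ext0 hK hmu hmod mi pe) pe).
move=> v0.
have [Cf Cf0 fC] := annular_bounded af.
have [CA CA0 fA] := annular_bounded aAf.
have dil p : Cintegrable mu p -> Cintegrable mu (fun t => p (t * v)).
  move=> pi; have [+ _] := Cintegral_mulK hK hmu hmod v0 pi.
  by under eq_fun do rewrite mulrC.
have jj p q (C : R) : Cintegrable mu p -> Cmeas (q : Borel K -> R[i]) ->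
    (forall x, normc (q x) <= C) -> Cintegrable mu (fun t => q t * p (t * v)).
  move=> pi mq qC; have := CintegrableM_bounded (dil _ pi) mq qC.
  by under eq_fun do rewrite mulrC.
have j1 := jj _ _ _ Ahi af.1 fC.
have j2 := jj _ _ _ hi aAf.1 fA.
have j3 := jj _ _ _ hi af.1 fC.
apply: (etrans (esym (CintegralB j1 j2))); apply: (etrans _ (CintegralZ _ j3)).
apply: (Cintegral_ext0 hK hmu hmod).
- exact: (Cintegrable_meas (CintegrableB j1 j2)).
- exact: (Cintegrable_meas (CintegrableZ _ j3)).
move=> t t0; rewrite /opA mM// lnM ?posrE ?mgt0// rmorphD/=; ring.
Qed.

(* For test functions both sides are the integral of log|v| f(t) h(u) lambda(tuv),
   so that B(h)(0) is proportional to the integral of h against dt/|t|. *)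
Lemma log_functional_sym f h : nice f -> nice h ->
  Cintegral mu (fun t => f t * ((modulus t)^-1)%:C) * log_functional h =
  Cintegral mu (fun t => h t * ((modulus t)^-1)%:C) * log_functional f.
Proof.
move=> nf nh; apply: (etrans (log_functionalE nf nh)).
apply: (etrans _ (esym (log_functionalE nh nf))).
have [fi hi] : Cintegrable mu f /\ Cintegrable mu h.
  by split; apply: annular_integrable; [case: nf|case: nh].
by apply: eq_Cintegral => v; rewrite (E_sym v fi hi).
Qed.

Lemma fourier_integrable f y : Cintegrable mu f ->
  Cintegrable mu (fun x : Borel K => f x * lambda (- ((x : K) * y))).
Proof.
move=> fi; have := fourier_inv_integrable hK (- y) fi.
by under eq_fun do rewrite mulrN.
Qed.

Lemma fourier_meas f : Cintegrable mu f -> Cmeas (fourier mu f : Borel K -> R[i]).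
Proof.
move=> fi; rewrite (_ : fourier mu f = fun y => fourier_inv mu f (- y)).
  exact: Cmeas_opp (fourier_inv_meas hK hmu hmod fi).
by apply/funext => y; rewrite fourierE.
Qed.

Lemma fourier_inv_translate f w y : Cintegrable mu f ->
  Cintegrable mu (fun x : Borel K => f ((x : K) + w)) /\
  fourier_inv mu (fun x => f (x + w)) y = lambda (- (w * y)) * fourier_inv mu f y.
Proof.
move=> fi; have [i1 _] := Cintegral_addK hmu w fi.
have i1' : Cintegrable mu (fun x : Borel K => f ((x : K) + w)).
  by move: i1; under eq_fun do rewrite addrC.
split; first exact: i1'.
have fyi := fourier_inv_integrable hK y fi.
have i2 := CintegrableZ (lambda (- (w * y))) fyi.
have [_ e2] := Cintegral_addK hmu w i2.
apply: (etrans _ (CintegralZ _ fyi)); apply: (etrans _ e2).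
apply: eq_Cintegral => x; rewrite [w + x]addrC mulrCA -(lambdaD hK).
by rewrite mulrDl addrCA addNr addr0.
Qed.

(** The formula moving F from one factor of an integral to the other, applied to k and x |-> F
    g(xw), followed by inversion for g. As inversion is not applied to k, integrability of k
    suffices. *)
Lemma fourier_multiplication k g w : w != 0 -> Cintegrable mu k -> annular g ->
  Cintegrable mu (fourier mu g) ->
  (forall z, fourier mu (fourier mu g) z = g (- z)) ->
  Cintegral mu (fun x : Borel K => fourier mu k x * fourier mu g ((x : K) * w)) =
  Cintegral mu (fun x : Borel K => g x * k (- ((x : K) * w))).
Proof.
move=> w0 ki ag gi FF.
have [gwi _] := Cintegral_mulK hK hmu hmod w0 gi.
have [||_ _ e] := @fubini_prod _ _ _ _ hK mu hmu modulus hmod k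
  (fun x => fourier mu g (w * x)) (fun v x => lambda (- (v * x))) ki gwi.
- apply: (Cmeas_prod hK (f := fun x => lambda (- x))).
  exact: (Cmeas_opp (Cmeas_lambda hK)).
- by move=> x y; rewrite normc_lambda.
have gi' v := fourier_integrable (v / w) gi.
have e1 : Cintegral mu (fun x : Borel K => fourier mu k x * fourier mu g ((x : K) * w)) =
    Cintegral mu (fun y => Cintegral mu (fun x => k x * fourier mu g (w * y) * lambda (- (x * y)))).
  apply: eq_Cintegral => y.
  apply: (etrans (esym (CintegralZr (fourier mu g (y * w)) (fourier_integrable y ki)))).
  by apply: eq_Cintegral => x; rewrite mulrAC [w * y]mulrC.
apply: (etrans e1); apply: (etrans (esym e)).
have [Cg Cg0 gC] := annular_bounded ag.
pose G v := k v * g (- (v / w)).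
have Gi : Cintegrable mu G.
  apply: (CintegrableM_bounded ki); last by move=> v; exact: gC.
  rewrite (_ : (fun v => _) = fun v => g (- w^-1 * v)).
    exact: (Cmeas_comp ag.1 (measurable_mullK _)).
  by apply/funext => v; rewrite mulNr mulrC.
have wn0 : - w != 0 by rewrite oppr_eq0.
have [_ e2] := Cintegral_mulK hK hmu hmod wn0 Gi.
rewrite (modulusN hK hmu hmod) in e2.
have -> : (fun x : Borel K => g x * k (- ((x : K) * w))) = (fun x => G (- w * x)).
  apply/funext => x; rewrite /G mulrC mulNr [w * _]mulrC; congr (_ * g _).
  by rewrite mulNr opprK mulfK.
apply: (etrans _ (esym e2)); apply: (etrans _ (CintegralZ _ Gi)).
apply: eq_Cintegral => v.
have [_ e3] := Cintegral_mulK hK hmu hmod w0 (gi' v).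
transitivity (k v * (((modulus w)^-1)%:C * fourier mu (fourier mu g) (v / w))); last first.
  by rewrite FF mulrCA.
apply: (etrans _ (congr1 (fun a => k v * a) e3)).
have [i3 _] := Cintegral_mulK hK hmu hmod w0 (gi' v).
apply: (etrans _ (CintegralZ (k v) i3)); apply: eq_Cintegral => x.
rewrite -mulrA; congr (_ * (_ * lambda (- _))).
have e4 : w * (v / w) = v by rewrite mulrC divfK.
by rewrite [in RHS]mulrAC e4.
Qed.

Section Characters.
Variable chi : K -> R[i].
Hypothesis hchi : unitary_character chi.

Lemma unitary_characterV : unitary_character (fun x => (chi x)^-1).
Proof.
case: (hchi) => h1 h2 h3; split=> [x y x0 y0|x x0|x x0].
- by rewrite h1// invfM.
- by rewrite normfV h2// invr1.
- by apply: cvgV; [rewrite -normr_eq0 h2// oner_eq0|exact: h3].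
Qed.

Lemma quasichar_dual (s : R[i]) x : x != 0 ->
  quasichar modulus chi (s - 1) x * (quasicharV modulus chi (- s) x * (modulus x)%:C) = 1.
Proof.
move=> x0; have c0 : chi x != 0.
  by rewrite -normr_eq0; case: hchi => _ -> // _; rewrite oner_eq0.
have mE : (modulus x)%:C = cpow (modulus x) 1 :> R[i].
  by rewrite /cpow mul1r expC_real lnK// posrE mgt0.
have e : cpow (modulus x) (s - 1) * (cpow (modulus x) (- s) * (modulus x)%:C) = 1 :> R[i].
  by rewrite mE -!cpowD (_ : s - 1 + (- s + 1) = 0); [rewrite /cpow mul0r expC0|ring].
rewrite /quasichar/quasicharV.
transitivity ((chi x * (chi x)^-1) *
  (cpow (modulus x) (s - 1) * (cpow (modulus x) (- s) * (modulus x)%:C))); last by rewrite e divff// mul1r.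
by ring.
Qed.

(** The substitution x = tv turns each product of two Mellin integrals into an integral over v of
    q(v) times an inner integral without characters, and [fourier_multiplication] identifies the two
    inner integrals for every v <> 0. *)
Lemma tate (s : R[i]) k g : Cintegrable mu k -> annular g ->
  Cintegrable mu (fourier mu g) ->
  (forall z, fourier mu (fourier mu g) z = g (- z)) ->
  Cintegrable mu (fun x : Borel K => fourier mu k x * quasicharV modulus chi (- s) x) ->
  Cintegrable mu (fun x : Borel K => fourier mu g x * quasichar modulus chi (s - 1) x) ->
  Cintegrable mu (fun x : Borel K => k (- (x : K)) * quasichar modulus chi (s - 1) x) ->
  dist mu (quasicharV modulus chi (- s)) (fourier mu k) *
    dist mu (quasichar modulus chi (s - 1)) (fourier mu g) =
  dist mu (quasicharV modulus chi (- s)) g *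
    dist mu (quasichar modulus chi (s - 1)) (fun x => k (- x)).
Proof.
move=> ki ag gi FF i1 i2 i3.
set qV := quasicharV modulus chi (- s) in i1 *.
set q := quasichar modulus chi (s - 1) in i2 i3 *.
have mqV : Cmeas (qV : Borel K -> R[i]).
  exact: (Cmeas_quasichar hK hmu hmod unitary_characterV).
have mmod : Cmeas ((fun x => (modulus x)%:C) : Borel K -> R[i]).
  by apply: Cmeas_real; exact: (measurable_modulus hK hmu hmod).
have qM x y : x != 0 -> y != 0 -> q (x * y) = q x * q y.
  exact: (quasicharM hK hmu hmod hchi).
have qd x : x != 0 -> q x * (qV x * (modulus x)%:C) = 1 by exact: quasichar_dual.
(* The product of the integrals of f qV and of p q as the integral of a multiplicative convolution;
   the factor |t| compensates the 1/|t| of [fubini_dil]. *)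
have dil f p : Cmeas (f : Borel K -> R[i]) -> Cintegrable mu (fun x => f x * qV x) ->
    Cintegrable mu (fun x => p x * q x) ->
    Cintegrable mu (fun v =>
      Cintegral mu (fun t => f t * (qV t * (modulus t)%:C) * (p (t * v) * q (t * v)))) /\
    Cintegral mu (fun v => Cintegral mu (fun t => f t * (qV t * (modulus t)%:C) * (p (t * v) * q (t * v)))) =
    dist mu qV f * dist mu q p.
  move=> mf fi pi.
  have e0 t : t != 0 -> f t * qV t = f t * (qV t * (modulus t)%:C) * ((modulus t)^-1)%:C.
    by move=> t0; rewrite -!mulrA -rmorphM mulfV ?mulr1// gt_eqF// mgt0.
  have j1 := Cintegrable_ext0 hK hmu hmod fi e0.
  have mf' : Cmeas ((fun t => f t * (qV t * (modulus t)%:C)) : Borel K -> R[i]).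
    by apply: CmeasM => //; apply: CmeasM.
  have [j2 e2] := fubini_dil hK hmu hmod mf' j1 pi.
  split; first exact: j2.
  apply: (etrans e2); congr (_ * _); apply/esym.
  exact: (Cintegral_ext0 hK hmu hmod (Cintegrable_meas fi) (Cintegrable_meas j1) e0).
have mk := fourier_meas ki.
have [a1 b1] := dil _ _ mk i1 i2.
have giq : Cintegrable mu (fun x => g x * qV x).
  apply: (annular_integrable (annularM ag mqV _)) => r r0.
  exists (expR (`|complex.Re (- s)| * `|ln r|)) => x xr.
  have x0 : x != 0 by apply: contraTneq xr => ->; rewrite m0 leNgt r0.
  rewrite (normc_quasichar modulus unitary_characterV)// ler_expR.
  apply: (le_trans (ler_norm _)); rewrite normrM ler_wpM2l//.
  exact: elog_annulus.
have [a2 b2] := dil _ (fun y => k (- y)) ag.1 giq i3.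
apply: (etrans (esym b1)); apply: (etrans _ b2).
apply: (Cintegral_ext0 hK hmu hmod (Cintegrable_meas a1) (Cintegrable_meas a2)) => v v0.
have step f p : Cintegrable mu (fun t => f t * p (t * v)) ->
    Cintegral mu (fun t => f t * (qV t * (modulus t)%:C) * (p (t * v) * q (t * v))) =
    q v * Cintegral mu (fun t : Borel K => f t * p ((t : K) * v)).
  move=> fpi; apply: (etrans _ (CintegralZ (q v) fpi)); apply/esym.
  have m1 := Cintegrable_meas (CintegrableZ (q v) fpi).
  have pe t : t != 0 -> q v * (f t * p (t * v)) =
      f t * (qV t * (modulus t)%:C) * (p (t * v) * q (t * v)).
    move=> t0; rewrite qM//.
    transitivity (q v * (f t * p (t * v)) * (q t * (qV t * (modulus t)%:C))); last by ring.
    by rewrite qd// mulr1.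
  exact: (Cintegral_ext0 hK hmu hmod m1 (Cmeas_ext0 hK hmu hmod m1 pe) pe).
have jj (p f : K -> R[i]) (C : R) : Cintegrable mu p -> Cmeas (f : Borel K -> R[i]) ->
    (forall x, normc (f x) <= C) -> Cintegrable mu (fun t => f t * p (t * v)).
  move=> pi mf fC; have [pvi _] := Cintegral_mulK hK hmu hmod v0 pi.
  have := CintegrableM_bounded pvi mf fC.
  rewrite (_ : (fun x : Borel K => p (v * x) * f x) = (fun t => f t * p (t * v)))//.
  by apply/funext => t; rewrite mulrC [v * _]mulrC.
have [Cg Cg0 gC] := annular_bounded ag.
have [Ck Ck0 kC] := fourier_inv_bound hK ki.
have i4 := jj _ _ _ gi mk (fun x => _ : normc (fourier mu k x) <= Ck).
have [kNi _] := Cintegral_oppK hK hmu hmod ki.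
have i5 := jj _ _ _ kNi ag.1 gC.
apply: (etrans (step _ _ (i4 _))); first by move=> x; rewrite fourierE.
apply: (etrans _ (esym (step _ (fun y => k (- y)) i5))).
by rewrite fourier_multiplication.
Qed.

End Characters.
End TateIdentity.

(** * Test functions *)

Section TestFunctions.
Context {R : realType} {K : valuedFieldType R} {F : fieldExtType rat}
  {iota : {rmorphism F -> K}}.
Hypothesis hK : is_completion iota.
Implicit Types (x y z t v w : K) (f g h : K -> R[i]).

Lemma compact_supportP f :
  compact_support f <-> exists r : R, forall x, f x != 0 -> absv x <= r.
Proof.
split=> [cf|[r hr]]; last first.
  apply: (@subclosed_compact _ _ [set x : K | absv x <= r]).
  - exact: closed_closure.
  - exact: (closed_ball_compact hK).
  - move=> x cx; apply: (@closed_absv_le R K r); move: x cx.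
    by apply: closure_subset => x /=; exact: hr.
have [[x0 fx0]|h] := pselect (exists x, f x != 0); last first.
  by exists 0 => x fx; exfalso; apply: h; exists x.
have ne : closure [set x | f x != 0] !=set0 by exists x0; exact: subset_closure.
have ca : {within closure [set x | f x != 0], continuous (@absv R K)}.
  by apply: continuous_subspaceT => x; exact: absv_continuous.
have [c _ hc] := compact_EVT_max ne cf ca.
by exists (absv c) => x fx; apply: hc; rewrite inE; exact: subset_closure.
Qed.

Lemma locally_constant_continuous f : locally_constant f -> continuous f.
Proof.
move=> lf x; apply: cvg_near_cst; exact: lf.
Qed.

Lemma continuous_ReIm f : continuous (fun x => complex.Re (f x)) ->
  continuous (fun x => complex.Im (f x)) -> continuous f.
Proof.
move=> cr ci x; apply/cvg_normcP => e e0.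
have e2 : 0 < e / 2 by rewrite divr_gt0.
have h1 : nbhs x [set y | `|complex.Re (f x) - complex.Re (f y)| < e / 2].
  by have /cvgr_dist_lt := cr x; apply.
have h2 : nbhs x [set y | `|complex.Im (f x) - complex.Im (f y)| < e / 2].
  by have /cvgr_dist_lt := ci x; apply.
near=> y; apply: le_lt_trans (normc_le_ReIm _) _; rewrite cReB cImB (splitr e).
by apply: ltrD; near: y.
Unshelve. all: by end_near. Qed.

Lemma schwartz_bruhat_continuous f : schwartz_bruhat f -> continuous f.
Proof.
move=> [h1 h2]; have [ar|nar] := pselect (archimedean K); last first.
  by apply: locally_constant_continuous; case: (h2 nar).
have [sr si _ _] := h1 ar; apply: continuous_ReIm.
  by case: (sr [::]).
by case: (si [::]).
Qed.

Lemma test_continuous f : test_function f -> continuous f.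
Proof. by case=> /schwartz_bruhat_continuous. Qed.

Lemma test_off0 f : test_function f ->
  exists2 r : R, 0 < r & forall x, f x != 0 -> r <= absv x.
Proof.
move=> [_ _ /nbhs_absvP[e e0 h]]; exists e => // x.
by apply: contraNle => h1; apply/eqP; apply: h; rewrite sub0r absvN.
Qed.

(** If lambda were trivial, every inverse Fourier transform would be constant, and so would f by
    self-duality. *)
Lemma lambda_nontrivial (mu : {measure set (Borel K) -> \bar R}) f :
  self_dual mu -> schwartz_bruhat f -> f 1 <> f 0 -> exists a : K, lambda a != 1.
Proof.
move=> hdual sb f10; apply/not_existsP => h.
have l1 a : lambda (a : K) = 1 by apply/eqP/negPn/negP; exact: h.
have c y z : fourier_inv mu (fourier mu f) y = fourier_inv mu (fourier mu f) z.
  by rewrite /fourier_inv; apply: eq_Cintegral => x; rewrite !l1.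
by apply: f10; have := c 1 0; rewrite hdual.
Qed.

Section NonArchimedean.
Hypothesis hna : ~ archimedean K.

Lemma absv_locally_constant x y : absv (x - y) < absv x -> absv y = absv x.
Proof.
move=> h; apply/eqP; rewrite eq_le; apply/andP; split.
  have -> : y = x + (y - x) by rewrite addrC subrK.
  apply: absvD_le => //.
  by rewrite absvB ltW.
rewrite leNgt; apply/negP => h2; have : absv (y + (x - y)) < absv x by apply: absvD_lt.
by rewrite addrC subrK ltxx.
Qed.

Lemma ball_indic_locally_constant (a : K) (e : R) : 0 < e ->
  locally_constant (fun x => ((absv (x - a) < e)%R%:R : R)%:C : R[i]).
Proof.
move=> e0 x; apply/nbhs_absvP; exists e => // y xy /=.
have -> : (absv (y - a) < e) = (absv (x - a) < e); last by [].
apply/idP/idP => h.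
  have -> : x - a = (x - y) + (y - a) by rewrite addrA subrK.
  exact: absvD_lt.
have -> : y - a = (y - x) + (x - a) by rewrite addrA subrK.
by apply: absvD_lt => //; rewrite absvB.
Qed.

Lemma nonarch_test f : locally_constant f -> compact_support f ->
  (\forall x \near (0 : K), f x = 0) -> test_function f.
Proof. by move=> lf cf f0; split=> //; split=> // /hna. Qed.

Lemma nonarch_bump (a : K) (e : R) : a != 0 -> 0 < e ->
  exists f : K -> R, [/\ test_function (fun x => (f x)%:C), forall x, 0 <= f x,
    f a = 1 & forall x, f x != 0 -> absv (x - a) < e].
Proof.
move=> a0 e0; have aa : 0 < absv a by rewrite absv_gt0E.
pose d := Num.min e (absv a).
have d0 : 0 < d by rewrite lt_min e0.
exists (fun x => (absv (x - a) < d)%R%:R); split.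
- apply: nonarch_test; first exact: ball_indic_locally_constant.
    apply/compact_supportP; exists (absv a + absv a) => x.
    have [h _|_] := ltP (absv (x - a)) d; last by rewrite eqxx.
    rewrite -(subrK a x); apply: le_trans (absvD _ _) _; rewrite lerD2r.
    by apply: (le_trans (ltW h)); rewrite ge_min lexx orbT.
  apply/nbhs_absvP; exists (absv a) => // y; rewrite sub0r absvN => hy /=.
  have -> : absv (y - a) = absv a.
    rewrite absvB; apply: absv_locally_constant.
    by rewrite opprB addrC subrK.
  by case: ltP => // h; exfalso; move: h; rewrite lt_min ltxx andbF.
- by move=> x; rewrite ler0n.
- by rewrite subrr absv0 d0.
- move=> x; case: ltP => [h _|_]; last by rewrite eqxx.
  by apply: (lt_le_trans h); rewrite ge_min lexx.
Qed.

(** Compactness of the ball of radius r + 1, which contains the support and its translates by |v| <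
    1; farther out both values vanish. *)
Lemma locally_constant_uniform f : locally_constant f -> compact_support f ->
  exists2 d : R, 0 < d & forall x v, absv v < d -> f (x + v) = f x.
Proof.
move=> lf /compact_supportP[r hr].
have f0 x : r < absv x -> f x = 0.
  by move=> rx; apply/eqP/negPn/negP => /hr; rewrite leNgt rx.
have cS : compact [set x : K | absv x <= r + 1] by exact: (closed_ball_compact hK).
have /compact_near_coveringP := cS.
move=> /(_ K (nbhs (0 : K)) (fun v x => f (x + v) = f x) _).
case.
  move=> x _.
  have [e e0 he] := (nbhs_absvP _ _).1 (lf x).
  have e2 : 0 < e / 2 by rewrite divr_gt0.
  exists ([set y | absv (x - y) < e / 2], [set v | absv (0 - v) < e / 2]).
    by split; apply/nbhs_absvP; exists (e / 2).
  move=> [y v] /= [hy hv]; rewrite (he y) ?(he (y + v))//.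
    rewrite opprD addrA; apply: (le_lt_trans (absvD _ _)).
    by rewrite (splitr e) ltrD// -[- v]add0r.
  by apply: (lt_trans hy); rewrite ltr_pdivrMr// mulr2n mulrDr mulr1 ltrDl.
move=> A hA hsub; have [e e0 he] := (@nbhs_absvP R K 0 _).1 (ex_intro2 _ _ A hA hsub).
exists (Num.min e 1); first by rewrite lt_min e0/=.
move=> x v; rewrite lt_min => /andP[ve v1].
have [xr|xr] := leP (absv x) (r + 1).
  by apply: (he v _ x xr); rewrite sub0r absvN.
rewrite !f0//; first by apply: lt_trans xr; rewrite ltrDl.
rewrite -(ltrD2r 1); apply: (lt_le_trans xr).
have -> : absv x = absv ((x + v) + - v) by rewrite addrK.
by apply: (le_trans (absvD _ _)); rewrite lerD2l absvN ltW.
Qed.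

Variable mu : {measure set (Borel K) -> \bar R}.
Hypothesis hmu : is_haar mu.
Variable modulus : K -> R.
Hypothesis hmod : is_module mu modulus.

Lemma opA_nonarch_test f : test_function f -> test_function (opA modulus f).
Proof.
move=> [[_ /(_ hna)[lf cf]] _ f0]; apply: nonarch_test.
- move=> x; have [->|x0] := eqVneq x 0.
    have f00 : f 0 = 0 by exact: (nbhs_singleton f0).
    by apply: filterS f0 => y fy; rewrite /opA fy f00 !mulr0.
  have xp : 0 < absv x by rewrite absv_gt0E.
  have h : \forall y \near x, absv y = absv x.
    by apply/nbhs_absvP; exists (absv x) => // y; exact: absv_locally_constant.
  apply: filterS2 h (lf x) => y yx fy; rewrite /opA fy.
  by rewrite (modulus_absv_eq hK hmu hmod yx).
- apply/compact_supportP; have [r hr] := (compact_supportP f).1 cf.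
  by exists r => x; rewrite mulf_eq0 negb_or => /andP[_ /hr].
- by apply: filterS f0 => x fx; rewrite /opA fx mulr0.
Qed.

Hypothesis hdual : self_dual mu.

(** As soon as |a / y| < d, invariance of f under translation by a / y shows that the transform at y
    equals lambda(a) times itself. With lambda(a) <> 1 it vanishes, so the transform has bounded
    support. *)
Lemma nonarch_fourier_inv_rapid f : test_function f -> Cintegrable mu f ->
  rapid modulus (fourier_inv mu f).
Proof.
move=> tf fi; have [[_ /(_ hna)[lf cf]] _ f0] := tf.
have [d d0 hd] := locally_constant_uniform lf cf.
have [a la] : exists a : K, lambda a != 1.
  have [u [[sbu _ _] _ u1 us]] := nonarch_bump (oner_neq0 K) (@ltr01 R).
  apply: (lambda_nontrivial hdual sbu); rewrite u1.
  have -> : u 0 = 0 by apply/eqP/negPn/negP => /us; rewrite sub0r absvN absv1 ltxx.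
  by move=> /eqP; rewrite oner_eq0.
have [k k0 mE] := modulus_powR hK hmu hmod.
have a0 : a != 0 by apply: contraNneq la => ->; rewrite (lambda0 hK).
have Finv0 y : absv a / d < absv y -> fourier_inv mu f y = 0.
  move=> hy; have y0 : y != 0.
    by rewrite -absv_gt0E; apply: le_lt_trans hy; rewrite divr_ge0 ?absv_ge0// ltW.
  have yp : 0 < absv y by rewrite absv_gt0E.
  have hv : absv (a / y) < d.
    move: hy; rewrite absvf_div (ltr_pdivrMr _ _ d0) => hy.
    by rewrite (ltr_pdivrMr _ _ yp) mulrC.
  have fyi := fourier_inv_integrable hK y fi.
  have [_ e] := Cintegral_addK hmu (a / y) fyi.
  have e2 : fourier_inv mu f y = lambda a * fourier_inv mu f y.
    apply: (etrans (esym e)); apply: (etrans _ (CintegralZ _ fyi)).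
    apply: eq_Cintegral => x; rewrite addrC hd; last exact: hv.
    rewrite mulrDl (divfK y0) (lambdaD hK); ring.
  have : (1 - lambda a) * fourier_inv mu f y = 0 by rewrite mulrBl mul1r -e2 subrr.
  move=> /eqP; rewrite mulf_eq0 subr_eq0 eq_sym (negbTE la)/= => /eqP //.
have [C C0 hC] := fourier_inv_bound hK fi.
split; first exact: (fourier_inv_meas hK hmu hmod fi).
exists (C * (1 + (absv a / d) `^ k) ^+ 2) => [|y].
  by rewrite mulr_ge0// exprn_ge0// addr_ge0// powR_ge0.
have [hy|hy] := ltP (absv a / d) (absv y).
  by rewrite Finv0// normc0 mul0r mulr_ge0// exprn_ge0// addr_ge0// powR_ge0.
have h1 : 0 <= modulus y by rewrite mE powR_ge0.
apply: ler_pM; rewrite ?normc_ge0 ?exprn_ge0 ?addr_ge0//.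
rewrite mE in h1 *; rewrite ler_pXn2r ?nnegrE ?addr_ge0 ?powR_ge0// lerD2l.
by apply: ge0_ler_powR; rewrite ?nnegrE ?absv_ge0 ?divr_ge0 ?absv_ge0 ?(ltW d0)// ltW.
Qed.

End NonArchimedean.
End TestFunctions.

(** * Calculus of directional derivatives *)

Section DirectionalDerivatives.
Context {R : realType} {K : valuedFieldType R}.
Variable r : {rmorphism R -> K}.
Hypothesis hr : forall t : R, r t = real_emb K t.
Implicit Types (x v : K) (g f : K -> R) (vs : seq K).

(** A relational form of [dirderiv] that carries the existence of the derivative; the ring morphism
    [r] replaces [real_emb]. *)
Definition pd g v x (d : R) : Prop :=
  is_derive (0 : R) (1 : R) (fun h : R => g (x + r h * v)) d.

Let lineE g v x : (fun h : R => g (x + r h * v)) = (fun h : R => g (x + real_emb K h * v)).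
Proof. by apply/funext => h; rewrite hr. Qed.

Lemma pd_dirderiv g v x d : pd g v x d -> dirderiv v g x = d.
Proof.
rewrite /pd lineE => h; rewrite /dirderiv derive1E; exact: (@derive_val _ _ _ _ _ _ _ h).
Qed.

Lemma pd_eq g v x d d' : pd g v x d -> d = d' -> pd g v x d'.
Proof. by move=> h <-. Qed.

Lemma pdD f g v x d e : pd f v x d -> pd g v x e -> pd (fun y => f y + g y) v x (d + e).
Proof. by move=> h1 h2; exact: (is_deriveD h1 h2). Qed.

Lemma pdB f g v x d e : pd f v x d -> pd g v x e -> pd (fun y => f y - g y) v x (d - e).
Proof. by move=> h1 h2; exact: (is_deriveB h1 h2). Qed.

Lemma pdM f g v x d e : pd f v x d -> pd g v x e ->
  pd (fun y => f y * g y) v x (d * g x + f x * e).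
Proof.
move=> h1 h2; have := is_deriveM h1 h2; rewrite rmorph0 mul0r addr0 => h.
by apply: (is_derive_eq h); rewrite /GRing.scale/= addrC mulrC.
Qed.

Lemma pd_cst (t : R) v x : pd (fun=> t) v x 0.
Proof. exact: is_derive_cst. Qed.

Lemma pd_comp (u : R -> R) g v x d e : is_derive (g x) (1 : R) u e -> pd g v x d ->
  pd (fun y => u (g y)) v x (e * d).
Proof.
move=> h1 h2; have h1' : is_derive (g (x + r 0 * v)) (1 : R) u e.
  by rewrite rmorph0 mul0r addr0.
exact: (is_derive1_comp h1' h2).
Qed.

Lemma pd_near f g v x d : (fun h : R => x + r h * v) @ (0 : R) --> x ->
  (\forall y \near x, f y = g y) -> pd f v x d -> pd g v x d.
Proof.
by move=> cl fg; apply: near_eq_is_derive; exact: (cl _ fg).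
Qed.

Lemma smooth_pd g : smooth g -> forall vs v x, pd (dirderivs vs g) v x (dirderivs (v :: vs) g x).
Proof.
move=> sg vs v x; have [_ /(_ v x) h] := sg vs; rewrite /pd lineE.
by rewrite /= /dirderiv derive1E; exact: derivableP.
Qed.

Lemma smooth_dirderiv g v : smooth g -> smooth (dirderiv v g).
Proof.
move=> sg vs; have -> : dirderivs vs (dirderiv v g) = dirderivs (vs ++ [:: v]) g.
  by rewrite /dirderivs foldr_cat.
exact: sg.
Qed.

(** A coinduction principle: membership in S passes to all iterated directional derivatives, without
    computing them. *)
Lemma smooth_class (S : (K -> R) -> Prop) : (forall g, S g -> continuous g) ->
  (forall g v, S g -> exists2 d, S d & forall x, pd g v x (d x)) ->
  forall g, S g -> smooth g.
Proof.
move=> hc hd g Sg vs.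
have Svs : S (dirderivs vs g).
  elim: vs => //= v vs IH; have [d Sd dE] := hd _ v IH.
  rewrite (_ : dirderiv v _ = d)//; apply/funext => x; exact: pd_dirderiv.
split; first exact: hc.
move=> v x; have [d _ dE] := hd _ v Svs; have := dE x; rewrite /pd lineE => h.
exact: (@ex_derive _ _ _ _ _ _ _ h).
Qed.

(** The algebra generated by G. Once the derivatives of the generators lie in it, those of all its
    elements do by the product rule, as [smooth_class] requires. *)
Inductive gen_alg (G : (K -> R) -> Prop) : (K -> R) -> Prop :=
| GenAlg g : G g -> gen_alg G g
| GenCst t : gen_alg G (fun=> t)
| GenAdd f g : gen_alg G f -> gen_alg G g -> gen_alg G (fun x => f x + g x)
| GenMul f g : gen_alg G f -> gen_alg G g -> gen_alg G (fun x => f x * g x).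

Lemma gen_alg_continuous G (D : set K) :
  (forall g, G g -> forall x, D x -> {for x, continuous g}) ->
  forall g, gen_alg G g -> forall x, D x -> {for x, continuous g}.
Proof.
move=> hG g; elim=> {g} [g Gg|t|f g _ IHf _ IHg|f g _ IHf _ IHg] x Dx.
- exact: hG.
- exact: cvg_cst.
- by apply: cvgD; [exact: IHf|exact: IHg].
- by apply: cvgM; [exact: IHf|exact: IHg].
Qed.

Lemma gen_alg_pd G (D : set K) :
  (forall g v, G g -> exists2 d, gen_alg G d & forall x, D x -> pd g v x (d x)) ->
  forall g v, gen_alg G g -> exists2 d, gen_alg G d & forall x, D x -> pd g v x (d x).
Proof.
move=> hG g v; elim=> {g} [g Gg|t|f g gf [d gd hd] gg [e ge he]|f g gf [d gd hd] gg [e ge he]].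
- exact: hG.
- exists (fun=> 0); [exact: GenCst|by move=> x _; exact: pd_cst].
- by exists (fun x => d x + e x); [exact: GenAdd|move=> x Dx; apply: pdD; [exact: hd|exact: he]].
- exists (fun x => d x * g x + f x * e x).
    by apply: GenAdd; exact: GenMul.
  by move=> x Dx; apply: pdM; [exact: hd|exact: he].
Qed.

End DirectionalDerivatives.

(** * A smooth function on the line vanishing on one side of 0 *)

Section BumpDerivative.
Variable R : realType.
Implicit Types (t : R) (k : nat).

(* The derivatives of exp(-1/t) are combinations of these functions. *)
Definition ek k t : R := if 0 < t then t^-1 ^+ k * expR (- t^-1) else 0.

Lemma ek_ge0 k t : 0 <= ek k t.
Proof.
by rewrite /ek; case: ifP => // t0; rewrite mulr_ge0 ?exprn_ge0 ?invr_ge0 ?expR_ge0 ?ltW.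
Qed.

Lemma ek_le k t : 0 <= t -> ek k t <= (k.+1)%:R ^+ k.+1 * t.
Proof.
rewrite le_eqVlt => /predU1P[<-|t0]; first by rewrite /ek ltxx mulr0.
rewrite /ek t0 expRN.
have k0 : 0 < (k.+1)%:R :> R by [].
have h : (t^-1 / (k.+1)%:R) ^+ k.+1 <= expR t^-1.
  have -> : t^-1 = (k.+1)%:R * (t^-1 / (k.+1)%:R) by rewrite mulrC divfK// gt_eqF.
  rewrite expRM_natl [_ * (_ / _)]mulrC divfK ?gt_eqF//.
  rewrite ler_pXn2r ?nnegrE ?divr_ge0 ?invr_ge0 ?expR_ge0 ?(ltW t0)//.
  by apply: le_trans (expR_ge1Dx _); rewrite lerDr.
rewrite ler_pdivrMr ?expR_gt0//.
have h2 : (k.+1)%:R ^+ k.+1 * t * (t^-1 / (k.+1)%:R) ^+ k.+1 = t^-1 ^+ k.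
  rewrite exprMn [t^-1 ^+ _ * _]mulrC mulrACA -exprMn divff ?gt_eqF// expr1n mul1r.
  by rewrite exprS mulrA divff ?mul1r// gt_eqF.
rewrite -h2 ler_wpM2l// mulr_ge0 ?exprn_ge0 ?ltW//.
Qed.

(** At 0 the difference quotient is [ek k.+1] on the right and 0 on the left; it tends to 0 by
    [ek_le]. *)
Lemma is_derive_ek k t : is_derive t (1 : R) (ek k) (ek k.+2 t - k%:R * ek k.+1 t).
Proof.
have [t0|t0|t0] := ltgtP t 0.
- rewrite /ek ltNge (ltW t0)/= mulr0 subr0.
  have hn : \forall x \near t, cst 0 x = ek k x.
    by apply: filterS (lt_nbhsl t0) => x x0; rewrite /ek ltNge (ltW x0).
  exact: (near_eq_is_derive hn (is_derive_cst 0 t (1 : R))).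
- have h1 : is_derive t (1 : R) (fun x : R => x^-1) (- t ^- 2).
    have := is_deriveV (lt0r_neq0 t0) (is_derive_id t (1 : R)) => h.
    by apply: (is_derive_eq h); rewrite /GRing.scale/= mulr1.
  have h2 := is_deriveX k h1.
  have h3 : is_derive t (1 : R) (fun x : R => expR (- x^-1)) (expR (- t^-1) * t ^- 2).
    have h4 : is_derive t (1 : R) (fun x : R => - x^-1) (t ^- 2).
      by apply: (is_derive_eq (is_deriveN h1)); rewrite opprK.
    exact: (@is_derive1_comp R (@expR R) (fun x => - x^-1) t _ _ (is_derive_expR _) h4).
  have h2' : is_derive t (1 : R) (fun x : R => x^-1 ^+ k) (k%:R * t^-1 ^+ k.-1 * - t ^- 2).
    by move: h2; rewrite exprfctE.
  have h5 := is_deriveM h2' h3.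
  have hn : \forall x \near t, ((fun x : R => x^-1 ^+ k) * (fun x : R => expR (- x^-1))) x = ek k x.
    apply: filterS (lt_nbhsr t0) => x x0; by rewrite /ek x0 mulrfctE.
  apply: (is_derive_eq (near_eq_is_derive hn h5)); rewrite /GRing.scale/= /ek t0.
  rewrite -exprVn; set u := t^-1; case: k {h2 h2' h5 hn} => [|k] /=.
    by rewrite !mul0r mulr0 subr0 addr0 expr0 mul1r mulrC.
  by rewrite !exprS; ring.
- subst t; rewrite {2 3}/ek ltxx mulr0 subr0.
  have H : h^-1 *: (ek k (h *: (1 : R) + 0) - ek k 0) @[h --> (0 : R)^'] --> (0 : R).
    rewrite {2}/ek ltxx; apply/cvgr0Pnorm_lt => e e0.
    have C0 : 0 < (k.+2)%:R ^+ k.+2 :> R by rewrite exprn_gt0.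
    near=> h; have -> : h *: (1 : R) + 0 = h by rewrite addr0; exact: mulr1.
    rewrite subr0 /GRing.scale/=.
    have [h0|h0] := leP h 0; first by rewrite (_ : ek k h = 0) ?mulr0 ?normr0// /ek ltNge h0.
    have -> : h^-1 * ek k h = ek k.+1 h by rewrite /ek h0 exprS mulrA.
    rewrite ger0_norm ?ek_ge0//; apply: le_lt_trans (ek_le _ (ltW h0)) _.
    rewrite mulrC -ltr_pdivlMr//; apply: le_lt_trans (ler_norm _) _.
    near: h; apply: dnbhs0_lt; exact: divr_gt0.
  by apply: DeriveDef; [exact: (cvgP _ H)|exact: (cvg_lim (@Rhausdorff R) H)].
Unshelve. all: by end_near. Qed.

End BumpDerivative.

(** * Smooth functions on an archimedean completion *)

Section ArchimedeanSmooth.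
Context {R : realType} {K : valuedFieldType R} {F : fieldExtType rat}
  {iota : {rmorphism F -> K}}.
Hypothesis hK : is_completion iota.
Hypothesis har : archimedean K.
Variables (r : {rmorphism R -> K}) (c : R) (j : K) (a b : K -> R).
Hypotheses (c0 : 0 < c) (hr : forall t : R, r t = real_emb K t)
  (absvr : forall t : R, absv (r t) = `|t| `^ c) (co : coordinates r j a b).
Implicit Types (x y v : K) (g : K -> R) (vs : seq K).

Lemma line_cvg x v : (fun h : R => x + r h * v) @ (0 : R) --> x.
Proof.
have rc : r h @[h --> (0 : R)] --> (0 : K).
  have hn e : 0 < e -> \forall h \near (0 : R), absv (0 - r h) < e.
    move=> e0; have e1 : 0 < e `^ c^-1 by rewrite powR_gt0.
    apply: filterS (nbhs0_lt e1) => h he; rewrite sub0r absvN absvr.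
    exact: (powR_lt_root c0 e0).
  by apply/cvg_absvP.
rewrite -[X in _ --> X]addr0 -[X in _ + X](mul0r v).
apply: cvgDK; first exact: cvg_cst.
by apply: cvgMK; [exact: rc|exact: cvg_cst].
Qed.

Lemma pd_a v x : pd r a v x (a v).
Proof.
rewrite /pd (_ : (fun h : R => _) = (fun h : R => a x + h * a v)).
  by apply: is_derive_eq; rewrite /GRing.scale/=; ring.
by apply/funext => h; rewrite (coordD co) (coordZ co).
Qed.

Lemma pd_b v x : pd r b v x (b v).
Proof.
rewrite /pd (_ : (fun h : R => _) = (fun h : R => b x + h * b v)).
  by apply: is_derive_eq; rewrite /GRing.scale/=; ring.
by apply/funext => h; rewrite (coordD co) (coordZ co).
Qed.

Lemma pd_off0 g v x : (\forall y \near x, g y = 0) -> pd r g v x 0.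
Proof.
move=> g0; have h : \forall y \near x, 0 = g y by apply: filterS g0 => y ->.
exact: (@pd_near _ _ r (fun=> 0) g v x 0 (@line_cvg x v) h (pd_cst r 0 v x)).
Qed.

Lemma dirderivs_near0 g vs x : (\forall y \near x, g y = 0) ->
  \forall y \near x, dirderivs vs g y = 0.
Proof.
move=> g0; elim: vs => //= v vs /nbhs_interior; apply: filterS => y hy.
by apply: (pd_dirderiv hr); exact: pd_off0.
Qed.

Lemma dirderivs_bounded g (rho : R) : smooth g -> (forall x, g x != 0 -> absv x <= rho) ->
  forall vs, exists2 M : R, 0 <= M &
    forall x, `|dirderivs vs g x| <= M /\ (rho < absv x -> dirderivs vs g x = 0).
Proof.
move=> sg hrho vs.
have z x : rho < absv x -> dirderivs vs g x = 0.
  move=> hx; have h : \forall y \near x, g y = 0.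
    have op := open_nbhs_nbhs (conj (@open_absv_gt R K rho) hx).
    apply: filterS op => y /= hy; apply/eqP/negPn/negP => /hrho.
    by rewrite leNgt hy.
  exact: nbhs_singleton (dirderivs_near0 vs h).
have [cD _] := sg vs.
have cM : {within [set x : K | absv x <= Num.max rho 0], continuous (fun x => `|dirderivs vs g x|)}.
  by apply: continuous_subspaceT => x; apply: (cvg_norm (cD x)).
have ne : [set x : K | absv x <= Num.max rho 0] !=set0.
  by exists 0; rewrite /= absv0 le_max lexx orbT.
have [m _ hm] := compact_EVT_max ne (@closed_ball_compact _ _ _ _ hK (Num.max rho 0)) cM.
exists `|dirderivs vs g m| => // x; split; last exact: z.
have [hx|hx] := leP (absv x) (Num.max rho 0); first by apply: hm; rewrite inE.
by rewrite z ?normr0//; apply: le_lt_trans hx; rewrite le_max lexx.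
Qed.

Lemma rapidly_decreasing_supp g (rho : R) : smooth g ->
  (forall x, g x != 0 -> absv x <= rho) -> rapidly_decreasing g.
Proof.
move=> sg hrho vs m; have [M M0 hM] := dirderivs_bounded sg hrho vs.
exists (Num.max rho 0 ^+ m * M) => x; have [h1 h2] := hM x.
have [hx|hx] := leP (absv x) rho; last first.
  by rewrite h2// normr0 mulr0 mulr_ge0// exprn_ge0// le_max lexx orbT.
apply: ler_pM => //; rewrite ?exprn_ge0 ?absv_ge0//.
by apply: lerXn2r; rewrite ?nnegrE ?absv_ge0 ?le_max ?lexx ?orbT ?hx.
Qed.

Lemma arch_test (f : K -> R[i]) :
  smooth (fun x => complex.Re (f x)) -> smooth (fun x => complex.Im (f x)) ->
  compact_support f -> (\forall x \near (0 : K), f x = 0) -> test_function f.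
Proof.
move=> sr si cf f0; split=> //; split=> // _.
have [rho hrho] := (compact_supportP hK f).1 cf.
by split=> //; apply: (rapidly_decreasing_supp (rho := rho)) => // x fx; apply: hrho;
  apply: contraNneq fx => ->.
Qed.

Lemma test_smooth (f : K -> R[i]) : test_function f ->
  smooth (fun x => complex.Re (f x)) /\ smooth (fun x => complex.Im (f x)).
Proof. by move=> [[/(_ har)[]]]. Qed.

Lemma smooth_cst (t : R) : smooth (fun _ : K => t).
Proof.
apply: (smooth_class hr (S := fun g => exists s, g = fun=> s)); last by exists t.
  by move=> g [s ->]; exact: cst_continuous.
by move=> g v [s ->]; exists (fun=> 0); [exists 0|move=> x; exact: pd_cst].
Qed.

Section Bump.
Variables (x0 : K) (e : R).

(** The usual bump function is [ek 0] composed with w, that is exp(-1 / (e - |x - x0|^2)) in a disc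
    and 0 outside. All the [ek k] are among the generators because differentiation raises k. *)
Let w x := e - ((a x - a x0) * (a x - a x0) + (b x - b x0) * (b x - b x0)).

Let G g := [\/ g = a, g = b | exists k, g = fun x => ek k (w x)].

Let pd_w v x : pd r w v x ((- 2 * a v) * (a x + - a x0) + (- 2 * b v) * (b x + - b x0)).
Proof.
have ha : pd r (fun y => a y - a x0) v x (a v - 0) by exact: pdB (pd_a _ _) (pd_cst _ _ _ _).
have hb : pd r (fun y => b y - b x0) v x (b v - 0) by exact: pdB (pd_b _ _) (pd_cst _ _ _ _).
apply: (pd_eq (pdB (pd_cst _ e _ _) (pdD (pdM ha ha) (pdM hb hb)))); ring.
Qed.

Let G_pd g v : G g -> exists2 d, gen_alg G d & forall x, setT x -> pd r g v x (d x).
Proof.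
have ga : gen_alg G a by apply: GenAlg; apply: Or31.
have gb : gen_alg G b by apply: GenAlg; apply: Or32.
have ge k : gen_alg G (fun x => ek k (w x)) by apply: GenAlg; apply: Or33; exists k.
case=> [->|->|[k ->]].
- by exists (fun=> a v); [exact: GenCst|move=> x _; exact: pd_a].
- by exists (fun=> b v); [exact: GenCst|move=> x _; exact: pd_b].
exists (fun x => (ek k.+2 (w x) + - k%:R * ek k.+1 (w x)) *
  ((- 2 * a v) * (a x + - a x0) + (- 2 * b v) * (b x + - b x0))).
  by repeat (apply: GenMul || apply: GenAdd || exact: GenCst || exact: ga || exact: gb || exact: ge).
move=> x _; rewrite mulNr; exact: pd_comp (is_derive_ek k (w x)) (pd_w v x).
Qed.

Let G_cont g : G g -> forall x, setT x -> {for x, continuous g}.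
Proof.
have [ca cb] := coord_continuous co c0 absvr.
have cw : continuous w.
  move=> x; rewrite /w; apply: cvgB; first exact: cvg_cst.
  by apply: cvgD; apply: cvgM; apply: cvgB; (exact: cvg_cst || exact: ca || exact: cb).
case=> [->|->|[k ->]] x _; [exact: ca|exact: cb|].
apply: (@continuous_comp K R R w (ek k) x (cw x)).
have [d _] := is_derive_ek k (w x).
exact/differentiable_continuous/derivable1_diffP.
Qed.

Lemma smooth_bump : smooth (fun x => ek 0 (w x)).
Proof.
apply: (smooth_class hr (S := gen_alg G)).
- by move=> g Gg x; exact: (gen_alg_continuous G_cont Gg).
- by move=> g v Gg; have [d Gd hd] := gen_alg_pd G_pd v Gg; exists d => // x; exact: hd.
- by apply: GenAlg; apply: Or33; exists 0%N.
Qed.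

Lemma bump_gt0 x : (0 < ek 0 (w x)) = (sqnorm a b (x - x0) < e).
Proof.
have -> : (sqnorm a b (x - x0) < e) = (0 < w x).
  by rewrite /w subr_gt0 /sqnorm !(coordB co) !expr2.
by rewrite /ek; case: ifP => _; rewrite ?ltxx// expr0 mul1r expR_gt0.
Qed.

End Bump.

Lemma arch_bump (x0 : K) (e : R) : x0 != 0 -> 0 < e ->
  exists f : K -> R, [/\ test_function (fun x => (f x)%:C), forall x, 0 <= f x,
    0 < f x0 & forall x, f x != 0 -> absv (x - x0) < e].
Proof.
move=> x00 e0; have a0 : 0 < absv x0 by rewrite absv_gt0E.
pose d := Num.min e (absv x0 / 2).
have d0 : 0 < d by rewrite lt_min e0 divr_gt0.
pose s := d `^ c^-1.
have s0 : 0 < s by rewrite powR_gt0.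
exists (fun x => ek 0 (s ^+ 2 - ((a x - a x0) * (a x - a x0) + (b x - b x0) * (b x - b x0)))).
have supp x : ek 0 (s ^+ 2 - ((a x - a x0) * (a x - a x0) + (b x - b x0) * (b x - b x0))) != 0 ->
    absv (x - x0) < d.
  move=> h; have : sqnorm a b (x - x0) < s ^+ 2 by rewrite -bump_gt0 lt0r h ek_ge0.
  move=> h2; rewrite (absv_sqnorm co c0 absvr); apply: (powR_lt_root c0 d0).
    exact: sqrtr_ge0.
  by rewrite -/s -(ger0_norm (ltW s0)) -sqrtr_sqr ltr_sqrt ?exprn_gt0.
split.
- apply: arch_test.
  + exact: smooth_bump.
  + exact: smooth_cst.
  + apply/(compact_supportP hK); exists (absv x0 + absv x0) => x h.
    have : absv (x - x0) < d by apply: supp; apply: contraNneq h => ->.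
    rewrite lt_min => /andP[_ h1]; rewrite -(subrK x0 x).
    apply: le_trans (absvD _ _) _; rewrite lerD2r (le_trans (ltW h1))// ler_pdivrMr// mulr2n mulrDr mulr1.
    by rewrite lerDl ltW.
  + apply/nbhs_absvP; exists (absv x0 / 2); first by rewrite divr_gt0.
    move=> y; rewrite sub0r absvN => hy.
    have [->//|/supp] := eqVneq (ek 0 (s ^+ 2 - ((a y - a x0) * (a y - a x0) + (b y - b x0) * (b y - b x0)))) 0.
    rewrite lt_min => /andP[_ h1]; exfalso.
    have : absv x0 < absv x0 / 2 + absv x0 / 2.
      have {1}-> : x0 = y - (y - x0) by rewrite opprB addrC subrK.
      by apply: le_lt_trans (absvD _ _) _; rewrite absvN ltrD.
    by rewrite -splitr ltxx.
- by move=> x; exact: ek_ge0.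
- by rewrite bump_gt0 subrr (sqnorm0 co) exprn_gt0.
- by move=> x /supp; rewrite lt_min => /andP[].
Qed.

Section LogMultiplication.

(** Away from 0 these generate an algebra closed under differentiation: the logarithm of the norm
    differentiates into its inverse times the coordinates. *)
Let G g := [\/ g = a, g = b, g = (fun x => (sqnorm a b x)^-1) | g = (fun x => ln (sqnorm a b x))].
Let D : set K := [set x | x != 0].

Let pd_N v x : pd r (sqnorm a b) v x (2 * a v * a x + 2 * b v * b x).
Proof.
rewrite (_ : sqnorm a b = fun x => a x * a x + b x * b x); last first.
  by apply/funext => y; rewrite /sqnorm !expr2.
apply: (pd_eq (pdD (pdM (pd_a _ _) (pd_a _ _)) (pdM (pd_b _ _) (pd_b _ _)))); ring.
Qed.

Let G_pd g v : G g -> exists2 d, gen_alg G d & forall x, D x -> pd r g v x (d x).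
Proof.
have ga : gen_alg G a by apply: GenAlg; apply: Or41.
have gb : gen_alg G b by apply: GenAlg; apply: Or42.
have gi : gen_alg G (fun x => (sqnorm a b x)^-1) by apply: GenAlg; apply: Or43.
case=> [->|->|->|->].
- by exists (fun=> a v); [exact: GenCst|move=> x _; exact: pd_a].
- by exists (fun=> b v); [exact: GenCst|move=> x _; exact: pd_b].
- exists (fun x => (- 1 * ((sqnorm a b x)^-1 * (sqnorm a b x)^-1)) *
    (2 * a v * a x + 2 * b v * b x)).
    by repeat (apply: GenMul || apply: GenAdd || exact: GenCst || exact: ga || exact: gb || exact: gi).
  move=> x Dx; have nx := lt0r_neq0 (sqnorm_gt0 co Dx).
  apply: (pd_comp (u := fun t : R => t^-1) _ (pd_N v x)).
  have h := @is_deriveV R id _ _ _ nx (is_derive_id (sqnorm a b x) (1 : R)).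
  by apply: (is_derive_eq h); rewrite /GRing.scale/= mulr1 mulN1r expr2 invfM.
- exists (fun x => (sqnorm a b x)^-1 * (2 * a v * a x + 2 * b v * b x)).
    by repeat (apply: GenMul || apply: GenAdd || exact: GenCst || exact: ga || exact: gb || exact: gi).
  move=> x Dx; apply: (pd_comp (u := @ln R) _ (pd_N v x)).
  exact: is_derive1_ln (sqnorm_gt0 co Dx).
Qed.

Let G_cont g : G g -> forall x, D x -> {for x, continuous g}.
Proof.
have [ca cb] := coord_continuous co c0 absvr.
have cN : continuous (sqnorm a b).
  move=> x; rewrite (_ : sqnorm a b = fun x => a x * a x + b x * b x); last first.
    by apply/funext => y; rewrite /sqnorm !expr2.
  by apply: cvgD; apply: cvgM; (exact: ca || exact: cb).
case=> [->|->|->|->] x Dx; [exact: ca|exact: cb| |].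
  by apply: cvgV; [exact: lt0r_neq0 (sqnorm_gt0 co Dx)|exact: cN].
by apply: (@continuous_comp K R R _ (@ln R) x (cN x)); exact: continuous_ln (sqnorm_gt0 co Dx).
Qed.

(** A factor smooth away from 0 is cut off by one vanishing near 0. Sums are included because the
    product rule yields two such terms. *)
Inductive cut_alg : (K -> R) -> Prop :=
| CutMul m g : gen_alg G m -> smooth g -> (\forall x \near (0 : K), g x = 0) ->
    cut_alg (fun x => m x * g x)
| CutAdd f g : cut_alg f -> cut_alg g -> cut_alg (fun x => f x + g x).

Lemma smooth_cut_alg g : cut_alg g -> smooth g.
Proof.
apply: (smooth_class hr) => [{}g|{}g v].
- elim=> {g} [m g Gm sg g0|f g _ IHf _ IHg] x; last by apply: cvgD; [exact: IHf|exact: IHg].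
  have [->|x0] := eqVneq x 0; last first.
    apply: cvgM; first exact: (gen_alg_continuous G_cont Gm).
    by have [cg _] := sg [::]; exact: cg.
  apply: cvg_near_cst; have g00 := nbhs_singleton g0.
  by apply: filterS g0 => y gy; rewrite gy g00 !mulr0.
- elim=> {g} [m g Gm sg g0|f g _ [d cd hd] _ [e ce he]]; last first.
    by exists (fun x => d x + e x); [exact: CutAdd|move=> x; exact: pdD].
  have [d Gd hd] := gen_alg_pd G_pd v Gm.
  have g1 : \forall y \near (0 : K), dirderiv v g y = 0 := dirderivs_near0 [:: v] g0.
  exists (fun x => d x * g x + m x * dirderiv v g x).
    by apply: CutAdd; apply: CutMul => //; exact: smooth_dirderiv.
  move=> x; have [->|x0] := eqVneq x 0; last first.
    by apply: pdM; [exact: hd|exact: (smooth_pd hr sg [::])].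
  rewrite (nbhs_singleton g0) (nbhs_singleton g1) !mulr0 addr0; apply: pd_off0.
  by apply: filterS g0 => y gy; rewrite gy mulr0.
Qed.

Lemma smooth_ln_sqnorm g (t : R) : smooth g -> (\forall x \near (0 : K), g x = 0) ->
  smooth (fun x => t * ln (sqnorm a b x) * g x).
Proof.
move=> sg g0; apply: smooth_cut_alg; apply: (@CutMul (fun x => t * ln (sqnorm a b x))) => //.
by apply: GenMul; [exact: GenCst|apply: GenAlg; exact: Or44].
Qed.

End LogMultiplication.

Lemma smooth_translate g w : smooth g -> smooth (fun x => g (x + w)).
Proof.
move=> sg; 
apply: (smooth_class hr (S := fun f => exists2 u, smooth u & f = fun x => u (x + w))); last by exists g.
  move=> f [u su ->] x; have [cu _] := su [::].
  apply: (@continuous_comp K K R (fun x => x + w) u x); last exact: cu.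
  by apply: cvgDK; [exact: cvg_id|exact: cvg_cst].
move=> f v [u su ->]; exists (fun x => dirderiv v u (x + w)).
  by exists (dirderiv v u) => //; exact: smooth_dirderiv.
move=> x; have := smooth_pd hr su [::] v (x + w); rewrite /pd/=.
by under eq_fun do rewrite addrAC.
Qed.

End ArchimedeanSmooth.

(** * Decay of Fourier transforms in the archimedean case *)

Section ArchimedeanDecay.
Context {R : realType} {K : valuedFieldType R} {F : fieldExtType rat}
  {iota : {rmorphism F -> K}}.
Hypothesis hK : is_completion iota.
Hypothesis har : archimedean K.
Variables (r : {rmorphism R -> K}) (c : R) (j : K) (a b : K -> R).
Hypotheses (c0 : 0 < c) (hr : forall t : R, r t = real_emb K t)
  (absvr : forall t : R, absv (r t) = `|t| `^ c) (co : coordinates r j a b)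
  (hbase : forall x : K, base_field x <-> (exists t : R, x = r t)).
Implicit Types (x y v w : K) (g : K -> R) (f : K -> R[i]).

Let one_powR (d : R) : (1 : R) `^ d = 1. Proof. by rewrite powR1. Qed.

(* Finite differences play the role of derivatives in the decay estimate: the
   Fourier transform turns a difference of step w into the factor
   lambda(-wy) - 1, which is bounded below for a step adapted to y. *)
Definition fdiff (V : zmodType) w (g : K -> V) : K -> V := fun x => g (x + w) - g x.

Lemma smooth_fdiff w g : smooth g -> smooth (fdiff w g).
Proof.
move=> sg; apply: (smooth_class hr (S := fun u => exists u1 u2,
  [/\ smooth u1, smooth u2 & u = fun x => u1 x - u2 x])).
- move=> u [u1 [u2 [s1 s2 ->]]] x; have [k1 _] := s1 [::]; have [k2 _] := s2 [::].
  by apply: cvgB; [exact: k1|exact: k2].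
- move=> u v [u1 [u2 [s1 s2 ->]]]; exists (fun x => dirderiv v u1 x - dirderiv v u2 x).
    by exists (dirderiv v u1), (dirderiv v u2); split;
      [exact: (smooth_dirderiv v s1)|exact: (smooth_dirderiv v s2)|].
  by move=> x; apply: pdB; [exact: (smooth_pd hr s1 [::])|exact: (smooth_pd hr s2 [::])].
exists (fun x => g (x + w)), g; split; [|exact: sg|by []].
exact: (smooth_translate hr w sg).
Qed.

Lemma dirderivs_fdiff w g v m : smooth g ->
  dirderivs (nseq m v) (fdiff w g) = fdiff w (dirderivs (nseq m v) g).
Proof.
move=> sg; elim: m => //= m ->; apply/funext => x; apply: (pd_dirderiv hr).
apply: (pdB (r := r)); last exact: (smooth_pd hr sg (nseq m v)).
have := smooth_pd hr sg (nseq m v) v (x + w); rewrite /pd/=.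
by under eq_fun do rewrite addrAC.
Qed.

Lemma fdiff_bound g v (h M : R) : smooth g -> (forall x, `|dirderiv v g x| <= M) ->
  forall x, `|fdiff (r h * v) g x| <= `|h| * M.
Proof.
move=> sg hM x.
pose phi (t : R) := g (x + r t * v).
have dphi t : is_derive t (1 : R) phi (dirderiv v g (x + r t * v)).
  have h1 := smooth_pd hr sg [::] v (x + r t * v).
  have h2 : is_derive t (1 : R) (fun s : R => s - t) (1 : R).
    by apply: is_derive_eq; rewrite subr0.
  have h1' : is_derive (t - t) (1 : R) (fun h : R => g (x + r t * v + r h * v)) (dirderiv v g (x + r t * v)).
    by rewrite subrr.
  have := @is_derive1_comp R (fun h : R => g (x + r t * v + r h * v)) (fun s : R => s - t) t _ _ h1' h2.
  rewrite mulr1.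
  rewrite (_ : _ \o _ = phi)//; apply/funext => s /=.
  by rewrite /phi -addrA -mulrDl -rmorphD addrCA subrr addr0.
have cont (s t : R) : {within `[s, t], continuous phi}.
  by apply: derivable_within_continuous => z _; have [] := dphi z.
rewrite /fdiff -[g x]/(g x) (_ : g x = phi 0); last by rewrite /phi rmorph0 mul0r addr0.
rewrite -[g _]/(phi h).
have [h0|h0] := leP 0 h.
  have [z _ ->] := @MVT_segment R phi _ 0 h h0 (fun s _ => dphi s) (cont _ _).
  by rewrite subr0 normrM mulrC ler_wpM2l.
have [z _ hz] := @MVT_segment R phi _ h 0 (ltW h0) (fun s _ => dphi s) (cont _ _).
by rewrite distrC hz sub0r normrM normrN mulrC ler_wpM2l.
Qed.

Lemma smooth_dirderivs g vs : smooth g -> smooth (dirderivs vs g).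
Proof. by move=> sg; elim: vs => [|v vs IH]; [exact: sg|exact: (smooth_dirderiv v IH)]. Qed.

Lemma fdiff_iter_bound m : forall g v (h M : R), smooth g ->
  (forall x, `|dirderivs (nseq m v) g x| <= M) ->
  forall x, `|iter m (fdiff (r h * v)) g x| <= `|h| ^+ m * M.
Proof.
elim: m => [|m IH] g v h M sg hM x; first by rewrite expr0 mul1r; exact: hM.
rewrite iterSr exprSr -mulrA; apply: IH; first exact: smooth_fdiff.
move=> y; rewrite dirderivs_fdiff//; apply: fdiff_bound => //.
exact: smooth_dirderivs.
Qed.

Lemma fdiff_iter_supp (V : zmodType) m (g : K -> V) w (rho : R) :
  (forall x, g x != 0 -> absv x <= rho) ->
  forall x, iter m (fdiff w) g x != 0 -> absv x <= rho + m%:R * absv w.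
Proof.
elim: m g rho => [|m IH] g rho hg x; first by rewrite mul0r addr0; exact: hg.
rewrite iterSr => h; have := IH (fdiff w g) (rho + absv w) _ x h.
rewrite -addrA -[X in _ + (X + _)]mul1r -mulrDl -natr1 [1 + _]addrC; apply => y.
rewrite /fdiff; have [e1|e1] := eqVneq (g y) 0.
  rewrite e1 subr0 => /hg e2; rewrite -[y](addrK w); apply: le_trans (absvD _ _) _.
  by rewrite absvN lerD2r.
by move=> _; apply: (le_trans (hg _ e1)); rewrite lerDl absv_ge0.
Qed.

Lemma fdiff_iter_ReIm m f w x :
  complex.Re (iter m (fdiff w) f x) = iter m (fdiff w) (fun x => complex.Re (f x)) x /\
  complex.Im (iter m (fdiff w) f x) = iter m (fdiff w) (fun x => complex.Im (f x)) x.
Proof.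
elim: m x => //= m IH x; rewrite /fdiff cReB cImB.
by have [-> ->] := IH (x + w); have [-> ->] := IH x.
Qed.

Variable mu : {measure set (Borel K) -> \bar R}.
Hypothesis hmu : is_haar mu.

Lemma fourier_inv_fdiff f w y : Cintegrable mu f ->
  Cintegrable mu (fdiff w f) /\
  fourier_inv mu (fdiff w f) y = (lambda (- (w * y)) - 1) * fourier_inv mu f y.
Proof.
move=> fi; have [i1' e] := fourier_inv_translate hK hmu w y fi.
split; first exact: (CintegrableB i1' fi).
have fyi := fourier_inv_integrable hK y fi.
have fyi' := fourier_inv_integrable hK y i1'.
rewrite mulrBl mul1r -e; apply: (etrans _ (CintegralB fyi' fyi)).
by apply: eq_Cintegral => x; rewrite /fdiff mulrBl.
Qed.

Lemma fourier_inv_fdiff_iter m f w y : Cintegrable mu f ->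
  Cintegrable mu (iter m (fdiff w) f) /\
  fourier_inv mu (iter m (fdiff w) f) y = (lambda (- (w * y)) - 1) ^+ m * fourier_inv mu f y.
Proof.
move=> fi; elim: m => [|m [i1 e1]]; first by rewrite expr0 mul1r.
have [i2 e2] := fourier_inv_fdiff w y i1; split; first exact: i2.
by apply: (etrans e2); rewrite e1 exprS mulrA.
Qed.

Lemma integrable_ball (C t : R) : mu.-integrable setT
  (EFin \o (fun x : Borel K => C * \1_([set x : K | absv x <= t] : set (Borel K)) x)).
Proof.
have mB : measurable ([set x : K | absv x <= t] : set (Borel K)) by exact: measurable_absv_le.
suff h : mu.-integrable setT (EFin \o (\1_([set x : K | absv x <= t] : set (Borel K)) : Borel K -> R)).
  exact: (integrableZl measurableT C h).
apply/integrableP; split; first by apply/measurable_EFinP; exact: measurable_indic.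
under eq_integral => x _ do rewrite /= ger0_norm//.
by rewrite integral_indic// setIT (@haar_ball_lty _ _ _ _ hK mu hmu t).
Qed.

Lemma arch_decay f v m : test_function f -> Cintegrable mu f -> exists2 C : R, 0 <= C &
  forall y, normc (fourier_inv mu f y) * `|real_trace (v * y)| ^+ m <= C.
Proof.
move=> tf fi; have [sr si] := test_smooth har tf.
have [_ /(compact_supportP hK)[rho hrho] _] := tf.
have [trD trZ _] := real_trace_emb hK hr hbase c0 absvr.
have supr x : complex.Re (f x) != 0 -> absv x <= rho.
  by move=> h; apply: hrho; apply: contraNneq h => ->.
have supi x : complex.Im (f x) != 0 -> absv x <= rho.
  by move=> h; apply: hrho; apply: contraNneq h => ->.
have [Mr Mr0 hMr] := dirderivs_bounded hK c0 hr absvr sr supr (nseq m v).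
have [Mi Mi0 hMi] := dirderivs_bounded hK c0 hr absvr si supi (nseq m v).
pose V := Rintegral mu setT (fun x : Borel K =>
  1 * \1_([set x : K | absv x <= rho + m%:R * absv v] : set (Borel K)) x).
have V0 : 0 <= V by apply: Rintegral_ge0 => x _; rewrite mul1r.
have [B B0 hB] := fourier_inv_bound hK fi.
exists (B + 2 * ((Mr + Mi) * V)); first by rewrite addr_ge0// !mulr_ge0// addr_ge0.
move=> y; set t := real_trace (v * y).
have [t1|t1] := leP `|t| 1.
  apply: (@le_trans _ _ B); last by rewrite lerDl !mulr_ge0// addr_ge0.
  by apply: (le_trans _ (hB y)); rewrite ler_piMr ?normc_ge0// exprn_ile1.
have t0 : t != 0 by rewrite -normr_gt0 (lt_trans _ t1).
(* The step is such that lambda(-hvy) = exp(i pi) = -1. Each difference then multiplies the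
   transform by -2, while it costs a factor |h| = 1 / (2|t|) in the bound on f. As |t| > 1, the
   steps are at most 1 and all supports stay in one ball. *)
pose h := (2 * t)^-1.
have h1 : `|h| <= 1.
  rewrite /h normfV normrM [`|2|]ger0_norm// invf_le1 ?mulr_gt0 ?normr_gt0//.
  by rewrite (le_trans (ltW t1))// ler_peMl// ler1n.
have [i1 e1] := fourier_inv_fdiff_iter m (r h * v) y fi.
have lam : lambda (- (r h * v * y)) = -1 :> R[i].
  rewrite (lambda_arch _ har); have -> : - (r h * v * y) = r (- h) * (v * y).
    by rewrite rmorphN mulNr mulrA.
  rewrite trZ -/t; have -> : - (2 * pi * (- h * t)) = pi :> R by rewrite /h; field.
  by rewrite expC_i cospi sinpi; apply: complexP; rewrite /= ?oppr0.
have e2 : normc (fourier_inv mu (iter m (fdiff (r h * v)) f) y) = 2 ^+ m * normc (fourier_inv mu f y).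
  rewrite e1 normcM lam (_ : -1 - 1 = (- 2%:R : R)%:C); last first.
    by rewrite rmorphN rmorph_nat -opprD.
  congr (_ * _); elim: (m) => [|n IH]; first by rewrite !expr0 normc1.
  by rewrite !exprS normcM IH normc_real normrN ger0_norm.
have bnd : normc (fourier_inv mu (iter m (fdiff (r h * v)) f) y) <=
    2 * ((`|h| ^+ m * (Mr + Mi)) * V).
  set M := `|h| ^+ m * (Mr + Mi).
  have M0 : 0 <= M by rewrite mulr_ge0 ?exprn_ge0// addr_ge0.
  rewrite /V -RintegralZl//; last exact: integrable_ball.
  apply: normc_Cintegral_le; first exact: (fourier_inv_integrable hK y i1).
    move=> x; rewrite normcM normc_lambda mulr1 mul1r indicE.
    have [->|fx] := eqVneq (iter m (fdiff (r h * v)) f x) 0.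
      by rewrite normc0 mulr_ge0.
    have hx : absv x <= rho + m%:R * absv v.
      apply: (le_trans (fdiff_iter_supp hrho fx)); rewrite lerD2l ler_wpM2l//.
      rewrite absvM absvr ler_piMl ?absv_ge0//.
      by rewrite -[leRHS](one_powR c) ge0_ler_powR ?nnegrE// ltW.
    rewrite mem_set//= mulr1; apply: le_trans (normc_le_ReIm _) _.
    have [-> ->] := fdiff_iter_ReIm m f (r h * v) x.
    rewrite /M mulrDr; apply: lerD; apply: fdiff_iter_bound => // z.
      by case: (hMr z).
    by case: (hMi z).
  have := integrable_ball 1 (rho + m%:R * absv v).
  exact: (integrableZl measurableT M).
have ht : `|h| * `|t| <= 1.
  rewrite -normrM /h invfM -mulrA mulVf// mulr1 ger0_norm ?invr_ge0//.
  by rewrite invf_le1// ler1n.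
apply: (@le_trans _ _ (2 ^+ m * normc (fourier_inv mu f y) * `|t| ^+ m)).
  by rewrite ler_wpM2r ?exprn_ge0// ler_peMl ?normc_ge0// exprn_ege1// ler1n.
rewrite -e2; apply: (le_trans (ler_wpM2r (exprn_ge0 _ (normr_ge0 _)) bnd)).
apply: (@le_trans _ _ (2 * ((Mr + Mi) * V))); last by rewrite lerDr.
rewrite (_ : _ * `|t| ^+ m = (`|h| * `|t|) ^+ m * (2 * ((Mr + Mi) * V))); last by rewrite exprMn; ring.
by rewrite ler_piMl ?exprn_ile1 ?mulr_ge0 ?addr_ge0.
Qed.

Variable modulus : K -> R.
Hypothesis hmod : is_module mu modulus.
Hypothesis hdual : self_dual mu.

Lemma arch_fourier_inv_rapid f : test_function f -> Cintegrable mu f ->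
  rapid modulus (fourier_inv mu f).
Proof.
move=> tf fi.
have [trD trZ _] := real_trace_emb hK hr hbase c0 absvr.
have [k k0 mE] := modulus_powR hK hmu hmod.
pose S y := Num.sqrt (sqnorm a b y).
have S0 y : 0 <= S y by exact: sqrtr_ge0.
have mS y : modulus y = S y `^ (c * k).
  by rewrite mE (absv_sqnorm co c0 absvr) powRrM.
have ck0 : 0 < c * k by rewrite mulr_gt0.
have [z z0] : exists z : K, real_trace z != 0.
  have [u [[sbu _ u0] _ u1 _]] := arch_bump hK har c0 hr absvr co (oner_neq0 K) (@ltr01 R).
  have [z lz] : exists z : K, lambda z != 1.
    apply: (lambda_nontrivial hdual sbu); rewrite (nbhs_singleton u0).
    by move=> /(congr1 (@complex.Re R)) /= e; move: u1; rewrite e ltxx.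
  exists z; apply: contraNneq lz => tz.
  by rewrite (lambda_arch _ har) tz mulr0 oppr0 mulr0 expC0.
(* Nondegeneracy of the trace form: z = qy with q = z / y, and expanding q in coordinates bounds the
   fixed number tr z by the real traces of y and jy. Decay in these two functionals is therefore
   decay in the norm of y. *)
have hS y : `|real_trace z| * S y <= S z * (`|real_trace (1 * y)| + `|real_trace (j * y)|).
  have [->|y0] := eqVneq y 0.
    by rewrite /S (sqnorm0 co) sqrtr0 !mulr0 mulr_ge0// addr_ge0.
  pose q := y^-1 * z.
  have zE : z = r (a q) * (1 * y) + r (b q) * (j * y).
    rewrite mul1r mulrA -mulrDl [r (b q) * j]mulrC -(coordE co q) /q mulrC mulrA divff// mul1r//.
  have Sq : S q * S y = S z.
    rewrite /S -sqrtrM ?sqnorm_ge0// -(sqnormM co) /q mulrC mulrA divff// mul1r//.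
  have Sy : 0 < S y by rewrite sqrtr_gt0 (sqnorm_gt0 co).
  rewrite -Sq mulrAC ler_pM2r// {1}zE trD !trZ mulrDr.
  apply: le_trans (ler_normD _ _) _; rewrite !normrM.
  by apply: lerD; rewrite ler_wpM2r// (coord_le a b q).
(* The module is the power ck of the norm S, so 2ck orders of decay in S control (1 + |y|)^2. *)
have [m hm] : exists m : nat, 2 * (c * k) <= m%:R.
  by exists (Num.bound (2 * (c * k))); apply: ltW; apply: archi_boundP; rewrite mulr_ge0// ltW.
have [C1 C10 h1] := arch_decay 1 m tf fi.
have [C2 C20 h2] := arch_decay j m tf fi.
have [B B0 hB] := fourier_inv_bound hK fi.
split; first exact: (fourier_inv_meas hK hmu hmod fi).
pose kap := `|real_trace z|.
have kap0 : 0 < kap by rewrite normr_gt0.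
pose D := (2 * S z / kap) ^+ m * (C1 + C2).
have D0 : 0 <= D.
  by rewrite mulr_ge0 ?addr_ge0// exprn_ge0// divr_ge0 ?mulr_ge0// ltW.
have hD y : normc (fourier_inv mu f y) * S y ^+ m <= D.
  set n := normc _; have n0 : 0 <= n by exact: normc_ge0.
  set t1 := `|real_trace (1 * y)|; set t2 := `|real_trace (j * y)|.
  have q0 : 0 <= 2 * S z / kap by rewrite divr_ge0 ?mulr_ge0// ltW.
  have max0 : 0 <= Num.max t1 t2 by rewrite le_max normr_ge0.
  have Sle : S y <= 2 * S z / kap * Num.max t1 t2.
    rewrite mulrAC ler_pdivlMr// mulrC; apply: (le_trans (hS y)); rewrite -/t1 -/t2.
    rewrite -mulrA mulrCA ler_wpM2l// mulr2n mulrDl !mul1r.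
    by apply: lerD; rewrite le_max lexx ?orbT.
  apply: (@le_trans _ _ (n * (2 * S z / kap * Num.max t1 t2) ^+ m)).
    apply: (ler_wpM2l n0); apply: lerXn2r; rewrite ?nnegrE//.
    by apply: mulr_ge0; [exact: q0|exact: max0].
  rewrite exprMn mulrCA /D; apply: ler_wpM2l; first exact: (exprn_ge0 m q0).
  rewrite maxEle; case: ifP => _.
    by apply: (le_trans (h2 y)); rewrite lerDr.
  by apply: (le_trans (h1 y)); rewrite lerDl.
(* The 4 bounds (1 + u)^2 for u <= 1, and (1 + u)^2 <= 4 u^2 for u >= 1. *)
exists (4 * (B + D)); first by rewrite mulr_ge0// addr_ge0.
move=> y; rewrite mS; set n := normc _; have n0 : 0 <= n by exact: normc_ge0.
have [S1|S1] := leP (S y) 1.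
  rewrite [leRHS]mulrC; apply: ler_pM => //; first by rewrite exprn_ge0// addr_ge0// powR_ge0.
    by apply: (le_trans (hB y)); rewrite lerDl.
  have -> : 4 = (1 + 1) ^+ 2 :> R by ring.
  rewrite ler_pXn2r ?nnegrE ?addr_ge0 ?powR_ge0// lerD2l.
  by rewrite -[leRHS](one_powR (c * k)) ge0_ler_powR ?nnegrE// ltW.
apply: (@le_trans _ _ (4 * (n * S y ^+ m))); last first.
  by rewrite ler_wpM2l//; apply: (le_trans (hD y)); rewrite lerDr.
rewrite [leRHS]mulrCA; apply: (ler_wpM2l n0).
have Sp : 1 <= S y `^ (c * k).
  by rewrite -[leLHS](one_powR (c * k)) ge0_ler_powR ?nnegrE ?ler01 ?(ltW S1)// ltW.
apply: (@le_trans _ _ ((2 * S y `^ (c * k)) ^+ 2)).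
  rewrite ler_pXn2r ?nnegrE ?addr_ge0 ?mulr_ge0 ?powR_ge0//.
  by rewrite mulr2n mulrDl mul1r lerD2r.
rewrite exprMn (_ : 2 ^+ 2 = 4 :> R); last by ring.
rewrite ler_wpM2l// -powR_mulrn ?powR_ge0// -powRrM -powR_mulrn//.
by apply: ler_powR; [exact: ltW|rewrite mulrC].
Qed.

End ArchimedeanDecay.

(** * Test functions on an arbitrary completion *)

Section UniformTestFunctions.
Context {R : realType} {K : valuedFieldType R} {F : fieldExtType rat}
  {iota : {rmorphism F -> K}}.
Hypothesis hK : is_completion iota.
Variable mu : {measure set (Borel K) -> \bar R}.
Hypothesis hmu : is_haar mu.
Hypothesis hdual : self_dual mu.
Variable modulus : K -> R.
Hypothesis hmod : is_module mu modulus.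
Implicit Types (x y z t v w : K) (f g h : K -> R[i]).

Let mgt0 t : t != 0 -> 0 < modulus t. Proof. exact: (modulus_gt0 hK hmu hmod). Qed.
Let mge0 t : 0 <= modulus t. Proof. exact: (modulus_ge0 hK hmu hmod). Qed.

Lemma normc_dist (p q : R[i]) : `|normc p - normc q| <= normc (p - q).
Proof.
have h (u v : R[i]) : normc u - normc v <= normc (u - v).
  by rewrite lerBlDr -{1}(subrK v u) ler_normcD.
rewrite ler_norml h andbT lerNl opprB normcB; exact: h.
Qed.

Lemma continuous_absvP f x : {for x, continuous f} -> forall e : R, 0 < e ->
  exists2 d : R, 0 < d & forall y, absv (x - y) < d -> normc (f x - f y) < e.
Proof.
move=> cf e e0; apply: (@nbhs_absvP R K x [set y | normc (f x - f y) < e]).1.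
exact: (@cvg_normcP R K (nbhs x) _ f (f x)).1 cf e e0.
Qed.

Lemma test_bump (a : K) (e : R) : a != 0 -> 0 < e ->
  exists f : K -> R, [/\ test_function (fun x => (f x)%:C), forall x, 0 <= f x,
    0 < f a & forall x, f x != 0 -> absv (x - a) < e].
Proof.
move=> a0 e0; have [har|hna] := pselect (archimedean K).
  have [c [r [j [u [v [c0 hr absvr co _]]]]]] := archimedean_coordinates hK har.
  exact: (arch_bump hK har c0 hr absvr co a0 e0).
have [f [tf f0 f1 fs]] := nonarch_bump hK hna a0 e0.
by exists f; split=> //; rewrite f1.
Qed.

Lemma test_opA f : test_function f -> test_function (opA modulus f).
Proof.
move=> tf; have [har|hna] := pselect (archimedean K); last first.
  exact: (opA_nonarch_test hK hna hmu hmod tf).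
have [c [r [j [u [v [c0 hr absvr co _]]]]]] := archimedean_coordinates hK har.
have [sr si] := test_smooth har tf; have [_ cf f0] := tf.
have [k k0 mE] := modulus_powR hK hmu hmod.
have lnE x : x != 0 -> ln (modulus x) = c * k / 2 * ln (sqnorm u v x).
  move=> x0; have n0 := sqnorm_gt0 co x0.
  rewrite mE ln_powR (absv_sqnorm co c0 absvr) ln_powR -powR12_sqrt ?(ltW n0)// ln_powR.
  by field.
have f00 := nbhs_singleton f0.
have z0 (p : R[i] -> R) : p 0 = 0 -> \forall x \near (0 : K), p (f x) = 0.
  by move=> p0; apply: filterS f0 => x ->.
have sm (p : R[i] -> R) : p 0 = 0 -> (forall (t : R) (q : R[i]), p (t%:C * q) = t * p q) ->
    smooth (fun x => p (f x)) -> smooth (fun x => p (opA modulus f x)).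
  move=> p0 pZ sp.
  rewrite (_ : (fun x => _) = fun x => c * k / 2 * ln (sqnorm u v x) * p (f x)).
    exact: (smooth_ln_sqnorm c0 hr absvr co _ sp (z0 _ p0)).
  apply/funext => x; rewrite /opA pZ; have [->|x0] := eqVneq x 0.
    by rewrite f00 p0 !mulr0.
  by rewrite lnE.
apply: (arch_test hK har c0 hr absvr).
- by apply: (sm (@complex.Re R)) => // t q; rewrite cReM mul0r subr0.
- by apply: (sm (@complex.Im R)) => // t q; rewrite cImM mul0r addr0.
- apply/(compact_supportP hK); have [rho hrho] := (compact_supportP hK f).1 cf.
  by exists rho => x; rewrite mulf_eq0 negb_or => /andP[_ /hrho].
- by apply: filterS f0 => x fx; rewrite /opA fx mulr0.
Qed.

Lemma test_translate f w : test_function f -> (\forall x \near w, f x = 0) ->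
  test_function (fun x => f (x + w)).
Proof.
move=> tf fw; have [_ cf f0] := tf.
have fw0 : \forall x \near (0 : K), f (x + w) = 0.
  have [e e0 he] := (@nbhs_absvP R K w _).1 fw.
  apply/nbhs_absvP; exists e => // y hy; apply: he.
  by rewrite opprD addrCA subrr addr0 -sub0r.
have cfw : compact_support (fun x => f (x + w)).
  apply/(compact_supportP hK); have [rho hrho] := (compact_supportP hK f).1 cf.
  exists (rho + absv w) => x /hrho h; rewrite -[x](addrK w).
  by apply: le_trans (absvD _ _) _; rewrite absvN lerD2r.
have [har|hna] := pselect (archimedean K).
  have [c [r [j [u [v [c0 hr absvr co _]]]]]] := archimedean_coordinates hK har.
  have [sr si] := test_smooth har tf.
  apply: (arch_test hK har c0 hr absvr _ _ cfw fw0).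
    exact: (smooth_translate hr w sr).
  exact: (smooth_translate hr w si).
have [[_ /(_ hna)[lf _]] _ _] := tf.
apply: (nonarch_test hna _ cfw fw0) => x.
have [e e0 he] := (@nbhs_absvP R K (x + w) _).1 (lf (x + w)).
apply/nbhs_absvP; exists e => // y hy; apply: he.
by rewrite opprD addrACA subrr addr0.
Qed.

Lemma test_annular f : test_function f -> annular modulus f.
Proof.
move=> tf; have cf := test_continuous tf.
split; first exact: Cmeas_continuous.
have [r r0 hr] := test_off0 tf.
have [_ /(compact_supportP hK)[rho hrho] _] := tf.
have [k k0 mE] := modulus_powR hK hmu hmod.
have cn : {within [set x : K | absv x <= Num.max rho 0], continuous (fun x => normc (f x))}.
  apply: continuous_subspaceT => x.
  have h e : 0 < e -> \forall y \near x, `|normc (f x) - normc (f y)| < e.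
    move=> e0; have [d d0 hd] := continuous_absvP (cf x) e0.
    apply/nbhs_absvP; exists d => // y /hd; apply: le_lt_trans; exact: normc_dist.
  by apply/cvgrPdist_lt.
have ne : [set x : K | absv x <= Num.max rho 0] !=set0.
  by exists 0; rewrite /= absv0 le_max lexx orbT.
have [m _ hm] := compact_EVT_max ne (@closed_ball_compact _ _ _ _ hK (Num.max rho 0)) cn.
pose rho' := Num.max rho r.
have rho0 : 0 < rho' by rewrite lt_max r0 orbT.
exists (Num.min (r `^ k) (rho' `^ k)^-1), (normc (f m)); split=> [| |x fx].
- by rewrite lt_min powR_gt0// invr_gt0 powR_gt0.
- exact: normc_ge0.
have h1 := hr x fx; have h2 := hrho x fx; split; last first.
  by apply: hm; rewrite inE /= le_max h2.
rewrite mE; apply/andP; split.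
  rewrite ge_min; apply/orP; left.
  by apply: ge0_ler_powR; rewrite ?nnegrE ?absv_ge0 ?(ltW r0) ?(ltW k0).
apply: (@le_trans _ _ (rho' `^ k)).
  by apply: ge0_ler_powR; rewrite ?nnegrE ?absv_ge0 ?(ltW rho0) ?(ltW k0)// le_max h2.
rewrite -[leLHS]invrK lef_pV2 ?posrE ?invr_gt0 ?powR_gt0// ?ge_min ?lexx ?orbT//.
by rewrite lt_min powR_gt0// invr_gt0 powR_gt0.
Qed.

Lemma test_integrable f : test_function f -> Cintegrable mu f.
Proof. by move=> /test_annular/(annular_integrable hK hmu hmod). Qed.

Lemma test_fourier_inv_rapid f : test_function f -> rapid modulus (fourier_inv mu f).
Proof.
move=> tf; have fi := test_integrable tf.
have [har|hna] := pselect (archimedean K); last first.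
  exact: (nonarch_fourier_inv_rapid hK hna hmu hmod hdual tf fi).
have [c [r [j [u [v [c0 hr absvr co hb]]]]]] := archimedean_coordinates hK har.
exact: (arch_fourier_inv_rapid hK har c0 hr absvr co hb hmu hmod hdual tf fi).
Qed.

Lemma test_fourier_rapid f : test_function f -> rapid modulus (fourier mu f).
Proof.
move=> tf; have [mf [C C0 hC]] := test_fourier_inv_rapid tf.
split; first exact: (fourier_meas hK hmu hmod (test_integrable tf)).
exists C; first exact: C0.
by move=> y; rewrite fourierE -(modulusN hK hmu hmod y); exact: (hC (- y)).
Qed.

Lemma test_fourierK f z : test_function f -> fourier mu (fourier mu f) z = f (- z).
Proof. by case=> sb _ _; rewrite fourierE (hdual sb). Qed.

Lemma test_nice f : test_function f -> nice mu modulus f.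
Proof.
move=> tf; split; [exact: test_annular|exact: test_fourier_inv_rapid|].
apply/funext => y.
have i1 := rapid_integrable hK hmu hmod (test_fourier_rapid tf).
have i2 := fourier_inv_integrable hK y i1.
have [_ e] := Cintegral_oppK hK hmu hmod i2.
have [sb _ _] := tf; rewrite -[in RHS](hdual sb).
apply: (etrans _ e); apply: eq_Cintegral => x.
by rewrite fourierE opprK mulNr.
Qed.

(** Take a bump supported where phi is within |phi(a)| / 2 of phi(a). After division by phi(a) the
    integrand has real part at least f / 2, and f has positive integral. *)
Lemma bump_integral_neq0 (phi : K -> R[i]) (a : K) : a != 0 ->
  {for a, continuous phi} -> phi a != 0 ->
  (forall f, test_function f -> Cintegrable mu (fun x : Borel K => f x * phi x)) ->
  exists2 f, test_function f & Cintegral mu (fun x : Borel K => f x * phi x) != 0.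
Proof.
move=> a0 cphi phia ifp.
have pa : 0 < normc (phi a) by rewrite normc_gt0.
have e2 : 0 < normc (phi a) / 2 by rewrite divr_gt0.
have [e e0 he] := continuous_absvP cphi e2.
have [f [tf f0 fa fs]] := test_bump a0 e0.
exists (fun x => (f x)%:C) => //.
pose q x := (f x)%:C * phi x * (phi a)^-1.
have iq : Cintegrable mu (q : Borel K -> R[i]) by exact: (CintegrableZr _ (ifp _ tf)).
suff : 0 < complex.Re (Cintegral mu (q : Borel K -> R[i])).
  apply: contraTneq => e3.
  by rewrite (CintegralZr _ (ifp _ tf)) e3 mul0r ltxx.
have fi : mu.-integrable setT (EFin \o (f : Borel K -> R)).
  by have [+ _] := test_integrable tf.
have qE x : complex.Re (q x) = f x * complex.Re (phi x * (phi a)^-1).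
  by rewrite /q -mulrA cReM mul0r subr0.
have qge x : f x * 2^-1 <= complex.Re (q x).
  rewrite qE; have [->|fx] := eqVneq (f x) 0; first by rewrite !mul0r.
  rewrite ler_wpM2l//; have : normc (phi a - phi x) < normc (phi a) / 2.
    by apply: he; rewrite absvB fs.
  rewrite mulrC -ltr_pdivrMr// -normcV -normcM mulrBl divff// => h.
  have := le_lt_trans (le_trans (ler_norm _) (Re_le_normc _)) h.
  by rewrite cReB /=; lra.
have cf : continuous f by move=> x; have [+ _] := Re_continuous_at (test_continuous tf (x := x)).
pose U : set K := [set x | f a / 2 < f x].
have opU : open U.
  rewrite (_ : U = f @^-1` [set t | f a / 2 < t]) //.
  by apply: open_comp; [move=> x _; exact: cf|exact: open_gt].
have fa2 : 0 < f a / 2 by rewrite divr_gt0.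
have Ua : U a by rewrite /U/= ltr_pdivrMr// mulr2n mulrDr mulr1 ltrDl.
have muU : (0 < mu U)%E by case: hmu => _ _; apply => //; exists a.
have mU : measurable (U : set (Borel K)) by exact: open_measurableK.
have mf : measurable_fun setT (EFin \o (f : Borel K -> R)) := measurable_int _ fi.
have I0 : 0 < Rintegral mu setT (f : Borel K -> R).
  have h1 : ((f a / 2)%:E * mu U <= \int[mu]_(x in (U : set (Borel K))) (f x)%:E)%E.
    rewrite -(integral_cst mu mU); apply: ge0_le_integral => //.
    - by move=> x _; rewrite lee_fin ltW.
    - exact: (measurable_funTS mf).
    - by move=> x /= h; rewrite lee_fin ltW.
  have h2 : (\int[mu]_(x in (U : set (Borel K))) (f x)%:E <= \int[mu]_x (f x)%:E)%E.
    by apply: ge0_subset_integral => // x _; rewrite lee_fin.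
  apply: fine_gt0; apply/andP; split.
    by apply: lt_le_trans (le_trans h1 h2); rewrite mule_gt0.
  have [_] := integrableP _ _ _ fi; apply: le_lt_trans.
  apply: ge0_le_integral => //.
  - by move=> x _; rewrite lee_fin.
  - exact: measurableT_comp.
  - by move=> x _; rewrite lee_fin ler_norm.
have [qi _] := iq.
apply: (@lt_le_trans _ _ (Rintegral mu setT (fun x : Borel K => f x * 2^-1))).
  by rewrite RintegralZr// mulr_gt0.
apply: le_Rintegral => //.
exact: (integrableZr measurableT _ fi).
Qed.

End UniformTestFunctions.

(** * Complex derivatives *)

Section ComplexDerivative.
Variable R : realType.
Implicit Types (f g : R[i] -> R[i]) (z w D h : R[i]).

(* Bounds on the real moduli, so as to avoid the partial order of R[i]. *)
Definition cder f z D : Prop := forall e : R, 0 < e -> exists2 d : R, 0 < d &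
  forall h, normc h < d -> normc (f (z + h) - f z - h * D) <= e * normc h.

Lemma cder_derive1 f z D : cder f z D -> derive1 f z = D.
Proof.
move=> hf; rewrite /derive1; apply: cvg_lim; first exact: norm_hausdorff.
apply/cvg_normcP => e e0; have e2 : 0 < e / 2 by rewrite divr_gt0.
have [d d0 hd] := hf _ e2.
have hn : \forall h \near (0 : R[i]), normc h < d.
  by apply/nbhs_normcP; exists d => // h; rewrite sub0r normcN.
suff : \forall h \near (0 : R[i]), h != 0 ->
    normc (D - h^-1 *: (f (h + z) - f z)) < e by [].
apply: filterS hn => h hh h0.
have hp : 0 < normc h by rewrite normc_gt0.
have -> : D - h^-1 *: (f (h + z) - f z) = - (h^-1 * (f (z + h) - f z - h * D)).
  have e3 : D = h^-1 * (h * D) by rewrite mulrA mulVf// mul1r.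
  have sE (p : R[i]) : h^-1 *: p = h^-1 * p by [].
  by rewrite [h + z]addrC sE [in RHS]mulrBr -e3 opprB.
rewrite normcN normcM normcV mulrC ltr_pdivrMr//.
apply: (le_lt_trans (hd _ hh)).
by rewrite ltr_pM2r// ltr_pdivrMr// mulr2n mulrDr mulr1 ltrDl.
Qed.

Lemma cder_uniq f z D1 D2 : cder f z D1 -> cder f z D2 -> D1 = D2.
Proof. by move=> /cder_derive1 <- /cder_derive1. Qed.

Lemma cder_near f g z D (d : R) : 0 < d -> (forall h, normc h < d -> f (z + h) = g (z + h)) ->
  cder f z D -> cder g z D.
Proof.
move=> d0 fg hf e e0; have [d' d'0 hd'] := hf e e0.
exists (Num.min d d'); first by rewrite lt_min d0.
move=> h; rewrite lt_min => /andP[h1 h2]; rewrite -(fg _ h1).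
have := fg 0; rewrite normc0 addr0 => <-//; exact: hd'.
Qed.

Lemma cder_taylor f z D (C d : R) : 0 <= C -> 0 < d ->
  (forall h, normc h < d -> normc (f (z + h) - f z - h * D) <= C * normc h ^+ 2) ->
  cder f z D.
Proof.
move=> C0 d0 hd e e0; have C1 : 0 < C + 1 by rewrite ltr_wpDl.
exists (Num.min d (e / (C + 1))); first by rewrite lt_min d0 divr_gt0.
move=> h; rewrite lt_min => /andP[h1 h2]; apply: (le_trans (hd h h1)).
rewrite expr2 mulrA ler_wpM2r ?normc_ge0//.
move: h2; rewrite ltr_pdivlMr// mulrC => /ltW; apply: le_trans.
by rewrite ler_wpM2r ?normc_ge0// lerDl.
Qed.

Lemma cder_lip f z D : cder f z D -> exists2 d : R, 0 < d &
  forall h, normc h < d -> normc (f (z + h) - f z) <= (normc D + 1) * normc h.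
Proof.
move=> /(_ 1 ltr01)[d d0 hd]; exists d => // h h1.
have -> : f (z + h) - f z = (f (z + h) - f z - h * D) + h * D by rewrite subrK.
apply: le_trans (ler_normcD _ _) _; rewrite normcM mulrDl addrC [normc D * _]mulrC.
by rewrite lerD2l; exact: hd.
Qed.

Lemma cder_cont f z D : cder f z D -> forall e : R, 0 < e -> exists2 d : R, 0 < d &
  forall h, normc h < d -> normc (f (z + h) - f z) < e.
Proof.
move=> /cder_lip[d d0 hd] e e0; have D1 : 0 < normc D + 1 by rewrite ltr_wpDl ?normc_ge0.
exists (Num.min d (e / (normc D + 1))); first by rewrite lt_min d0 divr_gt0.
move=> h; rewrite lt_min => /andP[h1 h2]; apply: (le_lt_trans (hd h h1)).
by rewrite mulrC -ltr_pdivlMr.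
Qed.

Lemma cder_neq0 f z D : cder f z D -> f z != 0 -> exists2 d : R, 0 < d &
  forall h, normc h < d -> normc (f z) / 2 <= normc (f (z + h)).
Proof.
move=> hf f0; have p0 : 0 < normc (f z) / 2 by rewrite divr_gt0// normc_gt0.
have [d d0 hd] := cder_cont hf p0; exists d => // h /hd h1.
have : normc (f z) <= normc (f (z + h) - f z) + normc (f (z + h)).
  have {1}-> : f z = - (f (z + h) - f z) + f (z + h) by rewrite opprB subrK.
  by apply: le_trans (ler_normcD _ _) _; rewrite normcN.
by move=> h2; rewrite -(lerD2l (normc (f z) / 2)) -splitr (le_trans h2)// lerD2r ltW.
Qed.

Lemma cderM f g z D E : cder f z D -> cder g z E ->
  cder (fun z => f z * g z) z (D * g z + f z * E).
Proof.
move=> hf hg e e0.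
have [d1 d10 l1] := cder_lip hf; have [d2 d20 l2] := cder_lip hg.
have M0 : 0 < normc (g z) + normc (f z) + 1 by rewrite ltr_wpDl// addr_ge0 ?normc_ge0.
have e2 : 0 < e / 2 / (normc (g z) + normc (f z) + 1) by rewrite !divr_gt0.
have [d3 d30 l3] := hf _ e2; have [d4 d40 l4] := hg _ e2.
have N0 : 0 < (normc D + 1) * (normc E + 1) by rewrite mulr_gt0// ltr_wpDl ?normc_ge0.
exists (Num.min (Num.min d1 d2) (Num.min (Num.min d3 d4) (e / 2 / ((normc D + 1) * (normc E + 1))))).
  by rewrite !lt_min d10 d20 d30 d40 !divr_gt0.
move=> h; rewrite !lt_min => /andP[/andP[h1 h2] /andP[/andP[h3 h4] h5]].
have -> : f (z + h) * g (z + h) - f z * g z - h * (D * g z + f z * E) =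
    (f (z + h) - f z - h * D) * g z + f z * (g (z + h) - g z - h * E) +
    (f (z + h) - f z) * (g (z + h) - g z) by ring.
apply: le_trans (ler_normcD _ _) _; rewrite (splitr e) [leRHS]mulrDl; apply: lerD.
  apply: le_trans (ler_normcD _ _) _; rewrite !normcM.
  apply: (@le_trans _ _ ((e / 2 / (normc (g z) + normc (f z) + 1)) * normc h * (normc (g z) + normc (f z)))).
    rewrite mulrDr; apply: lerD; first by rewrite ler_wpM2r ?normc_ge0//; exact: l3.
    by rewrite [leRHS]mulrC ler_wpM2l ?normc_ge0//; exact: l4.
  rewrite mulrAC ler_wpM2r ?normc_ge0// mulrAC ler_pdivrMr// ler_wpM2l ?divr_ge0// ?(ltW e0)//.
  by rewrite lerDl.
rewrite normcM; apply: (@le_trans _ _ (((normc D + 1) * normc h) * ((normc E + 1) * normc h))).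
  by apply: ler_pM; rewrite ?normc_ge0//; [exact: l1|exact: l2].
rewrite mulrACA mulrA ler_wpM2r ?normc_ge0// mulrC -ler_pdivlMr//; exact: ltW.
Qed.

(** The quotient k is known through f = kg near z alone, and no continuity of k is assumed. This is
    how Gamma and the symbols of the commutators are shown to be differentiable. *)
Lemma cder_quot f g k z D E (d : R) : 0 < d ->
  (forall h, normc h < d -> f (z + h) = k (z + h) * g (z + h)) -> g z != 0 ->
  cder f z D -> cder g z E -> cder k z ((D - k z * E) / g z).
Proof.
move=> d0 fkg g0 hf hg e e0; set Q := _ / g z.
have gp : 0 < normc (g z) by rewrite normc_gt0.
have [d1 d10 l1] := cder_neq0 hg g0.
have M0 : 0 < 1 + normc (k z) + normc Q by rewrite -addrA ltr_pwDl// addr_ge0 ?normc_ge0.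
pose e' := e * (normc (g z) / 2) / (1 + normc (k z) + normc Q).
have e'0 : 0 < e' by rewrite !divr_gt0// mulr_gt0// divr_gt0.
have [d2 d20 l2] := hf _ e'0; have [d3 d30 l3] := hg _ e'0.
have [d4 d40 l4] := cder_cont hg e'0.
exists (Num.min (Num.min d d1) (Num.min (Num.min d2 d3) d4)).
  by rewrite !lt_min d0 d10 d20 d30 d40.
move=> h; rewrite !lt_min => /andP[/andP[h0 h1] /andP[/andP[h2 h3] h4]].
have fz : f z = k z * g z by have := fkg 0; rewrite normc0 addr0; apply.
have e1 : g (z + h) * (k (z + h) - k z - h * Q) =
    (f (z + h) - f z - h * D) - k z * (g (z + h) - g z - h * E) - h * Q * (g (z + h) - g z).
  have gQ : Q * g z = D - k z * E by rewrite /Q divfK.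
  have -> : h * D = h * (Q * g z) + h * (k z * E) by rewrite gQ; ring.
  by rewrite (fkg _ h0) fz; ring.
have gh : 0 < normc (g (z + h)) by apply: lt_le_trans (l1 _ h1); rewrite divr_gt0.
rewrite -(ler_pM2l gh) -normcM e1.
apply: (@le_trans _ _ (e' * normc h * (1 + normc (k z) + normc Q))); last first.
  have eM : e' * (1 + normc (k z) + normc Q) = e * (normc (g z) / 2).
    by rewrite /e' divfK// lt0r_neq0.
  rewrite mulrAC eM [leRHS]mulrCA mulrA; apply: (ler_wpM2r (normc_ge0 _)).
  by apply: (ler_wpM2l (ltW e0)); exact: l1.
rewrite [leRHS]mulrDr [X in _ <= X + _]mulrDr mulr1; apply: le_trans (ler_normcB _ _) _; apply: lerD.
  apply: le_trans (ler_normcB _ _) _; apply: lerD; first exact: l2.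
  by rewrite normcM mulrC ler_wpM2r ?normc_ge0//; exact: l3.
rewrite normcM [normc (h * Q)]normcM (_ : e' * normc h * normc Q = normc h * normc Q * e'); last by ring.
have hQ0 : 0 <= normc h * normc Q by apply: mulr_ge0; exact: normc_ge0.
apply: (ler_wpM2l hQ0).
exact: ltW (l4 _ h4).
Qed.

Lemma expC_lip h : normc h <= 1 -> normc (expC h - 1) <= (1 + 8 * expR 1) * normc h.
Proof.
move=> h1; have -> : expC h - 1 = (expC h - 1 - h) + h by rewrite subrK.
apply: le_trans (ler_normcD _ _) _; rewrite mulrDl mul1r addrC lerD2l.
apply: (le_trans (expC_taylor h)); rewrite -!mulrA ler_wpM2l//.
rewrite [leRHS]mulrC; apply: (ler_wpM2l (normc_ge0 _)).
rewrite -[leRHS]mul1r; apply: ler_pM; rewrite ?normc_ge0 ?expR_ge0//.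
by rewrite ler_expR (le_trans (Re_le_normc _)).
Qed.

Lemma expC_continuous : continuous (@expC R).
Proof.
move=> z; apply: (@cvg_normcP R R[i] (nbhs z) _ (@expC R) (expC z)).2 => e e0.
pose C := normc (expC z) * (1 + 8 * expR 1).
have C0 : 0 < C by rewrite mulr_gt0 ?normc_gt0 ?expC_neq0// ltr_pwDl// mulr_ge0 ?expR_ge0.
have d0 : 0 < Num.min 1 (e / C) by rewrite lt_min ltr01 divr_gt0.
have hn : \forall w \near z, normc (z - w) < Num.min 1 (e / C).
  by apply/nbhs_normcP; exists (Num.min 1 (e / C)).
apply: filterS hn => w; rewrite lt_min => /andP[h1 h2].
have -> : expC z - expC w = - (expC z * (expC (w - z) - 1)).
  by rewrite mulrBr mulr1 -expCD [z + _]addrC subrK opprB.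
rewrite normcN normcM.
apply: (@le_lt_trans _ _ (C * normc (w - z))).
  rewrite /C -mulrA ler_wpM2l ?normc_ge0//; apply: expC_lip.
  by rewrite normcB ltW.
by rewrite mulrC -ltr_pdivlMr// normcB.
Qed.

End ComplexDerivative.

(** * The symbols of B, H and the commutators *)

Section GammaFactor.
Context {R : realType} {K : valuedFieldType R} {F : fieldExtType rat}
  {iota : {rmorphism F -> K}}.
Hypothesis hK : is_completion iota.
Variable mu : {measure set (Borel K) -> \bar R}.
Hypothesis hmu : is_haar mu.
Hypothesis hdual : self_dual mu.
Variable modulus : K -> R.
Hypothesis hmod : is_module mu modulus.
Implicit Types (x y t w : K) (f g h : K -> R[i]) (s z : R[i]).

Let mgt0 t : t != 0 -> 0 < modulus t. Proof. exact: (modulus_gt0 hK hmu hmod). Qed.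
Let mge0 t : 0 <= modulus t. Proof. exact: (modulus_ge0 hK hmu hmod). Qed.
Let tint := test_integrable hK hmu hmod.
Let Trap := test_fourier_inv_rapid hK hmu hdual hmod.

(** A translation by y multiplies F^-1 h by the character that appears in the Fourier transform at
    y: B commutes with translations. *)
Lemma opB_translate h y : test_function h ->
  opB mu modulus h y = log_functional mu modulus (fun x => h (x + y)).
Proof.
move=> th; rewrite /opB /fourier /log_functional; apply: eq_Cintegral => w.
rewrite /opA; have [_ ->] := fourier_inv_translate hK hmu y w (tint th).
by rewrite -mulrA [fourier_inv _ _ _ * _]mulrC [w * y]mulrC.
Qed.

Lemma continuous_realC (u : K -> R) x : {for x, continuous u} ->
  {for x, continuous (fun y => (u y)%:C : R[i])}.
Proof.
move=> cu; apply: (@cvg_normcP R K (nbhs x) _ (fun y => (u y)%:C) ((u x)%:C)).2 => e e0.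
have /cvgrPdist_lt/(_ e e0) := cu; apply: filterS => y.
by rewrite -rmorphB normc_real.
Qed.

Lemma modV_functional_neq0 : exists2 f, test_function f &
  Cintegral mu (fun t => f t * ((modulus t)^-1)%:C) != 0.
Proof.
apply: (bump_integral_neq0 hK hmu hmod (oner_neq0 K)).
- apply: continuous_realC; apply: cvgV; first by rewrite (modulus1 hK hmu hmod) oner_neq0.
  exact: (@modulus_continuous_neq0 _ _ _ _ hK mu hmu modulus hmod 1 (oner_neq0 K)).
- by rewrite (modulus1 hK hmu hmod) invr1 oner_neq0.
- move=> f tf; apply: (annular_integrable hK hmu hmod).
  exact: (annular_modV hK hmu hmod (test_annular hK hmu hmod tf)).
Qed.

(* Far from the support of h, the translate of h is again a test function on
   K \ {0}, and log_functional_sym bounds B(h)(y) by a multiple of 1/|y|. *)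
Lemma opB_far h : test_function h -> exists C rho : R, [/\ 0 <= C, 0 <= rho &
  forall y, rho < absv y -> normc (opB mu modulus h y) * modulus y <= C].
Proof.
move=> th; have [f0 tf0 I0] := modV_functional_neq0.
have [_ /(compact_supportP hK)[rho hrho] _] := th.
have [k k0 mE] := modulus_powR hK hmu hmod.
pose r0 := Num.max rho 0.
have r00 : 0 <= r0 by rewrite le_max lexx orbT.
have hr0 x : h x != 0 -> absv x <= r0 by move=> /hrho hx; rewrite le_max hx.
pose c := log_functional mu modulus f0 / Cintegral mu (fun t => f0 t * ((modulus t)^-1)%:C).
pose N := Rintegral mu setT (fun x : Borel K => normc (h x)).
have N0 : 0 <= N by apply: Rintegral_ge0 => x _; exact: normc_ge0.
exists (normc c * (2 * (2 `^ k * N))), (2 * r0); split.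
- by rewrite mulr_ge0 ?normc_ge0// mulr_ge0// mulr_ge0// powR_ge0.
- by rewrite mulr_ge0.
move=> y hy.
have y0 : y != 0 by rewrite -absv_gt0E; apply: le_lt_trans hy; rewrite mulr_ge0.
have my := mgt0 y0.
(* For absolute value of y beyond 2 r0 the translate lives where t is at least half as large as y;
   the module being the k-th power of the absolute value, this costs 2^k. *)
have pw t : h (t + y) != 0 -> `|(modulus t)^-1| <= 2 `^ k / modulus y.
  move=> ht; have h1 := hr0 _ ht.
  have h2 : absv y <= 2 * absv t.
    have h3 : absv y <= absv (t + y) + absv t.
      by have {1}-> : y = (t + y) - t; [rewrite addrC addKr|rewrite -[absv t]absvN; exact: absvD].
    have : 2 * absv (t + y) <= absv y by apply: (le_trans _ (ltW hy)); rewrite ler_wpM2l.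
    by move=> h4; lra.
  have t0 : t != 0.
    rewrite -absv_gt0E; have : 0 < 2 * absv t by apply: lt_le_trans h2; rewrite absv_gt0E.
    by rewrite pmulr_rgt0.
  have mt := mgt0 t0; rewrite ger0_norm; last by rewrite invr_ge0 ltW.
  rewrite -[leLHS]mul1r (ler_pdivrMr _ _ mt) mulrAC (ler_pdivlMr _ _ my) mul1r.
  rewrite !mE -powRM ?absv_ge0//; apply: ge0_ler_powR; rewrite ?nnegrE ?mulr_ge0 ?absv_ge0 ?(ltW k0)//.
have hy0 : \forall x \near y, h x = 0.
  have ry : r0 < absv y by apply: le_lt_trans hy; rewrite ler_peMl// ler1n.
  have op := open_nbhs_nbhs (conj (@open_absv_gt R K r0) ry).
  apply: filterS op => x /= hx; apply/eqP/negPn/negP => /hr0.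
  by rewrite leNgt hx.
have th' := test_translate hK th hy0.
have nf0 := test_nice hK hmu hdual hmod tf0.
have nh' := test_nice hK hmu hdual hmod th'.
have sym := log_functional_sym hK hmu hmod nf0 nh'.
have TE : opB mu modulus h y =
    c * Cintegral mu (fun t => h (t + y) * ((modulus t)^-1)%:C).
  have alg (p q u m : R[i]) : p != 0 -> p * q = m * u -> q = u / p * m.
    by move=> p0 e; apply: (mulfI p0); rewrite e mulrA [u / p]mulrC mulrA (mulfV p0) mul1r mulrC.
  rewrite (opB_translate y th); exact: (alg _ _ _ _ I0 sym).
have ih' : Cintegrable mu (fun t : Borel K => h (t + y) * ((modulus t)^-1)%:C).
  apply: (annular_integrable hK hmu hmod).
  exact: (annular_modV hK hmu hmod (test_annular hK hmu hmod th')).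
have ihn : mu.-integrable setT (EFin \o (fun x : Borel K => normc (h ((x : K) + y)))).
  exact: (Cintegrable_normc (tint th')).
have NE : Rintegral mu setT (fun x : Borel K => normc (h ((x : K) + y))) = N.
  have [_] := Rintegral_addK hmu y (Cintegrable_normc (tint th)).
  move=> e; apply: (etrans _ e); congr Rintegral; apply/funext => x.
  by rewrite addrC.
rewrite TE normcM -mulrA; apply: (ler_wpM2l (normc_ge0 _)).
rewrite -(ler_pdivlMr _ _ my).
have -> : 2 * (2 `^ k * N) / modulus y = 2 * (2 `^ k / modulus y * N) by ring.
rewrite -NE -RintegralZl; [|by []|exact: ihn].
apply: normc_Cintegral_le; [exact: ih'| |exact: (integrableZl measurableT _ ihn)].
move=> t; have [->|ht] := eqVneq (h (t + y)) 0; first by rewrite mul0r normc0 mulr0.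
rewrite normcM normc_real mulrC; apply: (ler_wpM2r (normc_ge0 _)); exact: pw.
Qed.

Lemma opB_tame h : test_function h -> tame modulus (opB mu modulus h).
Proof.
move=> th; have [k k0 mE] := modulus_powR hK hmu hmod.
have ki := opA_rapid_integrable hK hmu hmod (Trap th).
have [B B0 hB] := fourier_inv_bound hK ki.
have [C [rho [C0 rho0 hC]]] := opB_far th.
split; first exact: (fourier_meas hK hmu hmod ki).
have D0 : 0 <= B * (1 + rho `^ k) + (B + C).
  by rewrite !addr_ge0// mulr_ge0// addr_ge0// powR_ge0.
move=> e e0; exists (B * (1 + rho `^ k) + (B + C)) => // y y0.
apply: (@le_trans _ _ (B * (1 + rho `^ k) + (B + C))); last first.
  by rewrite ler_peMr// -[leLHS]expR0 ler_expR mulr_ge0 ?elog_ge0// ltW.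
have hBy : normc (opB mu modulus h y) <= B.
  by rewrite -[opB _ _ _ _]/(fourier mu (opA modulus (fourier_inv mu h)) y) fourierE hB.
have [hy|hy] := ltP rho (absv y).
  rewrite mulrDr mulr1; apply: (@le_trans _ _ (B + C)).
    by apply: lerD => //; exact: hC.
  by rewrite lerDr mulr_ge0// addr_ge0// powR_ge0.
apply: (@le_trans _ _ (B * (1 + rho `^ k))); last by rewrite lerDl addr_ge0.
apply: ler_pM; rewrite ?normc_ge0 ?addr_ge0// lerD2l mE.
by apply: ge0_ler_powR; rewrite ?nnegrE ?absv_ge0 ?(ltW k0).
Qed.

Lemma quasichar_continuous (c : K -> R[i]) z x : unitary_character c -> x != 0 ->
  {for x, continuous (quasichar modulus c z)}.
Proof.
move=> [_ _ hc] x0; apply: cvgM; first exact: hc.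
have cl : {for x, continuous (fun y => z * (ln (modulus y))%:C)}.
  apply: cvgM; first exact: cvg_cst.
  apply: continuous_realC.
  have c1 := @modulus_continuous_neq0 _ _ _ _ hK mu hmu modulus hmod x x0.
  by apply: (@continuous_comp K R R modulus (@ln R) x c1); exact: continuous_ln (mgt0 x0).
exact: (@continuous_comp K R[i] R[i] _ (@expC R) x cl (@expC_continuous R _)).
Qed.

Lemma mellin_cder (c : K -> R[i]) f z : unitary_character c -> tame modulus f ->
  -1 < complex.Re z < 0 -> cder (mellin mu modulus c f) z (mellin mu modulus c (opA modulus f) z).
Proof.
move=> hc tf zs; have [C [d [C0 d0 hd]]] := mellin_taylor hK hmu hmod hc tf zs.
exact: (cder_taylor C0 d0 hd).
Qed.

Lemma mellin_test_neq0 (c : K -> R[i]) z : unitary_character c -> -1 < complex.Re z < 0 ->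
  exists2 f, test_function f & mellin mu modulus c f z != 0.
Proof.
move=> hc zs; apply: (bump_integral_neq0 hK hmu hmod (oner_neq0 K)).
- exact: (@quasichar_continuous c z 1 hc (oner_neq0 K)).
- by rewrite -normc_eq0 (normc_quasichar modulus hc) ?oner_neq0// lt0r_neq0// expR_gt0.
- move=> f tf; apply: (tame_mellin_integrable hK hmu hmod hc _ zs).
  exact: (annular_tame hK hmu hmod (test_annular hK hmu hmod tf)).
Qed.

End GammaFactor.

(** * The functional equation and the commutators *)

Section LogDerivative.
Context {R : realType} {K : valuedFieldType R} {F : fieldExtType rat}
  {iota : {rmorphism F -> K}}.
Hypothesis hK : is_completion iota.
Variable mu : {measure set (Borel K) -> \bar R}.
Hypothesis hmu : is_haar mu.
Hypothesis hdual : self_dual mu.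
Variable modulus : K -> R.
Hypothesis hmod : is_module mu modulus.
Variable chi : K -> R[i].
Hypothesis hchi : unitary_character chi.
Variable Gam : R[i] -> R[i].
Hypothesis hGam : is_Gamma mu modulus chi Gam.
Implicit Types (x y t w : K) (f g h : K -> R[i]) (s z : R[i]).

Let chiV x := (chi x)^-1.
Let hchiV : unitary_character chiV. Proof. exact: unitary_characterV. Qed.

(** At the exponent -s, differentiation in s brings out -log|x|, whereas in [Psi] it brings out
    log|x|. *)
Definition mellinV f s := mellin mu modulus (fun x => (chi x)^-1) f (- s).
Let Psi f s := mellin mu modulus chi f (s - 1).

Lemma mellinVE f s : dist mu (quasicharV modulus chi (- s)) f = mellinV f s.
Proof. by []. Qed.

Let stripN s : strip s -> -1 < complex.Re (- s) < 0.
Proof. by rewrite /strip/= cReN oppr_lt0 ltrN2 => /andP[-> ->]. Qed.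

Let stripB s : strip s -> -1 < complex.Re (s - 1) < 0.
Proof. by rewrite /strip/= cReB/= => /andP[h1 h2]; apply/andP; split; lra. Qed.

Lemma strip_open s : strip s -> exists2 d : R, 0 < d &
  forall h : R[i], normc h < d -> strip (s + h).
Proof.
move=> /andP[h1 h2]; exists (Num.min (complex.Re s) (1 - complex.Re s)).
  by rewrite lt_min h1 subr_gt0.
move=> h; rewrite lt_min /strip/= cReD => /andP[h3 h4].
have := Re_le_normc h; rewrite ler_norml => /andP[h5 h6].
by apply/andP; split; lra.
Qed.

Let rapid_tame' := rapid_tame hK hmu hmod.
Let Ttame f : test_function f -> tame modulus f.
Proof. by move=> tf; exact: (annular_tame hK hmu hmod (test_annular hK hmu hmod tf)). Qed.
Let Ftame f : test_function f -> tame modulus (fourier mu f).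
Proof. by move=> tf; exact: rapid_tame' (test_fourier_rapid hK hmu hdual hmod tf). Qed.

Let Gam_eq f s : test_function f -> strip s -> Psi (fourier mu f) s = Gam s * mellinV f s.
Proof. by move=> [sb _ _] hs; exact: (hGam hs sb). Qed.

Lemma mellinV_cder f s : tame modulus f -> strip s ->
  cder (mellinV f) s (- mellinV (opA modulus f) s).
Proof.
move=> tf hs e e0; have [d d0 hd] := mellin_cder hK hmu hmod hchiV tf (stripN hs) e0.
exists d; first exact: d0.
move=> h hh; rewrite /mellinV opprD -(normcN h) mulrN -mulNr; apply: hd.
by rewrite normcN.
Qed.

Let Psi_cder f s : tame modulus f -> strip s -> cder (Psi f) s (Psi (opA modulus f) s).
Proof.
move=> tf hs e e0; have [d d0 hd] := mellin_cder hK hmu hmod hchi tf (stripB hs) e0.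
exists d; first exact: d0.
move=> h hh; rewrite /Psi (_ : s + h - 1 = s - 1 + h); first exact: (hd h hh).
by rewrite addrAC.
Qed.

Let mellinV_neq0 s : strip s -> exists2 f, test_function f & mellinV f s != 0.
Proof. by move=> hs; exact: (mellin_test_neq0 hK hmu hmod hchiV (stripN hs)). Qed.

Let integrableV f s : tame modulus f -> strip s ->
  Cintegrable mu (fun x : Borel K => f x * quasicharV modulus chi (- s) x).
Proof. by move=> tf hs; exact: (tame_mellin_integrable hK hmu hmod hchiV tf (stripN hs)). Qed.

Let integrableQ f s : tame modulus f -> strip s ->
  Cintegrable mu (fun x : Borel K => f x * quasichar modulus chi (s - 1) x).
Proof. by move=> tf hs; exact: (tame_mellin_integrable hK hmu hmod hchi tf (stripB hs)). Qed.

Let tate_test k g s : Cintegrable mu k -> test_function g -> strip s ->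
  tame modulus (fourier mu k) -> tame modulus (fun x => k (- x)) ->
  mellinV (fourier mu k) s * Psi (fourier mu g) s = mellinV g s * Psi (fun x => k (- x)) s.
Proof.
move=> ki tg hs t1 t2; apply: (tate hK hmu hmod hchi ki).
- exact: (test_annular hK hmu hmod tg).
- exact: (rapid_integrable hK hmu hmod (test_fourier_rapid hK hmu hdual hmod tg)).
- by move=> z; exact: (test_fourierK hdual z tg).
- exact: (integrableV t1 hs).
- exact: (integrableQ (Ftame tg) hs).
- exact: (integrableQ t2 hs).
Qed.

Lemma tame_opp f : tame modulus f -> tame modulus (fun x => f (- x)).
Proof.
move=> [mf hf]; split; first exact: Cmeas_opp.
move=> e e0; have [C C0 hC] := hf e e0; exists C; first exact: C0.
move=> x x0; have xn0 : - x != 0 by rewrite oppr_eq0.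
have := hC _ xn0; rewrite /elog (modulusN hK hmu hmod); exact.
Qed.

Lemma cder_cstM (c : R[i]) (u : R[i] -> R[i]) z D :
  cder u z D -> cder (fun z => c * u z) z (c * D).
Proof.
have cc : cder (fun _ : R[i] => c) z 0.
  move=> e e0; exists 1; first exact: ltr01.
  move=> h _; rewrite mulr0 !subr0 subrr normc0; exact: (mulr_ge0 (ltW e0) (normc_ge0 _)).
by move=> hu; have := cderM cc hu; rewrite mul0r add0r.
Qed.

Lemma Gam_neq0 s : strip s -> Gam s != 0.
Proof.
move=> hs; apply/eqP => G0.
have [g tg Mg] := mellinV_neq0 hs.
(* The bump is placed at -1 because Tate's identity evaluates the reflected function psi(-x). *)
have [psi tpsi I0] : exists2 f, test_function f &
    Cintegral mu (fun x : Borel K => f x * quasichar modulus chi (s - 1) (- (x : K))) != 0.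
  have n1 : (-1 : K) != 0 by rewrite oppr_eq0 oner_neq0.
  apply: (bump_integral_neq0 hK hmu hmod n1).
  - have c1 := @quasichar_continuous _ _ _ _ hK mu hmu modulus hmod chi (s - 1) 1 hchi (oner_neq0 K).
    have c2 : {for (-1 : K), continuous (fun x : K => - x)} by exact: opp_continuousK.
    apply: (@continuous_comp K K R[i] (fun x => - x) (quasichar modulus chi (s - 1)) (-1) c2).
    by rewrite opprK.
  - by rewrite opprK -normc_eq0 (normc_quasichar modulus hchi) ?oner_neq0// lt0r_neq0// expR_gt0.
  - move=> f tf.
    have [i1 _] := Cintegral_oppK hK hmu hmod (integrableQ (tame_opp (Ttame tf)) hs).
    by move: i1; under eq_fun do rewrite opprK.
have tN := tame_opp (Ttame tpsi).
have e := tate_test (test_integrable hK hmu hmod tpsi) tg hs (Ftame tpsi) tN.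
move: e; rewrite (Gam_eq tg hs) G0 mul0r mulr0 => /esym/eqP; rewrite mulf_eq0 (negbTE Mg)/= => /eqP e.
move/eqP: I0; apply; rewrite -[RHS]e.
have [_ e2] := Cintegral_oppK hK hmu hmod (integrableQ tN hs).
by apply: (etrans _ e2); apply: eq_Cintegral => x; rewrite opprK.
Qed.

(** The module being even, the reflection of k = log|y| F^-1 f is log|y| F f. The auxiliary g is
    chosen with nonzero Mellin integral, which then cancels. *)
Lemma Gam_opB f s : test_function f -> strip s ->
  Gam s * mellinV (opB mu modulus f) s = Psi (opA modulus (fourier mu f)) s.
Proof.
move=> tf hs; have [g tg Mg] := mellinV_neq0 hs.
have ki := opA_rapid_integrable hK hmu hmod (test_fourier_inv_rapid hK hmu hdual hmod tf).
have kE : (fun x => opA modulus (fourier_inv mu f) (- x)) = opA modulus (fourier mu f).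
  by apply/funext => x; rewrite /opA (modulusN hK hmu hmod) fourierE.
have tk : tame modulus (fun x => opA modulus (fourier_inv mu f) (- x)).
  by rewrite kE; apply: (opA_tame hK hmu hmod); exact: Ftame.
have e := tate_test ki tg hs (opB_tame hK hmu hdual hmod tf) tk.
rewrite kE (Gam_eq tg hs) in e; apply: (mulfI Mg); apply: (etrans _ e).
by rewrite -[mellinV (opB _ _ _) s]/(mellinV (fourier mu (opA modulus (fourier_inv mu f))) s); ring.
Qed.

(** The definition of Gamma, applied to a test function whose Mellin integral is nonzero at s,
    presents it near s as a quotient of differentiable functions. *)
Lemma Gam_cder s : strip s -> exists D, cder Gam s D.
Proof.
move=> hs; have [g tg Mg] := mellinV_neq0 hs; have [d d0 hd] := strip_open hs.
have h1 := Psi_cder (Ftame tg) hs; have h2 := mellinV_cder (Ttame tg) hs.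
by eexists; apply: (cder_quot d0 _ Mg h1 h2) => h hh; exact: (Gam_eq tg (hd h hh)).
Qed.

(** P becomes multiplication by G under the Mellin integral. Tameness is included so that P f can be
    multiplied by log|x| and the identity differentiated in s. *)
Definition derivation_symbol (P : (K -> R[i]) -> K -> R[i]) (G : R[i] -> R[i]) :=
  forall f, test_function f -> tame modulus (P f) /\
    forall s, strip s -> mellinV (P f) s = G s * mellinV f s.

Lemma opH_symbol : derivation_symbol (opH mu modulus) (fun s => derive1 Gam s / Gam s).
Proof.
move=> f tf.
have tA : tame modulus (opA modulus f) by apply: (opA_tame hK hmu hmod); exact: Ttame.
have tB := opB_tame hK hmu hdual hmod tf.
split; first exact: (tameD hK hmu hmod tA tB).
move=> s hs; have [D hD] := Gam_cder hs; rewrite (cder_derive1 hD).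
have -> : mellinV (opH mu modulus f) s =
    mellinV (opA modulus f) s + mellinV (opB mu modulus f) s.
  apply: (etrans _ (CintegralD (integrableV tA hs) (integrableV tB hs))).
  by apply: eq_Cintegral => x; rewrite /opH mulrDl.
have h1 := Psi_cder (Ftame tf) hs.
have [d d0 hd] := strip_open hs.
have h2 := cderM hD (mellinV_cder (Ttame tf) hs).
have h3 := cder_near d0 (fun (u : R[i]) hu => esym (Gam_eq tf (hd u hu))) h2.
have e := cder_uniq h1 h3; rewrite -(Gam_opB tf hs) in e.
have G0 := Gam_neq0 hs; apply: (mulfI G0); rewrite mulrDr e; field.
exact: G0.
Qed.

(** Differentiating M(P f) = G M(f) gives -M(A P f) = G' M(f) - G M(A f). Differentiability of G is
    part of the conclusion, G being a quotient of Mellin integrals near s. *)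
Lemma comm_symbol P G : derivation_symbol P G ->
  (forall s, strip s -> exists D, cder G s D) /\
  derivation_symbol (comm (opA modulus) P) (fun s => - derive1 G s).
Proof.
move=> hP.
have hG s : strip s -> exists D, cder G s D.
  move=> hs; have [g tg Mg] := mellinV_neq0 hs; have [d d0 hd] := strip_open hs.
  have [tP eP] := hP g tg.
  have h1 := mellinV_cder tP hs; have h2 := mellinV_cder (Ttame tg) hs.
  by eexists; apply: (cder_quot d0 _ Mg h1 h2) => h hh; exact: (eP _ (hd h hh)).
split; [exact: hG|move=> f tf]; have [tP eP] := hP f tf.
have tAf := test_opA hK hmu hmod tf.
have [tPA ePA] := hP _ tAf.
have tAP := opA_tame hK hmu hmod tP.
split; first exact: (tameB hK hmu hmod tAP tPA).
move=> s hs; have [D hD] := hG s hs; rewrite (cder_derive1 hD).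
have -> : mellinV (comm (opA modulus) P f) s =
    mellinV (opA modulus (P f)) s - mellinV (P (opA modulus f)) s.
  apply: (etrans _ (CintegralB (integrableV tAP hs) (integrableV tPA hs))).
  by apply: eq_Cintegral => x; rewrite /comm mulrBl.
rewrite (ePA s hs).
have [d d0 hd] := strip_open hs.
have h1 := mellinV_cder tP hs.
have h2 := cderM hD (mellinV_cder (Ttame tf) hs).
have h3 := cder_near d0 (fun (u : R[i]) hu => esym (eP _ (hd u hu))) h2.
have e := cder_uniq h1 h3.
by rewrite -[mellinV (opA modulus (P f)) s]opprK e mulrN opprD opprK addrK mulNr.
Qed.

Definition log_deriv s := derive1 Gam s / Gam s.

Lemma opKN_symbol n : derivation_symbol (opKN mu modulus n.+1)
    (fun s => (-1) ^+ n.+1 * derive1n n.+1 log_deriv s).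
Proof.
rewrite /opKN /=; elim: n => [|n IH].
  have [_ h] := comm_symbol opH_symbol => f tf /=.
  have [h1 h2] := h f tf; rewrite opK1E; split; first exact: h1.
  by move=> s hs; rewrite (h2 s hs) expr1 mulN1r.
have [cG h] := comm_symbol IH => f tf; have [h1 h2] := h f tf; split; first exact: h1.
move=> s hs; apply: (etrans (h2 s hs)); congr (_ * _).
have [D hD] := cG s hs; rewrite (cder_derive1 hD).
(* Multiplying the symbol by its sign once more, the square of the sign being 1, isolates the
   iterated derivative and shows it to be differentiable. *)
have := cder_cstM ((-1) ^+ n.+1) hD.
rewrite (_ : (fun z => _) = derive1n n.+1 log_deriv); last first.
  by apply/funext => z; rewrite mulrA -expr2 -exprM mulnC exprM sqrrN expr1n expr1n mul1r.
move=> /cder_derive1; rewrite derive1nS => ->.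
by rewrite exprS mulrA mulN1r mulNr -expr2 -exprM mulnC exprM sqrrN expr1n expr1n mulN1r.
Qed.

Lemma opKN_dist n f s : strip s -> test_function f ->
  Cintegrable mu (fun x : Borel K => opKN mu modulus n.+1 f x * quasicharV modulus chi (- s) x) /\
  KN_dist mu modulus n.+1 (quasicharV modulus chi (- s)) f =
    derive1n n.+1 log_deriv s * dist mu (quasicharV modulus chi (- s)) f.
Proof.
move=> hs tf; have [h1 h2] := opKN_symbol n tf; split; first exact: (integrableV h1 hs).
rewrite /KN_dist !mellinVE (h2 s hs) !mulrA -expr2 -exprM mulnC exprM sqrrN expr1n expr1n mul1r.
by [].
Qed.

End LogDerivative.

(** * Logarithms of the Gamma function *)

Section LogBranch.
Variable R : realType.
Implicit Types (f g L : R[i] -> R[i]) (z w D h s : R[i]).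

Let E := 8 * expR (1 : R).
Let E0 : 0 < E. Proof. by rewrite mulr_gt0// expR_gt0. Qed.

Let expC_taylor1 h : normc h <= 1 -> normc (expC h - 1 - h) <= E * normc h ^+ 2.
Proof.
move=> h1; apply: (le_trans (expC_taylor h)); rewrite mulrAC ler_wpM2r ?exprn_ge0 ?normc_ge0//.
by rewrite ler_wpM2l// ler_expR (le_trans (Re_le_normc _)).
Qed.

(** With k = L(z + h) - L(z) and m = (f(z + h) - f(z)) / f(z) one has exp k - 1 = m, so k = m +
    O(k^2). Continuity of L makes k small enough for |k| <= 2|m|, and the error becomes O(h^2). *)
Lemma cder_log_branch f L z D (d : R) : 0 < d ->
  (forall h, normc h < d -> expC (L (z + h)) = f (z + h)) ->
  (forall e : R, 0 < e -> exists2 d : R, 0 < d & forall h, normc h < d -> normc (L (z + h) - L z) < e) ->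
  cder f z D -> cder L z (D / f z).
Proof.
move=> d0 hL cL hf e e0.
have fz : f z = expC (L z) by rewrite -[in RHS](addr0 z) hL ?normc0// addr0.
have f0 : f z != 0 by rewrite fz expC_neq0.
have fp : 0 < normc (f z) by rewrite normc_gt0.
have [d1 d10 l1] := cder_lip hf.
have e2 : 0 < e / 2 * normc (f z) by rewrite mulr_gt0// divr_gt0.
have [d2 d20 l2] := hf _ e2.
(* Below 1 / (2E) the quadratic error E |k|^2 is at most |k| / 2, which yields |k| <= 2|m|. *)
have k0 : 0 < Num.min 1 (2 * E)^-1 by rewrite lt_min ltr01 invr_gt0 mulr_gt0.
have [d3 d30 l3] := cL _ k0.
(* This M satisfies |m| <= M |h| for small h; the threshold for h comes from E (2M|h|)^2 = 4 E M^2
   |h|^2. *)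
pose M := (normc D + 1) / normc (f z).
have M0 : 0 < M by rewrite divr_gt0// ltr_wpDl ?normc_ge0.
have e4 : 0 < e / 2 / (4 * E * M ^+ 2) 
  by apply: divr_gt0; [exact: divr_gt0|apply: mulr_gt0; [exact: mulr_gt0|exact: exprn_gt0]].
exists (Num.min (Num.min d d1) (Num.min (Num.min d2 d3) (e / 2 / (4 * E * M ^+ 2)))).
  by rewrite !lt_min d0 d10 d20 d30.
move=> h; rewrite !lt_min => /andP[/andP[h0 h1] /andP[/andP[h2 h3] h4]].
set k := L (z + h) - L z.
set m := (f (z + h) - f z) / f z.
have km : expC k - 1 = m.
  rewrite /k expCD expCN hL// -fz /m mulrBl mulfV//.
have := l3 _ h3; rewrite -/k lt_min => /andP[k1 kE].
have km2 : normc (k - m) <= E * normc k ^+ 2.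
  by rewrite normcB -km; apply: expC_taylor1; exact: ltW.
have m1 : normc m <= M * normc h.
  rewrite /m normcM normcV ler_pdivrMr// /M mulrAC divfK ?lt0r_neq0//; exact: l1.
have k2 : normc k <= 2 * normc m.
  have h5 : E * normc k ^+ 2 <= normc k / 2.
    rewrite expr2 mulrA mulrC ler_wpM2l ?normc_ge0// -ler_pdivlMl//.
    by apply: (le_trans (ltW kE)); rewrite invfM mulrC.
  have h6 : normc k <= normc (k - m) + normc m.
    by rewrite -{1}(subrK m k) ler_normcD.
  have := le_trans h6 (lerD (le_trans km2 h5) (lexx _)).
  by move=> h7; lra.
have -> : k - h * (D / f z) = (k - m) + (f (z + h) - f z - h * D) / f z.
  by rewrite /m; field.
apply: (le_trans (ler_normcD _ _)); rewrite (splitr e) [leRHS]mulrDl; apply: lerD; last first.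
  rewrite normcM normcV ler_pdivrMr// mulrAC; exact: l2.
apply: (le_trans km2); apply: (@le_trans _ _ (E * (2 * (M * normc h)) ^+ 2)).
  have Mh : 0 <= M * normc h by apply: mulr_ge0; [exact: ltW|exact: normc_ge0].
  rewrite ler_wpM2l ?(ltW E0)// lerXn2r ?nnegrE ?normc_ge0//; first exact: mulr_ge0.
  by apply: (le_trans k2); rewrite ler_wpM2l.
have -> : E * (2 * (M * normc h)) ^+ 2 = (4 * E * M ^+ 2 * normc h) * normc h by ring.
rewrite ler_wpM2r ?normc_ge0// mulrC -ler_pdivlMr; first exact: ltW.
by apply: mulr_gt0; [exact: mulr_gt0|exact: exprn_gt0].
Qed.

(** The principal logarithm on the right half-plane, where the argument is an arctangent. *)
Definition clog w : R[i] := (ln (normc w)) +i* (atan (complex.Im w / complex.Re w)).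

Lemma clogK w : 0 < complex.Re w -> expC (clog w) = w.
Proof.
move=> w0; have n0 : 0 < normc w.
  by rewrite normc_gt0; apply: contraTneq w0 => ->; rewrite ltxx.
rewrite /expC /clog /= lnK//; set t := complex.Im w / complex.Re w.
have ct : cos (atan t) = complex.Re w / normc w.
  rewrite cos_atan; have -> : 1 + t ^+ 2 = (normc w / complex.Re w) ^+ 2.
    have nE : normc w ^+ 2 = complex.Re w ^+ 2 + complex.Im w ^+ 2.
      by case: (w) => a b /=; rewrite sqr_sqrtr// addr_ge0// sqr_ge0.
    by rewrite [RHS]expr_div_n nE /t; field; rewrite lt0r_neq0.
  by rewrite sqrtr_sqr ger0_norm ?divr_ge0 ?(ltW n0) ?(ltW w0)// invf_div.
have st : sin (atan t) = complex.Im w / normc w.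
  have c0 : cos (atan t) != 0 by rewrite ct mulf_neq0 ?invr_eq0 ?lt0r_neq0.
  have := atanK t; rewrite /tan => e; rewrite -(divfK c0 (sin (atan t))) e ct /t.
  by rewrite mulrA divfK// lt0r_neq0.
apply: complexP; rewrite ?cReM ?cImM /= !mul0r ?subr0 ?addr0.
  by rewrite ct mulrC divfK// lt0r_neq0.
by rewrite st mulrC divfK// lt0r_neq0.
Qed.

(** A half turn or a quarter turn brings the remaining nonzero numbers into the right half-plane,
    where [clog] inverts the exponential. *)
Lemma expC_surj w : w != 0 -> exists c, expC c = w.
Proof.
move=> w0; have [h|h|h] := ltgtP 0 (complex.Re w).
- by exists (clog w); exact: clogK.
- exists (clog (- w) + 'i%C * pi%:C); rewrite expCD clogK; last by rewrite cReN oppr_gt0.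
  by rewrite expC_i cospi sinpi; apply: complexP; rewrite ?cReM ?cImM ?cReN ?cImN /=; ring.
have [k|k|k] := ltgtP 0 (complex.Im w).
- exists (clog (- 'i%C * w) + 'i%C * (pi / 2)%:C); rewrite expCD clogK; last first.
    by rewrite cReM /=; move: k; lra.
  rewrite expC_i cos_pihalf sin_pihalf.
  by rewrite mulrAC mulNr -expr2 sqr_i opprK mul1r.
- exists (clog ('i%C * w) + 'i%C * (- (pi / 2))%:C); rewrite expCD clogK; last first.
    by rewrite cReM /=; move: k; lra.
  rewrite expC_i cosN sinN cos_pihalf sin_pihalf.
  have -> : (0 +i* -1)%C = - 'i%C :> R[i] by apply: complexP => /=; rewrite ?oppr0.
  by rewrite mulrN mulrAC -expr2 sqr_i mulN1r opprK.
by move/eqP: w0; case; apply: complexP; rewrite -?h -?k.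
Qed.

Lemma lip_continuous (g : R[i] -> R) :
  (forall z w, `|g z - g w| <= normc (z - w)) -> continuous g.
Proof.
move=> lg w; apply/(@cvgrPdist_lt _ _ _ (nbhs w)) => e e0; apply/nbhs_normcP; exists e => // z hz.
by apply: le_lt_trans hz; exact: lg.
Qed.

Lemma Re_continuous : continuous (@complex.Re R).
Proof.
by apply: lip_continuous => z w; rewrite -cReB; exact: Re_le_normc.
Qed.

Lemma Im_continuous : continuous (@complex.Im R).
Proof.
by apply: lip_continuous => z w; rewrite -cImB; exact: Im_le_normc.
Qed.

Lemma clog_continuous w : 0 < complex.Re w -> {for w, continuous clog}.
Proof.
move=> w0; have n0 : 0 < normc w.
  by rewrite normc_gt0; apply: contraTneq w0 => ->; rewrite ltxx.
have c1 : {for w, continuous (fun z : R[i] => ln (normc z))}.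
  apply: continuous_comp; last exact: continuous_ln.
  by apply: lip_continuous; exact: normc_dist.
have c2 : {for w, continuous (fun z : R[i] => atan (complex.Im z / complex.Re z))}.
  apply: continuous_comp; last exact: continuous_atan.
  apply: (@cvgM _ _ (nbhs w) _ (@complex.Im R) (fun z => (complex.Re z)^-1)); first exact: (@Im_continuous w).
  apply: (@cvgV _ _ (nbhs w)); [exact: lt0r_neq0|exact: (@Re_continuous w)].
apply/(@cvg_normcP _ _ (nbhs w)) => e e0; have e2 : 0 < e / 2 by apply: divr_gt0.
have := (@cvgrPdist_lt _ _ _ (nbhs w) (nbhs_filter w) _ _).1 c1 _ e2.
have := (@cvgrPdist_lt _ _ _ (nbhs w) (nbhs_filter w) _ _).1 c2 _ e2.
apply: filterS2 => z h1 h2; apply: (le_lt_trans (normc_le_ReIm _)).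
by rewrite (splitr e) cReB cImB; apply: ltrD.
Qed.

Lemma clog_normc_lt1 w : normc (w - 1) < 1 -> 0 < complex.Re w.
Proof.
move=> h; have := le_lt_trans (Re_le_normc _) h.
by rewrite cReB /= ltr_norml => /andP[]; lra.
Qed.

Lemma near_derive1 f g z :
  (\forall w \near z, f w = g w) -> \forall w \near z, derive1 f w = derive1 g w.
Proof.
move=> /near_join fg; apply: filterS fg => w fg.
by rewrite !derive1E; exact: near_eq_derive.
Qed.

Lemma near_derive1n n f g z :
  (\forall w \near z, f w = g w) -> derive1n n f z = derive1n n g z.
Proof.
move=> fg; suff : \forall w \near z, derive1n n f w = derive1n n g w by exact: nbhs_singleton.
by elim: n => [//|n ih]; rewrite !derive1nS; exact: near_derive1.
Qed.

End LogBranch.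

(** * Branches of the logarithm of Gamma near a point of the strip *)

Section Main.
Variables (R : realType) (F : fieldExtType rat) (K : valuedFieldType R) (iota : {rmorphism F -> K}).
Hypothesis hK : is_completion iota.
Variable mu : {measure set (Borel K) -> \bar R}.
Hypotheses (hmu : is_haar mu) (hdual : self_dual mu).
Variables (modulus : K -> R) (chi : K -> R[i]) (Gam : R[i] -> R[i]).
Hypotheses (hmod : is_module mu modulus) (hchi : unitary_character chi).
Hypothesis hGam : is_Gamma mu modulus chi Gam.
Variable s : R[i].
Hypothesis hs : strip s.

Let Gcder := Gam_cder hK hmu hdual hmod hchi hGam.
Let Gneq0 := Gam_neq0 hK hmu hdual hmod hchi hGam.

Lemma Gam_continuous z : strip z -> {for z, continuous Gam}.
Proof.
move=> hz; have [D hD] := Gcder hz.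
apply/(@cvg_normcP _ _ (nbhs z)) => e e0; have [d d0 hd] := cder_cont hD e0.
apply/nbhs_normcP; exists d => // w hw.
by rewrite normcB -[in Gam w](subrKC z w); apply: hd; rewrite normcB.
Qed.

Lemma log_branch_exists : exists L, is_log_branch Gam s L.
Proof.
(* Here c is any logarithm of Gam s, and near s the ratio Gam z / Gam s stays at distance less than
   1 from 1, hence in the right half-plane. *)
have [c hc] := expC_surj (Gneq0 hs); exists (fun z => c + clog (Gam z / Gam s)).
have gs : 0 < normc (Gam s) by rewrite normc_gt0 Gneq0.
have [D hD] := Gcder hs; have [d d0 hd] := cder_cont hD gs.
have [d' d'0 hd'] := strip_open hs.
apply/nbhs_normcP; exists (Num.min d d'); first by rewrite lt_min d0.
move=> z; rewrite lt_min => /andP[h1 h2].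
have ez : z = s + (z - s) by rewrite addrC subrK.
have sz : strip z by rewrite ez; apply: hd'; rewrite normcB.
have wz : 0 < complex.Re (Gam z / Gam s).
  apply: clog_normc_lt1; rewrite -(mulfV (Gneq0 hs)) -mulrBl normcM normcV.
  rewrite ltr_pdivrMr// mul1r [z in Gam z]ez; apply: hd; by rewrite normcB.
split; last by rewrite expCD clogK// hc mulrC (divfK (Gneq0 hs)).
apply: (@cvgD _ _ _ (nbhs z)); first exact: (@cvg_cst _ _ _ (nbhs z)).
apply: (@continuous_comp _ _ _ (fun z => Gam z / Gam s) (@clog R)); last exact: clog_continuous.
apply: (@cvgM _ _ (nbhs z) _ Gam (fun=> (Gam s)^-1));
  [exact: Gam_continuous|exact: (@cvg_cst _ _ _ (nbhs z))].
Qed.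

Lemma log_branch_derive1 L : is_log_branch Gam s L ->
  \forall z \near s, derive1 L z = log_deriv Gam z.
Proof.
move=> /nbhs_normcP[d d0 hL]; have [d' d'0 hd'] := strip_open hs.
apply/nbhs_normcP; exists (Num.min d d'); first by rewrite lt_min d0.
move=> z; rewrite lt_min => /andP[h1 h2].
have sz : strip z by rewrite -(subrK s z) addrC; apply: hd'; rewrite normcB.
have [D hD] := Gcder sz; rewrite /log_deriv (cder_derive1 hD); apply: cder_derive1.
have dz : 0 < d - normc (s - z) by rewrite subr_gt0.
apply: (cder_log_branch dz _ _ hD).
  move=> h hh; apply: (hL (z + h) _).2.
  have -> : s - (z + h) = (s - z) + - h by rewrite opprD addrA.
  by apply: (le_lt_trans (ler_normcD _ _)); rewrite normcN -ltrBrDl.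
move=> e e0; have := (@cvg_normcP _ _ (nbhs z) (nbhs_filter z) _ _).1 (hL z h1).1 _ e0.
move=> /nbhs_normcP[d2 d20 h3]; exists d2 => // h hh.
by rewrite normcB; apply: h3; rewrite opprD addrA subrr add0r normcN.
Qed.

End Main.

Theorem mainTheorem6 (R : realType) (F : fieldExtType rat)
    (K : valuedFieldType R) (iota : {rmorphism F -> K})
    (hK : is_completion iota)
    (mu : {measure set (Borel K) -> \bar R})
    (hmu : is_haar mu) (hdual : self_dual mu)
    (modulus : K -> R) (hmod : is_module mu modulus)
    (chi : K -> R[i]) (hchi : unitary_character chi)
    (Gam : R[i] -> R[i]) (hGam : is_Gamma mu modulus chi Gam)
    (s : R[i]) (hs : 0 < complex.Re s < 1)
    (N : nat) (hN : (1 <= N)%N) :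
  (exists L : R[i] -> R[i], is_log_branch Gam s L) /\
  (forall L : R[i] -> R[i], is_log_branch Gam s L ->
   forall alpha : K -> R[i], test_function alpha ->
     Cintegrable mu (fun x : Borel K =>
       opKN mu modulus N alpha x * quasicharV modulus chi (- s) x) /\
     KN_dist mu modulus N (quasicharV modulus chi (- s)) alpha =
       derive1n N.+1 L s * dist mu (quasicharV modulus chi (- s)) alpha).
Proof.
split; first exact: (log_branch_exists hK hmu hdual hmod hchi hGam hs).
case: N hN => // n _ L hL alpha ta.
have [hi he] := opKN_dist hK hmu hdual hmod hchi hGam n hs ta.
(* One derivative turns L into Gam'/Gam on a whole neighbourhood of s, as the remaining n + 1
   derivatives at s require. *)
have ed : derive1n n.+2 L s = derive1n n.+1 (log_deriv Gam) s.
  rewrite derive1Sn; exact: (near_derive1n n.+1 (log_branch_derive1 hK hmu hdual hmod hchi hGam hs hL)).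
split; first exact: hi.
by apply: (etrans he); rewrite ed.
Qed.
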